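(* Let $(p,q,r)\in\mathbb Q^3$ with $r>0$, $p\in(-1,r)$ and $|p|<q<\min\{p+2,\,2r-p\}$, and let $\lambda^0_{p,q,r}$ be the $L$-shaped diagram with (rational) interlacing coordinates $$a_0=-1\;<\;b_1=\frac{p+q-2}2\;<\;a_1=p\;<\;b_2=\frac{p-q+2r}2\;<\;a_2=r.$$ Let $T^\infty_{p,q,r}$ and $D_{p,q,r}$ be the corresponding limiting surface and domain. - If $r=1$, then $T^\infty_{p,q,1}$ is defined and continuous on $D_{p,q,1}$ if and only if $$p=0\qquad\text{or}\qquad q=2-\sqrt{2-p^2}.$$ - If $r\ne1$, then $T^\infty_{p,q,r}$ is defined and continuous on $D_{p,q,r}$ if and only if $$\big(p\le0\text{ and }q=Q^+_r(p)\big)\qquad\text{or}\qquad\big(p\ge r-1\text{ and }q=Q^-_r(p)\big),$$ where $$Q^\pm_r(p)=1+r\pm\frac{\sqrt{(1+p-r)(1+2p-r)\big(pr+(1+r)^2-p-2p^2\big)}}{1+2p-r}.$$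
   Context: **Young diagrams.** A partition $\lambda$ is identified with its Young diagram in Russian convention, i.e. the set of box centres $\{(j-i,\,i+j-1):1\le i\le\ell(\lambda),\,1\le j\le\lambda_i\}$; each box is a square of area $2$ with sides parallel to the lines $y=\pm x$. The upper boundary is the graph of a $1$-Lipschitz function $\omega_\lambda$ with $\omega_\lambda(x)=|x|$ for $|x|$ large; the interlacing coordinates $a_0<b_1<\dots<b_m<a_m$ are its local minima ($a_i$) and local maxima ($b_i$). All objects below are invariant when all interlacing coordinates are multiplied by the same positive integer; a diagram with rational interlacing coordinates thus means an honest Young diagram obtained after multiplying all of them by a common positive integer making them integers, and $\eta=1/\sqrt{|\lambda^0|}$ for this integer diagram $\lambda^0$. **Limiting height function.** A Poissonized Young tableau of shape $\lambda$ is a function $T:\lambda\to[0,1]$ with distinct values, increasing along rows and columns; a uniform random one is sampled from normalized Lebesgue measure on the set of such functions. Its height function is $H_{\lambda,T}(x,t)=\#\{y:(x,y)\in\lambda,\ T(x,y)\le t\}$. For $n\ge1$ let $N=n^2|\lambda^0|$, let $\lambda_N$ be obtained from $\lambda^0$ by replacing each box by an $n\times n$ square of boxes, and let $T_N$ be a uniform random Poissonized Young tableau of shape $\lambda_N$. It is known that $\frac1{\sqrt N}H_{\lambda_N,T_N}(\lfloor x\sqrt N\rfloor,t)$ converges in probability as $n\to\infty$, uniformly in $(x,t)\in[\eta a_0,\eta a_m]\times[0,1]$ (integer coordinates), to a deterministic function $H^\infty$. **Limiting surface.** Let $\omega_{\eta\lambda^0}(x)=\eta\,\omega_{\lambda^0}(x/\eta)$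 and $D_{\lambda^0}=\{(x,y)\in\mathbb R^2:|x|<y<\omega_{\eta\lambda^0}(x)\}$. For $(x,y)\in D_{\lambda^0}$ set $T^\infty_+(x,y)=\sup\{t\in[0,1]:H^\infty(x,t)\le\frac12(y-|x|)\}$ and $T^\infty_-(x,y)=\inf\{t\in[0,1]:H^\infty(x,t)\ge\frac12(y-|x|)\}$. The limiting surface $T^\infty$ is defined at the points where $T^\infty_-=T^\infty_+$, as this common value. $D_{p,q,r}$ and $T^\infty_{p,q,r}$ denote these objects for $\lambda^0=\lambda^0_{p,q,r}$. A condition $q=Q^\pm_r(p)$ is regarded as not satisfied when the expression $Q^\pm_r(p)$ is not a well-defined real number. *)

(* Defs.v *)
From HB Require Import structures.
From mathcomp Require Import all_boot all_order all_algebra.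
From mathcomp Require Import all_classical all_reals all_analysis.

Set Implicit Arguments.
Unset Strict Implicit.
Unset Printing Implicit Defensive.

Import Order.TTheory GRing.Theory Num.Theory.
Import numFieldNormedType.Exports.
Local Open Scope classical_set_scope.
Local Open Scope ring_scope.

Definition is_partition (la : seq nat) : bool :=
  sorted geq la && (0%N \notin la).

(* Box (i, j), with i, j >= 1, is represented by its centre (j - i, i + j - 1). *)
Definition boxes (la : seq nat) : seq (int * int) :=
  [seq (j%:Z - i%:Z, i%:Z + j%:Z - 1)
     | i <- iota 1 (size la), j <- iota 1 (nth 0%N la i.-1)].

Definition dilate (n : nat) (la : seq nat) : seq nat :=
  flatten [seq nseq n (n * l)%N | l <- la].

Section Boundary.
Context {R : realType}.
Implicit Types (la : seq nat) (x : R).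

Definition region la : set (R * R) :=
  [set P | exists2 b, b \in boxes la &
     `|P.1 - b.1%:~R| + `|P.2 - b.2%:~R| <= 1].

(* Outside the range of the diagram the set below is just [set `|x|]. *)
Definition omega la x : R := sup (`|x| |` [set y | region la (x, y)]).

Definition is_local_min (f : R -> R) x : Prop := \forall y \near x, f x <= f y.
Definition is_local_max (f : R -> R) x : Prop := \forall y \near x, f y <= f x.

Definition interlacing_coordinates la (a b : seq R) : Prop :=
  [/\ size a = (size b).+1,
      forall i, (i < size b)%N -> a`_i < b`_i < a`_i.+1,
      [set x | is_local_min (omega la) x] = [set` a] &
      [set x | is_local_max (omega la) x] = [set` b]].

Definition eta la : R := (Num.sqrt (size (boxes la))%:R)^-1.

Definition domain la : set (R * R) :=
  [set P | `|P.1| < P.2 < eta la * omega la (P.1 / eta la)].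

End Boundary.

Section ProductMeasure.
Context d (T : measurableType d) (R : realType).
Variable mu : {sigma_finite_measure set T -> \bar R}.

Definition cons_pair n (x : T * n.-tuple T) : n.+1.-tuple T :=
  [the n.+1.-tuple T of x.1 :: x.2].

Lemma measurable_cons_pair n : measurable_fun setT (@cons_pair n).
Proof. exact: (@measurable_cons _ _ _ _ fst n snd measurable_fst measurable_snd). Qed.

Section Step.
Variables (n : nat) (nu : {sigma_finite_measure set (n.-tuple T) -> \bar R}).

Definition product_cons : set (n.+1.-tuple T) -> \bar R :=
  pushforward (mu \x nu)%E (@cons_pair n).

Let product_cons0 : product_cons set0 = 0%E.
Proof. by rewrite /product_cons /pushforward preimage_set0 measure0. Qed.

Let product_cons_ge0 A : (0 <= product_cons A)%E.
Proof. exact: measure_ge0 (mu \x nu)%E _. Qed.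

Let product_cons_sigma_additive : semi_sigma_additive product_cons.
Proof.
move=> F mF tF mUF; rewrite /product_cons /pushforward preimage_bigcup.
have mcons A : measurable A -> measurable (@cons_pair n @^-1` A).
  by move=> mA; rewrite -[X in measurable X]setTI; exact: measurable_cons_pair.
apply: measure_semi_sigma_additive.
- by move=> i; exact: mcons.
- by apply/trivIsetP => /= i j _ _ ij; rewrite -preimage_setI;
    move/trivIsetP: tF => /(_ _ _ _ _ ij) ->//; rewrite preimage_set0.
- by rewrite -preimage_bigcup; exact: mcons.
Qed.

HB.instance Definition _ := isMeasure.Build _ _ _ product_cons
  product_cons0 product_cons_ge0 product_cons_sigma_additive.

Let product_cons_sigma_finite : sigma_finite setT product_cons.
Proof.
have [F UF mF] : sigma_finite setT (mu \x nu)%E.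
  have /sigma_finiteP[F [TF ndF Foo]] := sigma_finiteT mu.
  have /sigma_finiteP[G [TG ndG Goo]] := sigma_finiteT nu.
  exists (fun i => F i `*` G i).
    rewrite -setXTT TF TG predeqE => -[x y]; split.
      move=> [/= [i _ Fix] [j _ Gjy]]; exists (maxn i j) => //; split.
      - by move: x Fix; exact/subsetPset/ndF/leq_maxl.
      - by move: y Gjy; exact/subsetPset/ndG/leq_maxr.
    by move=> [i _ []/= ? ?]; split; exists i.
  move=> i; have [? ?] := Foo i; have [? ?] := Goo i.
  split; first exact: measurableX.
  by rewrite product_measure1E// lte_mul_pinfty// ge0_fin_numE.
pose g (t : n.+1.-tuple T) := (thead t, [tuple of behead t]).
have mg : measurable_fun setT g.
  apply/measurable_fun_pairP; split => /=.
    exact: measurable_tnth.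
  exact: measurable_behead.
have cK : cancel (@cons_pair n) g.
  by case=> x t; rewrite /g /cons_pair; congr pair; exact/val_inj.
exists (fun i => g @^-1` F i); first by rewrite -preimage_bigcup -UF preimage_setT.
move=> i; have [mFi Fi] := mF i; split.
  by rewrite -[X in measurable X]setTI; exact: mg.
rewrite /product_cons /pushforward -comp_preimage.
by rewrite (_ : g \o _ = id) //; apply/funext => x; exact: cK.
Qed.

HB.instance Definition _ :=
  Measure_isSigmaFinite.Build _ _ _ product_cons product_cons_sigma_finite.

End Step.

(* The n-fold product of mu, on n-tuples. *)
Fixpoint tuple_measure (n : nat) :
    {sigma_finite_measure set (n.-tuple T) -> \bar R} :=
  match n with
  | 0 => \d_([tuple] : 0.-tuple T)
  | n'.+1 => product_cons (tuple_measure n')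
  end.

End ProductMeasure.

Section Tableaux.
Context {R : realType}.
Implicit Types (la : seq nat).

(* A filling of la is stored as the tuple of its values along boxes la. *)
Definition filling la := (size (boxes la)).-tuple (measurableTypeR R).

Definition entry la (T : filling la) (b : int * int) : R :=
  nth 0 (T : seq R) (index b (boxes la)).

(* In these coordinates the next box in the row of (x, y) is (x + 1, y + 1),
   and the next box in its column is (x - 1, y + 1). *)
Definition poissonized_tableaux la : set (filling la) :=
  [set T | [/\ {in boxes la, forall b, 0 <= entry T b <= 1},
               {in boxes la &, injective (entry T)},
               forall x y, (x, y) \in boxes la -> (x + 1, y + 1) \in boxes la ->
                 entry T (x, y) < entry T (x + 1, y + 1) &
               forall x y, (x, y) \in boxes la -> (x - 1, y + 1) \in boxes la ->
                 entry T (x, y) < entry T (x - 1, y + 1)]].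

Definition uniform_tableau_prob la (A : set (filling la)) : R :=
  let vol := tuple_measure (@lebesgue_measure R) (size (boxes la)) in
  fine (vol (A `&` @poissonized_tableaux la)) /
  fine (vol (@poissonized_tableaux la)).

Definition height la (T : filling la) (x : int) (t : R) : nat :=
  count (fun b => (b.1 == x) && (entry T b <= t)) (boxes la).

(* H is the limit in probability, uniformly on [eta a0, eta am] x [0, 1], of the
   rescaled height functions; its values elsewhere are unconstrained. *)
Definition is_limiting_height la (a0 am : R) (H : R -> R -> R) : Prop :=
  forall eps : R, 0 < eps ->
    (fun n : nat =>
       let sqrtN := Num.sqrt (n ^ 2 * size (boxes la))%:R : R in
       uniform_tableau_prob [set T : filling (dilate n la) |
         exists x t : R,
           [/\ eta la * a0 <= x <= eta la * am, 0 <= t <= 1 &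
               eps < `|(height T (Num.floor (x * sqrtN)) t)%:R / sqrtN
                       - H x t| ]]) @ \oo --> (0 : R).

End Tableaux.

Section Surface.
Context {R : realType}.
Implicit Types (H : R -> R -> R) (P : R * R).

Definition surface_sup H P : R :=
  sup [set t | 0 <= t <= 1 /\ H P.1 t <= (P.2 - `|P.1|) / 2].
Definition surface_inf H P : R :=
  inf [set t | 0 <= t <= 1 /\ H P.1 t >= (P.2 - `|P.1|) / 2].

(* The surface is the common value of surface_inf and surface_sup, where they
   agree. *)
Definition surface_defined_continuous H (D : set (R * R)) : Prop :=
  {in D, surface_inf H =1 surface_sup H} /\
  {within D, continuous (surface_sup H)}.

End Surface.

Section Q.
Context {R : realType}.
Implicit Types p q r : R.

Definition Qradicand r p : R :=
  (1 + p - r) * (1 + 2 * p - r) * (p * r + (1 + r) ^+ 2 - p - 2 * p ^+ 2).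

(* Num.sqrt and / are total, so well-definedness is part of the condition. *)
Definition Q_wd r p : Prop := 0 <= Qradicand r p /\ 1 + 2 * p - r != 0.

Definition is_Qplus r p q : Prop :=
  Q_wd r p /\ q = 1 + r + Num.sqrt (Qradicand r p) / (1 + 2 * p - r).
Definition is_Qminus r p q : Prop :=
  Q_wd r p /\ q = 1 + r - Num.sqrt (Qradicand r p) / (1 + 2 * p - r).

End Q.

(* Main.v *)
Require Import Defs.
From mathcomp Require Import all_boot all_order all_algebra.
From mathcomp Require Import all_classical all_reals all_analysis.
From mathcomp Require Import measurable_realfun.
From mathcomp Require Import complex ring lra zify.
From mathcomp Require polyrcf.

Set Implicit Arguments.
Unset Strict Implicit.
Unset Printing Implicit Defensive.

Import Order.TTheory GRing.Theory Num.Theory.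
Import numFieldNormedType.Exports.
Local Open Scope classical_set_scope.
Local Open Scope ring_scope.

(* Growth along characteristics. For a shape p put
     kerov p z = z * prod_(b in p) (1 - (z - c(b))^-2),  c(b) the content of b.
   In partial fractions the residues of kerov la are the numbers
   |la| * P(the last box of a random linear extension of la is this corner).
   Hence, if p_m is the shape formed by the first m boxes of a random linear
   extension of the diagram with N boxes and Im z > 0, then removing one box while
   moving z by a fixed complex step theta changes the mean of
   |kerov p_m z - m theta|^2 by a lower order term, provided
   kerov la (z + (N - m) theta) = N theta. With K the rescaled transform of la, this
   gives K_s(w - (1 - s) K(w)) = s K(w) in the limit, s = m / N. The Poisson kernel
   turns this into local density bounds: the increment of the height at x near time
   s is comparable with Im K(w), where w solves w - (1 - s) K(w) = x.
   A nonreal root w makes t |-> H(x, t) strictly increasing near s; a real root at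
   which the left-hand side has positive derivative makes it locally constant.

   The surface is defined and continuous exactly when no H(x, .) has a flat piece
   at a height strictly between 0 and H(x, 1). Here K = A / B with
   A = prod (w - a_i), B = prod (w - b_i), and the equation is a real cubic in w.
   If w = a1 is a critical point of phi = B / ((w - a0)(w - a2)), then a frozen time
   is followed by frozen times up to 1 or preceded by frozen times down to 0.
   Otherwise, for x close to a1 on one side, the time 1 - phi(a1) is liquid and is
   preceded by a frozen interval at positive height.
   The condition phi'(a1) = 0 reads
     (1 + 2p - r)(q - 1 - r)^2 = (1 + p - r)(pr + (1 + r)^2 - p - 2p^2). *)

(** * Partial fractions and complex moduli *)

(** The squared error is followed because its mean closes up under one removal. With Y = Im z of
    order n, a removal changes the error by O(1/Y), but the conditional mean of this change is only
    O(|error| / Y^2 + 1/Y^3), since the choice of theta cancels the leading terms. About n^2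
    removals therefore leave an error O(1), negligible against [kerov], which has order n. The
    transfer from Poisson sums to heights loses factors 2 and 9; this is harmless, as flatness only
    depends on whether Im K(w) vanishes. [H] is known only through probabilities of events that are
    not known to be measurable, being unions over uncountably many x and t. Volumes of such sets are
    compared by monotonicity alone, and the probabilities are bounded below by explicit unions of
    cells on which the order of the entries is fixed. This turns the hypothesis into convergence of
    mean heights. Given the order, the number of entries at most t is binomial, so time t means t N
    boxes up to O(sqrt N), which monotonicity in time absorbs. *)

Section PartialFractions.
Context {F : fieldType}.
Implicit Types (x y z : F) (s : seq F).

Definition pf_coef x s : F := \prod_(y <- s | y != x) (1 - (x - y)^-1).

Lemma pf_coef_cons x y s : y \notin s ->
  pf_coef x (y :: s) = (if y == x then 1 else 1 - (x - y)^-1) * pf_coef x s.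
Proof. by rewrite /pf_coef big_cons; case: eqP => //= _; rewrite mul1r. Qed.

Lemma pf_coef_notin x s : x \notin s ->
  pf_coef x s = \prod_(y <- s) (1 - (x - y)^-1).
Proof.
move=> xs; rewrite /pf_coef big_seq_cond [RHS]big_seq.
by apply: eq_bigl => y; case: (y \in s) / boolP => //= ys; apply: contraNneq xs => <-.
Qed.

Lemma big_pf_coef_cons (G : F -> F) y s : y \notin s ->
  \sum_(x <- y :: s) pf_coef x (y :: s) * G x =
  pf_coef y s * G y + \sum_(x <- s) (1 - (x - y)^-1) * pf_coef x s * G x.
Proof.
move=> ys; rewrite big_cons pf_coef_cons // eqxx mul1r; congr (_ + _).
rewrite big_seq [RHS]big_seq; apply: eq_bigr => x xs.
by rewrite pf_coef_cons //; case: eqP => // yx; rewrite yx xs in ys.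
Qed.

Lemma partial_fractions s z : uniq s -> z \notin s ->
  \prod_(y <- s) (1 - (z - y)^-1) = 1 - \sum_(x <- s) pf_coef x s * (z - x)^-1.
Proof.
elim: s z => [|y s IH] z; first by rewrite !big_nil subr0.
rewrite /= inE negb_or => /andP[ys us] /andP[zy zs].
rewrite big_cons IH // big_pf_coef_cons // pf_coef_notin // IH //.
have -> : \sum_(x <- s) (1 - (x - y)^-1) * pf_coef x s * (z - x)^-1 =
  \sum_(x <- s) pf_coef x s * (z - x)^-1
   - (z - y)^-1 * \sum_(x <- s) pf_coef x s * (z - x)^-1
   + (z - y)^-1 * \sum_(x <- s) pf_coef x s * (y - x)^-1.
  rewrite !mulr_sumr -sumrB -big_split /= big_seq [RHS]big_seq.
  apply: eq_bigr => x xs.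
  have xy : x - y != 0 by rewrite subr_eq0; apply: contraNneq ys => <-.
  have zx : z - x != 0 by rewrite subr_eq0; apply: contraNneq zs => ->.
  have -> : (y - x)^-1 = - (x - y)^-1 by rewrite -invrN opprB.
  by field; rewrite xy zx subr_eq0 zy.
ring.
Qed.

(** This is the coefficient of 1/z at infinity in [partial_fractions]; induction on s replaces the
    expansion. *)
Lemma sum_pf_coef s : uniq s -> \sum_(x <- s) pf_coef x s = (size s)%:R.
Proof.
elim: s => [|y s IH] /=; first by rewrite big_nil.
move=> /andP[ys us].
under eq_bigr do rewrite -[pf_coef _ _]mulr1.
rewrite (big_pf_coef_cons (fun=> 1)) // mulr1 pf_coef_notin // partial_fractions //.
have -> : \sum_(x <- s) (1 - (x - y)^-1) * pf_coef x s * 1 =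
  \sum_(x <- s) pf_coef x s + \sum_(x <- s) pf_coef x s * (y - x)^-1.
  rewrite -big_split /=; apply: eq_bigr => x _.
  by rewrite mulr1 mulrBl mul1r -(opprB x y) invrN mulrN mulrC.
rewrite IH // [(size s).+1%:R]mulrS; ring.
Qed.

(** The next coefficient at infinity: the product has coefficient binomial(size s, 2) minus the sum
    of s at z^-2. *)
Lemma sum_pf_coefM s : uniq s ->
  \sum_(x <- s) pf_coef x s * x = \sum_(x <- s) x - (\sum_(i < size s) i)%:R.
Proof.
elim: s => [|y s IH] /=; first by rewrite !big_nil big_ord0 subr0.
move=> /andP[ys us].
rewrite big_pf_coef_cons // pf_coef_notin // partial_fractions // big_cons.
have -> : \sum_(x <- s) (1 - (x - y)^-1) * pf_coef x s * x =
  \sum_(x <- s) pf_coef x s * x + y * \sum_(x <- s) pf_coef x s * (y - x)^-1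
  - \sum_(x <- s) pf_coef x s.
  rewrite mulr_sumr -big_split /= -sumrB big_seq [RHS]big_seq.
  apply: eq_bigr => x xs.
  have xy : x - y != 0 by rewrite subr_eq0; apply: contraNneq ys => <-.
  have -> : (y - x)^-1 = - (x - y)^-1 by rewrite -invrN opprB.
  by field.
rewrite IH // sum_pf_coef // big_ord_recr /= natrD; ring.
Qed.

End PartialFractions.

Section ComplexModulus.
Context {R : rcfType}.
Implicit Types (z w : R[i]).

Definition cmod z : R := ComplexField.Normc.normc z.

Lemma cmodE z : cmod z = Num.sqrt (complex.Re z ^+ 2 + complex.Im z ^+ 2).
Proof. by case: z. Qed.

Lemma sqr_cmod z : cmod z ^+ 2 = complex.Re z ^+ 2 + complex.Im z ^+ 2.
Proof. by rewrite cmodE sqr_sqrtr // addr_ge0 ?sqr_ge0. Qed.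

Lemma cmod_ge0 z : 0 <= cmod z. Proof. by rewrite cmodE sqrtr_ge0. Qed.

Lemma cmodM z w : cmod (z * w) = cmod z * cmod w.
Proof. exact: ComplexField.Normc.normcM. Qed.

Lemma cmodV z : cmod z^-1 = (cmod z)^-1.
Proof. exact: ComplexField.Normc.normcV. Qed.

Lemma cmodD z w : cmod (z + w) <= cmod z + cmod w.
Proof. exact: le_normcD. Qed.

Lemma cmodN z : cmod (- z) = cmod z.
Proof. exact: normcN. Qed.

Lemma cmodB z w : cmod (z - w) <= cmod z + cmod w.
Proof. by rewrite -[in leRHS](cmodN w) cmodD. Qed.

Lemma cmod_ge_sub z w : cmod z - cmod w <= cmod (z - w).
Proof. by rewrite lerBlDr -{1}(subrK w z) cmodD. Qed.

Lemma cmod0 : cmod 0 = 0. Proof. exact: ComplexField.Normc.normc0. Qed.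
Lemma cmod1 : cmod 1 = 1. Proof. exact: ComplexField.Normc.normc1. Qed.

Lemma cmod_real (x : R) : cmod x%:C%C = `|x|.
Proof. by rewrite cmodE /= expr0n addr0 sqrtr_sqr. Qed.

Lemma cmod_nat n : cmod n%:R = n%:R.
Proof. by rewrite -(rmorph_nat (real_complex R)) cmod_real normr_nat. Qed.

Lemma cmodX z n : cmod (z ^+ n) = cmod z ^+ n.
Proof. by elim: n => [|n IH]; rewrite ?expr0 ?cmod1 // !exprS cmodM IH. Qed.

Lemma cmod_sum (I : Type) (r : seq I) (P : pred I) (G : I -> R[i]) :
  cmod (\sum_(i <- r | P i) G i) <= \sum_(i <- r | P i) cmod (G i).
Proof.
elim/big_rec2: _ => [|i x y _ h]; first by rewrite cmod0.
by rewrite (le_trans (cmodD _ _)) // lerD2l.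
Qed.

Lemma cmod_eq0 z : (cmod z == 0) = (z == 0).
Proof.
apply/eqP/eqP => [|->]; last exact: cmod0.
exact: ComplexField.Normc.eq0_normc.
Qed.

Lemma cmod_gt0 z : (0 < cmod z) = (z != 0).
Proof. by rewrite lt_def cmod_ge0 andbT cmod_eq0. Qed.

Lemma Re_le_cmod z : `|complex.Re z| <= cmod z.
Proof.
by rewrite -(ler_pXn2r (n := 2)) ?nnegrE ?cmod_ge0 // sqr_cmod real_normK ?num_real // lerDl sqr_ge0.
Qed.

Lemma Im_le_cmod z : `|complex.Im z| <= cmod z.
Proof.
by rewrite -(ler_pXn2r (n := 2)) ?nnegrE ?cmod_ge0 // sqr_cmod real_normK ?num_real // lerDr sqr_ge0.
Qed.

Lemma cReD z w : complex.Re (z + w) = complex.Re z + complex.Re w.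
Proof. by case: z w => [? ?] []. Qed.
Lemma cImD z w : complex.Im (z + w) = complex.Im z + complex.Im w.
Proof. by case: z w => [? ?] []. Qed.
Lemma cReN z : complex.Re (- z) = - complex.Re z. Proof. by case: z. Qed.
Lemma cImN z : complex.Im (- z) = - complex.Im z. Proof. by case: z. Qed.
Lemma cReM z w : complex.Re (z * w) =
  complex.Re z * complex.Re w - complex.Im z * complex.Im w.
Proof. by case: z w => [? ?] []. Qed.
Lemma cImM z w : complex.Im (z * w) =
  complex.Re z * complex.Im w + complex.Im z * complex.Re w.
Proof. by case: z w => [? ?] []. Qed.
Lemma cImV z : complex.Im z^-1 = - complex.Im z / cmod z ^+ 2.
Proof. by rewrite sqr_cmod mulNr; case: z. Qed.

Lemma Re_natr n : complex.Re (n%:R : R[i]) = n%:R.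
Proof. by rewrite -(rmorph_nat (real_complex R)). Qed.
Lemma Im_natr n : complex.Im (n%:R : R[i]) = 0.
Proof. by rewrite -(rmorph_nat (real_complex R)). Qed.
Lemma Re_intr m : complex.Re (m%:~R : R[i]) = m%:~R.
Proof. by rewrite -(rmorph_int (real_complex R)). Qed.
Lemma Im_intr m : complex.Im (m%:~R : R[i]) = 0.
Proof. by rewrite -(rmorph_int (real_complex R)). Qed.

Lemma Re_sum (I : Type) (r : seq I) (P : pred I) (G : I -> R[i]) :
  complex.Re (\sum_(i <- r | P i) G i) = \sum_(i <- r | P i) complex.Re (G i).
Proof. by elim/big_rec2: _ => [//|i x y _ <-]; rewrite cReD. Qed.

Lemma Im_sum (I : Type) (r : seq I) (P : pred I) (G : I -> R[i]) :
  complex.Im (\sum_(i <- r | P i) G i) = \sum_(i <- r | P i) complex.Im (G i).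
Proof. by elim/big_rec2: _ => [//|i x y _ <-]; rewrite cImD. Qed.

Lemma complex_eq z w :
  complex.Re z = complex.Re w -> complex.Im z = complex.Im w -> z = w.
Proof. by case: z w => [a b] [c d] /= -> ->. Qed.

End ComplexModulus.

(** * Diagrams, linear extensions and the transition identity *)

Section Boxes.
Implicit Types (la : seq nat) (b : int * int) (s : seq (int * int)) (i j : nat).

Lemma geq_trans : transitive geq.
Proof. by move=> y x z xy yz; apply: leq_trans yz xy. Qed.

Lemma nth_sorted_geq la i j : sorted geq la -> (i <= j)%N ->
  (nth 0%N la j <= nth 0%N la i)%N.
Proof.
move=> sl ij; have [jl|jl] := ltnP j (size la); last by rewrite nth_default.
apply: (sorted_leq_nth (leT := geq) geq_trans (fun x => leqnn x) 0%N sl) => //.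
by rewrite inE (leq_ltn_trans ij).
Qed.

Lemma sorted_geq_nth la :
  (forall i, (nth 0 la i.+1 <= nth 0 la i)%N) -> sorted geq la.
Proof.
move=> h; case: la h => //= x la h; apply/(pathP 0%N) => i _.
exact: (h i).
Qed.

(* Rows and columns are numbered from 0 here, from 1 in [boxes]. *)
Definition box_at i j : int * int := (j%:Z - i%:Z, (i + j).+1%:Z).

Lemma box_at_inj i j i' j' : box_at i j = box_at i' j' -> i = i' /\ j = j'.
Proof. by move=> [h1 h2]; lia. Qed.

Lemma mem_boxesP la b : reflect (exists i j, (j < nth 0 la i)%N /\ b = box_at i j)
  (b \in boxes la).
Proof.
apply: (iffP allpairsPdep) => [[i [j [ii jj ->]]]|[i [j [jj ->]]]].
  rewrite !mem_iota in ii jj; exists i.-1, j.-1; split; first lia.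
  by rewrite /box_at; congr pair; lia.
have il : (i < size la)%N by case: (ltnP i (size la)) => // h; rewrite nth_default in jj.
exists i.+1, j.+1; rewrite !mem_iota /=; split; [lia|lia|].
by rewrite /box_at; congr pair; lia.
Qed.

Lemma box_at_boxes la i j : (box_at i j \in boxes la) = (j < nth 0 la i)%N.
Proof.
apply/mem_boxesP/idP => [[i' [j' [h /box_at_inj[-> ->]]]] //|h].
by exists i, j.
Qed.

Lemma boxes_uniq la : uniq (boxes la).
Proof.
apply: allpairs_uniq_dep; [exact: iota_uniq|by move=> i _; exact: iota_uniq|].
move=> [i j] [i' j'] /allpairsPdep[x [y [xi yi [e1 e2]]]].
move=> /allpairsPdep[x' [y' [xi' yi' [e1' e2']]]] /= [h1 h2].
have -> : i = i' by lia.
by have -> : j = j' by lia.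
Qed.

(** A row that becomes empty stays in the list, so the number of rows never changes. This is why the
    induction runs over [sorted geq] lists rather than over [is_partition]. *)
Definition remove_box i la := set_nth 0%N la i (nth 0%N la i).-1.

Definition corner i la := (i < size la)%N && (nth 0 la i.+1 < nth 0 la i)%N.

Definition corner_box i la := box_at i (nth 0%N la i).-1.

Lemma nth_remove_box i la k :
  nth 0%N (remove_box i la) k = if k == i then (nth 0%N la i).-1 else nth 0%N la k.
Proof. exact: nth_set_nth. Qed.

Lemma size_remove_box i la : corner i la -> size (remove_box i la) = size la.
Proof. by move=> /andP[h _]; rewrite size_set_nth; apply/maxn_idPr. Qed.

Lemma sorted_remove_box i la : sorted geq la -> corner i la ->
  sorted geq (remove_box i la).
Proof.
move=> sl /andP[il h]; apply: sorted_geq_nth => k; rewrite !nth_remove_box.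
have := nth_sorted_geq sl (leqnSn k).
by have [e|e] := eqVneq k.+1 i; have [e'|e'] := eqVneq k i; subst; lia.
Qed.

Lemma boxes_remove_box i la : sorted geq la -> corner i la ->
  perm_eq (boxes la) (corner_box i la :: boxes (remove_box i la)).
Proof.
move=> sl /andP[il h]; apply: uniq_perm; first exact: boxes_uniq.
  rewrite /= boxes_uniq andbT /corner_box box_at_boxes nth_remove_box eqxx.
  by rewrite ltnn.
move=> b; rewrite inE; apply/idP/orP.
  move=> /mem_boxesP[i' [j [hj ->]]]; rewrite /corner_box !box_at_boxes nth_remove_box.
  have [e|e] := eqVneq i' i; last by right.
  subst i'; have [->|ne] := eqVneq j (nth 0%N la i).-1; [by left|right; lia].
move=> [/eqP ->|/mem_boxesP[i' [j [hj ->]]]]; rewrite /corner_box box_at_boxes; first lia.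
by move: hj; rewrite nth_remove_box; case: eqP => [->|//]; lia.
Qed.

Lemma size_boxes_remove i la : sorted geq la -> corner i la ->
  size (boxes la) = (size (boxes (remove_box i la))).+1.
Proof. by move=> sl ci; rewrite (perm_size (boxes_remove_box sl ci)). Qed.

Lemma corner_exists la : (0 < size (boxes la))%N -> exists i, corner i la.
Proof.
move=> h; apply: contrapT => nc.
have hle i : (nth 0 la i <= nth 0 la i.+1)%N.
  have [il|il] := ltnP i (size la); last by rewrite nth_default.
  by rewrite leqNgt; apply/negP => hi; apply: nc; exists i; rewrite /corner il.
have hz i : nth 0%N la i = 0%N.
  apply/eqP; rewrite -leqn0 -[X in (_ <= X)%N](nth_default 0%N (leq_addl i (size la))).
  elim: (size la) => [|k IH]; first by rewrite addn0.
  by rewrite addnS (leq_trans IH).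
by move: h; rewrite -has_predT => /hasP[b /mem_boxesP[i [j []]]]; rewrite hz.
Qed.

Definition precedes b b' :=
  (b' == (b.1 + 1, b.2 + 1)) || (b' == (b.1 - 1, b.2 + 1)).

Definition linear_ext s := pairwise (fun b b' => ~~ precedes b' b) s.

(* A standard tableau is encoded by the list of its boxes in increasing order. *)
Definition linear_exts la := [seq s <- permutations (boxes la) | linear_ext s].

Definition corners la := [seq i <- iota 0 (size la) | corner i la].

Lemma mem_corners la i : (i \in corners la) = corner i la.
Proof.
by rewrite mem_filter mem_iota /=; case: (boolP (corner i la)) => // /andP[-> _].
Qed.

Lemma corners_uniq la : uniq (corners la).
Proof. by rewrite filter_uniq // iota_uniq. Qed.

Lemma precedes_box_at i j : precedes (box_at i j) (box_at i j.+1).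
Proof. by rewrite /precedes; apply/orP; left; apply/eqP; congr pair => /=; lia. Qed.

Lemma precedes_box_at' i j : precedes (box_at i j) (box_at i.+1 j).
Proof. by rewrite /precedes; apply/orP; right; apply/eqP; congr pair => /=; lia. Qed.

Lemma not_precedes_corner la i b : sorted geq la -> corner i la -> b \in boxes la ->
  ~~ precedes (corner_box i la) b.
Proof.
move=> sl /andP[il h] /mem_boxesP[i' [j' [hj ->]]]; apply/negP.
have hs := nth_sorted_geq sl (leqnSn i).
move=> /orP[] /eqP[e1 e2].
  have ei : i' = i by lia. have ej : j' = nth 0%N la i by lia. by subst; lia.
have ei : i' = i.+1 by lia. have ej : j' = (nth 0%N la i).-1 by lia. by subst; lia.
Qed.

(** The successors of the last box in its row and in its column cannot lie in the diagram, since
    they would have to come later. So the box ends its row, and the next row is shorter. *)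
Lemma mem_linear_exts_rcons la s b : sorted geq la -> rcons s b \in linear_exts la ->
  exists i, [/\ corner i la, b = corner_box i la & s \in linear_exts (remove_box i la)].
Proof.
move=> sl; rewrite mem_filter mem_permutations /linear_ext pairwise_rcons.
move=> /andP[/andP[/allP hb hs] hp].
have memE x : (x \in rcons s b) = (x \in boxes la) by apply: perm_mem.
have : b \in boxes la by rewrite -memE mem_rcons mem_head.
move=> /mem_boxesP[i [j [hj eb]]].
have hn b' : precedes b b' -> b' != b -> b' \notin boxes la.
  move=> pb nb; rewrite -memE mem_rcons inE negb_or nb /=.
  by apply/negP => /hb; rewrite pb.
have h1 : j = (nth 0%N la i).-1.
  have := hn (box_at i j.+1); rewrite eb precedes_box_at box_at_boxes => /(_ isT).
  have -> : box_at i j.+1 != box_at i j by apply/eqP => /box_at_inj; lia.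
  by move=> /(_ isT); lia.
have h2 : (nth 0 la i.+1 < nth 0 la i)%N.
  have := hn (box_at i.+1 j); rewrite eb precedes_box_at' box_at_boxes => /(_ isT).
  have -> : box_at i.+1 j != box_at i j by apply/eqP => /box_at_inj; lia.
  by move=> /(_ isT); lia.
have ci : corner i la.
  rewrite /corner h2 andbT; case: ltnP => // h; by rewrite nth_default in hj.
exists i; split => //; first by rewrite eb h1.
rewrite mem_filter mem_permutations /linear_ext hs /= -(perm_cons b).
rewrite -perm_rcons (perm_trans hp) // (perm_trans (boxes_remove_box sl ci)) //.
by rewrite /corner_box -h1 -eb.
Qed.

Lemma rcons_mem_linear_exts la s i : sorted geq la -> corner i la ->
  s \in linear_exts (remove_box i la) -> rcons s (corner_box i la) \in linear_exts la.
Proof.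
move=> sl ci; rewrite !mem_filter !mem_permutations /linear_ext pairwise_rcons.
move=> /andP[-> hp]; have hb := boxes_remove_box sl ci.
rewrite andbT; apply/andP; split; last first.
  rewrite perm_rcons perm_sym (perm_trans hb) // perm_cons perm_sym.
  exact: hp.
apply/allP => b bs; apply: not_precedes_corner => //.
by rewrite (perm_mem hb) inE -(perm_mem hp) bs orbT.
Qed.

Lemma perm_linear_exts la : sorted geq la -> (0 < size (boxes la))%N ->
  perm_eq (linear_exts la)
    [seq rcons s (corner_box i la) | i <- corners la, s <- linear_exts (remove_box i la)].
Proof.
move=> sl h0; apply: uniq_perm.
- by rewrite filter_uniq // permutations_uniq.
- apply: allpairs_uniq_dep; first exact: corners_uniq.
    by move=> i _; rewrite filter_uniq // permutations_uniq.
  move=> [i s] [i' s'] /allpairsPdep[x [y [xi yi [-> ->]]]].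
  move=> /allpairsPdep[x' [y' [xi' yi' [-> ->]]]] /= /rcons_inj e.
  have ey : y = y' := congr1 fst e.
  by have [ex _] := box_at_inj (congr1 snd e : corner_box x la = _); rewrite ex ey.
move=> s; apply/idP/allpairsPdep.
  move=> hs; have hsz : size s = size (boxes la).
    by move: hs; rewrite mem_filter mem_permutations => /andP[_ /perm_size].
  case/lastP: s hs hsz => [|s b] hs hsz; first by rewrite -hsz in h0.
  have [i [ci -> hs']] := mem_linear_exts_rcons sl hs.
  by exists i, s; rewrite mem_corners.
move=> [i [s' [ci hs' ->]]]; rewrite mem_corners in ci.
exact: rcons_mem_linear_exts.
Qed.

Lemma size_linear_ext la s : s \in linear_exts la -> size s = size (boxes la).
Proof. by rewrite mem_filter mem_permutations => /andP[_ /perm_size]. Qed.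

(** The extensions are sorted by their last box; as m is less than the number of boxes, the first m
    boxes do not see it. *)
Lemma sum_linear_exts_rec (V : nmodType) la m (G : seq (int * int) -> V) :
  sorted geq la -> (m < size (boxes la))%N ->
  \sum_(s <- linear_exts la) G (take m s) =
  \sum_(i <- corners la) \sum_(s <- linear_exts (remove_box i la)) G (take m s).
Proof.
move=> sl hm; rewrite (perm_big _ (perm_linear_exts sl _)) /=; last exact: leq_ltn_trans hm.
rewrite big_allpairs_dep /= big_seq [RHS]big_seq; apply: eq_bigr => i ci.
rewrite mem_corners in ci; rewrite big_seq [RHS]big_seq; apply: eq_bigr => s hs.
rewrite -cats1 takel_cat // (size_linear_ext hs).
by rewrite -ltnS -size_boxes_remove.
Qed.

Definition num_ext la := size (linear_exts la).

Lemma num_ext_rec la : sorted geq la -> (0 < size (boxes la))%N ->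
  num_ext la = (\sum_(i <- corners la) num_ext (remove_box i la))%N.
Proof.
move=> sl h0; rewrite /num_ext -sum1_size.
rewrite (sum_linear_exts_rec (V := nat) (fun=> 1%N) sl h0).
by apply: eq_bigr => i _; rewrite sum1_size.
Qed.

Lemma num_ext_gt0 la : sorted geq la -> (0 < num_ext la)%N.
Proof.
have [n] := ubnP (size (boxes la)); elim: n la => // n IH la hn sl.
have [h0|h0] := posnP (size (boxes la)).
  by move: h0 => /size0nil h0; rewrite /num_ext /linear_exts h0.
have [i ci] := corner_exists h0.
rewrite num_ext_rec // (big_rem i) ?mem_corners //= ltn_addr // IH //.
  by rewrite (size_boxes_remove sl ci) in hn.
exact: sorted_remove_box.
Qed.

End Boxes.

Lemma bigD1_seq_cond (F : comPzSemiRingType) (I : eqType) (r : seq I) (P : pred I) (i : I)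
    (G : I -> F) : uniq r -> i \in r -> P i ->
  \prod_(k <- r | P k) G k = G i * \prod_(k <- r | P k && (k != i)) G k.
Proof.
move=> ur ir Pi; rewrite -big_filter (bigD1_seq i) ?filter_uniq ?mem_filter ?Pi //=.
by rewrite big_filter_cond.
Qed.

(** * The law of the last box and the partial fractions of the transform *)

Section Transition.
Context {F : numFieldType}.
Implicit Types (la : seq nat) (i j k : nat) (z : F).

(** The content of the last box of row k. Adding [size la] gives the strictly decreasing shifted row
    lengths of the Frobenius formula for the number of standard tableaux. *)
Definition row_end la k : F := (nth 0%N la k)%:R - k.+1%:R.

(** The value of |la| f(la minus a box) / f(la) predicted by the Frobenius formula for the number f
    of standard tableaux: lowering one shifted row length by 1 changes the factorial and the
    differences by exactly these factors. [num_ext_corner] confirms the prediction. *)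
Definition corner_weight la i : F := (row_end la i + (size la)%:R) *
  \prod_(k <- iota 0 (size la) | k != i) (1 - (row_end la i - row_end la k)^-1).

Lemma row_end_corner la i : corner i la -> row_end la i = (corner_box i la).1%:~R.
Proof.
move=> /andP[_ h]; rewrite /row_end /= rmorphB /=.
by case: (nth 0%N la i) h => // n _; rewrite /= -!natr1; ring.
Qed.

Lemma row_end_diff la i j : sorted geq la -> (i < j)%N ->
  row_end la i - row_end la j = (nth 0%N la i - nth 0%N la j + (j - i))%:R.
Proof.
move=> sl ij; have h := nth_sorted_geq sl (ltnW ij).
by rewrite /row_end natrD !natrB ?(ltnW ij) // -!natr1; ring.
Qed.

Lemma row_end_inj la : sorted geq la -> injective (row_end la).
Proof.
have gen i j : sorted geq la -> (i < j)%N -> row_end la i != row_end la j.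
  move=> sl ij; rewrite -subr_eq0 row_end_diff // pnatr_eq0; lia.
move=> sl i j e; have [ij|ij|//] := ltngtP i j.
  by move: (gen _ _ sl ij); rewrite e eqxx.
by move: (gen _ _ sl ij); rewrite e eqxx.
Qed.

Lemma row_end_uniq la : sorted geq la -> uniq [seq row_end la k | k <- iota 0 (size la)].
Proof. by move=> sl; rewrite map_inj_uniq ?iota_uniq //; apply: row_end_inj. Qed.

Lemma pf_coef_row la i : sorted geq la ->
  pf_coef (row_end la i) [seq row_end la k | k <- iota 0 (size la)] =
  \prod_(k <- iota 0 (size la) | k != i) (1 - (row_end la i - row_end la k)^-1).
Proof.
by move=> sl; rewrite /pf_coef big_map; apply: eq_bigl => k; rewrite (inj_eq (row_end_inj sl)).
Qed.

(** If the next row has the same length, the two row ends differ by 1 and the factor of that row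
    vanishes. Otherwise the row is the last one and empty, and the first factor vanishes. *)
Lemma corner_weight_eq0 la i : sorted geq la -> (i < size la)%N -> ~~ corner i la ->
  corner_weight la i = 0.
Proof.
move=> sl il; rewrite /corner il /= -leqNgt => h.
have h' := nth_sorted_geq sl (leqnSn i).
have [iL|iL] := ltnP i.+1 (size la); last first.
  have e : i.+1 = size la by lia.
  rewrite /corner_weight /row_end -e; move: h; rewrite e [nth 0%N la (size la)]nth_default // leqn0 => /eqP ->.
  by rewrite sub0r addNr mul0r.
rewrite /corner_weight (bigD1_seq_cond (i := i.+1)) ?mem_iota ?iota_uniq //=; last lia.
rewrite row_end_diff // subSnn.
have -> : (nth 0 la i - nth 0 la i.+1 + 1)%N = 1%N by lia.
by rewrite invr1 subrr mul0r mulr0.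
Qed.

Lemma size_boxes la : size (boxes la) = (\sum_(k <- iota 0 (size la)) nth 0 la k)%N.
Proof.
rewrite size_allpairs_dep sumnE big_map.
rewrite -[1%N]/(1 + 0)%N iotaDl big_map; apply: eq_bigr => k _.
by rewrite size_iota add1n.
Qed.

(** The weights combine the two moments in [sum_pf_coef] and [sum_pf_coefM]; the triangular numbers
    coming from the row indices and from the second moment cancel against (size la)^2. *)
Lemma sum_corner_weight la : sorted geq la ->
  \sum_(i <- iota 0 (size la)) corner_weight la i = (size (boxes la))%:R.
Proof.
move=> sl; have u := row_end_uniq sl.
have h1 := sum_pf_coef u; have h2 := sum_pf_coefM u.
rewrite !big_map size_map size_iota in h1 h2.
rewrite (eq_bigr (fun i => pf_coef (row_end la i) [seq row_end la k | k <- iota 0 (size la)]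
   * row_end la i + (size la)%:R * pf_coef (row_end la i) [seq row_end la k | k <- iota 0 (size la)])).
  rewrite big_split /= -mulr_sumr h1 h2 size_boxes natr_sum.
  rewrite /row_end sumrB -!natr_sum -!natrM.
  have e : ((size la) * (size la) =
     \sum_(k <- iota 0 (size la)) k.+1 + \sum_(i < size la) i)%N.
    rewrite -(big_mkord xpredT (fun i => i)) /index_iota subn0 -big_split /=.
    elim: (size la) => [|n IH]; first by rewrite big_nil.
    rewrite -{3}addn1 iotaD big_cat /= -IH big_seq1; lia.
  move/(congr1 (fun n => n%:R : F)): e; rewrite natrD => ->; ring.
by move=> i _; rewrite pf_coef_row // /corner_weight mulrC mulrDr; congr (_ + _); rewrite mulrC.
Qed.

Lemma row_end_remove la i k : corner i la -> row_end (remove_box i la) k =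
  if k == i then row_end la i - 1 else row_end la k.
Proof.
move=> /andP[_ h]; rewrite /row_end nth_remove_box; case: eqP => // ->.
by case: (nth 0%N la i) h => // n _; rewrite /= -!natr1; ring.
Qed.

Lemma corner_remove la i j : sorted geq la -> i != j -> corner i la -> corner j la ->
  corner j (remove_box i la).
Proof.
move=> sl ij ci cj; rewrite /corner size_remove_box //.
case/andP: cj => -> /= h; rewrite !nth_remove_box [j == i]eq_sym (negbTE ij).
case: eqP => [e|//]; subst i; lia.
Qed.

Lemma remove_boxC la i j : corner i la -> corner j la -> i != j ->
  remove_box i (remove_box j la) = remove_box j (remove_box i la).
Proof.
move=> ci cj ij; have s1 := size_remove_box ci; have s2 := size_remove_box cj.
have le1 : (i < size la)%N by case/andP: ci.
have le2 : (j < size la)%N by case/andP: cj.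
apply: (@eq_from_nth _ 0%N).
  rewrite !size_set_nth; lia.
have ji : (j == i) = false by rewrite eq_sym (negbTE ij).
move=> k _; rewrite !nth_remove_box (negbTE ij) ji.
by case: (k =P i) => [->|_]; rewrite ?(negbTE ij).
Qed.

Lemma corner_gap la i j : sorted geq la -> (i < j)%N -> corner i la -> corner j la ->
  exists n : nat, row_end la i - row_end la j = n.+2%:R.
Proof.
move=> sl ij /andP[_ h] _; exists (nth 0 la i - nth 0 la j + (j - i) - 2)%N.
rewrite row_end_diff //; congr (_%:R).
have := nth_sorted_geq sl ij; lia.
Qed.

(** Shortening row i only changes its own factor: with d the row end of j minus that of i, 1 - 1/d
    becomes 1 - 1/(d + 1), and the quotient is d^2 / (d^2 - 1). The form with squares is symmetric
    in i and j, which [num_ext_corner] exploits. *)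
Lemma corner_weight_remove la i j : sorted geq la -> i != j -> corner i la -> corner j la ->
  corner_weight (remove_box i la) j * ((row_end la i - row_end la j) ^+ 2 - 1)
    = corner_weight la j * (row_end la i - row_end la j) ^+ 2.
Proof.
move=> sl ij ci cj; rewrite /corner_weight size_remove_box //.
have il : (i < size la)%N by case/andP: ci.
rewrite row_end_remove // eq_sym (negbTE ij).
rewrite (bigD1_seq_cond (i := i)) ?mem_iota ?iota_uniq //=.
rewrite [in RHS](bigD1_seq_cond (i := i)) ?mem_iota ?iota_uniq //=.
rewrite row_end_remove // eqxx.
rewrite (eq_bigr (fun k => 1 - (row_end la j - row_end la k)^-1)); last first.
  by move=> k /andP[_ h]; rewrite row_end_remove // (negbTE h).
set P := \prod_(_ <- _ | _) _.
(* Two corners have contents at distance at least 2, so no denominator vanishes after the shift by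
   1. *)
have [n hn] : exists n : nat, row_end la i - row_end la j = n.+2%:R
    \/ row_end la j - row_end la i = n.+2%:R.
  have [h|h|h] := ltngtP i j.
  - by have [n hn] := corner_gap sl h ci cj; exists n; left.
  - by have [n hn] := corner_gap sl h cj ci; exists n; right.
  - by rewrite h eqxx in ij.
set a := row_end la i in hn *; set b := row_end la j in hn *.
have h0 : b - a != 0.
  case: hn => hn; first by rewrite -opprB hn oppr_eq0 pnatr_eq0.
  by rewrite hn pnatr_eq0.
have h1 : b - (a - 1) != 0.
  case: hn => hn.
    have -> : b - (a - 1) = - n.+1%:R.
      have -> : b - (a - 1) = - (a - b) + 1 by ring.
      by rewrite hn -[n.+2%:R]natr1; ring.
    by rewrite oppr_eq0 pnatr_eq0.
  have -> : b - (a - 1) = (b - a) + 1 by ring.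
  by rewrite hn natr1 pnatr_eq0.
field.
by rewrite h0 h1.
Qed.

(** By induction, la without i and la without j are both compared with la without the two boxes;
    since [corner_weight_remove] is symmetric, the cross products in [key] agree. Summing [key] over
    the corners j, the weights add up to |la| and the numbers of extensions to that of la. *)
Lemma num_ext_corner la i : sorted geq la -> corner i la ->
  (num_ext (remove_box i la))%:R * (size (boxes la))%:R
    = corner_weight la i * (num_ext la)%:R.
Proof.
have [n] := ubnP (size (boxes la)); elim: n la i => // n IH la i hn sl ci.
have h0 : (0 < size (boxes la))%N by rewrite (size_boxes_remove sl ci).
have key j : corner j la -> (num_ext (remove_box i la))%:R * corner_weight la j
   = (num_ext (remove_box j la))%:R * corner_weight la i.
  move=> cj; have [->//|ij] := eqVneq i j.
  have ji : j != i by rewrite eq_sym.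
  have si := sorted_remove_box sl ci; have sj := sorted_remove_box sl cj.
  have zi := size_boxes_remove sl ci; have zj := size_boxes_remove sl cj.
  have e1 := IH (remove_box i la) j _ si (corner_remove sl ij ci cj).
  have e2 := IH (remove_box j la) i _ sj (corner_remove sl ji cj ci).
  have {}e1 := e1 (ltac:(lia)); have {}e2 := e2 (ltac:(lia)).
  have w1 := corner_weight_remove sl ij ci cj.
  have w2 := corner_weight_remove sl ji cj ci.
  have [m hm] : exists m : nat, (row_end la i - row_end la j) ^+ 2 = m.+2%:R ^+ 2.
    have [h|h|h] := ltngtP i j.
    - by have [m hm] := corner_gap sl h ci cj; exists m; rewrite hm.
    - by have [m hm] := corner_gap sl h cj ci; exists m; rewrite -sqrrN opprB hm.
    - by rewrite h eqxx in ij.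
  have e3 : size (boxes (remove_box i la)) = size (boxes (remove_box j la)) by lia.
  rewrite (remove_boxC ci cj ij) -e3 in e2.
  rewrite -[(row_end la j - _) ^+ 2]sqrrN opprB in w2.
  rewrite !hm in w1 w2.
  set D := m.+2%:R ^+ 2 in w1 w2.
  have D0 : D != 0 by rewrite expf_eq0 pnatr_eq0.
  clearbody D; move: (corner_weight la j) (corner_weight la i) w1 w2 => wj wi w1 w2.
  apply: (mulIf D0); rewrite -!mulrA -w1 -w2 mulrA [RHS]mulrA; congr (_ * _).
  by rewrite mulrC -e1 [RHS]mulrC -e2.
have hs := sum_corner_weight sl.
rewrite -hs mulr_sumr (num_ext_rec sl h0) natr_sum mulr_sumr /corners big_filter.
rewrite [RHS]big_seq_cond [LHS]big_seq [LHS](bigID (fun j => corner j la)) /=.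
rewrite [X in _ + X]big1 ?addr0; last first.
  move=> j /andP[]; rewrite mem_iota => /andP[_ jl] cj.
  by rewrite corner_weight_eq0 ?mulr0.
by apply: eq_bigr => j /andP[_ cj]; rewrite key // mulrC.
Qed.

Definition kerov (p : seq (int * int)) z : F :=
  z * \prod_(b <- p) (1 - (z - b.1%:~R) ^- 2).

Lemma kerov_perm p q z : perm_eq p q -> kerov p z = kerov q z.
Proof. by move=> h; rewrite /kerov (perm_big _ h). Qed.

Definition non_integer z := forall m : int, z - m%:~R != 0.

(** A box of content c contributes (z - c - 1)(z - c + 1) / (z - c)^2, so the product along a row
    telescopes and only the two ends survive. *)
Lemma kerov_row z (i a : nat) : non_integer z ->
  \prod_(j <- iota 1 a) (1 - (z - (j%:Z - i.+1%:Z)%:~R) ^- 2) =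
  (z + i.+1%:R) / (z + i%:R) * (1 - (z - (a%:R - i.+1%:R))^-1).
Proof.
move=> hz; elim: a => [|a IH].
  rewrite big_nil; have h1 := hz (- i.+1%:Z); have h2 := hz (- i%:Z).
  rewrite rmorphN /= opprK -pmulrn in h1.
  rewrite rmorphN /= opprK -pmulrn in h2.
  rewrite sub0r opprK; rewrite -natr1 addrA in h1 *.
  by field; rewrite h1 h2.
rewrite -{1}[a.+1]addn1 iotaD big_cat /= IH big_seq1 add1n.
have h2 := hz (- i%:Z); rewrite rmorphN /= opprK -pmulrn in h2.
have h3 := hz (a.+1%:Z - i.+1%:Z); have h4 := hz (a%:Z - i.+1%:Z).
rewrite rmorphB /= -!pmulrn in h3.
rewrite rmorphB /= -!pmulrn in h4.
rewrite rmorphB /= -!pmulrn.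
rewrite -!natr1 in h3 h4 *.
field; rewrite h2 h4 ?andbT.
by move: h3; apply: contra_neq => <-; ring.
Qed.

Lemma kerov_rows la z : non_integer z -> kerov (boxes la) z =
  (z + (size la)%:R) *
  \prod_(k <- iota 0 (size la)) (1 - (z - row_end la k)^-1).
Proof.
move=> hz; rewrite /kerov big_allpairs_dep /=.
rewrite -[1%N]/(1 + 0)%N iotaDl big_map /=.
under eq_bigr => k _ do rewrite add1n kerov_row //.
rewrite big_split /= mulrA; congr (_ * _).
have hn (n : nat) : z + n%:R != 0.
  by have := hz (- n%:Z); rewrite rmorphN /= opprK.
elim: (size la) => [|n IH]; first by rewrite big_nil mulr1 addr0.
by rewrite -{1}[n.+1]addn1 iotaD big_cat /= mulrA IH big_seq1 add0n mulrCA divff ?mulr1.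
Qed.

(** In the partial fractions of [kerov_rows], (z + l)/(z - e) = 1 + (e + l)/(z - e) turns [pf_coef]
    into [corner_weight]; the constants cancel by [sum_pf_coef], and rows that are not corners have
    weight 0. *)
Lemma kerov_transition la z : sorted geq la -> non_integer z ->
  kerov (boxes la) z =
  z - \sum_(i <- corners la) corner_weight la i / (z - (corner_box i la).1%:~R).
Proof.
move=> sl hz; rewrite kerov_rows //; have u := row_end_uniq sl.
have zk k : z - row_end la k != 0.
  have := hz ((nth 0%N la k)%:Z - k.+1%:Z); by rewrite rmorphB.
have zn : z \notin [seq row_end la k | k <- iota 0 (size la)].
  by apply/mapP => -[k _ e]; have := zk k; rewrite e subrr eqxx.
have h1 := sum_pf_coef u.
have h := partial_fractions u zn; rewrite !big_map in h h1; rewrite h.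
rewrite size_map size_iota in h1.
rewrite mulrBr mulr1 mulr_sumr.
rewrite (eq_bigr (fun i => pf_coef (row_end la i) [seq row_end la k | k <- iota 0 (size la)]
   + corner_weight la i / (z - row_end la i))); last first.
  move=> i _; rewrite /corner_weight -pf_coef_row //; have := zk i.
  set c := pf_coef _ _; set r := row_end _ _ => zi; by field.
rewrite big_split /= h1 opprD addrA addrK; congr (_ - _).
rewrite /corners big_filter [LHS](bigID (fun i => corner i la)) /=.
rewrite [X in _ + X]big1_seq ?addr0; last first.
  move=> i /andP[ci]; rewrite mem_iota => /andP[_ il].
  by rewrite corner_weight_eq0 ?mul0r.
by apply: eq_bigr => i ci; rewrite row_end_corner.
Qed.

End Transition.

(** * Second moments along a characteristic *)

Section OneStep.
Context {R : realType}.
Local Notation C := R[i].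
Variables (I : Type) (r : seq I) (p : I -> R) (c : I -> int).
Hypotheses (p_ge0 : forall i, 0 <= p i) (p_sum : \sum_(i <- r) p i = 1).
Variables (m : nat) (Z theta : C) (A B Y : R).
Hypotheses (Y2 : 2 <= Y) (ImZ : Y <= complex.Im Z) (ImZ' : Y <= complex.Im (Z - theta)).
Hypotheses (mY : m%:R <= A * Y ^+ 2) (thY : cmod theta * Y <= B).
Hypothesis (Z'Y : cmod (Z - theta) <= B * Y).

Local Ltac ylra := move: (Y2) => ?; lra.
Local Ltac ynra := move: (Y2) => ?; nra.

(** One removal in abstract form: [I] indexes the corners, [p i] is the probability of the corner of
    content [c i], and [m] is the number of boxes, so [K] is the transform before the removal. With
    Y of order n, [A] controls m, of order n^2, and [B] controls theta, of order 1/n, and Z, of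
    order n. *)
Local Notation K z := (z - m%:R * \sum_(i <- r) (p i)%:C%C / (z - (c i)%:~R)).

Lemma cmod_avg (G : I -> C) (M : R) : (forall i, cmod (G i) <= M) ->
  cmod (\sum_(i <- r) (p i)%:C%C * G i) <= M.
Proof.
move=> h; rewrite (le_trans (cmod_sum _ _ _)) //.
rewrite -[leRHS]mul1r -p_sum mulr_suml ler_sum // => i _.
by rewrite cmodM cmod_real ger0_norm // ler_wpM2l.
Qed.

Lemma cmod_sub_int (z : C) (k : int) : Y <= complex.Im z -> Y <= cmod (z - k%:~R).
Proof.
move=> h; rewrite (le_trans _ (Im_le_cmod _)) // cImD cImN Im_intr subr0.
by rewrite (le_trans h) // ler_norm.
Qed.

Lemma cmod_inv_sub_int (z : C) (k : int) : Y <= complex.Im z ->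
  cmod (z - k%:~R)^-1 <= Y^-1.
Proof.
move=> h; have h' := cmod_sub_int k h; have Y0 : 0 < Y by ylra.
by rewrite cmodV lef_pV2 ?posrE // (lt_le_trans Y0).
Qed.

Lemma neq_int (z : C) (k : int) : Y <= complex.Im z -> z - k%:~R != 0.
Proof. by move=> h; rewrite -cmod_gt0 (lt_le_trans _ (cmod_sub_int k h)) //; ylra. Qed.

(** Removing the corner i multiplies the transform at Z - theta by 1 + [rho i]. *)
Let rho i := ((Z - theta - (c i)%:~R) ^+ 2 - 1)^-1.

Lemma sqr_sub1_lb i : Y ^+ 2 / 2 <= cmod ((Z - theta - (c i)%:~R) ^+ 2 - 1).
Proof.
have h := cmod_sub_int (c i) ImZ'.
rewrite (le_trans _ (cmod_ge_sub _ _)) // cmod1 cmodX.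
have : Y ^+ 2 <= cmod (Z - theta - (c i)%:~R) ^+ 2 by rewrite ler_pXn2r ?nnegrE ?cmod_ge0 //; ylra.
by ynra.
Qed.

Lemma rho_bound i : cmod (rho i) <= 2 / Y ^+ 2.
Proof.
have Y0 : 0 < Y ^+ 2 / 2 by rewrite divr_gt0 ?exprn_gt0 //; ylra.
have h := sqr_sub1_lb i.
by rewrite /rho cmodV -(invf_div (Y ^+ 2)) lef_pV2 ?posrE // (lt_le_trans Y0).
Qed.

Let S := m%:R * \sum_(i <- r) (p i)%:C%C * ((Z - (c i)%:~R)^-1 * (Z - theta - (c i)%:~R)^-1).
Let q := \sum_(i <- r) (p i)%:C%C * rho i.

Let A_ge0 : 0 <= A.
Proof.
have : 0 <= A * Y ^+ 2 by apply: le_trans mY.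
by rewrite pmulr_lge0 // exprn_gt0 //; ylra.
Qed.

Let B_ge0 : 0 <= B.
Proof. by apply: le_trans thY; rewrite mulr_ge0 ?cmod_ge0 //; ylra. Qed.

Let Y_gt0 : 0 < Y. Proof. ylra. Qed.

Lemma S_bound : cmod S <= A.
Proof.
rewrite /S cmodM cmod_nat.
have -> : A = A * Y ^+ 2 * (Y^-1 * Y^-1) by field; ylra.
apply: ler_pM; rewrite ?cmod_ge0 //; apply: cmod_avg => i.
by rewrite cmodM ler_pM ?cmod_ge0 // cmod_inv_sub_int.
Qed.

Lemma q_bound : cmod q <= 2 / Y ^+ 2.
Proof. by apply: cmod_avg => i; apply: rho_bound. Qed.

Lemma theta_bound : cmod theta <= B / Y.
Proof. by rewrite ler_pdivlMr. Qed.

Lemma K_shift : K (Z - theta) = K Z - theta * (1 + S).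
Proof.
have -> : K Z - theta * (1 + S) = Z - theta - m%:R * (\sum_(i <- r) (p i)%:C%C / (Z - (c i)%:~R)
   + theta * \sum_(i <- r) (p i)%:C%C * ((Z - (c i)%:~R)^-1 * (Z - theta - (c i)%:~R)^-1)).
  by rewrite /S; ring.
congr (_ - _ * _); rewrite mulr_sumr -big_split /=; apply: eq_bigr => i _.
have h1 := neq_int (c i) ImZ; have h2 := neq_int (c i) ImZ'.
by field; rewrite h1 h2.
Qed.

(** Both terms are m times means of almost equal kernels of size 1/Y^2. The shift of one factor by
    theta and the -1 in [rho] are relative changes of order 1/Y^2, which leaves m times O(1/Y^4). *)
Lemma mq_bound : cmod (m%:R * q - S) <= A * (2 * B + 2) / Y ^+ 2.
Proof.
have -> : m%:R * q - S = m%:R * \sum_(i <- r) (p i)%:C%C *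
   (theta * (rho i * (Z - (c i)%:~R)^-1) +
    rho i * ((Z - (c i)%:~R)^-1 * (Z - theta - (c i)%:~R)^-1)).
  rewrite /q /S -mulrBr -sumrB; congr (_ * _); apply: eq_bigr => i _.
  have h1 := neq_int (c i) ImZ; have h2 := neq_int (c i) ImZ'.
  have h3 : (Z - theta - (c i)%:~R) ^+ 2 - 1 != 0.
    rewrite -cmod_gt0 (lt_le_trans _ (sqr_sub1_lb i)) // divr_gt0 ?exprn_gt0 //.
  by rewrite /rho; field; rewrite h1 h2 h3.
rewrite cmodM cmod_nat.
have -> : A * (2 * B + 2) / Y ^+ 2 = A * Y ^+ 2 * ((2 * B + 2) / Y ^+ 4) by field; ylra.
apply: ler_pM; rewrite ?cmod_ge0 //; apply: cmod_avg => i.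
have h1 := cmod_inv_sub_int (c i) ImZ; have h2 := cmod_inv_sub_int (c i) ImZ'.
rewrite (le_trans (cmodD _ _)) // !cmodM.
have -> : (2 * B + 2) / Y ^+ 4 = B / Y * (2 / Y ^+ 2 * Y^-1) + 2 / Y ^+ 2 * (Y^-1 * Y^-1).
  by field; ylra.
apply: lerD.
  by rewrite !ler_pM ?mulr_ge0 ?cmod_ge0 ?theta_bound ?rho_bound.
by rewrite !ler_pM ?mulr_ge0 ?cmod_ge0 ?rho_bound.
Qed.

(** [e] is the error before the removal, and [e + d i] is the error after the corner i has been
    removed. *)
Let e := K Z - m%:R * theta.
Let d i := - theta * S + K (Z - theta) * rho i.

(** Inserting K (Z - theta) = m theta + e - theta (1 + S) replaces two terms of order 1/Y, namely
    theta S and the mean of K times rho, by the small difference theta (m q - S). This cancellation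
    is what the displacement by theta is for. *)
Lemma avg_d : \sum_(i <- r) (p i)%:C%C * d i =
  e * q + theta * (m%:R * q - S) - theta * (1 + S) * q.
Proof.
have -> : e * q + theta * (m%:R * q - S) - theta * (1 + S) * q =
    - theta * S + K (Z - theta) * q by rewrite K_shift /e; ring.
rewrite /d (eq_bigr (fun i => (p i)%:C%C * (- theta * S) + K (Z - theta) * ((p i)%:C%C * rho i))).
  by rewrite big_split /= -mulr_suml -rmorph_sum p_sum mul1r -mulr_sumr.
by move=> i _; ring.
Qed.

Let C3 := A * B * (2 * B + 2) + 2 * B * (1 + A).

Lemma avg_d_bound : cmod (\sum_(i <- r) (p i)%:C%C * d i) <=
  2 * cmod e / Y ^+ 2 + C3 / Y ^+ 3.
Proof.
rewrite avg_d (le_trans (cmodB _ _)) //.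
have h1 : cmod (e * q) <= 2 * cmod e / Y ^+ 2.
  rewrite cmodM mulrC mulrAC ler_pM ?cmod_ge0 //; exact: q_bound.
have h2 : cmod (theta * (m%:R * q - S)) <= B / Y * (A * (2 * B + 2) / Y ^+ 2).
  by rewrite cmodM ler_pM ?cmod_ge0 ?theta_bound ?mq_bound.
have h3 : cmod (theta * (1 + S) * q) <= B / Y * (1 + A) * (2 / Y ^+ 2).
  rewrite !cmodM ler_pM ?mulr_ge0 ?cmod_ge0 ?q_bound // ler_pM ?cmod_ge0 ?theta_bound //.
  by rewrite (le_trans (cmodD _ _)) // cmod1 lerD2l S_bound.
have -> : C3 / Y ^+ 3 = B / Y * (A * (2 * B + 2) / Y ^+ 2) + B / Y * (1 + A) * (2 / Y ^+ 2).
  by rewrite /C3; field; ylra.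
have h4 := cmodD (e * q) (theta * (m%:R * q - S)).
by ylra.
Qed.

Let D2 := A * B + 2 * (A + B).

Lemma d_bound i : cmod (d i) <= D2 / Y.
Proof.
rewrite /d (le_trans (cmodD _ _)) //.
have h1 : cmod (- theta * S) <= B / Y * A.
  by rewrite cmodM cmodN ler_pM ?cmod_ge0 ?theta_bound ?S_bound.
have h2 : cmod (K (Z - theta)) <= (A + B) * Y.
  rewrite (le_trans (cmodB _ _)) // mulrDl addrC lerD // cmodM cmod_nat.
  have -> : A * Y = A * Y ^+ 2 * Y^-1 by field; ylra.
  rewrite ler_pM ?cmod_ge0 //; apply: cmod_avg => j; exact: cmod_inv_sub_int.
have h3 : cmod (K (Z - theta) * rho i) <= (A + B) * Y * (2 / Y ^+ 2).
  by rewrite cmodM ler_pM ?cmod_ge0 ?rho_bound.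
have -> : D2 / Y = B / Y * A + (A + B) * Y * (2 / Y ^+ 2) by rewrite /D2; field; ylra.
exact: lerD.
Qed.

Definition step_const : R := (A * B * (2 * B + 2) + 2 * B * (1 + A)) ^+ 2 +
  (A * B + 2 * (A + B)) ^+ 2.

Lemma sqr_cmodD (a b : C) : cmod (a + b) ^+ 2 = cmod a ^+ 2 + cmod b ^+ 2
  + 2 * (complex.Re a * complex.Re b + complex.Im a * complex.Im b).
Proof. rewrite !sqr_cmod cReD cImD; ring. Qed.

Lemma dot_le_cmod (a b : C) :
  complex.Re a * complex.Re b + complex.Im a * complex.Im b <= cmod a * cmod b.
Proof.
have h : complex.Re a * complex.Re b + complex.Im a * complex.Im b =
  complex.Re (a^*%C * b) by case: a b => [a1 a2] [b1 b2] /=; ring.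
rewrite h (le_trans (ler_norm _)) // (le_trans (Re_le_cmod _)) // cmodM.
by rewrite (_ : cmod a^*%C = cmod a) // !cmodE; case: a {h} => [a1 a2] /=; rewrite sqrrN.
Qed.

(** In the mean of |e + d i|^2 the squares of [d] cost D2^2 / Y^2, and the cross term only sees the
    mean of [d]. The 5 consists of 4, from twice |e| times 2 |e| / Y^2, and of 1, from splitting 2
    |e| C3 / Y^3 into squares. *)
Lemma one_step_bound :
  \sum_(i <- r) p i * cmod (K (Z - theta) * (1 + rho i) - (m%:R - 1) * theta) ^+ 2
  <= (1 + 5 / Y ^+ 2) * cmod (K Z - m%:R * theta) ^+ 2 + step_const / Y ^+ 2.
Proof.
rewrite -/e.
have -> : \sum_(i <- r) p i * cmod (K (Z - theta) * (1 + rho i) - (m%:R - 1) * theta) ^+ 2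
  = cmod e ^+ 2 + \sum_(i <- r) p i * cmod (d i) ^+ 2 +
    2 * (complex.Re e * complex.Re (\sum_(i <- r) (p i)%:C%C * d i) +
         complex.Im e * complex.Im (\sum_(i <- r) (p i)%:C%C * d i)).
  rewrite (eq_bigr (fun i => p i * cmod e ^+ 2 + p i * cmod (d i) ^+ 2 +
     2 * (complex.Re e * complex.Re ((p i)%:C%C * d i) +
          complex.Im e * complex.Im ((p i)%:C%C * d i)))); last first.
    move=> i _.
    have -> : K (Z - theta) * (1 + rho i) - (m%:R - 1) * theta = e + d i.
      by rewrite /d /e mulrDr mulr1 {1}K_shift; ring.
    by rewrite sqr_cmodD cReM cImM /=; ring.
  rewrite !big_split /= -mulr_suml p_sum mul1r -mulr_sumr big_split /=.
  by rewrite -!mulr_sumr -Re_sum -Im_sum.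
have h1 : \sum_(i <- r) p i * cmod (d i) ^+ 2 <= D2 ^+ 2 / Y ^+ 2.
  rewrite -expr_div_n -[leRHS]mul1r -p_sum mulr_suml ler_sum // => i _.
  rewrite ler_wpM2l // ler_pXn2r ?nnegrE ?cmod_ge0 ?d_bound //.
  by rewrite (le_trans (cmod_ge0 (d i))) ?d_bound.
have h2 := dot_le_cmod e (\sum_(i <- r) (p i)%:C%C * d i).
have h3 : cmod e * cmod (\sum_(i <- r) (p i)%:C%C * d i) <=
   cmod e * (2 * cmod e / Y ^+ 2 + C3 / Y ^+ 3).
  by rewrite ler_wpM2l ?cmod_ge0 ?avg_d_bound.
have h4 : 2 * (cmod e * (C3 / Y ^+ 3)) <= cmod e ^+ 2 / Y ^+ 2 + C3 ^+ 2 / Y ^+ 2.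
  have a1 : 2 * (cmod e * (C3 / Y ^+ 3)) <= (cmod e / Y) ^+ 2 + (C3 / Y ^+ 2) ^+ 2.
    have : 0 <= (cmod e / Y - C3 / Y ^+ 2) ^+ 2 by apply: sqr_ge0.
    have -> : cmod e * (C3 / Y ^+ 3) = (cmod e / Y) * (C3 / Y ^+ 2) by field; ylra.
    by ynra.
  apply: (le_trans a1); rewrite !expr_div_n lerD2l ler_wpM2l ?sqr_ge0 //.
  have Y4 : 1 <= Y ^+ 2 by ynra.
  by rewrite lef_pV2 ?posrE ?exprn_gt0 // [leRHS]expr2 ler_peMl // sqr_ge0.
have -> : step_const / Y ^+ 2 = C3 ^+ 2 / Y ^+ 2 + D2 ^+ 2 / Y ^+ 2.
  by rewrite /step_const mulrDl.
have h5 : cmod e * (2 * cmod e / Y ^+ 2) = 2 * (cmod e ^+ 2 / Y ^+ 2) by field; ylra.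
rewrite mulrDr h5 in h3.
have h6 : (1 + 5 / Y ^+ 2) * cmod e ^+ 2 = cmod e ^+ 2 + 5 * (cmod e ^+ 2 / Y ^+ 2) by field; ylra.
rewrite h6; ylra.
Qed.

End OneStep.

(** * Means over random linear extensions *)

Section Means.
Context {R : realType}.
Local Notation C := R[i].
Implicit Types (la : seq nat) (G : seq (int * int) -> R).

Definition mean la m G : R :=
  (\sum_(s <- linear_exts la) G (take m s)) / (num_ext la)%:R.

Definition trans_prob la i : R := (num_ext (remove_box i la))%:R / (num_ext la)%:R.

Lemma num_ext_neq0 la : sorted geq la -> (num_ext la)%:R != 0 :> R.
Proof. by move=> sl; rewrite pnatr_eq0 -lt0n num_ext_gt0. Qed.

Lemma trans_prob_ge0 la i : 0 <= trans_prob la i.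
Proof. by rewrite divr_ge0. Qed.

Lemma trans_prob_sum la : sorted geq la -> (0 < size (boxes la))%N ->
  \sum_(i <- corners la) trans_prob la i = 1.
Proof.
move=> sl h; rewrite -mulr_suml -natr_sum -num_ext_rec // divff //.
exact: num_ext_neq0.
Qed.

Lemma mean_rec la m G : sorted geq la -> (m < size (boxes la))%N ->
  mean la m G = \sum_(i <- corners la) trans_prob la i * mean (remove_box i la) m G.
Proof.
move=> sl h; rewrite /mean sum_linear_exts_rec // mulr_suml.
rewrite big_seq [RHS]big_seq; apply: eq_bigr => i; rewrite mem_corners => ci.
have := num_ext_neq0 (sorted_remove_box sl ci); have := num_ext_neq0 sl.
rewrite /trans_prob; set a := (num_ext la)%:R; set b := (num_ext _)%:R => ha hb.
by field; rewrite ha hb.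
Qed.

Lemma mean_full la G : sorted geq la -> (forall p q, perm_eq p q -> G p = G q) ->
  mean la (size (boxes la)) G = G (boxes la).
Proof.
move=> sl h; rewrite /mean big_seq (eq_bigr (fun=> G (boxes la))); last first.
  move=> s hs; apply: h; rewrite take_oversize ?(size_linear_ext hs) //.
  by move: hs; rewrite mem_filter mem_permutations => /andP[].
by rewrite -big_seq big_const_seq count_predT iter_addr_0 -/(num_ext la) -[G _ *+ _]mulr_natr mulfK // num_ext_neq0.
Qed.

Lemma mean_le la m G G' :
  (forall s, s \in linear_exts la -> G (take m s) <= G' (take m s)) ->
  mean la m G <= mean la m G'.
Proof.
move=> h; rewrite /mean ler_wpM2r ?invr_ge0 // big_seq [leRHS]big_seq.
by apply: ler_sum.
Qed.

Lemma meanD la m G G' : mean la m (fun p => G p + G' p) = mean la m G + mean la m G'.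
Proof. by rewrite /mean big_split mulrDl. Qed.

Lemma meanZ la m a G : mean la m (fun p => a * G p) = a * mean la m G.
Proof. by rewrite /mean -mulr_sumr mulrA. Qed.

Lemma mean_cst la m a : sorted geq la -> mean la m (fun=> a) = a.
Proof.
move=> sl; rewrite /mean big_const_seq count_predT iter_addr_0 -/(num_ext la).
by rewrite -[a *+ _]mulr_natr mulfK // num_ext_neq0.
Qed.

Lemma mean_ge0 la m G : (forall p, 0 <= G p) -> 0 <= mean la m G.
Proof. by move=> h; rewrite divr_ge0 // sumr_ge0. Qed.

Lemma mean_sum la m (I : Type) (r : seq I) (G : I -> seq (int * int) -> R) :
  mean la m (fun p => \sum_(i <- r) G i p) = \sum_(i <- r) mean la m (G i).
Proof. by rewrite /mean exchange_big /= mulr_suml. Qed.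

Lemma mean_sqr_le la m G : sorted geq la -> mean la m G ^+ 2 <= mean la m (fun p => G p ^+ 2).
Proof.
move=> sl; set a := mean la m G.
have : 0 <= mean la m (fun p => (G p - a) ^+ 2) by apply: mean_ge0 => p; apply: sqr_ge0.
have -> : (fun p => (G p - a) ^+ 2) = (fun p => (G p ^+ 2 + (- 2 * a) * G p) + a ^+ 2).
  by apply/funext => p; ring.
by rewrite !meanD meanZ mean_cst // -/a; lra.
Qed.

Lemma non_integer_Im (z : C) : complex.Im z != 0 -> non_integer z.
Proof.
move=> h k; apply: contra_neq h => /(congr1 (fun w => complex.Im w)).
by rewrite cImD cImN Im_intr subr0.
Qed.

Lemma kerov_trans_prob la (z : C) : sorted geq la -> complex.Im z != 0 ->
  kerov (boxes la) z = z - (size (boxes la))%:R *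
   \sum_(i <- corners la) (trans_prob la i)%:C%C / (z - (corner_box i la).1%:~R).
Proof.
move=> sl hz; rewrite kerov_transition //; last exact: non_integer_Im.
congr (_ - _).
rewrite mulr_sumr big_seq [RHS]big_seq; apply: eq_bigr => i; rewrite mem_corners => ci.
rewrite mulrA; congr (_ / _).
have := num_ext_corner (F := R[i]) sl ci.
have n0 : (num_ext la)%:R != 0 :> C by rewrite pnatr_eq0 -lt0n num_ext_gt0.
move=> e; apply: (mulIf n0); rewrite -e /trans_prob rmorphM fmorphV !rmorph_nat /=.
by rewrite mulrC -!mulrA mulVf ?mulr1.
Qed.

Lemma kerov_remove la i (z : C) : sorted geq la -> corner i la ->
  z - (corner_box i la).1%:~R != 0 -> (z - (corner_box i la).1%:~R) ^+ 2 - 1 != 0 ->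
  kerov (boxes (remove_box i la)) z =
  kerov (boxes la) z * (1 + ((z - (corner_box i la).1%:~R) ^+ 2 - 1)^-1).
Proof.
move=> sl ci h1 h2; rewrite (kerov_perm _ (boxes_remove_box sl ci)) /kerov big_cons.
set P := \prod_(_ <- _) _; move: h1 h2; set w := z - _ => h1 h2.
by field; rewrite h1 h2.
Qed.

(* Induction on the number of boxes to be removed: the last box moves z by theta. *)
Lemma chain_L2 la m (z theta : C) (A B Y : R) : sorted geq la ->
  (m <= size (boxes la))%N -> 2 <= Y -> (size (boxes la))%:R <= A * Y ^+ 2 ->
  cmod theta * Y <= B ->
  (forall j : nat, (m + j <= size (boxes la))%N ->
     Y <= complex.Im (z + j%:R * theta) /\ cmod (z + j%:R * theta) <= B * Y) ->
  mean la m (fun p => cmod (kerov p z - m%:R * theta) ^+ 2) <=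
  (1 + 5 / Y ^+ 2) ^+ (size (boxes la) - m) *
  (cmod (kerov (boxes la) (z + (size (boxes la) - m)%:R * theta)
      - (size (boxes la))%:R * theta) ^+ 2
   + (size (boxes la) - m)%:R * (step_const A B / Y ^+ 2)).
Proof.
move=> + hm hY; have [k] := ubnP (size (boxes la) - m)%N.
elim: k la hm => // k IH la hm hk sl hA hth hpath.
have [hmN|hmN] := leqP (size (boxes la)) m.
  have -> : m = size (boxes la) by apply/eqP; rewrite eqn_leq hm.
  rewrite subnn mul0r addr0 expr0 mul1r mul0r addr0 mean_full //.
  by move=> p q pq; rewrite (kerov_perm _ pq).
have N0 : (0 < size (boxes la))%N by apply: leq_ltn_trans hmN.
set N := size (boxes la) in hm hk hA hpath hmN N0 *.
set D := step_const A B / Y ^+ 2.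
have D0 : 0 <= D by rewrite divr_ge0 ?sqr_ge0 // addr_ge0 ?sqr_ge0.
have q1 : 1 <= 1 + 5 / Y ^+ 2 by rewrite lerDl divr_ge0 // sqr_ge0.
set q := 1 + 5 / Y ^+ 2 in q1 *.
set Z := z + (N - m)%:R * theta.
have eNm : (N - m)%N = (N.-1 - m).+1 by clear -hmN; lia.
have eZ : Z - theta = z + (N.-1 - m)%:R * theta.
  by rewrite /Z eNm -natr1; ring.
have [hZ1 _] : Y <= complex.Im Z /\ cmod Z <= B * Y.
  by apply: hpath; rewrite subnKC.
have [hZ2 hZ3] : Y <= complex.Im (Z - theta) /\ cmod (Z - theta) <= B * Y.
  by rewrite eZ; apply: hpath; clear -hmN; lia.
have Y0 : 0 < Y by lra.
have step : \sum_(i <- corners la) trans_prob la i *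
   mean (remove_box i la) m (fun p => cmod (kerov p z - m%:R * theta) ^+ 2) <=
   \sum_(i <- corners la) trans_prob la i * (q ^+ (N.-1 - m) *
   (cmod (kerov (boxes la) (Z - theta) *
      (1 + ((Z - theta - (corner_box i la).1%:~R) ^+ 2 - 1)^-1) - (N%:R - 1) * theta) ^+ 2
    + (N.-1 - m)%:R * D)).
  rewrite big_seq [leRHS]big_seq; apply: ler_sum => i; rewrite mem_corners => ci.
  apply: ler_wpM2l; first exact: trans_prob_ge0.
  have sz := size_boxes_remove sl ci.
  have eN : size (boxes (remove_box i la)) = N.-1 by rewrite /N sz.
  have := IH (remove_box i la); rewrite eN.
  move=> /(_ _ _ (sorted_remove_box sl ci) _ hth) IH'.
  have hN1 : (N.-1)%:R <= A * Y ^+ 2 by apply: le_trans hA; rewrite ler_nat leq_pred.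
  have g1 : (m <= N.-1)%N by clear -hmN; lia.
  have g2 : (N.-1 - m < k)%N by clear -hmN hk; lia.
  have := IH' g1 g2 hN1.
  have hj : forall j, (m + j <= N.-1)%N -> Y <= complex.Im (z + j%:R * theta) /\
      cmod (z + j%:R * theta) <= B * Y by move=> j hj; apply: hpath; clear -hj N0; lia.
  move=> /(_ hj); rewrite -eZ kerov_remove //.
  - have -> // : N%:R - 1 = N.-1%:R :> C by rewrite -{1}(prednK N0) -natr1 addrK.
  - exact: (neq_int hY).
  - have := sqr_sub1_lb (fun _ : unit => (corner_box i la).1) hY hZ2 tt.
    by rewrite -cmod_gt0; apply: lt_le_trans; rewrite divr_gt0 ?exprn_gt0.
rewrite mean_rec //; apply: (le_trans step).
have -> : \sum_(i <- corners la) trans_prob la i * (q ^+ (N.-1 - m) *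
   (cmod (kerov (boxes la) (Z - theta) *
      (1 + ((Z - theta - (corner_box i la).1%:~R) ^+ 2 - 1)^-1) - (N%:R - 1) * theta) ^+ 2
    + (N.-1 - m)%:R * D)) =
   q ^+ (N.-1 - m) * (\sum_(i <- corners la) trans_prob la i *
     cmod (kerov (boxes la) (Z - theta) *
      (1 + ((Z - theta - (corner_box i la).1%:~R) ^+ 2 - 1)^-1) - (N%:R - 1) * theta) ^+ 2
     + (N.-1 - m)%:R * D).
  rewrite mulrDr -[X in _ = _ + _ * X]mul1r -(trans_prob_sum sl N0) mulr_suml !mulr_sumr.
  by rewrite -big_split /=; apply: eq_bigr => i _; ring.
rewrite eNm exprSr -mulrA ler_wpM2l ?exprn_ge0 //; first lra.
have ImZn0 : complex.Im Z != 0 by rewrite gt_eqF // (lt_le_trans Y0).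
have ImZn0' : complex.Im (Z - theta) != 0 by rewrite gt_eqF // (lt_le_trans Y0).
have := one_step_bound (fun i => (corner_box i la).1)
  (trans_prob_ge0 la) (trans_prob_sum sl N0) hY hZ1 hZ2 hA hth hZ3.
rewrite -!kerov_trans_prob //; set X := \sum_(i <- _) _ => hX.
set E2 := cmod _ ^+ 2 in hX *; have E20 : 0 <= E2 by rewrite sqr_ge0.
rewrite -/D -/q in hX; rewrite -natr1.
have : 0 <= (N.-1 - m)%:R :> R by [].
move: ((N.-1 - m)%:R : R) => n n0.
have n1 : 0 <= n + 1 by lra.
have q0 : 0 <= q - 1 by lra.
have h := mulr_ge0 q0 (mulr_ge0 n1 D0).
have -> : q * (E2 + (n + 1) * D) = q * E2 + (q - 1) * ((n + 1) * D) + (n + 1) * D by ring.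
lra.
Qed.

(** At z = x + i Y this is Y / ((x - c)^2 + Y^2), the Poisson kernel without the factor 1/pi. *)
Definition poisson (z : C) (c : int) : R := - complex.Im (z - c%:~R)^-1.

(** If m + 1 is the number of boxes, the added box is a corner with law [trans_prob], and
    [kerov_trans_prob] expresses the mean of its kernel through [kerov]. For smaller m both sides
    split according to the last box of the extension. *)
Lemma mean_increment la m (z : C) : sorted geq la -> (m < size (boxes la))%N ->
  complex.Im z != 0 ->
  mean la m.+1 (fun p => \sum_(b <- p) poisson z b.1)
   - mean la m (fun p => \sum_(b <- p) poisson z b.1) =
  mean la m.+1 (fun p => complex.Im (kerov p z - z) / m.+1%:R).
Proof.
move=> + hm hz; have [k] := ubnP (size (boxes la) - m)%N.
elim: k la hm => // k IH la hm hk sl.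
have N0 : (0 < size (boxes la))%N by apply: leq_ltn_trans hm.
have [h|h] := ltnP m.+1 (size (boxes la)).
  rewrite !mean_rec // -sumrB big_seq [RHS]big_seq; apply: eq_bigr => i.
  rewrite mem_corners => ci; have sz := size_boxes_remove sl ci.
  by rewrite -mulrBr IH //; [lia|lia|exact: sorted_remove_box].
have e : m.+1 = size (boxes la) by apply/eqP; rewrite eqn_leq h hm.
rewrite [in X in X - _]e [in RHS]e.
have PI : forall p q : seq (int * int), perm_eq p q ->
   \sum_(b <- p) poisson z b.1 = \sum_(b <- q) poisson z b.1.
  by move=> p q pq; apply: perm_big.
have PJ : forall p q : seq (int * int), perm_eq p q ->
   complex.Im (kerov p z - z) / (size (boxes la))%:R =
   complex.Im (kerov q z - z) / (size (boxes la))%:R.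
  by move=> p q pq; rewrite (kerov_perm _ pq).
rewrite (mean_full sl PI) (mean_full sl PJ) mean_rec //.
rewrite -[X in X - _]mul1r -{1}(trans_prob_sum sl N0) mulr_suml -sumrB.
rewrite kerov_trans_prob // addrAC subrr add0r cImN.
rewrite -(rmorph_nat (real_complex R)) cImM /= mul0r addr0 Im_sum mulNr.
rewrite mulrAC divff ?pnatr_eq0 -?lt0n // mul1r -sumrN.
rewrite big_seq [RHS]big_seq; apply: eq_bigr => i; rewrite mem_corners => ci.
have sz := size_boxes_remove sl ci.
have -> : m = size (boxes (remove_box i la)) by lia.
rewrite (mean_full (sorted_remove_box sl ci) PI) -mulrBr.
rewrite (PI _ _ (boxes_remove_box sl ci)) big_cons addrK /poisson.
by rewrite cImM /= mul0r addr0 mulrN.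
Qed.

End Means.

(** * Heights and Poisson sums *)

Section Heights.
Implicit Types (la : seq nat) (p s : seq (int * int)) (c : int).

Definition cnt c p : nat := count (fun b => b.1 == c) p.

Lemma linear_ext_ideal la s m b b' : s \in linear_exts la ->
  b \in take m s -> b' \in boxes la -> precedes b' b -> b' \in take m s.
Proof.
rewrite mem_filter mem_permutations => /andP[hp hs] hb hb' pb.
move: hb'; rewrite -(perm_mem hs) -{1}(cat_take_drop m s) mem_cat => /orP[//|hd].
move: hp; rewrite /linear_ext -{1}(cat_take_drop m s) pairwise_cat => /and3P[/allrelP h _ _].
by move: (h b b' hb hd); rewrite pb.
Qed.

Lemma linear_ext_uniq la s : s \in linear_exts la -> uniq s.
Proof.
by rewrite mem_filter mem_permutations => /andP[_ /perm_uniq ->]; apply: boxes_uniq.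
Qed.

Lemma linear_ext_boxes la s b : s \in linear_exts la -> b \in s -> b \in boxes la.
Proof. by rewrite mem_filter mem_permutations => /andP[_ /perm_mem ->]. Qed.

(** The map g moves a diagonal to its neighbour; in the applications [bad] is the box of the
    diagonal in the first row or column, which has no image. *)
Lemma cnt_shift p c c' (g : int * int -> int * int) (bad : int * int) :
  uniq p -> injective g ->
  (forall b, b \in p -> b.1 = c -> b != bad -> (g b \in p) && ((g b).1 == c')) ->
  (cnt c p <= (cnt c' p).+1)%N.
Proof.
move=> up gi h; rewrite /cnt -!size_filter.
set F := seq.filter _ p; set F' := seq.filter _ p.
have uF : uniq F by rewrite filter_uniq.
have : (size [seq g b | b <- rem bad F] <= size F')%N.
  apply: uniq_leq_size; first by rewrite map_inj_uniq // rem_uniq.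
  move=> x /mapP[b + ->]; rewrite mem_rem_uniq // inE mem_filter => /and3P[nb /eqP bc bp].
  by have /andP[h1 h2] := h b bp bc nb; rewrite mem_filter h1 h2.
rewrite size_map; have [bF|bF] := boolP (bad \in F); first by rewrite size_rem // -subn1 leq_subLR add1n.
by rewrite rem_id // => /leqW.
Qed.

(** A box is sent to its predecessor in its column, which any linear extension lists earlier;
    [(c, c + 1)] is the box of the first row on this diagonal. *)
Lemma cnt_right la s m c : sorted geq la -> s \in linear_exts la ->
  (cnt c (take m s) <= (cnt (c + 1) (take m s)).+1)%N.
Proof.
move=> sl hs; apply: (@cnt_shift _ _ _ (fun b => (b.1 + 1, b.2 - 1)) (c, c + 1)).
- by rewrite take_uniq // (linear_ext_uniq hs).
- by move=> [a b] [a' b'] /= [h1 h2]; congr pair; lia.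
move=> b bp bc nb; rewrite /= bc eqxx andbT.
have /mem_boxesP[i [j [hj eb]]] := linear_ext_boxes hs (mem_take bp).
case: i eb hj => [|i] eb hj.
  by case/eqP: nb; rewrite eb /box_at in bc *; move: bc => /= bc; congr pair; lia.
have -> : (c + 1, b.2 - 1) = box_at i j by rewrite -bc eb /box_at /=; congr pair; lia.
apply: (linear_ext_ideal hs bp); last by rewrite eb precedes_box_at'.
by rewrite box_at_boxes (leq_trans hj) // nth_sorted_geq.
Qed.

Lemma cnt_left la s m c : sorted geq la -> s \in linear_exts la ->
  (cnt (c + 1) (take m s) <= (cnt c (take m s)).+1)%N.
Proof.
move=> sl hs; apply: (@cnt_shift _ _ _ (fun b => (b.1 - 1, b.2 - 1)) (c + 1, - c)).
- by rewrite take_uniq // (linear_ext_uniq hs).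
- by move=> [a b] [a' b'] /= [h1 h2]; congr pair; lia.
move=> b bp bc nb; rewrite /= bc addrK eqxx andbT.
have /mem_boxesP[i [j [hj eb]]] := linear_ext_boxes hs (mem_take bp).
case: j eb hj => [|j] eb hj.
  by case/eqP: nb; rewrite eb /box_at in bc *; move: bc => /= bc; congr pair; lia.
have -> : (c, b.2 - 1) = box_at i j.
  by move: bc; rewrite eb /box_at /= => bc; congr pair; lia.
apply: (linear_ext_ideal hs bp); last by rewrite eb precedes_box_at.
by rewrite box_at_boxes (leq_trans _ hj).
Qed.

Lemma cnt_right_iter la s m c k : sorted geq la -> s \in linear_exts la ->
  (cnt c (take m s) <= cnt (c + k%:Z) (take m s) + k)%N.
Proof.
move=> sl hs; elim: k => [|k IH]; first by rewrite addr0 addn0.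
have h := cnt_right m (c + k%:Z) sl hs.
have e : c + k.+1%:Z = c + k%:Z + 1 by lia.
by rewrite e (leq_trans IH) // addnS -addSn leq_add2r.
Qed.

Lemma cnt_left_iter la s m c k : sorted geq la -> s \in linear_exts la ->
  (cnt (c + k%:Z) (take m s) <= cnt c (take m s) + k)%N.
Proof.
move=> sl hs; elim: k => [|k IH]; first by rewrite addr0 addn0.
have h := cnt_left m (c + k%:Z) sl hs.
have e : c + k.+1%:Z = c + k%:Z + 1 by lia.
by rewrite e (leq_trans h) // addnS ltnS.
Qed.

Lemma sum_cnt_le (T : seq int) p : uniq T -> (\sum_(c <- T) cnt c p <= size p)%N.
Proof.
move=> uT; rewrite /cnt -sum1_size.
under eq_bigr do rewrite -sum1_count big_mkcond.
rewrite exchange_big /=; apply: leq_sum => b _.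
rewrite -big_mkcond /= sum1_count.
by rewrite (eq_count (a2 := pred1 b.1)) ?count_uniq_mem ?leq_b1 // => x; rewrite /= eq_sym.
Qed.

(** If a diagonal holds h boxes, the k-th diagonal to its right holds at least h - k, so the shape
    has at least h (h + 1) / 2 boxes. *)
Lemma cnt_sqr_le la s m c : sorted geq la -> s \in linear_exts la ->
  (cnt c (take m s) ^ 2 <= 2 * size (take m s))%N.
Proof.
move=> sl hs; set h := cnt c (take m s).
have h1 := @sum_cnt_le [seq c + k%:Z | k <- iota 0 h] (take m s).
rewrite big_map in h1.
have h2 : (\sum_(k <- iota 0 h) (h - k) <= \sum_(k <- iota 0 h) cnt (c + k%:Z) (take m s))%N.
  apply: leq_sum => k _; have := cnt_right_iter m c k sl hs; rewrite -/h; lia.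
have h3 : (h ^ 2 <= 2 * \sum_(k <- iota 0 h) (h - k))%N.
  have gen n : (n <= h -> 2 * (n * h) <= 2 * (\sum_(k <- iota 0 n) (h - k)) + n * n)%N.
    elim: n => [|n IH] nh; first by rewrite mul0n.
    rewrite -{2}[n.+1]addn1 iotaD big_cat /= big_seq1 add0n.
    have := IH (ltnW nh); move: (\sum_(_ <- _) _)%N => S; clear -nh; nia.
  by have := gen h (leqnn h); move: (\sum_(_ <- _) _)%N => S; clear; rewrite -mulnn; lia.
have : uniq [seq c + k%:Z | k <- iota 0 h].
  by rewrite map_inj_uniq ?iota_uniq // => x y; lia.
move=> /h1; lia.
Qed.

Lemma sum_by_content (V : nmodType) (psi : int -> V) (T : seq int) p : uniq T ->
  (forall b, b \in p -> b.1 \in T) ->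
  \sum_(b <- p) psi b.1 = \sum_(c <- T) psi c *+ cnt c p.
Proof.
move=> uT h; rewrite /cnt.
transitivity (\sum_(c <- T) \sum_(b <- p | b.1 == c) psi b.1).
  rewrite (exchange_big_dep xpredT) //= big_seq [RHS]big_seq; apply: eq_bigr => b bp.
  rewrite -big_filter (eq_filter (a2 := pred1 b.1)); last by move=> x /=; rewrite eq_sym.
  by rewrite filter_pred1_uniq ?h // big_seq1.
apply: eq_bigr => c _; rewrite (eq_bigr (fun=> psi c)) => [|b /eqP -> //].
by rewrite big_const_seq iter_addr_0.
Qed.

End Heights.

Section PoissonSums.
Context {R : realType}.
Variables (D : nat -> R) (Y d0 : R) (W : nat).

(** [d0] stands for an increment at the centre and [D j] for the sum of the two increments at
    distance j from it. *)
Definition poisson_sum : R :=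
  d0 / Y + \sum_(1 <= j < W) D j * (Y / (j%:R ^+ 2 + Y ^+ 2)).

(** Comparison of the kernel with 4 Y / ((j + Y)(j + 1 + Y)), which telescopes. *)
Lemma sum_poisson_le (k : nat) : 1 <= Y ->
  \sum_(1 <= j < k) Y / (j%:R ^+ 2 + Y ^+ 2) <= 4.
Proof.
move=> Y1.
have gen n : \sum_(1 <= j < n.+1) Y / (j%:R ^+ 2 + Y ^+ 2) <= 4 * Y * ((1 + Y)^-1 - (n.+1%:R + Y)^-1).
  elim: n => [|n IH]; first by rewrite big_geq // subrr mulr0.
  rewrite big_nat_recr //= (le_trans (lerD IH (lexx _))) // -[n.+2%:R]natr1.
  have : 1 <= n.+1%:R :> R by rewrite ler1n.
  set x := n.+1%:R => x1.
  have x0 : 0 < x + Y by lra.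
  have x2 : 0 < x + 1 + Y by lra.
  have h1 : (x + Y)^-1 - (x + 1 + Y)^-1 = ((x + Y) * (x + 1 + Y))^-1.
    by field; apply/andP; split; lra.
  have h2 : (x ^+ 2 + Y ^+ 2)^-1 <= 4 * ((x + Y) * (x + 1 + Y))^-1.
    have P0 : 0 < (x + Y) * (x + 1 + Y) by rewrite mulr_gt0.
    rewrite -(invf_div _ 4) lef_pV2 ?posrE; [nra|nra|lra].
  have : Y * (x ^+ 2 + Y ^+ 2)^-1 <= Y * (4 * ((x + Y) * (x + 1 + Y))^-1) by rewrite ler_wpM2l //; lra.
  rewrite -h1; lra.
case: k => [|k]; first by rewrite big_geq.
apply: (le_trans (gen k)).
have h3 : 0 <= (k.+1%:R + Y)^-1 by rewrite invr_ge0 addr_ge0 //; lra.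
have h4 : Y * (1 + Y)^-1 <= 1 by rewrite ler_pdivrMr; lra.
have : 0 <= Y * (k.+1%:R + Y)^-1 by rewrite mulr_ge0 //; lra.
lra.
Qed.

(** Only the j up to Y are kept: there are at least Y/2 of them, the kernel is at least 1/(2 Y)
    there, and D j is at least 2 d0 - 4 Y. *)
Lemma poisson_sum_ge : 2 <= Y -> Y + 1 <= W%:R -> (forall j, 0 <= D j) -> 0 <= d0 ->
  (forall j, 2 * d0 - 4 * j%:R <= D j) -> d0 <= 2 * poisson_sum + 2 * Y.
Proof.
move=> Y2 YW D0 d00 hD.
have S0 : 0 <= poisson_sum.
  rewrite addr_ge0 ?divr_ge0 ?sumr_ge0 //; first lra.
  by move=> j _; rewrite mulr_ge0 // divr_ge0 ?addr_ge0 ?sqr_ge0 //; lra.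
have [hd|hd] := leP d0 (2 * Y); first lra.
have [n /andP[n1 n2]] : exists n : nat, n%:R <= Y < n.+1%:R.
  exists (Num.truncn Y); apply: truncn_itv; lra.
suff : (d0 - 2 * Y) / 2 <= poisson_sum by lra.
have -> : (d0 - 2 * Y) / 2 = (Y / 2) * ((2 * d0 - 4 * Y) * (Y / (2 * Y ^+ 2))).
  by field; lra.
have nW : (n.+1 <= W)%N by rewrite -(ler_nat R) -natr1; lra.
have nY : Y / 2 <= n%:R by rewrite -natr1 in n2; lra.
have pos : 0 <= (2 * d0 - 4 * Y) * (Y / (2 * Y ^+ 2)).
  by rewrite mulr_ge0 ?divr_ge0 ?mulr_ge0 ?sqr_ge0 //; lra.
apply: (le_trans (ler_wpM2r pos nY)).
rewrite /poisson_sum (@big_cat_nat _ _ _ n.+1) //=.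
rewrite -[leLHS]add0r lerD ?divr_ge0 //; first lra.
rewrite -[leLHS]addr0 lerD //; last first.
  by apply: sumr_ge0 => j _; rewrite mulr_ge0 // divr_ge0 ?addr_ge0 ?sqr_ge0 //; lra.
have -> : n%:R * ((2 * d0 - 4 * Y) * (Y / (2 * Y ^+ 2))) =
  \sum_(1 <= j < n.+1) (2 * d0 - 4 * Y) * (Y / (2 * Y ^+ 2)).
  by rewrite sumr_const_nat subn1 mulr_natl.
rewrite !big_nat; apply: ler_sum => j /andP[j1 j2].
have jY : j%:R <= Y by apply: le_trans n1; rewrite ler_nat -ltnS.
have j0 : 0 <= j%:R :> R by [].
apply: ler_pM; [lra|by rewrite divr_ge0 ?mulr_ge0 ?sqr_ge0 //; lra| |].
  by apply: le_trans (hD j); lra.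
apply: ler_wpM2l; first lra.
rewrite lef_pV2 ?posrE; nra.
Qed.

(** The sum is cut at J. Up to J the increments are at most 2 d0 + 4 J and the kernel has sum at
    most 4; beyond J the kernel is at most Y / J^2 and the increments have total at most M. *)
Lemma poisson_sum_le (J : nat) (M : R) : 1 <= Y -> (0 < J)%N -> (forall j, 0 <= D j) ->
  0 <= d0 -> (forall j, D j <= 2 * d0 + 4 * j%:R) ->
  \sum_(1 <= j < W) D j <= M ->
  poisson_sum <= 9 * d0 + 16 * J%:R + Y * M / J%:R ^+ 2.
Proof.
move=> Y1 J0 D0 d00 hD hM; rewrite /poisson_sum.
have h1 : d0 / Y <= d0 by rewrite ler_pdivrMr; nra.
have J1 : 0 < J%:R :> R by rewrite ltr0n.
have pk j : 0 <= Y / (j%:R ^+ 2 + Y ^+ 2).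
  by rewrite divr_ge0 ?addr_ge0 ?sqr_ge0 //; lra.
have h2 : \sum_(1 <= j < W) D j * (Y / (j%:R ^+ 2 + Y ^+ 2)) <=
   \sum_(1 <= j < W) ((2 * d0 + 4 * J%:R) * (Y / (j%:R ^+ 2 + Y ^+ 2)) + D j * (Y / J%:R ^+ 2)).
  apply: ler_sum => j _; have [jJ|jJ] := leqP j J.
    rewrite -[leLHS]addr0 lerD //; last first.
      by rewrite mulr_ge0 ?divr_ge0 ?sqr_ge0 //; lra.
    by rewrite ler_wpM2r // (le_trans (hD j)) // lerD2l ler_pM2l ?ler_nat.
  rewrite -[leLHS]add0r lerD //; first by rewrite mulr_ge0 //; nra.
  rewrite ler_wpM2l // ler_wpM2l //; first lra.
  have : J%:R <= j%:R :> R by rewrite ler_nat ltnW.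
  by rewrite lef_pV2 ?posrE; nra.
have h3 := sum_poisson_le W Y1.
rewrite big_split /= -mulr_sumr -mulr_suml in h2.
have h4 : (2 * d0 + 4 * J%:R) * \sum_(1 <= j < W) Y / (j%:R ^+ 2 + Y ^+ 2) <= (2 * d0 + 4 * J%:R) * 4.
  by rewrite ler_wpM2l //; nra.
have h5 : (\sum_(1 <= j < W) D j) * (Y / J%:R ^+ 2) <= Y * M / J%:R ^+ 2.
  have -> : Y * M / J%:R ^+ 2 = M * (Y / J%:R ^+ 2) by ring.
  by rewrite ler_wpM2r // divr_ge0 ?sqr_ge0 //; lra.
lra.
Qed.

End PoissonSums.

(** * Volumes of sets of tableaux *)

Section Volume.
Context {R : realType}.
Local Notation T := (measurableTypeR R).
Local Notation mu := (@lebesgue_measure R).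
Implicit Types (n j : nat).

Definition vol n : {sigma_finite_measure set (n.-tuple T) -> \bar R} :=
  @tuple_measure _ T R mu n.

(** The integral of a nonnegative function is a supremum over the simple functions below it, hence
    monotone even for functions that are not measurable. This makes [vol_mono] valid for arbitrary
    sets, such as the event in [is_limiting_height]. *)
Lemma nonneg_integral_mono d (S : measurableType d) (m : {measure set S -> \bar R})
    (f g : S -> \bar R) :
  (forall x, 0 <= f x)%E -> (forall x, f x <= g x)%E ->
  (\int[m]_x f x <= \int[m]_x g x)%E.
Proof.
move=> f0 fg; rewrite !ge0_integralTE => [||//]; last by move=> x; apply: le_trans (fg x).
apply: le_ereal_sup => _ [h hf <-].
by exists h => // x; apply: le_trans (fg x).
Qed.

Lemma vol_cons n (A : set (n.+1.-tuple T)) :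
  vol n.+1 A = (\int[mu]_x vol n [set y | A (cons_pair (x, y))])%E.
Proof.
rewrite /vol /= /product_cons /pushforward /product_measure1 /=.
apply: eq_integral => x _ /=; congr (tuple_measure _ _ _).
by apply/seteqP; split => y; rewrite /xsection /= inE.
Qed.

Lemma vol_mono n (A B : set (n.-tuple T)) : A `<=` B -> (vol n A <= vol n B)%E.
Proof.
elim: n A B => [|n IH] A B AB.
  rewrite /vol /= !diracE lee_fin ler_nat.
  by case: (boolP (_ \in A)) => // /set_mem /AB /mem_set ->.
rewrite !vol_cons; apply: nonneg_integral_mono => x; first exact: measure_ge0.
by apply: IH => y; apply: AB.
Qed.

Lemma measurable_nth n i : measurable_fun setT (fun y : n.-tuple T => nth (0 : R) y i : T).
Proof.
have [h|h] := ltnP i n; last first.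
  by rewrite (_ : (fun _ => _) = cst 0) //; apply/funext => y; rewrite nth_default // size_tuple.
rewrite (_ : (fun _ => _) = fun y : n.-tuple T => tnth y (Ordinal h)).
  exact: measurable_tnth.
by apply/funext => y; rewrite (tnth_nth 0).
Qed.

Definition ins n j (x : T) (y : n.-tuple T) : n.+1.-tuple T :=
  [tuple if (i < j)%N then nth (0 : R) y i else if i == j :> nat then x else nth (0 : R) y i.-1
   | i < n.+1].

Lemma nth_ins n j (x : T) (y : n.-tuple T) i : (j <= n)%N -> nth (0 : R) (ins j x y) i =
  if (i < j)%N then nth (0 : R) y i else if i == j then x else nth (0 : R) y i.-1.
Proof.
move=> jn; have [h|h] := ltnP i n.+1.
  by have := tnth_nth (0 : R) (ins j x y) (Ordinal h); rewrite tnth_mktuple => <-.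
have e1 : (i < j)%N = false by clear -h jn; lia.
have e2 : (i == j) = false by clear -h jn; lia.
rewrite e1 e2 [LHS]nth_default; last by rewrite size_tuple.
by rewrite [RHS]nth_default // size_tuple; clear -h; lia.
Qed.

Lemma eq_tuple_nth n (y z : n.-tuple T) :
  (forall i, nth (0 : R) y i = nth (0 : R) z i) -> y = z.
Proof. by move=> h; apply: eq_from_tnth => i; rewrite !(tnth_nth 0). Qed.

Lemma nth_cons_pair n (x : T) (y : n.-tuple T) i :
  nth (0 : R) (cons_pair (x, y)) i = if i is i'.+1 then nth (0 : R) y i' else x.
Proof. by case: i. Qed.

Lemma ins0 n (x : T) (y : n.-tuple T) : ins 0 x y = cons_pair (x, y).
Proof. by apply: eq_tuple_nth => i; rewrite nth_ins // nth_cons_pair; case: i. Qed.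

Lemma insS n j (t x : T) (y : n.-tuple T) : (j <= n)%N ->
  ins j.+1 x (cons_pair (t, y)) = cons_pair (t, ins j x y).
Proof.
move=> jn; apply: eq_tuple_nth => i; rewrite nth_cons_pair nth_ins //.
case: i => [|i]; first by rewrite nth_cons_pair.
rewrite nth_ins // ltnS eqSS nth_cons_pair /=.
by case: ltngtP => // ji; case: i ji => // i _; rewrite nth_cons_pair.
Qed.

Lemma measurable_ins d (S : measurableType d) n j (f : S -> T) (g : S -> n.-tuple T) :
  measurable_fun setT f -> measurable_fun setT g ->
  measurable_fun setT (fun s => ins j (f s) (g s)).
Proof.
move=> mf mg; apply/measurable_fun_tnthP => i.
have mn k : measurable_fun setT (fun s => nth (0 : R) (g s) k : T).
  rewrite (_ : (fun _ => _) = (fun y : n.-tuple T => nth (0 : R) y k : T) \o g) //.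
  by apply: measurableT_comp => //; exact: measurable_nth.
rewrite (_ : _ \o _ = fun s => if (i < j)%N then nth (0 : R) (g s) i else
  if i == j :> nat then f s else nth (0 : R) (g s) i.-1); last first.
  by apply/funext => s /=; rewrite tnth_mktuple.
by case: (i < j)%N => //; case: (i == j :> nat).
Qed.

(** Tonelli's theorem exchanges the coordinate with the head, one place at a time, so that any
    coordinate can be integrated outermost. *)
Lemma vol_ins n j (A : set (n.+1.-tuple T)) : (j <= n)%N -> measurable A ->
  vol n.+1 A = (\int[mu]_x vol n [set y | A (ins j x y)])%E.
Proof.
elim: j n A => [|j IH] n A jn mA.
  rewrite vol_cons; apply: eq_integral => x _; congr (vol n _).
  by apply/seteqP; split => y /=; rewrite ins0.
case: n jn A mA => [|n] jn A mA; first by exfalso; move: jn; rewrite ltn0.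
rewrite ltnS in jn.
rewrite vol_cons.
pose f (tx : T * T) := vol n [set y | A (cons_pair (tx.1, ins j tx.2 y))].
pose B : set ((T * T) * n.-tuple T) := [set z | A (cons_pair (z.1.1, ins j z.1.2 z.2))].
have mB : measurable B.
  rewrite -[B]setTI; have : measurable_fun setT
    (fun z : (T * T) * n.-tuple T => cons_pair (z.1.1, ins j z.1.2 z.2)).
    apply: (measurableT_comp (@measurable_cons_pair _ T n.+1)).
    apply/measurable_fun_pairP; split => /=.
      exact: (measurableT_comp measurable_fst measurable_fst).
    apply: measurable_ins => //.
    exact: (measurableT_comp measurable_snd measurable_fst).
  by apply.
have := measurable_fun_xsection (vol n) mB.
have -> : vol n \o xsection B = f.
  apply/funext => tx /=; rewrite /f; congr (vol n _).
  by apply/seteqP; split => y; rewrite /xsection /= inE.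
move=> mf.
have f0 z : (0 <= f z)%E by apply: measure_ge0.
transitivity (\int[mu]_t \int[mu]_x f (t, x))%E.
  apply: eq_integral => t _; rewrite (IH n) //.
  rewrite -[X in measurable X]setTI.
  have : measurable_fun setT (fun y : n.+1.-tuple T => cons_pair (t, y)).
    apply: (measurableT_comp (@measurable_cons_pair _ T n.+1)).
    by apply/measurable_fun_pairP; split; [exact: measurable_cst|exact: measurable_id].
  by apply.
rewrite (fubini_tonelli f mf f0); apply: eq_integral => x _.
rewrite vol_cons; apply: eq_integral => t _; congr (vol n _).
by apply/seteqP; split => y /=; rewrite insS.
Qed.

End Volume.

(** * Fillings whose entries have a prescribed order *)

Section Cells.
Context {R : realType}.
Local Notation T := (measurableTypeR R).
Local Notation mu := (@lebesgue_measure R).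
Context {B : eqType}.
Implicit Types (bs s : seq B) (b : B) (v : seq R) (bnd : itv_bound R) (t : R) (Q : pred nat).

(** [entry] for an arbitrary list of labels, so that labels can be removed one by one. *)
Definition ev bs n (y : n.-tuple T) b : R := nth (0 : R) y (index b bs).

Definition increasing_in bnd v :=
  pairwise <%R v && all (fun u => u \in Interval (BLeft 0) bnd) v.

Definition count_le t v : nat := count (fun u => u <= t) v.

Definition cell n bs s bnd t Q : set (n.-tuple T) :=
  [set y | increasing_in bnd [seq ev bs y b | b <- s] &&
           Q (count_le t [seq ev bs y b | b <- s])].

(** The outermost integral runs over the largest entry x, at the last label; it becomes the strict
    upper bound [BLeft x] for the others, and Q is shifted by 1 if x counts as at most t. *)
Fixpoint cell_vol n bnd t Q : \bar R :=
  if n is n'.+1 then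
    (\int[mu]_x if (x : R) \in Interval (BLeft 0%R) bnd
                then cell_vol n' (BLeft x) t (fun m => Q ((x <= t)%R + m)%N) else 0)%E
  else (Q 0%N)%:R%:E.

Lemma cell_volS n bnd t Q : cell_vol n.+1 bnd t Q =
    (\int[mu]_x if (x : R) \in Interval (BLeft 0%R) bnd
                then cell_vol n (BLeft x) t (fun m => Q ((x <= t)%R + m)%N) else 0)%E.
Proof. by []. Qed.

Lemma increasing_in_rcons bnd v x : increasing_in bnd (rcons v x) =
  (x \in Interval (BLeft 0) bnd) && increasing_in (BLeft x) v.
Proof.
rewrite /increasing_in pairwise_rcons all_rcons.
have [xb|] := boolP (x \in Interval (BLeft 0) bnd); last by rewrite /= andbF.
rewrite /= -andbA andbCA; congr (_ && _); elim: v => //= u v IH.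
rewrite andbACA IH; congr (_ && _).
move: xb; rewrite !itv_boundlr /= !bnd_simp => /andP[x0 xb].
have [ux|ux] := boolP (u < x); last by rewrite andbF.
have -> : (BRight u <= bnd)%O by apply: le_trans xb; rewrite bnd_simp ltW.
by rewrite !andbT.
Qed.

Lemma index_rem bs b b' : b \in bs -> b' != b -> index b' (rem b bs) =
  if (index b' bs < index b bs)%N then index b' bs else (index b' bs).-1.
Proof.
elim: bs => //= c bs IH; rewrite inE => bbs nb.
have [->|cb] := eqVneq c b; first by rewrite eq_sym (negbTE nb) ltn0.
move: bbs; rewrite eq_sym (negbTE cb) /= => bbs.
have [//|cb'] := eqVneq c b'.
rewrite IH // ltnS; case: ltnP => // h.
have : index b' bs != index b bs.
  apply: contraNneq nb => e; have b'bs : b' \in bs by rewrite -index_mem e index_mem.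
  by rewrite -(nth_index b b'bs) e nth_index.
move: h; case: (index b' bs) => //=; rewrite leqn0 => /eqP ->; by rewrite eqxx.
Qed.

Lemma ev_ins_eq bs n x (y : n.-tuple T) b : (index b bs <= n)%N ->
  ev bs (ins (index b bs) x y) b = x.
Proof. by move=> h; rewrite /ev nth_ins // ltnn eqxx. Qed.

Lemma ev_ins_neq bs n x (y : n.-tuple T) b b' : (index b bs <= n)%N -> b \in bs ->
  b' \in bs -> b' != b -> ev bs (ins (index b bs) x y) b' = ev (rem b bs) y b'.
Proof.
move=> h bb b'b nb; rewrite /ev nth_ins // index_rem //.
case: ifP => // _; case: eqP => // e; case/eqP: nb.
by rewrite -(nth_index b b'b) e nth_index.
Qed.

Lemma measurable_ev bs n b : measurable_fun setT (fun y : n.-tuple T => ev bs y b : T).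
Proof. exact: measurable_nth. Qed.

Lemma measurable_pred_set d (S : measurableType d) (f : S -> bool) :
  measurable_fun setT f -> measurable [set x | f x].
Proof.
move=> mf; rewrite (_ : [set x | f x] = setT `&` f @^-1` [set true]).
  exact: mf.
by apply/seteqP; split => x /=; [move=> ->|case].
Qed.

Lemma measurable_all_fun d (S : measurableType d) (I : Type) (r : seq I) (f : I -> S -> bool) :
  (forall i, measurable_fun setT (f i)) ->
  measurable_fun setT (fun y => all (fun i => f i y) r).
Proof.
move=> mf; elim: r => [|i r IH] /=; first exact: measurable_cst.
exact: measurable_and.
Qed.

Lemma measurable_pairwise d (S : measurableType d) (I : Type) (r : seq I)
    (f : I -> I -> S -> bool) :
  (forall i j, measurable_fun setT (f i j)) ->
  measurable_fun setT (fun y => pairwise (fun i j => f i j y) r).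
Proof.
move=> mf; elim: r => [|i r IH] /=; first exact: measurable_cst.
by apply: measurable_and => //; apply: measurable_all_fun.
Qed.

Lemma measurable_count d (S : measurableType d) (I : Type) (r : seq I)
    (f : I -> S -> bool) Q :
  (forall i, measurable_fun setT (f i)) ->
  measurable_fun setT (fun y => Q (count (fun i => f i y) r)).
Proof.
move=> mf; elim: r Q => [|i r IH] Q /=; first exact: measurable_cst.
rewrite (_ : (fun _ => _) = fun y => if f i y then Q (1 + count (fun i => f i y) r)%N
    else Q (count (fun i => f i y) r)).
  apply: measurable_fun_ifT; [exact: mf| |exact: (IH Q)].
  exact: (IH (fun m => Q (1 + m)%N)).
by apply/funext => y; case: (f i y).
Qed.

Lemma measurable_in_itv d (S : measurableType d) (f : S -> R) (i : interval R) :
  measurable_fun setT (f : S -> T) -> measurable_fun setT (fun y => f y \in i).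
Proof.
move=> mf; apply: (measurable_fun_bool true).
rewrite (_ : _ @^-1` _ = f @^-1` [set` i]).
  by apply: mf => //; exact: measurable_itv.
by apply/seteqP; split => y /=.
Qed.

Lemma measurable_cell n bs s bnd t Q : measurable (cell (n := n) bs s bnd t Q).
Proof.
apply: measurable_pred_set; rewrite /increasing_in /count_le.
apply: measurable_and; [apply: measurable_and|].
- rewrite (_ : (fun _ => _) = fun y : n.-tuple T => pairwise (fun b b' => ev bs y b < ev bs y b') s).
    by apply: measurable_pairwise => b b'; apply: measurable_fun_ltr; apply: measurable_ev.
  by apply/funext => y; rewrite pairwise_map.
- rewrite (_ : (fun _ => _) = fun y : n.-tuple T => all (fun b => ev bs y b \in Interval (BLeft 0) bnd) s).
    by apply: measurable_all_fun => b; apply: measurable_in_itv; apply: measurable_ev.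
  by apply/funext => y; rewrite all_map.
- rewrite (_ : (fun _ => _) = fun y : n.-tuple T => Q (count (fun b => ev bs y b <= t) s)).
    apply: measurable_count => b; apply: measurable_fun_ler; [exact: measurable_ev|exact: measurable_cst].
  by apply/funext => y; rewrite count_map.
Qed.

(** The coordinate of the last label of s is integrated outermost, wherever it stands in bs, so
    every order leads to the same recursion. *)
Lemma vol_cell n bs s bnd t Q : size bs = n -> uniq bs -> perm_eq s bs ->
  vol n (cell bs s bnd t Q) = cell_vol n bnd t Q.
Proof.
elim: n bs s bnd Q => [|n IH] bs s bnd Q sb ub ps.
  move/size0nil: sb => sb; move: ps; rewrite sb => /perm_nilP ->.
  rewrite /vol /= diracE; congr (_%:R%:E); congr nat_of_bool.
  by apply/idP/idP => [/set_mem|h]; [|apply/mem_set].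
case/lastP: s ps => [|s b] ps; first by have := perm_size ps; rewrite sb.
have bb : b \in bs by rewrite -(perm_mem ps) mem_rcons mem_head.
have jn : (index b bs <= n)%N by rewrite -ltnS -sb index_mem.
have bs' : b \notin s.
  by have := perm_uniq ps; rewrite ub rcons_uniq => /andP[].
have ps' : perm_eq s (rem b bs).
  rewrite -(perm_cons b) -perm_rcons (perm_trans ps) //; exact: perm_to_rem.
rewrite (vol_ins jn); last exact: measurable_cell.
rewrite cell_volS; apply: eq_integral => x _.
have evE (y : n.-tuple T) : [seq ev bs (ins (index b bs) x y) b0 | b0 <- rcons s b] =
    rcons [seq ev (rem b bs) y b0 | b0 <- s] x.
  rewrite map_rcons ev_ins_eq //; have e : [seq ev bs (ins (index b bs) x y) b0 | b0 <- s] =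
    [seq ev (rem b bs) y b0 | b0 <- s]; last first.
    exact: (congr1 (fun v : seq R => rcons v x) e).
  apply/eq_in_map => b' b's.
  have b'b : b' \in bs by rewrite -(perm_mem ps) mem_rcons inE b's orbT.
  have nb : b' != b by apply: contraNneq bs' => <-.
  exact: ev_ins_neq.
have cellE (y : n.-tuple T) : cell bs (rcons s b) bnd t Q (ins (index b bs) x y) =
    ((x : R) \in Interval (BLeft 0) bnd) &&
     increasing_in (BLeft (x : R)) [seq ev (rem b bs) y b0 | b0 <- s] &&
     Q ((x <= t)%R + count_le t [seq ev (rem b bs) y b0 | b0 <- s])%N.
  rewrite /cell /mkset evE increasing_in_rcons /count_le -cats1 count_cat /= addn0.
  by rewrite addnC.
case: ifP => xb; last first.
  rewrite (_ : [set _ | _] = set0) ?measure0 //.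
  by apply/seteqP; split => y //=; rewrite cellE xb.
rewrite -(IH (rem b bs) s) //; last first.
- by rewrite rem_uniq.
- by rewrite size_rem // sb.
congr (vol n _); apply/seteqP; split => y; first by rewrite /= cellE xb.
by move=> h; rewrite /= cellE xb.
Qed.

End Cells.

(** * Binomial means *)

Section Binomial.
Context {R : realType}.
Implicit Types (n m : nat) (t : R) (F G : nat -> R).

(** The mean of F under the binomial law with n trials and success probability t. *)
Fixpoint bin n t F : R :=
  if n is n'.+1 then t * bin n' t (fun m => F m.+1) + (1 - t) * bin n' t F else F 0%N.

Lemma binD n t F G : bin n t (fun m => F m + G m) = bin n t F + bin n t G.
Proof. elim: n F G => //= n IH F G; rewrite !IH; ring. Qed.

Lemma binZ n t a F : bin n t (fun m => a * F m) = a * bin n t F.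
Proof. elim: n F => //= n IH F; rewrite !IH; ring. Qed.

Lemma bin_cst n t a : bin n t (fun=> a) = a.
Proof. elim: n => //= n ->; ring. Qed.

Lemma eq_bin n t F G : (forall m, (m <= n)%N -> F m = G m) -> bin n t F = bin n t G.
Proof.
elim: n F G => /= [|n IH] F G h; first exact: h.
by congr (_ * _ + _ * _); apply: IH => m mn; apply: h; rewrite ?ltnS ?leqW.
Qed.

Lemma bin_le n t F G : 0 <= t <= 1 -> (forall m, (m <= n)%N -> F m <= G m) ->
  bin n t F <= bin n t G.
Proof.
move=> /andP[t0 t1]; elim: n F G => /= [|n IH] F G h; first exact: h.
by apply: lerD; apply: ler_wpM2l; rewrite ?subr_ge0 //; apply: IH => m mn; apply: h;
  rewrite ?ltnS ?leqW.
Qed.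

Lemma bin_ge0 n t F : 0 <= t <= 1 -> (forall m, (m <= n)%N -> 0 <= F m) -> 0 <= bin n t F.
Proof. by move=> t01 h; rewrite -(bin_cst n t 0); apply: bin_le. Qed.

(** Feeds Chebyshev's inequality. The free centre c is what the induction requires: a success in the
    first trial replaces c by c - 1. *)
Lemma bin_variance n t c :
  bin n t (fun m => (m%:R - c) ^+ 2) = n%:R * t * (1 - t) + (n%:R * t - c) ^+ 2.
Proof.
elim: n c => [|n IH] c /=; first by ring.
rewrite IH (_ : (fun m => _) = fun m => (m%:R - (c - 1)) ^+ 2).
  by rewrite IH -[n.+1%:R]natr1; ring.
by apply/funext => m; rewrite -natr1; congr (_ ^+ 2); ring.
Qed.

End Binomial.

Section Cube.
Context {R : realType}.
Local Notation T := (measurableTypeR R).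
Local Notation mu := (@lebesgue_measure R).
Implicit Types (n : nat) (t : R) (Q : pred nat).

Definition cube n t Q : set (n.-tuple T) :=
  [set y | all (fun u : R => 0 <= u <= 1) (y : seq R) && Q (count_le t (y : seq R))].

Lemma integral_two_steps (a b t : R) : 0 <= a -> 0 <= b -> 0 <= t <= 1 ->
  (\int[mu]_x (if (0 <= (x : R) <= 1)%R then (if (x <= t)%R then a else b)%:E else 0)
    = (t * a + (1 - t) * b)%R%:E)%E.
Proof.
move=> a0 b0 /andP[t0 t1].
have mA : measurable (`[0, t]%classic : set T) by exact: measurable_itv.
have mB : measurable (`]t, 1]%classic : set T) by exact: measurable_itv.
transitivity (\int[mu]_x ((a * \1_(`[0, t]%classic) x)%:E + (b * \1_(`]t, 1]%classic) x)%:E))%E.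
  apply: eq_integral => x _; rewrite !indicE -EFinD.
  rewrite !mem_setE !in_itv /=.
  have [x0|x0] := boolP (0 <= (x : R)); last first.
    rewrite andFb /= mulr0 add0r.
    have -> : (t < x) = false by apply/negP => tx; move/negP: x0; apply; rewrite ltW // (le_lt_trans t0).
    by rewrite mulr0.
  rewrite !andTb; have [xt|xt] := leP (x : R) t.
    by rewrite (le_trans xt t1) /= mulr1 mulr0 addr0.
  by case: (x <= 1); rewrite /= ?mulr1 ?mulr0 ?add0r.
have mi (c : R) (A : set T) : measurable A -> measurable_fun setT (fun x : T => (c * \1_A x)%:E).
  move=> mA'; apply/measurable_EFinP; apply: measurable_funM; first exact: measurable_cst.
  exact: measurable_indic.
rewrite ge0_integralD //; last 4 first.
- by move=> x _; rewrite lee_fin mulr_ge0.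
- exact: mi.
- by move=> x _; rewrite lee_fin mulr_ge0.
- exact: mi.
have int (c : R) (A : set T) : 0 <= c -> measurable A -> 
   (\int[mu]_x (c * \1_A x)%:E = c%:E * mu A)%E.
  move=> c0 mA'; under eq_integral do rewrite EFinM.
  rewrite ge0_integralZl_EFin //.
    by rewrite integral_indic // setIT.
  by apply/measurable_EFinP; exact: measurable_indic.
rewrite !int // !lebesgue_measure_itv /= !lte_fin.
have -> : (if 0 < t then (t%:E - 0%:E)%E else 0%E) = t%:E.
  by case: ltP => h; rewrite ?sube0 //; congr EFin; lra.
have -> : (if t < 1 then (1%:E - t%:E)%E else 0%E) = (1 - t)%:E.
  by case: ltP => h; rewrite -?EFinB //; congr EFin; lra.
by rewrite -!EFinM -EFinD; congr EFin; ring.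
Qed.

Lemma vol_cube n t Q : 0 <= t <= 1 ->
  vol n (cube (n := n) t Q) = (bin n t (fun m => (Q m)%:R))%:E.
Proof.
move=> t01; elim: n Q => [|n IH] Q.
  rewrite /vol /= diracE; congr (_%:R%:E); congr nat_of_bool.
  by apply/idP/idP => [/set_mem|h]; [|apply/mem_set].
rewrite vol_cons /= -(@integral_two_steps _ _ t) //; try by apply: bin_ge0.
apply: eq_integral => x _.
have cubeE (y : n.-tuple T) : cube t Q (cons_pair (x, y)) =
   (0 <= (x : R) <= 1) && all (fun u : R => 0 <= u <= 1) (y : seq R) &&
   Q ((x <= t)%R + count_le t (y : seq R))%N by [].
case: ifP => x01; last first.
  rewrite (_ : [set _ | _] = set0) ?measure0 //.
  by apply/seteqP; split => y //=; rewrite cubeE x01.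
have [xt|xt] := boolP ((x : R) <= t).
  rewrite -(IH (fun m => Q m.+1)); congr (vol n _); apply/seteqP; split => y;
    by rewrite /= cubeE x01 xt.
rewrite -(IH Q); congr (vol n _); apply/seteqP; split => y;
    by rewrite /= cubeE x01 (negbTE xt).
Qed.

Lemma measurable_mem n (x : R) : measurable [set y : n.-tuple T | x \in (y : seq R)].
Proof.
apply: measurable_pred_set.
rewrite (_ : (fun _ => _) = fun y : n.-tuple T => ~~ all (fun i => ~~ (nth (0 : R) y i == x)) (iota 0 n)).
  apply: measurable_neg; apply: measurable_all_fun => i; apply: measurable_neg.
  by apply: measurable_fun_eqr; [exact: measurable_nth|exact: measurable_cst].
apply/funext => y; rewrite -has_predC; apply/idP/hasP.
  move=> h; exists (index x (y : seq R)).
    by rewrite mem_iota /= add0n -{2}(size_tuple y) index_mem.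
  by rewrite /= negbK nth_index.
move=> [k]; rewrite mem_iota /= add0n negbK => hk /eqP <-.
by apply: mem_nth; rewrite size_tuple.
Qed.

Lemma measurable_uniq n : measurable [set y : n.-tuple T | uniq (y : seq R)].
Proof.
apply: measurable_pred_set.
rewrite (_ : (fun _ => _) = fun y : n.-tuple T =>
   pairwise (fun i j => ~~ (nth (0 : R) y i == nth (0 : R) y j)) (iota 0 n)).
  apply: measurable_pairwise => i j; apply: measurable_neg.
  by apply: measurable_fun_eqr; exact: measurable_nth.
apply/funext => y; rewrite uniq_pairwise -{1}(mkseq_nth (0 : R) y) size_tuple /mkseq.
by rewrite pairwise_map.
Qed.

Lemma vol_mem n (x : R) : vol n [set y : n.-tuple T | x \in (y : seq R)] = 0%E.
Proof.
elim: n => [|n IH].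
  by rewrite (_ : [set _ | _] = set0) ?measure0 //; apply/seteqP; split => y //=; rewrite tuple0.
rewrite vol_cons.
transitivity (\int[mu]_(z in setT) (cst 0%E : T -> \bar R) z)%E; last by rewrite integral_cst // mul0e.
apply: ae_eq_integral => //.
- rewrite (_ : (fun _ => _) = fun z : T => if (z : R) == x then vol n [set: n.-tuple T] else 0%E).
    apply: measurable_fun_ifT; [|exact: measurable_cst|exact: measurable_cst].
    by apply: measurable_fun_eqr; [exact: measurable_id|exact: measurable_cst].
  apply/funext => z; case: eqP => zx.
    by congr (vol n _); apply/seteqP; split => y //= _; rewrite inE zx eqxx.
  rewrite -[RHS]IH; congr (vol n _); apply/seteqP; split => y /=;
    by rewrite inE eq_sym; case: eqP.
exists [set x]; split; [exact: measurable_set1|exact: lebesgue_measure_set1|].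
move=> z /= h; apply: contrapT => zx; apply: h => _ /=.
rewrite -[RHS]IH; congr (vol n _); apply/seteqP; split => y /=;
  by rewrite inE eq_sym; case: eqP.
Qed.

Lemma vol_not_uniq n : vol n [set y : n.-tuple T | ~~ uniq (y : seq R)] = 0%E.
Proof.
elim: n => [|n IH].
  by rewrite (_ : [set _ | _] = set0) ?measure0 //; apply/seteqP; split => y //=; rewrite tuple0.
rewrite vol_cons.
transitivity (\int[mu]_z (cst 0%E : T -> \bar R) z)%E; last by rewrite integral_cst // mul0e.
apply: eq_integral => z _; apply/eqP; rewrite eq_le measure_ge0 andbT.
have mU : measurable [set y : n.-tuple T | ~~ uniq (y : seq R)].
  rewrite (_ : [set _ | _] = ~` [set y : n.-tuple T | uniq (y : seq R)]).
    by apply: measurableC; exact: measurable_uniq.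
  by apply/seteqP; split => y /= /negP.
have -> : (cst 0%E z = vol n [set y : n.-tuple T | (z : R) \in (y : seq R)] +
   vol n [set y : n.-tuple T | ~~ uniq (y : seq R)] :> \bar R)%E.
  by rewrite vol_mem IH adde0.
have h2 := measureU2 (vol n) (@measurable_mem n z) mU.
apply: le_trans h2.
by apply: vol_mono => y /=; rewrite negb_and negbK => /orP[]; [left|right].
Qed.

End Cube.

Section CellUnions.
Context {R : realType}.
Local Notation T := (measurableTypeR R).

Lemma vol_disjoint_union n (I : choiceType) (r : seq I) (F : I -> set (n.-tuple T)) :
  uniq r -> (forall i, measurable (F i)) ->
  (forall i j y, i \in r -> j \in r -> F i y -> F j y -> i = j) ->
  vol n (\big[setU/set0]_(i <- r) F i) = (\sum_(i <- r) vol n (F i))%E.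
Proof.
move=> + mF; elim: r => [|i r IH] /=; first by rewrite !big_nil measure0.
move=> /andP[ir ur] dF; rewrite !big_cons measureU //; last 2 first.
- by apply: bigsetU_measurable.
- apply/seteqP; split => y // [Fiy +]; rewrite -bigcup_seq => -[j /= jr Fjy].
  by move: ir; rewrite (dF i j y) ?jr ?mem_head // inE jr orbT.
congr (_ + _)%E; apply: IH => // a b y ar br.
by apply: dF; rewrite inE ?ar ?br orbT.
Qed.

Context {B : choiceType}.
Implicit Types (bs s : seq B) (t : R) (Q : pred nat).

Lemma ev_sorted_unique bs n (y : n.-tuple T) s s' : perm_eq s bs -> perm_eq s' bs ->
  pairwise <%R [seq ev bs y b | b <- s] -> pairwise <%R [seq ev bs y b | b <- s'] -> s = s'.
Proof.
rewrite !pairwise_map => ps ps' h h'.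
have tr : transitive (relpre (ev bs y) <%R) by move=> b a c /=; apply: lt_trans.
apply: (irr_sorted_eq tr) => //; first by move=> b /=; rewrite ltxx.
- by rewrite sorted_pairwise.
- by rewrite sorted_pairwise.
- by move=> b; rewrite (perm_mem ps) (perm_mem ps').
Qed.

Lemma ev_values bs n (y : n.-tuple T) : size bs = n -> uniq bs ->
  [seq ev bs y b | b <- bs] = y.
Proof.
move=> sb ub; have sy : size (y : seq R) = size bs by rewrite size_tuple.
case: bs sb ub sy => [|b0 bs] sb ub sy; first by move/size0nil: sy.
apply: (@eq_from_nth _ (0 : R)); rewrite size_map // => k hk.
by rewrite (nth_map b0) // /ev index_uniq.
Qed.

Lemma pairwise_lt_perm bs n (y : n.-tuple T) : size bs = n -> uniq bs ->
  uniq (y : seq R) -> exists2 s, perm_eq s bs & pairwise <%R [seq ev bs y b | b <- s].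
Proof.
move=> sb ub uy; exists (sort (relpre (ev bs y) <=%R) bs); first by rewrite perm_sort.
have uv : uniq [seq ev bs y b | b <- sort (relpre (ev bs y) <=%R) bs].
  have : perm_eq [seq ev bs y b | b <- sort (relpre (ev bs y) <=%R) bs] [seq ev bs y b | b <- bs].
    by apply: perm_map; rewrite perm_sort.
  by move/perm_uniq ->; rewrite ev_values.
rewrite -sorted_pairwise; last by move=> a b c; apply: lt_trans.
rewrite lt_sorted_uniq_le uv /= sorted_map.
by apply: sort_sorted => a b; apply: le_total.
Qed.

End CellUnions.

Section CellVolume.
Context {R : realType}.
Local Notation T := (measurableTypeR R).
Local Notation bnd1 := (BRight (1%R : R)).
Implicit Types (t : R) (Q : pred nat).

Lemma all_perm (S : eqType) (a : pred S) (v1 v2 : seq S) :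
  perm_eq v1 v2 -> all a v1 = all a v2.
Proof. by move=> h; apply: eq_all_r; apply: perm_mem. Qed.

(** Up to the null set of tuples with repeated entries, the cube is the disjoint union of n! cells,
    one for each order of the entries, all of the same volume. *)
Lemma cell_vol_bin n t Q : 0 <= t <= 1 ->
  cell_vol n bnd1 t Q = (bin n t (fun m => (Q m)%:R) / n`!%:R)%:E.
Proof.
move=> t01; pose bs := iota 0 n.
have sb : size bs = n by rewrite size_iota.
have ub : uniq bs by apply: iota_uniq.
have pm s : s \in permutations bs -> perm_eq s bs by rewrite mem_permutations.
have := @vol_disjoint_union R n _ (permutations bs) (fun s => cell bs s bnd1 t Q)
  (permutations_uniq _) (fun s => measurable_cell _ _ _ _ _).
move=> /(_ _) h.
have {}h : vol n (\big[setU/set0]_(s <- permutations bs) cell bs s bnd1 t Q) =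
   (\sum_(s <- permutations bs) vol n (cell (n := n) bs s bnd1 t Q))%E.
  apply: h => s s' y /pm ps /pm ps' /andP[/andP[h1 _] _] /andP[/andP[h2 _] _].
  exact: ev_sorted_unique h1 h2.
have e1 : (\sum_(s <- permutations bs) vol n (cell (n := n) bs s bnd1 t Q))%E =
   (\sum_(s <- permutations bs) cell_vol n bnd1 t Q)%E.
  by rewrite big_seq [RHS]big_seq; apply: eq_bigr => s /pm ps; apply: vol_cell.
have e2 : vol n (cube (n := n) t Q) = (\sum_(s <- permutations bs) cell_vol n bnd1 t Q)%E.
  rewrite -e1 -h; apply/eqP; rewrite eq_le; apply/andP; split.
    set U := \big[setU/set0]_(_ <- _) _.
    have mU : measurable U by apply: bigsetU_measurable => s _; apply: measurable_cell.
    have mN : measurable [set y : n.-tuple T | ~~ uniq (y : seq R)].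
      rewrite (_ : [set _ | _] = ~` [set y : n.-tuple T | uniq (y : seq R)]).
        by apply: measurableC; exact: measurable_uniq.
      by apply/seteqP; split => y /= /negP.
    rewrite -[leRHS]adde0 -(@vol_not_uniq R n).
    apply: le_trans (measureU2 (vol n) mU mN); apply: vol_mono => y /andP[hy Qy].
    have [uy|uy] := boolP (uniq (y : seq R)); last by right.
    left; have [s ps hs] := pairwise_lt_perm sb ub uy.
    have pv : perm_eq [seq ev bs y b | b <- s] (y : seq R).
      by rewrite -[X in perm_eq _ X](ev_values y sb ub) perm_map.
    rewrite /U -bigcup_seq; exists s; first by rewrite /= mem_permutations.
    rewrite /cell /mkset /increasing_in hs (all_perm _ pv) /count_le (permP pv) [Q _]Qy andbT.
    by apply: sub_all hy => u; rewrite in_itv.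
  apply: vol_mono => y; rewrite -bigcup_seq => -[s /= /pm ps /andP[/andP[h1 h2] h3]].
  have pv : perm_eq [seq ev bs y b | b <- s] (y : seq R).
    by rewrite -[X in perm_eq _ X](ev_values y sb ub) perm_map.
  rewrite /cube /mkset -(all_perm _ pv) /count_le -(permP pv) [Q _]h3 andbT.
  by apply: sub_all h2 => u; rewrite in_itv.
have card : size (permutations bs) = n`! by rewrite size_permutations // sb.
have c0 : (0 <= cell_vol n bnd1 t Q)%E.
  by rewrite -(@vol_cell R _ n bs bs) // measure_ge0.
have f0 : (0 < n`!)%N by apply: fact_gt0.
move: e2; rewrite vol_cube //; case: (cell_vol n bnd1 t Q) c0 => [v||] //= _.
  rewrite sumEFin => -[->]; congr EFin.
  rewrite big_const_seq count_predT card iter_addr_0 -[v *+ _]mulr_natr mulfK //.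
(* An infinite cell volume would contradict the finite volume of the cube. *)
case: (permutations bs) card => [e|x r _]; first by rewrite -e in f0.
rewrite big_cons addye //; apply/eqP => e.
have : (0 <= \sum_(j <- r) (+oo : \bar R))%E by apply: sume_ge0.
by rewrite e.
Qed.

End CellVolume.

Section TableauProbability.
Context {R : realType}.
Local Notation T := (measurableTypeR R).
Local Notation bnd1 := (BRight (1%R : R)).
Implicit Types (la : seq nat) (t : R).

Lemma pairwise_total (S : eqType) (r : rel S) (s : seq S) a b :
  pairwise r s -> a \in s -> b \in s -> a != b -> r a b || r b a.
Proof.
elim: s => //= x s IH /andP[/allP h1 h2]; rewrite !inE.
have [->|_] := eqVneq a x; have [->|_] := eqVneq b x => //=; rewrite ?eqxx //.
- by move=> _ /h1 -> .
- by move=> /h1 -> _ _; rewrite orbT.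
- exact: IH.
Qed.

Lemma cell_tableau la s t Q (y : filling la) : s \in linear_exts la ->
  cell (boxes la) s bnd1 t Q y -> poissonized_tableaux y.
Proof.
move=> hs /andP[/andP[h1 /allP h2] _].
have ps : perm_eq s (boxes la) by move: hs; rewrite mem_filter mem_permutations => /andP[].
have le : linear_ext s by move: hs; rewrite mem_filter => /andP[].
have ms b : (b \in boxes la) = (b \in s) by rewrite (perm_mem ps).
have both : pairwise (fun b b' => ~~ precedes b' b && (ev (boxes la) y b < ev (boxes la) y b')) s.
  rewrite pairwise_map in h1; rewrite pairwise_relI; apply/andP; split; [exact: le|exact: h1].
have ord b b' : b \in boxes la -> b' \in boxes la -> precedes b b' ->
    ev (boxes la) y b < ev (boxes la) y b'.
  rewrite !ms => bs b's pb; have nb : b != b'.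
    apply/eqP => e; move: pb; rewrite e /precedes => /orP[] /eqP; case: (b') => ? ? []; lia.
  have := pairwise_total both bs b's nb; rewrite pb /= orbF => /andP[_ ->] //.
split.
- move=> b; rewrite ms => bs; have := h2 (ev (boxes la) y b).
  by rewrite in_itv /=; apply; apply: map_f.
- move=> b b'; rewrite !ms => bs b's e; apply/eqP; apply/negPn/negP => nb.
  have := pairwise_total both bs b's nb.
  by rewrite -/(ev _ _ _) [ev _ _ b]e ltxx !andbF.
- by move=> a c h h'; apply: ord => //; rewrite /precedes eqxx.
- by move=> a c h h'; apply: ord => //; rewrite /precedes eqxx orbT.
Qed.

Lemma tableau_cell la t (y : filling la) : poissonized_tableaux y ->
  exists2 s, s \in linear_exts la & cell (boxes la) s bnd1 t predT y.
Proof.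
move=> [h1 h2 h3 h4]; have ub := boxes_uniq la.
have uy : uniq (y : seq R).
  by rewrite -(ev_values y (erefl _) ub) map_inj_in_uniq.
have [s ps hs] := pairwise_lt_perm (erefl _) ub uy.
have ms b : (b \in s) = (b \in boxes la) by rewrite (perm_mem ps).
exists s.
  rewrite mem_filter mem_permutations ps andbT /linear_ext.
  rewrite pairwise_map in hs.
  apply: (sub_in_pairwise _ (allss s) hs) => a b; rewrite !ms => as_ bs_ /= ab.
  apply/negP => pba; suff : ev (boxes la) y b < ev (boxes la) y a by rewrite ltNge (ltW ab).
  case: a as_ pba {ab} => a1 a2 as_; case: b bs_ => b1 b2 bs_.
  by rewrite /precedes => /orP[] /eqP [e1 e2]; subst; [apply: h3|apply: h4].
rewrite /cell /mkset /increasing_in hs !andbT /=.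
by apply/allP => u /mapP[b]; rewrite ms => /h1 hb ->; rewrite in_itv.
Qed.

(* A tableau whose first m boxes in increasing order of the entries are those with
   entry at most t lies in the m-th cell of its linear extension; the volume of this
   cell does not depend on the extension, so m is binomial. *)
Lemma tableau_prob_ge la t (A : set (filling la)) (Phi : seq (int * int) -> pred nat) :
  sorted geq la -> 0 <= t <= 1 ->
  (forall s (y : filling la), s \in linear_exts la ->
     cell (boxes la) s bnd1 t (Phi s) y -> A y) ->
  (\sum_(s <- linear_exts la) bin (size (boxes la)) t (fun m => (Phi s m)%:R))
    / (num_ext la)%:R <= uniform_tableau_prob A.
Proof.
move=> sl t01 hA; set N := size (boxes la).
have pm s : s \in linear_exts la -> perm_eq s (boxes la).
  by rewrite mem_filter mem_permutations => /andP[].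
have volE (Psi : seq (int * int) -> pred nat) :
   vol N (\big[setU/set0]_(s <- linear_exts la) cell (boxes la) s bnd1 t (Psi s)) =
   ((\sum_(s <- linear_exts la) bin N t (fun m => (Psi s m)%:R)) / N`!%:R)%:E.
  rewrite vol_disjoint_union; last 3 first.
  - by rewrite filter_uniq // permutations_uniq.
  - by move=> s; apply: measurable_cell.
  - move=> s s' y /pm ps /pm ps' /andP[/andP[h1 _] _] /andP[/andP[h2 _] _].
    exact: ev_sorted_unique h1 h2.
  rewrite mulr_suml -sumEFin big_seq [RHS]big_seq; apply: eq_bigr => s /pm ps.
  by rewrite (vol_cell bnd1 t (Psi s) (erefl _) (boxes_uniq la) ps) cell_vol_bin.
have PE : (@poissonized_tableaux R la : set (N.-tuple T)) =
   \big[setU/set0]_(s <- linear_exts la) cell (boxes la) s bnd1 t predT.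
  apply/seteqP; split => y; rewrite -bigcup_seq.
    by move=> /(tableau_cell t) [s hs hc]; exists s.
  by move=> [s hs hc]; apply: cell_tableau hc.
have f0 : 0 < N`!%:R :> R by rewrite ltr0n fact_gt0.
have n0 : 0 < (num_ext la)%:R :> R by rewrite ltr0n num_ext_gt0.
have vP : vol N (@poissonized_tableaux R la) = ((num_ext la)%:R / N`!%:R)%:E.
  rewrite PE volE; congr (_ / _)%:E.
  under eq_bigr do rewrite bin_cst.
  by rewrite big_const_seq count_predT iter_addr_0.
rewrite /uniform_tableau_prob -/(vol _) -/N vP /= invf_div mulrA.
rewrite ler_pM2r ?invr_gt0 // -ler_pdivrMr //.
(* The set A is arbitrary, so all that can be used is that it contains a measurable union of
   cells. *)
have sub : \big[setU/set0]_(s <- linear_exts la) cell (boxes la) s bnd1 t (Phi s)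
   `<=` A `&` @poissonized_tableaux R la.
  move=> y; rewrite -bigcup_seq => -[s hs hc]; split; first exact: hA hc.
  exact: cell_tableau hc.
have le1 := vol_mono sub.
have le2 : (vol N (A `&` @poissonized_tableaux R la) <= ((num_ext la)%:R / N`!%:R)%:E)%E.
  by rewrite -vP; apply: vol_mono => y [].
have fin : vol N (A `&` @poissonized_tableaux R la) \is a fin_num.
  by rewrite ge0_fin_numE ?measure_ge0 // (le_lt_trans le2) ?ltry.
by rewrite -lee_fin fineK // -volE.
Qed.

End TableauProbability.

(** * From characteristics to densities *)

Section Transfer.
Context {R : realType}.
Local Notation C := R[i].
Implicit Types (la : seq nat).

Definition mean_cnt la m (c : int) : R := mean la m (fun p => (cnt c p)%:R).

Definition mean_poisson la m (Z : C) : R := mean la m (fun p => \sum_(b <- p) poisson Z b.1).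

Lemma cnt_take_le (s : seq (int * int)) c m1 m2 : (m1 <= m2)%N ->
  (cnt c (take m1 s) <= cnt c (take m2 s))%N.
Proof.
move=> h; have -> : take m2 s = take m1 s ++ drop m1 (take m2 s).
  by rewrite -{1}(cat_take_drop m1 (take m2 s)) take_takel.
by rewrite /cnt count_cat leq_addr.
Qed.

Lemma mean_cnt_le la c m1 m2 : (m1 <= m2)%N -> mean_cnt la m1 c <= mean_cnt la m2 c.
Proof.
move=> h; rewrite /mean_cnt /mean ler_wpM2r ?invr_ge0 // ler_sum // => s _.
by rewrite ler_nat cnt_take_le.
Qed.

Lemma mean_cnt_ge0 la c m : 0 <= mean_cnt la m c.
Proof. exact: mean_ge0. Qed.

Lemma mean_cnt_right la m c (k : nat) : sorted geq la ->
  mean_cnt la m c <= mean_cnt la m (c + k%:Z) + k%:R.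
Proof.
move=> sl; rewrite -(mean_cst m k%:R sl) -meanD; apply: mean_le => s hs.
by rewrite -natrD ler_nat; apply: cnt_right_iter sl hs.
Qed.

Lemma mean_cnt_left la m c (k : nat) : sorted geq la ->
  mean_cnt la m (c + k%:Z) <= mean_cnt la m c + k%:R.
Proof.
move=> sl; rewrite -(mean_cst m k%:R sl) -meanD; apply: mean_le => s hs.
by rewrite -natrD ler_nat; apply: cnt_left_iter sl hs.
Qed.

Lemma poissonE (Z : C) (c0 c : int) : complex.Re Z = c0%:~R ->
  poisson Z c = complex.Im Z / ((c0 - c)%:~R ^+ 2 + complex.Im Z ^+ 2).
Proof.
move=> hz; rewrite /poisson cImV cImD cImN Im_intr subr0 mulNr opprK.
by rewrite sqr_cmod cReD cReN cImD cImN Re_intr Im_intr subr0 hz rmorphB.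
Qed.

(** A finite range of contents, symmetric about c0: with W large it contains all diagonals of the
    diagram, and the diagonals pair up by their distance from c0. *)
Definition window (c0 : int) (W : nat) : seq int :=
  c0 :: [seq c0 + k%:Z | k <- iota 1 W.-1] ++ [seq c0 - k%:Z | k <- iota 1 W.-1].

Lemma window_uniq c0 W : uniq (window c0 W).
Proof.
rewrite /window /= cat_uniq mem_cat negb_or.
apply/and4P; split.
- apply/andP; split; apply/mapP => -[k]; rewrite mem_iota => /andP[k0 _]; lia.
- by rewrite map_inj_uniq ?iota_uniq // => a b; lia.
- apply/hasPn => x /mapP[k]; rewrite mem_iota => /andP[k0 _] ->.
  by apply/mapP => -[k']; rewrite mem_iota => /andP[k0' _]; lia.
- by rewrite map_inj_uniq ?iota_uniq // => a b; lia.
Qed.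

Lemma mem_window c0 W c : (0 < W)%N -> `|c - c0| < W%:Z -> c \in window c0 W.
Proof.
move=> W0 h; rewrite /window inE mem_cat.
have [->|nc] := eqVneq c c0; first by [].
have [lt|ge] := ltP c0 c; apply/orP; right; apply/orP; [left|right]; apply/mapP;
  exists `|c - c0|%N; rewrite ?mem_iota; lia.
Qed.

Lemma big_window (V : nmodType) c0 W (f : int -> V) :
  \sum_(c <- window c0 W) f c = f c0 + \sum_(1 <= k < W) (f (c0 + k%:Z) + f (c0 - k%:Z)).
Proof.
rewrite /window big_cons big_cat !big_map /= big_split /=.
by rewrite /index_iota subn1.
Qed.

Lemma window_exists la (c0 : int) : exists W0 : nat, forall W, (W0 <= W)%N ->
  forall b, b \in boxes la -> b.1 \in window c0 W.
Proof.
exists (\max_(b <- boxes la) `|(b.1 - c0)%R|%N).+1 => W hW b hb.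
have hb' : (`|(b.1 - c0)%R|%N <= \max_(b <- boxes la) `|(b.1 - c0)%R|%N)%N.
  exact: leq_bigmax_seq.
by apply: mem_window; lia.
Qed.

(* Neighbouring diagonals have heights differing by at most 1, so the Poisson
   integral of the height increment controls its value at the centre. *)
Lemma poisson_transfer la m1 m2 (Z : C) (c0 : int) :
  sorted geq la -> (m1 <= m2)%N -> (m2 <= size (boxes la))%N ->
  complex.Re Z = c0%:~R -> 2 <= complex.Im Z ->
  let S := mean_poisson la m2 Z - mean_poisson la m1 Z in
  let d0 := mean_cnt la m2 c0 - mean_cnt la m1 c0 in
  d0 <= 2 * S + 2 * complex.Im Z /\
  (forall J : nat, (0 < J)%N ->
     S <= 9 * d0 + 16 * J%:R + complex.Im Z * (m2 - m1)%:R / J%:R ^+ 2).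
Proof.
move=> sl m12 m2N hR hI S d0; set Y := complex.Im Z.
have [W0 hW0] := window_exists la c0.
pose W := maxn W0 (Num.truncn Y).+2.
have hW : forall b, b \in boxes la -> b.1 \in window c0 W.
  by apply: hW0; apply: leq_maxl.
have YW : Y + 1 <= W%:R.
  have /andP[_ h1] := truncn_itv (le_trans (ler0n R 2) hI : 0 <= Y).
  have h2 : ((Num.truncn Y).+2%:R <= W%:R :> R) by rewrite ler_nat leq_maxr.
  by rewrite -natr1 in h2; rewrite (le_trans _ h2) // lerD2r ltW.
pose d c := mean_cnt la m2 c - mean_cnt la m1 c.
pose D k := d (c0 + k%:Z) + d (c0 - k%:Z).
have dge0 c : 0 <= d c by rewrite subr_ge0 mean_cnt_le.
have mp m : mean_poisson la m Z = \sum_(c <- window c0 W) poisson Z c * mean_cnt la m c.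
  rewrite /mean_poisson; have -> : mean la m (fun p => \sum_(b <- p) poisson Z b.1) =
     mean la m (fun p => \sum_(c <- window c0 W) poisson Z c * (cnt c p)%:R).
    rewrite /mean big_seq [in RHS]big_seq; congr (_ / _); apply: eq_bigr => s hs.
    rewrite (sum_by_content (poisson Z) (window_uniq c0 W)).
      by apply: eq_bigr => c _; rewrite mulr_natr.
    by move=> b bs; apply: hW; apply: linear_ext_boxes hs _; apply: mem_take bs.
  rewrite mean_sum; apply: eq_bigr => c _; exact: meanZ.
have SE : S = poisson_sum D Y d0 W.
  rewrite /S !mp -sumrB (eq_bigr (fun c => d c * (Y / ((c0 - c)%:~R ^+ 2 + Y ^+ 2)))).
    rewrite big_window /poisson_sum subrr expr0n /= add0r; congr (_ + _).
      rewrite /d -/d0; congr (_ * _); rewrite expr2 invfM mulrA divff ?mul1r //.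
      by rewrite gt_eqF // (lt_le_trans _ hI).
    apply: eq_bigr => k _; rewrite /D.
    have -> : c0 - (c0 + k%:Z) = - k%:Z by lia.
    have -> : c0 - (c0 - k%:Z) = k%:Z by lia.
    by rewrite rmorphN sqrrN /= -pmulrn [RHS]mulrDl.
  by move=> c _; rewrite (poissonE c hR) -mulrBr mulrC.
have D0 k : 0 <= D k by rewrite addr_ge0.
(* Each of the two mean heights is 1-Lipschitz in the content, so their difference is
   2-Lipschitz. *)
have b1 c (k : nat) : d c - 2 * k%:R <= d (c + k%:Z) <= d c + 2 * k%:R.
  have h1 := mean_cnt_right m1 c k sl; have h2 := mean_cnt_left m1 c k sl.
  have h3 := mean_cnt_right m2 c k sl; have h4 := mean_cnt_left m2 c k sl.
  by rewrite /d; apply/andP; split; lra.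
have DB k : 2 * d0 - 4 * k%:R <= D k <= 2 * d0 + 4 * k%:R.
  have /andP[h1 h2] := b1 c0 k; have /andP[h3 h4] := b1 (c0 - k%:Z) k.
  rewrite subrK in h3 h4.
  by rewrite /D -[d0]/(d c0); apply/andP; split; lra.
have d00 : 0 <= d0 by apply: dge0.
split.
  rewrite SE; apply: poisson_sum_ge => //.
  by move=> k; case/andP: (DB k).
move=> J J0; rewrite SE; apply: poisson_sum_le => //.
- by apply: le_trans hI; lra.
- by move=> k; case/andP: (DB k).
have tot m : (m <= size (boxes la))%N -> \sum_(c <- window c0 W) mean_cnt la m c = m%:R.
  move=> mN; rewrite /mean_cnt -mean_sum -(mean_cst m m%:R sl) /mean; congr (_ / _).
  rewrite big_seq [RHS]big_seq; apply: eq_bigr => s hs.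
  have cov b : b \in take m s -> b.1 \in window c0 W.
    by move=> bs; apply: hW; apply: linear_ext_boxes hs _; apply: mem_take bs.
  have := sum_by_content (fun=> 1 : R) (window_uniq c0 W) cov.
  by rewrite big_const_seq count_predT iter_addr_0 size_takel ?(size_linear_ext hs).
have := congr2 (fun a b => a - b) (tot m2 m2N) (tot m1 (leq_trans m12 m2N)).
rewrite -sumrB -natrB // => <-; rewrite big_window -/(d c0).
by rewrite [leRHS]addrC lerDl.
Qed.

Lemma sum_increments la m1 m2 (Z : C) : sorted geq la -> (m1 <= m2)%N ->
  (m2 <= size (boxes la))%N -> complex.Im Z != 0 ->
  mean_poisson la m2 Z - mean_poisson la m1 Z =
  \sum_(m1 <= m < m2) (mean la m.+1 (fun p => complex.Im (kerov p Z)) - complex.Im Z) / m.+1%:R.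
Proof.
move=> sl m12 m2N hZ; rewrite -(telescope_sumr (fun m => mean_poisson la m Z)) //.
rewrite !big_nat; apply: eq_bigr => m /andP[_ mm2].
rewrite /mean_poisson mean_increment ?(leq_trans mm2) //.
rewrite -(mean_cst m.+1 (complex.Im Z) sl) /mean -mulrBl -sumrB mulrAC; congr (_ / _).
by rewrite mulr_suml; apply: eq_bigr => s _; rewrite cImD cImN.
Qed.

(** At most A Y^2 removals give (1 + 5/Y^2)^k <= exp(5 A) and accumulated step errors of at most A
    [step_const]. The bound involves neither Y nor the number of boxes, hence is uniform over the
    dilations. *)
Definition chain_const (A B : R) : R := expR (5 * A) * (A * step_const A B).

Lemma step_const_ge0 (A B : R) : 0 <= step_const A B.
Proof. by rewrite addr_ge0 ?sqr_ge0. Qed.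

(** The last hypothesis kills the initial error in [chain_L2], at the full diagram, so only the
    accumulated step errors remain. Jensen's inequality passes from the second moment to the
    mean. *)
Lemma kerov_mean_close la m (Z theta : C) (A B Y : R) : sorted geq la ->
  (m <= size (boxes la))%N -> 2 <= Y -> (size (boxes la))%:R <= A * Y ^+ 2 ->
  cmod theta * Y <= B ->
  (forall j : nat, (m + j <= size (boxes la))%N ->
     Y <= complex.Im (Z + j%:R * theta) /\ cmod (Z + j%:R * theta) <= B * Y) ->
  kerov (boxes la) (Z + (size (boxes la) - m)%:R * theta) = (size (boxes la))%:R * theta ->
  (mean la m (fun p => complex.Im (kerov p Z)) - m%:R * complex.Im theta) ^+ 2
    <= chain_const A B.
Proof.
move=> sl mN Y2 hA hth hp he.
have h := chain_L2 sl mN Y2 hA hth hp; rewrite he subrr cmod0 expr0n add0r in h.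
have Y0 : 0 < Y by lra.
rewrite -(mean_cst m (m%:R * complex.Im theta) sl).
have -> : mean la m (fun p => complex.Im (kerov p Z)) - mean la m (fun=> m%:R * complex.Im theta)
  = mean la m (fun p => complex.Im (kerov p Z) - m%:R * complex.Im theta).
  by rewrite /mean -mulrBl sumrB.
apply: le_trans (mean_sqr_le _ _ sl) _; apply: le_trans (mean_le _) (le_trans h _).
  move=> s _; set p := take m s.
  have -> : complex.Im (kerov p Z) - m%:R * complex.Im theta = complex.Im (kerov p Z - m%:R * theta).
    by rewrite cImD cImN [complex.Im (m%:R * _)]cImM Im_natr Re_natr mul0r addr0.
  rewrite -real_normK ?num_real // ler_pXn2r ?nnegrE ?cmod_ge0 //; exact: Im_le_cmod.
have NA : (size (boxes la) - m)%:R <= A * Y ^+ 2.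
  by apply: le_trans hA; rewrite ler_nat leq_subr.
set k := (size (boxes la) - m)%N in NA *.
have YY : 0 < Y ^+ 2 by rewrite exprn_gt0.
apply: ler_pM.
- by rewrite exprn_ge0 // addr_ge0 // divr_ge0 // ltW.
- by rewrite mulr_ge0 // divr_ge0 ?step_const_ge0 // ltW.
- have h1 : 1 + 5 / Y ^+ 2 <= expR (5 / Y ^+ 2) by apply: expR_ge1Dx.
  apply: (@le_trans _ _ (expR (5 / Y ^+ 2) ^+ k)).
    by rewrite lerXn2r ?nnegrE ?expR_ge0 // addr_ge0 // divr_ge0 // ltW.
  rewrite -expRM_natl ler_expR.
  have -> : k%:R * (5 / Y ^+ 2) = 5 * (k%:R / Y ^+ 2) by ring.
  by rewrite ler_pM2l // ler_pdivrMr.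
- have -> : k%:R * (step_const A B / Y ^+ 2) = (k%:R / Y ^+ 2) * step_const A B by ring.
  by rewrite ler_wpM2r ?step_const_ge0 // ler_pdivrMr.
Qed.

End Transfer.

(** * Roots of the characteristic equation and their stability *)

Section CharacteristicRoots.
Context {R : realType}.
Local Notation C := R[i].

(** The last equation says that a boundary of slopes 1 and -1 with these extrema starts and ends on
    the graph of |x|. It removes the constant term in the expansion of [KC] at infinity, see
    [KC_form]. *)
Definition interlaced (a0 b1 a1 b2 a2 : R) :=
  [/\ a0 < b1, b1 < a1, a1 < b2, b2 < a2 & b1 + b2 = a0 + a1 + a2].

(** [mass1] and [mass2] are minus the residues of [KC] at b1 and b2; interlacing makes them
    positive. *)
Definition mass1 (a0 b1 a1 b2 a2 : R) := (b1 - a0) * (b1 - a1) * (b1 - a2) / (b2 - b1).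
Definition mass2 (a0 b1 a1 b2 a2 : R) := (b2 - a0) * (b2 - a1) * (a2 - b2) / (b2 - b1).

Lemma mass1_gt0 a0 b1 a1 b2 a2 : interlaced a0 b1 a1 b2 a2 -> 0 < mass1 a0 b1 a1 b2 a2.
Proof.
move=> [h1 h2 h3 h4 _]; rewrite divr_gt0 //; last lra.
by rewrite nmulr_rgt0; [lra|rewrite nmulr_llt0; lra].
Qed.

Lemma mass2_gt0 a0 b1 a1 b2 a2 : interlaced a0 b1 a1 b2 a2 -> 0 < mass2 a0 b1 a1 b2 a2.
Proof. by move=> [h1 h2 h3 h4 _]; rewrite divr_gt0 ?mulr_gt0 //; lra. Qed.

Definition numC (a0 a1 a2 : R) (w : C) := (w - a0%:C%C) * (w - a1%:C%C) * (w - a2%:C%C).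
Definition denC (b1 b2 : R) (w : C) := (w - b1%:C%C) * (w - b2%:C%C).
(* The rescaled transform of a diagram with the given interlacing coordinates. *)
Definition KC (a0 b1 a1 b2 a2 : R) (w : C) := numC a0 a1 a2 w / denC b1 b2 w.

Lemma denC_neq0 b1 b2 w : (denC b1 b2 w != 0) = (w - b1%:C%C != 0) && (w - b2%:C%C != 0).
Proof. by rewrite mulf_eq0 negb_or. Qed.

Lemma KC_form a0 b1 a1 b2 a2 w : interlaced a0 b1 a1 b2 a2 -> denC b1 b2 w != 0 ->
  KC a0 b1 a1 b2 a2 w = w - (mass1 a0 b1 a1 b2 a2)%:C%C / (w - b1%:C%C)
     - (mass2 a0 b1 a1 b2 a2)%:C%C / (w - b2%:C%C).
Proof.
move=> [h1 h2 h3 h4 hs]; rewrite denC_neq0 => /andP[w1 w2].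
have e : a1 = b1 + b2 - a0 - a2 by lra.
have bb : b2%:C%C - b1%:C%C != 0 :> C.
  by rewrite -rmorphB /= fmorph_eq0 subr_eq0; apply/eqP; lra.
rewrite /KC /numC /denC /mass1 /mass2 e !(rmorphM, rmorphB, rmorphD, fmorphV) /=.
by field; rewrite w1 w2 bb.
Qed.

(** Off the real line, 1 + [spread] is the factor by which [KC] multiplies the imaginary part; on
    it, 1 + [spread] is the derivative of [KC]. *)
Definition spread a0 b1 a1 b2 a2 (w : C) : R :=
  mass1 a0 b1 a1 b2 a2 / cmod (w - b1%:C%C) ^+ 2 + mass2 a0 b1 a1 b2 a2 / cmod (w - b2%:C%C) ^+ 2.

Lemma Im_KC a0 b1 a1 b2 a2 w : interlaced a0 b1 a1 b2 a2 -> denC b1 b2 w != 0 ->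
  complex.Im (KC a0 b1 a1 b2 a2 w) = complex.Im w * (1 + spread a0 b1 a1 b2 a2 w).
Proof.
move=> hI hw; rewrite KC_form // /spread.
rewrite cImD cImN cImD cImN !cImM !cImV /= !mul0r !addr0 !cImD !cImN /= !subr0.
by ring.
Qed.

Lemma Im_shift a0 b1 a1 b2 a2 w (s : R) : interlaced a0 b1 a1 b2 a2 -> denC b1 b2 w != 0 ->
  complex.Im (w - (1 - s)%:C%C * KC a0 b1 a1 b2 a2 w) =
  complex.Im w * (s - (1 - s) * spread a0 b1 a1 b2 a2 w).
Proof.
move=> hI hw; rewrite cImD cImN cImM /= mul0r addr0 Im_KC //; ring.
Qed.

Lemma spread_ge0 a0 b1 a1 b2 a2 w : interlaced a0 b1 a1 b2 a2 -> 0 <= spread a0 b1 a1 b2 a2 w.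
Proof.
move=> hI; rewrite addr_ge0 // divr_ge0 ?sqr_ge0 // ltW //.
- exact: mass1_gt0.
- exact: mass2_gt0.
Qed.

Lemma inv_near (u w b : C) (rho : R) : 0 < rho -> cmod (u - w) < rho ->
  rho <= cmod (u - b) / 2 -> u - b != 0 ->
  [/\ w - b != 0, cmod ((w - b)^-1 - (u - b)^-1) <= rho * (2 / cmod (u - b) ^+ 2) &
    (cmod (w - b) ^+ 2)^-1 <= (cmod (u - b) ^+ 2)^-1 + rho * (6 / cmod (u - b) ^+ 3)].
Proof.
move=> r0 huw hr hub; set g := cmod (u - b) in hr *.
have g0 : 0 < g by rewrite cmod_gt0.
have hwg : g - rho <= cmod (w - b).
  have := cmodD (w - b) (u - w); have -> : w - b + (u - w) = u - b by ring.
  by rewrite -/g; lra.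
have wb : w - b != 0 by rewrite -cmod_gt0; lra.
have hwg2 : g / 2 <= cmod (w - b) by lra.
have w0 : 0 < cmod (w - b) by rewrite cmod_gt0.
split => //.
  have -> : (w - b)^-1 - (u - b)^-1 = (u - w) * ((w - b)^-1 * (u - b)^-1) by field; rewrite wb hub.
  rewrite !cmodM !cmodV -/g ler_pM ?mulr_ge0 ?invr_ge0 ?cmod_ge0 //; first exact: ltW.
  have -> : 2 / g ^+ 2 = (g / 2)^-1 * g^-1 by field; lra.
  rewrite ler_wpM2r ?invr_ge0 //; first exact: ltW.
  by rewrite lef_pV2 ?posrE //; lra.
have t1 : (cmod (w - b) ^+ 2)^-1 <= ((g - rho) ^+ 2)^-1.
  rewrite lef_pV2 ?posrE ?exprn_gt0 //; last lra.
  by rewrite ler_pXn2r ?nnegrE //; lra.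
apply: (le_trans t1).
have -> : (g ^+ 2)^-1 + rho * (6 / g ^+ 3) = (g + 6 * rho) / g ^+ 3 by field; lra.
have d0 : 0 < (g - rho) ^+ 2 by rewrite exprn_gt0 //; lra.
have d1 : 0 < g ^+ 3 by rewrite exprn_gt0.
rewrite ler_pdivlMr // mulrC ler_pdivrMr //.
have -> : (g + 6 * rho) * (g - rho) ^+ 2 = g ^+ 3 + rho * ((4 * g - 3 * rho) * (g - 2 * rho)) by ring.
by rewrite lerDl !mulr_ge0 //; lra.
Qed.

(** The equation w - (1 - s) K(w) = z with denominators cleared; the two terms of degree 3 leave the
    leading coefficient s. *)
Definition critical_poly (a0 b1 a1 b2 a2 : R) (z : C) (s : R) : {poly C} :=
  Poly [:: - (z * b1%:C%C * b2%:C%C) + (1 - s)%:C%C * (a0%:C%C * a1%:C%C * a2%:C%C);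
     z * (b1%:C%C + b2%:C%C) + b1%:C%C * b2%:C%C
       - (1 - s)%:C%C * (a0%:C%C * a1%:C%C + a0%:C%C * a2%:C%C + a1%:C%C * a2%:C%C);
     - (z + b1%:C%C + b2%:C%C) + (1 - s)%:C%C * (a0%:C%C + a1%:C%C + a2%:C%C);
     s%:C%C].

Lemma critical_polyE a0 b1 a1 b2 a2 z s w : (critical_poly a0 b1 a1 b2 a2 z s).[w] =
  (w - z) * denC b1 b2 w - (1 - s)%:C%C * numC a0 a1 a2 w.
Proof.
rewrite /critical_poly horner_Poly /= /denC /numC rmorphB /=.
rewrite rmorph1; ring.
Qed.

(** The modulus at u is s times the product of the distances to the three roots, hence at least s
    rho^3 if all distances are at least rho. *)
Lemma critical_root_near a0 b1 a1 b2 a2 z (s : R) (u : C) (rho : R) : 0 < s -> 0 < rho ->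
  cmod ((critical_poly a0 b1 a1 b2 a2 z s).[u]) < s * rho ^+ 3 ->
  exists2 w, cmod (u - w) < rho & (critical_poly a0 b1 a1 b2 a2 z s).[w] = 0.
Proof.
move=> s0 r0; set P := critical_poly _ _ _ _ _ _ _ => hu.
have sz : P = [:: - (z * b1%:C%C * b2%:C%C) + (1 - s)%:C%C * (a0%:C%C * a1%:C%C * a2%:C%C);
     z * (b1%:C%C + b2%:C%C) + b1%:C%C * b2%:C%C
       - (1 - s)%:C%C * (a0%:C%C * a1%:C%C + a0%:C%C * a2%:C%C + a1%:C%C * a2%:C%C);
     - (z + b1%:C%C + b2%:C%C) + (1 - s)%:C%C * (a0%:C%C + a1%:C%C + a2%:C%C);
     s%:C%C] :> seq C.
  by apply: (PolyK (c := 0)); rewrite /= fmorph_eq0 gt_eqF.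
have lcP : lead_coef P = s%:C%C by rewrite lead_coefE sz.
have [r Pr] := closed_field_poly_normal P; rewrite lcP in Pr.
have sr : size r = 3%N.
  have := congr1 (fun q : {poly C} => size q) Pr.
  rewrite size_scale ?fmorph_eq0 ?gt_eqF // size_prod_XsubC sz /= => -[]; done.
have : cmod (P.[u]) = s * (cmod (u - r`_0) * cmod (u - r`_1) * cmod (u - r`_2)).
  rewrite {1}Pr hornerZ horner_prod cmodM cmod_real gtr0_norm //; congr (_ * _).
  case: r sr {Pr} => [|x [|y [|t [|]]]] //= _.
  by rewrite !big_cons big_nil mulr1 !hornerXsubC !cmodM mulrA.
move=> e; rewrite e ltr_pM2l // in hu.
have rootr k : (k < 3)%N -> P.[r`_k] = 0.
  move=> k3; rewrite Pr; apply/eqP; rewrite -[_ == 0]/(root _ _) rootZ ?fmorph_eq0 ?gt_eqF //.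
  by rewrite root_prod_XsubC mem_nth // sr.
have [h0|h0] := ltP (cmod (u - r`_0)) rho; first by exists r`_0 => //; apply: rootr.
have [h1|h1] := ltP (cmod (u - r`_1)) rho; first by exists r`_1 => //; apply: rootr.
have [h2|h2] := ltP (cmod (u - r`_2)) rho; first by exists r`_2 => //; apply: rootr.
suff : rho ^+ 3 <= cmod (u - r`_0) * cmod (u - r`_1) * cmod (u - r`_2) by rewrite leNgt hu.
have -> : rho ^+ 3 = rho * rho * rho by ring.
by rewrite !ler_pM ?mulr_ge0 // ltW.
Qed.

(* The real part of the condition says that w - (1 - s) K(w) has positive derivative
   at u, so that points of the upper half-plane near x come from points near u. *)
Definition good_root a0 b1 a1 b2 a2 (x s : R) (u : C) :=
  [/\ (u - x%:C%C) * denC b1 b2 u = (1 - s)%:C%C * numC a0 a1 a2 u, denC b1 b2 u != 0 &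
   0 < complex.Im u \/
   complex.Im u = 0 /\ 0 < s - (1 - s) * spread a0 b1 a1 b2 a2 u].

(** A root w near u comes from [critical_root_near]. For nonreal u it stays in the upper half-plane
    by closeness. For real u, [Im_shift] writes Im z as Im w times a factor that stays positive near
    u, so Im w > 0. *)
Lemma good_root_perturb a0 b1 a1 b2 a2 (x s0 : R) (u : C) : interlaced a0 b1 a1 b2 a2 ->
  0 < s0 -> s0 <= 1 -> good_root a0 b1 a1 b2 a2 x s0 u ->
  forall eps, 0 < eps -> exists2 delta, 0 < delta & forall (s : R) (z : C),
    `|s - s0| < delta -> s <= 1 -> cmod (z - x%:C%C) < delta -> 0 < complex.Im z ->
  exists w, [/\ 0 < s, 0 < complex.Im w, denC b1 b2 w != 0,
     w - (1 - s)%:C%C * KC a0 b1 a1 b2 a2 w = z &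
     cmod (KC a0 b1 a1 b2 a2 w - KC a0 b1 a1 b2 a2 u) <= eps].
Proof.
move=> hI s00 s01 [hu hd hc] eps eps0.
move: (hd); rewrite denC_neq0 => /andP[u1 u2].
set g1 := cmod (u - b1%:C%C); set g2 := cmod (u - b2%:C%C).
have g10 : 0 < g1 by rewrite cmod_gt0.
have g20 : 0 < g2 by rewrite cmod_gt0.
have n1 := mass1_gt0 hI; have n2 := mass2_gt0 hI.
set m1 := mass1 _ _ _ _ _ in n1; set m2 := mass2 _ _ _ _ _ in n2.
pose L := 1 + m1 * (2 / g1 ^+ 2) + m2 * (2 / g2 ^+ 2).
have L1 : 1 <= L.
  have h1 : 0 <= m1 * (2 / g1 ^+ 2) := mulr_ge0 (ltW n1) (divr_ge0 (ler0n _ _) (sqr_ge0 _)).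
  have h2 : 0 <= m2 * (2 / g2 ^+ 2) := mulr_ge0 (ltW n2) (divr_ge0 (ler0n _ _) (sqr_ge0 _)).
  by rewrite /L; lra.
pose M := m1 * (6 / g1 ^+ 3) + m2 * (6 / g2 ^+ 3).
have M0 : 0 <= M.
  apply: addr_ge0.
    exact: mulr_ge0 (ltW n1) (divr_ge0 (ler0n _ _) (exprn_ge0 _ (ltW g10))).
  exact: mulr_ge0 (ltW n2) (divr_ge0 (ler0n _ _) (exprn_ge0 _ (ltW g20))).
have S0 := spread_ge0 u hI; set S := spread _ _ _ _ _ _ in S0 hc.
(* The margin to be preserved: the height of u above the real line, or else the derivative at the
   real point u. *)
pose kap := if 0 < complex.Im u then complex.Im u else s0 - (1 - s0) * S.
have kap0 : 0 < kap.
  by rewrite /kap; case: ifP => // h; case: hc => [|[]//]; rewrite h.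
have [rho [r0 r1 r2 r3 [r4 r5]]] : exists rho : R, [/\ 0 < rho, rho <= g1 / 2, rho <= g2 / 2,
    rho * L <= eps & rho <= kap / 2 /\ rho * (2 * M) <= kap / 4].
  exists (Num.min (Num.min (g1 / 2) (g2 / 2)) (Num.min (eps / L)
     (Num.min (kap / 2) (kap / 4 / (2 * M + 1))))).
  have x1 : 0 < L by lra.
  have x2 : 0 < 2 * M + 1 by lra.
  have x3 : 0 < kap / 4 / (2 * M + 1) by rewrite !divr_gt0.
  set rho := Num.min _ _.
  have y1 : rho <= g1 / 2 by rewrite !ge_min lexx.
  have y2 : rho <= g2 / 2 by rewrite !ge_min lexx orbT.
  have y3 : rho <= eps / L by rewrite !ge_min lexx !orbT.
  have y4 : rho <= kap / 2 by rewrite !ge_min lexx !orbT.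
  have y5 : rho <= kap / 4 / (2 * M + 1) by rewrite !ge_min lexx !orbT.
  have y0 : 0 < rho by rewrite !lt_min !divr_gt0.
  split => //; first by rewrite -ler_pdivlMr.
  split => //; rewrite ler_pdivlMr // in y5; nra.
pose Q := cmod (denC b1 b2 u) + cmod (numC a0 a1 a2 u) + 1.
have Q1 : 1 <= Q by rewrite lerDr addr_ge0 ?cmod_ge0.
exists (Num.min (Num.min (s0 / 2) 1) (Num.min (kap / 4 / (1 + S)) (s0 / 2 * rho ^+ 3 / Q))).
  rewrite !lt_min !divr_gt0 ?mulr_gt0 ?exprn_gt0 ?divr_gt0 //; lra.
set delta := Num.min _ _ => s z hs sle hz Imz.
have d1 : delta <= s0 / 2 by rewrite !ge_min lexx.
have d2 : delta <= 1 by rewrite !ge_min lexx orbT.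
have d3 : delta * (1 + S) <= kap / 4.
  by rewrite -ler_pdivlMr; [rewrite !ge_min lexx !orbT|lra].
have d4 : delta * Q <= s0 / 2 * rho ^+ 3.
  by rewrite -ler_pdivlMr; [rewrite !ge_min lexx !orbT|lra].
have [hs1 hs2] : s0 - delta < s /\ s < s0 + delta.
  by clear -hs; move: hs; rewrite ltr_norml => /andP[? ?]; split; lra.
have s20 : s0 / 2 < s by clear -hs1 d1; lra.
have sp : 0 < s by clear -s20 s00; lra.
have [w huw hw] : exists2 w, cmod (u - w) < rho & (critical_poly a0 b1 a1 b2 a2 z s).[w] = 0.
  apply: critical_root_near => //; rewrite critical_polyE.
  have -> : (u - z) * denC b1 b2 u - (1 - s)%:C%C * numC a0 a1 a2 u =
     - (z - x%:C%C) * denC b1 b2 u + (s - s0)%:C%C * numC a0 a1 a2 u.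
    have -> : (s - s0)%:C%C = (1 - s0)%:C%C - (1 - s)%:C%C :> C by rewrite -rmorphB /=; congr (_%:C)%C; ring.
    by rewrite [X in _ = _ + X]mulrBl -hu; ring.
  apply: le_lt_trans (cmodD _ _) _.
  rewrite [cmod (_ * denC b1 b2 u)]cmodM [cmod (_ * numC a0 a1 a2 u)]cmodM cmodN cmod_real.
  have t1 : cmod (z - x%:C%C) * cmod (denC b1 b2 u) <= delta * cmod (denC b1 b2 u).
    by rewrite ler_wpM2r ?cmod_ge0 // ltW.
  have t2 : `|s - s0| * cmod (numC a0 a1 a2 u) <= delta * cmod (numC a0 a1 a2 u).
    by rewrite ler_wpM2r ?cmod_ge0 // ltW.
  have t3 : s0 / 2 * rho ^+ 3 < s * rho ^+ 3 by rewrite ltr_pM2r ?exprn_gt0.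
  have t4 : delta * Q = delta * cmod (denC b1 b2 u) + delta * cmod (numC a0 a1 a2 u) + delta.
    by rewrite /Q; ring.
  have t5 : 0 < delta by apply: le_lt_trans (normr_ge0 _) hs.
  clear -t1 t2 t3 t4 t5 d4; lra.
have [w1 e1 f1] := inv_near r0 huw r1 u1.
have [w2 e2 f2] := inv_near r0 huw r2 u2.
have dw : denC b1 b2 w != 0 by rewrite denC_neq0 w1 w2.
have eqz : w - (1 - s)%:C%C * KC a0 b1 a1 b2 a2 w = z.
  move: hw; rewrite critical_polyE => /eqP; rewrite subr_eq0 => /eqP hw.
  by rewrite /KC mulrA -hw mulfK // subKr.
have dK : cmod (KC a0 b1 a1 b2 a2 w - KC a0 b1 a1 b2 a2 u) <= eps.
  rewrite !KC_form // -/m1 -/m2.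
  have -> : w - m1%:C%C / (w - b1%:C%C) - m2%:C%C / (w - b2%:C%C) -
    (u - m1%:C%C / (u - b1%:C%C) - m2%:C%C / (u - b2%:C%C)) =
    - (u - w) - m1%:C%C * ((w - b1%:C%C)^-1 - (u - b1%:C%C)^-1)
     - m2%:C%C * ((w - b2%:C%C)^-1 - (u - b2%:C%C)^-1) by ring.
  apply: le_trans (cmodB _ _) _; apply: le_trans (lerD (cmodB _ _) (lexx _)) _.
  rewrite !cmodM cmodN !cmod_real (gtr0_norm n1) (gtr0_norm n2); apply: le_trans r3.
  have -> : rho * L = rho + m1 * (rho * (2 / g1 ^+ 2)) + m2 * (rho * (2 / g2 ^+ 2)).
    by rewrite /L; ring.
  by rewrite !lerD ?ler_wpM2l ?(ltW n1) ?(ltW n2) // ltW.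
exists w; split => //.
have [Imu|Imu] := ltP 0 (complex.Im u).
  have := Im_le_cmod (u - w); rewrite cImD cImN => h.
  have h' := ler_norm (complex.Im u - complex.Im w).
  by move: r4; rewrite /kap Imu => r4; clear -h h' huw r4 Imu; lra.
have br : 0 < s - (1 - s) * spread a0 b1 a1 b2 a2 w.
  have hk : kap = s0 - (1 - s0) * S by rewrite /kap ltNge Imu.
  have Sw : spread a0 b1 a1 b2 a2 w <= S + rho * M.
    rewrite /S /spread -/m1 -/m2 /M -/g1 -/g2.
    have := ler_wpM2l (ltW n1) f1; have := ler_wpM2l (ltW n2) f2.
    rewrite -/g1 -/g2 => k1 k2; clear -k1 k2; lra.
  have t : (1 - s) * spread a0 b1 a1 b2 a2 w <= (1 - s) * (S + rho * M).
    by rewrite ler_wpM2l //; clear -sle; lra.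
  have S2 : 0 <= rho * M by rewrite mulr_ge0 // ltW.
  have t2 : (1 - s) * (S + rho * M) <= (1 - s0 + delta) * (S + rho * M).
    by apply: ler_wpM2r; [clear -S0 S2; lra|clear -hs1; lra].
  have t3 : (1 - s0 + delta) * (rho * M) <= 2 * (rho * M).
    by apply: ler_wpM2r => //; clear -d2 s00; lra.
  clear -hk t t2 t3 hs1 d3 r5 kap0; lra.
have := Im_shift s hI dw; rewrite eqz => h.
by rewrite -(pmulr_lgt0 _ br) -h.
Qed.

End CharacteristicRoots.

Section Density.
Context {R : realType}.
Local Notation C := R[i].
Implicit Types (la : seq nat).

(** All that the analysis uses of the diagram. The scaling of the transform is exact for every n, so
    the end condition of [kerov_mean_close] can be met without error. *)
Definition dilation_data la (a0 b1 a1 b2 a2 : R) :=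
  [/\ interlaced a0 b1 a1 b2 a2, (0 < size (boxes la))%N &
   forall n, (0 < n)%N -> [/\ sorted geq (dilate n la),
     size (boxes (dilate n la)) = (n ^ 2 * size (boxes la))%N &
     forall z : C, complex.Im z != 0 ->
       kerov (boxes (dilate n la)) (n%:R * z) = n%:R * KC a0 b1 a1 b2 a2 z]].

(** For each m, [good_root_perturb] provides w with w - (1 - s) K(w) = z at s = (m + 1)/N, and theta
    = K(w) / (n N0) satisfies the end condition of [kerov_mean_close]. So the mean increment of the
    Poisson sum at this step is Im theta up to (Q + n y) / (m + 1), where Im K(w) is within eps of
    v. *)
Lemma density_sum_bounds la a0 b1 a1 b2 a2 (x s0 : R) (u : C) :
  dilation_data la a0 b1 a1 b2 a2 -> 0 < s0 -> s0 <= 1 ->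
  good_root a0 b1 a1 b2 a2 x s0 u -> forall eps, 0 < eps ->
  let v := complex.Im (KC a0 b1 a1 b2 a2 u) in
  let N0 := size (boxes la) in
  exists2 delta, 0 < delta & forall s1 y, 0 < s1 -> s0 - delta < s1 -> 0 < y -> y < delta ->
  exists Q : R, 0 <= Q /\ exists n0 : nat, forall n, (n0 <= n)%N -> forall (c : int) (m1 m2 : nat),
    `|c%:~R / n%:R - x| <= n%:R^-1 ->
    (m1 <= m2)%N -> (m2 <= n ^ 2 * N0)%N -> m2%:R < (s0 + delta) * (n ^ 2 * N0)%:R ->
    s1 * (n ^ 2 * N0)%:R <= m1.+1%:R ->
    (0 < n)%N /\ 2 <= n%:R * y /\
    (m2 - m1)%:R * ((v - eps) / (n%:R * N0%:R) - (Q + n%:R * y) / (s1 * (n ^ 2 * N0)%:R)) <=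
    mean_poisson (dilate n la) m2 (c%:~R +i* (n%:R * y))%C
     - mean_poisson (dilate n la) m1 (c%:~R +i* (n%:R * y))%C
    <= (m2 - m1)%:R * ((v + eps) / (n%:R * N0%:R) + Q / (s1 * (n ^ 2 * N0)%:R)).
Proof.
move=> [hI N00 hd] s00 s01 gr eps eps0 v N0.
have [delta d0 hdel] := good_root_perturb hI s00 s01 gr eps0.
exists (delta / 2); first by rewrite divr_gt0.
move=> s1 y s10 s1d y0 yd.
have N0r : 0 < N0%:R :> R by rewrite ltr0n.
pose kap := cmod (KC a0 b1 a1 b2 a2 u) + eps.
have kap0 : 0 < kap by rewrite ltr_wpDl ?cmod_ge0.
(* [A] is N / (n y)^2. The first summand of [B] bounds |theta| n y, the second bounds |Z + j theta|
   / (n y). The 1 in [Q] makes Q^2 at least [chain_const]. *)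
pose A := N0%:R / y ^+ 2.
pose B := kap * y / N0%:R + (`|x| + delta + kap) / y.
pose Q := chain_const A B + 1.
have cc : 0 <= chain_const A B.
  by rewrite /chain_const !mulr_ge0 ?expR_ge0 ?step_const_ge0 // ?invr_ge0 ?sqr_ge0 // ltW.
have Q0 : 0 <= Q by rewrite addr_ge0.
exists Q; split => //; exists (Num.truncn (2 / y + 2 / delta)).+1 => n hn c m1 m2 hc m12 m2N m2s s1m1.
have nlt : 2 / y + 2 / delta < n%:R.
  have h0 : 0 <= 2 / y + 2 / delta by rewrite addr_ge0 ?divr_ge0 ?(ltW y0) ?(ltW d0).
  have /andP[_ h1] := truncn_itv h0; apply: lt_le_trans h1 _; by rewrite ler_nat.
have p1 : 0 < 2 / y by rewrite divr_gt0.
have p2 : 0 < 2 / delta by rewrite divr_gt0.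
have n0r : 0 < n%:R :> R by lra.
have n0 : (0 < n)%N by rewrite -(ltr0n R).
have nr0 := lt0r_neq0 n0r; have N0r0 := lt0r_neq0 N0r.
have ny2 : 2 <= n%:R * y by rewrite -ler_pdivrMr //; lra.
have nd : n%:R^-1 < delta / 2.
  rewrite -(invf_div 2) ltf_pV2 ?posrE //; lra.
have [sl szN kN] := hd n n0.
set N := (n ^ 2 * N0)%N in m2N m2s s1m1 szN *.
have NE : N%:R = n%:R ^+ 2 * N0%:R :> R by rewrite natrM natrX.
have Nr : 0 < N%:R :> R by rewrite NE mulr_gt0 ?exprn_gt0.
split => //; split => //.
pose zz : C := ((c%:~R / n%:R) +i* y)%C.
have ZE : (c%:~R +i* (n%:R * y))%C = n%:R * zz.
  apply: complex_eq; rewrite ?cReM ?cImM Re_natr Im_natr /= mul0r ?subr0 ?addr0 //.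
  by rewrite mulrC divfK // gt_eqF.
have ImZ : complex.Im (c%:~R +i* (n%:R * y))%C != 0 :> R by rewrite /= gt_eqF //; lra.
rewrite sum_increments ?szN //.
have term m : (m1 <= m < m2)%N ->
   (v - eps) / (n%:R * N0%:R) - (Q + n%:R * y) / (s1 * N%:R) <=
   (mean (dilate n la) m.+1 (fun p => complex.Im (kerov p (c%:~R +i* (n%:R * y))%C))
     - complex.Im (c%:~R +i* (n%:R * y))%C) / m.+1%:R
   <= (v + eps) / (n%:R * N0%:R) + Q / (s1 * N%:R).
  move=> /andP[hm1 hm2]; pose s : R := m.+1%:R / N%:R.
  have mN : (m.+1 <= N)%N by apply: leq_trans hm2 m2N.
  have sle1 : s <= 1 by rewrite ler_pdivrMr // mul1r ler_nat.
  have ss1 : s1 <= s.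
    by rewrite ler_pdivlMr // (le_trans s1m1) // ler_nat.
  have ss2 : s < s0 + delta / 2.
    by rewrite ltr_pdivrMr // (le_lt_trans _ m2s) // ler_nat.
  have hs : `|s - s0| < delta.
    by clear -ss1 ss2 s1d d0; rewrite ltr_norml; apply/andP; split; lra.
  have hz : cmod (zz - x%:C%C) < delta.
    have -> : zz - x%:C%C = (c%:~R / n%:R - x)%:C%C + (0 +i* y)%C.
      by apply: complex_eq; rewrite /= ?addr0 ?add0r ?subr0 ?oppr0 ?addr0.
    apply: le_lt_trans (cmodD _ _) _; rewrite cmod_real.
    have -> : cmod (0 +i* y)%C = y by rewrite cmodE /= expr0n add0r sqrtr_sqr ger0_norm // ltW.
    clear -hc nd yd; lra.
  have [w [sp Imw dw ew hw]] := hdel s zz hs sle1 hz y0.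
  set kw := KC a0 b1 a1 b2 a2 w in ew hw.
  have kwk : cmod kw <= kap.
    have k := cmod_ge_sub kw (KC a0 b1 a1 b2 a2 u); rewrite /kap; clear -k hw; lra.
  have Imk : `|complex.Im kw - v| <= eps.
    by apply: le_trans hw; rewrite /v -cImN -cImD Im_le_cmod.
  have Imk0 : 0 <= complex.Im kw.
    rewrite Im_KC //; apply: mulr_ge0; first exact: ltW.
    by have k := spread_ge0 w hI; clear -k; lra.
  pose theta : C := (n%:R * N0%:R)^-1 * kw.
  have nn0 : n%:R != 0 :> C by rewrite pnatr_eq0 -lt0n.
  have NN0 : N0%:R != 0 :> C by rewrite pnatr_eq0 -lt0n.
  have cinv : cmod ((n%:R * N0%:R : C)^-1) = (n%:R * N0%:R)^-1 :> R.
    by rewrite cmodV cmodM !cmod_nat.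
  have Nth : N%:R * theta = n%:R * kw.
    by rewrite /theta natrM natrX; field; rewrite nn0 NN0.
  have jth (j : nat) : n%:R * zz + j%:R * theta = n%:R * (zz + (j%:R / N%:R)%:C%C * kw).
    rewrite rmorphM fmorphV !rmorph_nat /theta natrM natrX; field.
    by rewrite nn0 NN0.
  have ImjE (j : nat) : complex.Im (n%:R * zz + j%:R * theta) = n%:R * y + (j%:R / n%:R / N0%:R) * complex.Im kw.
    rewrite jth cImM Im_natr Re_natr mul0r addr0 cImD cImM /= mul0r addr0 NE.
    by field; rewrite ?nr0 ?N0r0.
  have [] : [/\ (size (boxes (dilate n la)))%:R <= A * (n%:R * y) ^+ 2,
     cmod theta * (n%:R * y) <= B,
    (forall j : nat, (m.+1 + j <= size (boxes (dilate n la)))%N ->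
     n%:R * y <= complex.Im (n%:R * zz + j%:R * theta) /\
     cmod (n%:R * zz + j%:R * theta) <= B * (n%:R * y)) &
     kerov (boxes (dilate n la)) (n%:R * zz + (size (boxes (dilate n la)) - m.+1)%:R * theta) =
     (size (boxes (dilate n la)))%:R * theta].
    split.
    - rewrite szN NE /A; have -> : N0%:R / y ^+ 2 * (n%:R * y) ^+ 2 = n%:R ^+ 2 * N0%:R.
        by clear -y0; field; rewrite gt_eqF.
      exact: lexx.
    - rewrite /theta cmodM cinv /B.
      have -> : (n%:R * N0%:R)^-1 * cmod kw * (n%:R * y) = cmod kw * y / N0%:R.
        by field; rewrite ?nr0 ?N0r0.
      rewrite -[leLHS]addr0 lerD //.
        by rewrite ler_pM2r ?invr_gt0 // ler_pM2r.
      by apply: divr_ge0; [have k := normr_ge0 x; clear -k d0 kap0; lra|exact: ltW].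
    - move=> j hj; rewrite szN in hj; split.
        by rewrite ImjE lerDl mulr_ge0 // !divr_ge0.
      rewrite jth cmodM cmod_nat [leRHS]mulrCA ler_pM2l //.
      apply: le_trans (cmodD _ _) _; rewrite cmodM cmod_real ger0_norm; last by rewrite divr_ge0.
      have h1 : cmod zz <= `|x| + delta.
        have k := cmod_ge_sub zz x%:C%C; rewrite cmod_real in k; clear -k hz; lra.
      have h2 : j%:R / N%:R <= 1 :> R.
        by rewrite ler_pdivrMr // mul1r ler_nat; apply: leq_trans hj; rewrite leq_addl.
      have h3 : j%:R / N%:R * cmod kw <= 1 * kap by rewrite ler_pM ?divr_ge0 ?cmod_ge0.
      have -> : B * y = kap * y / N0%:R * y + (`|x| + delta + kap) by rewrite /B; clear -y0 N0r; field; rewrite ?gt_eqF.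
      have h4 : 0 <= kap * y / N0%:R * y by rewrite !mulr_ge0 ?invr_ge0 // ltW.
      clear -h1 h3 h4; lra.
    - rewrite szN jth Nth.
      have -> : zz + ((N - m.+1)%:R / N%:R)%:C%C * kw = w.
        rewrite -ew natrB // mulrBl divff ?gt_eqF // -/s; ring.
      by apply: kN; rewrite gt_eqF.
  move=> e1 e2 e3 e4.
  have mNs : (m.+1 <= size (boxes (dilate n la)))%N by rewrite szN.
  have := kerov_mean_close sl mNs ny2 e1 e2 e3 e4.
  rewrite -ZE; set MM := mean _ _ _.
  have -> : m.+1%:R * complex.Im theta = m.+1%:R * (complex.Im kw / (n%:R * N0%:R)).
    congr (_ * _); rewrite /theta.
    have -> : (n%:R * N0%:R)^-1 = ((n%:R * N0%:R)^-1)%:C%C :> C.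
      by rewrite fmorphV rmorphM !rmorph_nat.
    by rewrite cImM /= mul0r addr0 mulrC.
  set t := complex.Im kw / _ => hsq.
  have mr : 0 < m.+1%:R :> R by rewrite ltr0n.
  have habs : `|MM - m.+1%:R * t| <= Q.
    rewrite -(ler_pXn2r (n := 2)) ?nnegrE // real_normK ?num_real //.
    apply: (le_trans hsq); rewrite /Q; clear -cc; nra.
  move: habs; rewrite ler_norml => /andP[l1 l2].
  move: Imk; rewrite ler_norml => /andP[l3 l4].
  have s1N : 0 < s1 * N%:R by rewrite mulr_gt0.
  have le3 : s1 * N%:R <= m.+1%:R by rewrite (le_trans s1m1) // ler_nat.
  have iv : (m.+1%:R)^-1 <= (s1 * N%:R)^-1 :> R by rewrite lef_pV2 ?posrE.
  have nN0 : 0 < n%:R * N0%:R :> R by rewrite mulr_gt0.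
  have t1 : (v - eps) / (n%:R * N0%:R) <= t.
    by rewrite ler_pM2r ?invr_gt0 //; clear -l3; lra.
  have t2 : t <= (v + eps) / (n%:R * N0%:R).
    by rewrite ler_pM2r ?invr_gt0 //; clear -l4; lra.
  have Y0 : 0 <= n%:R * y by clear -ny2; lra.
  rewrite /=; apply/andP; split.
    have k1 : (Q + n%:R * y) * (m.+1%:R)^-1 <= (Q + n%:R * y) * (s1 * N%:R)^-1.
      by rewrite ler_wpM2l //; clear -Q0 Y0; lra.
    have k2 : t - (Q + n%:R * y) / m.+1%:R <= (MM - n%:R * y) / m.+1%:R.
      rewrite ler_pdivlMr // mulrBl divfK ?gt_eqF //; clear -l1 l2 Y0; lra.
    by apply: le_trans k2; apply: lerB.
  have k1 : Q * (m.+1%:R)^-1 <= Q * (s1 * N%:R)^-1 by rewrite ler_wpM2l.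
  have k2 : (MM - n%:R * y) / m.+1%:R <= t + Q / m.+1%:R.
    rewrite ler_pdivrMr // mulrDl divfK ?gt_eqF //; clear -l1 l2 Y0; lra.
  by apply: (le_trans k2); apply: lerD.
have cst (a : R) : (m2 - m1)%:R * a = \sum_(m1 <= m < m2) a.
  by rewrite sumr_const_nat mulr_natl.
rewrite !cst; apply/andP; split; rewrite big_nat [leRHS]big_nat; apply: ler_sum => m hm.
  by case/andP: (term m hm).
by case/andP: (term m hm).
Qed.

End Density.

Section DensityBounds.
Context {R : realType}.
Local Notation C := R[i].
Implicit Types (la : seq nat).

Definition level la (n : nat) (s : R) : nat := Num.truncn (s * (n ^ 2 * size (boxes la))%:R).

Definition scaled_height la (x : R) (n : nat) (s : R) : R :=
  mean_cnt (dilate n la) (level la n s) (Num.floor (x * n%:R)) / n%:R.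

Lemma level_bounds la n s : 0 <= s ->
  (level la n s)%:R <= s * (n ^ 2 * size (boxes la))%:R < (level la n s).+1%:R.
Proof. by move=> s0; apply: truncn_itv; rewrite mulr_ge0. Qed.

Lemma level_le la n s1 s2 : 0 <= s1 -> s1 <= s2 -> (level la n s1 <= level la n s2)%N.
Proof.
move=> h1 h12; rewrite -ltnS -(ltr_nat R).
have /andP[a1 _] := level_bounds la n h1.
have /andP[_ a2] := level_bounds la n (le_trans h1 h12).
apply: le_lt_trans a1 _; apply: le_lt_trans a2; by rewrite ler_wpM2r.
Qed.

Lemma level_le_size la n s : 0 <= s -> s <= 1 -> (level la n s <= n ^ 2 * size (boxes la))%N.
Proof.
move=> h0 h1; rewrite -(ler_nat R); have /andP[a1 _] := level_bounds la n h0.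
by apply: le_trans a1 _; rewrite ler_piMl.
Qed.

Lemma floor_close (x : R) (n : nat) : (0 < n)%N ->
  `|(Num.floor (x * n%:R))%:~R / n%:R - x| <= n%:R^-1.
Proof.
move=> n0; have nr : 0 < n%:R :> R by rewrite ltr0n.
have /andP[h1 h2] := floor_itv (x * n%:R).
have -> : (Num.floor (x * n%:R))%:~R / n%:R - x =
   ((Num.floor (x * n%:R))%:~R - x * n%:R) / n%:R by field; rewrite gt_eqF.
rewrite normrM [`|n%:R^-1|]gtr0_norm ?invr_gt0 // -[leRHS]mul1r ler_pM2r ?invr_gt0 //.
rewrite rmorphD /= in h2; rewrite ler_norml; apply/andP; split; lra.
Qed.

Lemma Im_KC_good_ge0 a0 b1 a1 b2 a2 (x s0 : R) (u : C) : interlaced a0 b1 a1 b2 a2 ->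
  good_root a0 b1 a1 b2 a2 x s0 u -> 0 <= complex.Im (KC a0 b1 a1 b2 a2 u).
Proof.
move=> hI [_ hd hc]; rewrite Im_KC // mulr_ge0 //.
  by case: hc => [/ltW//|[-> _]].
by have := spread_ge0 u hI; lra.
Qed.

(** The factor 2 and the loss 2 Y = 2 n y come from [poisson_transfer]; the height y of z above the
    real line is at most h / 8, so the loss takes only a quarter of h n, and large n makes the other
    errors small. *)
Lemma density_upper la a0 b1 a1 b2 a2 (x s0 : R) (u : C) :
  dilation_data la a0 b1 a1 b2 a2 -> 0 < s0 -> s0 <= 1 ->
  good_root a0 b1 a1 b2 a2 x s0 u -> forall eps, 0 < eps ->
  exists2 delta, 0 < delta & forall s1 s2, s0 - delta < s1 -> 0 < s1 -> s1 <= s2 ->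
    s2 < s0 + delta -> s2 <= 1 ->
  forall h, 0 < h -> exists n0 : nat, forall n, (n0 <= n)%N ->
    scaled_height la x n s2 - scaled_height la x n s1 <=
    2 * (complex.Im (KC a0 b1 a1 b2 a2 u) + eps) * (s2 - s1) + h.
Proof.
move=> hd s00 s01 gr eps eps0.
have [hI N00 hdil] := hd.
have v0 := Im_KC_good_ge0 hI gr.
have [delta d0 hdel] := density_sum_bounds hd s00 s01 gr eps0.
set v := complex.Im _ in v0 hdel *; set N0 := size (boxes la) in hdel N00.
exists delta => // s1 s2 s1d s10 s12 s2d s21 h h0.
have N0r : 0 < N0%:R :> R by rewrite ltr0n.
pose y := Num.min (delta / 2) (h / 8).
have y0 : 0 < y by rewrite lt_min !divr_gt0.
have yd : y < delta.
  have : y <= delta / 2 by rewrite ge_min lexx.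
  lra.
have yh : y <= h / 8 by rewrite ge_min lexx orbT.
have [Q [Q0 [n0 hn0]]] := hdel s1 y s10 s1d y0 yd.
pose T := v + eps; pose q := Q / s1.
have T0 : 0 < T by rewrite /T; lra.
have q0 : 0 <= q by rewrite divr_ge0 // ltW.
exists (maxn n0 (Num.truncn (4 * (2 * q + T) / h)).+1) => n; rewrite geq_max => /andP[hn hn1].
have nlt : 4 * (2 * q + T) / h < n%:R.
  have h1 : 0 <= 4 * (2 * q + T) / h by apply: divr_ge0; clear -q0 T0 h0; lra.
  have /andP[_ h2] := truncn_itv h1; by apply: lt_le_trans h2 _; rewrite ler_nat.
rewrite ltr_pdivrMr // in nlt.
pose m1 := level la n s1; pose m2 := level la n s2; pose c := Num.floor (x * n%:R).
have s2p : 0 <= s2 by lra.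
have /andP[i1 i2] := level_bounds la n (ltW s10).
have /andP[i3 i4] := level_bounds la n s2p.
rewrite -/N0 -/m1 in i1 i2; rewrite -/N0 -/m2 in i3 i4.
set N : R := (n ^ 2 * N0)%:R in i1 i2 i3 i4.
have m12 : (m1 <= m2)%N by apply: level_le => //; apply: ltW.
have m2N : (m2 <= n ^ 2 * N0)%N by apply: level_le_size.
have n0' : (0 < n)%N by apply: leq_trans hn1.
have nr : 0 < n%:R :> R by rewrite ltr0n.
have n1 : 1 <= n%:R :> R by rewrite ler1n.
have NE : N = n%:R ^+ 2 * N0%:R by rewrite /N natrM natrX.
have N1 : 0 < N by rewrite NE mulr_gt0 ?exprn_gt0.
have nN : n%:R <= N.
  have N01 : 1 <= N0%:R :> R by rewrite ler1n.
  rewrite NE; clear -n1 N01; nra.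
have ms2 : m2%:R < (s0 + delta) * N by apply: le_lt_trans i3 _; rewrite ltr_pM2r.
have [_ [Y2 /andP[_ hS]]] := hn0 n hn c m1 m2 (floor_close x n0') m12 m2N ms2 (ltW i2).
have [sl szN _] := hdil n n0'.
have m2N' : (m2 <= size (boxes (dilate n la)))%N by rewrite szN.
have [tr _] := poisson_transfer sl m12 m2N'
  (erefl : complex.Re (c%:~R +i* (n%:R * y))%C = c%:~R) Y2.
rewrite /= -/(mean_poisson _ _ _) in tr.
set S := mean_poisson _ _ _ - _ in hS tr.
set d := mean_cnt _ m2 c - _ in tr.
have dE : scaled_height la x n s2 - scaled_height la x n s1 = d / n%:R.
  by rewrite /scaled_height -mulrBl.
rewrite dE ler_pdivrMr //.
have mm : (m2 - m1)%:R <= (s2 - s1) * N + 1.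
  rewrite natrB //; rewrite -natr1 in i2; clear -i2 i3; lra.
have kpos : 0 <= (v + eps) / (n%:R * N0%:R) + Q / (s1 * N).
  by rewrite addr_ge0 ?divr_ge0 ?mulr_ge0 // ltW.
have hS2 : S <= ((s2 - s1) * N + 1) * ((v + eps) / (n%:R * N0%:R) + Q / (s1 * N)).
  by apply: (le_trans hS); rewrite ler_wpM2r.
have e1 : ((s2 - s1) * N + 1) * ((v + eps) / (n%:R * N0%:R) + Q / (s1 * N)) =
  ((s2 - s1) + N^-1) * (n%:R * T + q).
  have x1 := lt0r_neq0 nr; have x2 := lt0r_neq0 N0r; have x3 := lt0r_neq0 s10.
  by rewrite NE /T /q; field; rewrite x1 x2 x3.
rewrite e1 in hS2.
have Ninv : 0 <= N^-1 <= n%:R^-1 by rewrite invr_ge0 ltW //= lef_pV2 ?posrE.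
have e2 : ((s2 - s1) + N^-1) * (n%:R * T + q) <= ((s2 - s1) + n%:R^-1) * (n%:R * T + q).
  have pos : 0 <= n%:R * T + q := addr_ge0 (mulr_ge0 (ltW nr) (ltW T0)) q0.
  by case/andP: Ninv => _ k; rewrite ler_wpM2r // lerD2l.
have e3 : ((s2 - s1) + n%:R^-1) * (n%:R * T + q) = (s2 - s1) * T * n%:R + (s2 - s1) * q + T + n%:R^-1 * q.
  by field; rewrite gt_eqF.
have e4 : n%:R^-1 * q <= q by rewrite ler_piMl // invf_le1.
have e5 : (s2 - s1) * q <= q by rewrite ler_piMl //; clear -s21 s10; lra.
have e6 : n%:R * y <= n%:R * (h / 8) by rewrite ler_pM2l.
rewrite -/T; rewrite e3 in e2.
have e7 : n%:R * (h / 8) = h * n%:R / 8 by ring.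
rewrite e7 in e6; rewrite [n%:R * h]mulrC in nlt.
have -> : (2 * T * (s2 - s1) + h) * n%:R = 2 * ((s2 - s1) * T * n%:R) + h * n%:R by ring.
move: tr hS2 e2 e4 e5 e6 nlt; clearbody S d T q y.
move: ((s2 - s1 + N^-1) * (n%:R * T + q)) ((s2 - s1) * T * n%:R) (h * n%:R) => X1 X2 X3.
move: (n%:R^-1 * q) ((s2 - s1) * q) (n%:R * y) => X4 X5 X6.
clear -T0 q0; lra.
Qed.

(** With y = rho^3 and a cut J of order rho n, the losses 16 J and Y N / J^2 in [poisson_transfer]
    and the subtracted imaginary part of z are all of order rho n; [G] collects their constants. *)
Lemma density_lower la a0 b1 a1 b2 a2 (x s0 : R) (u : C) :
  dilation_data la a0 b1 a1 b2 a2 -> 0 < s0 -> s0 <= 1 ->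
  good_root a0 b1 a1 b2 a2 x s0 u -> forall eps, 0 < eps ->
  eps <= complex.Im (KC a0 b1 a1 b2 a2 u) ->
  exists2 delta, 0 < delta & forall s1 s2, s0 - delta < s1 -> 0 < s1 -> s1 <= s2 ->
    s2 < s0 + delta -> s2 <= 1 ->
  forall h, 0 < h -> exists n0 : nat, forall n, (n0 <= n)%N ->
    (complex.Im (KC a0 b1 a1 b2 a2 u) - eps) * (s2 - s1) / 9 - h <=
    scaled_height la x n s2 - scaled_height la x n s1.
Proof.
move=> hd s00 s01 gr eps eps0.
have [hI N00 hdil] := hd.
have [delta d0 hdel] := density_sum_bounds hd s00 s01 gr eps0.
set v := complex.Im _ in hdel * => epsv; set N0 := size (boxes la) in hdel N00.
exists delta => // s1 s2 s1d s10 s12 s2d s21 h h0.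
have N0r : 0 < N0%:R :> R by rewrite ltr0n.
have s1i : 0 < s1^-1 by rewrite invr_gt0.
pose G := s1^-1 + 16 + N0%:R.
have G0 : 0 < G by rewrite /G; lra.
pose rho := Num.min 1 (Num.min (delta / 2) (h / G)).
have rho0 : 0 < rho by rewrite !lt_min ltr01 !divr_gt0.
have rho1 : rho <= 1 by rewrite ge_min lexx.
have rhod : rho <= delta / 2 by rewrite !ge_min lexx orbT.
have rhoh : rho * G <= h by rewrite -ler_pdivlMr // !ge_min lexx !orbT.
pose y := rho ^+ 3.
have y0 : 0 < y by rewrite exprn_gt0.
have yrho : y <= rho.
  have : rho ^+ 2 <= 1 by nra.
  rewrite /y exprS; nra.
have yd : y < delta by lra.
have [Q [Q0 [n0 hn0]]] := hdel s1 y s10 s1d y0 yd.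
pose q := Q / s1.
have q0 : 0 <= q by rewrite divr_ge0 // ltW.
have v0 : 0 < v by lra.
exists (maxn n0 (Num.truncn ((v + q + 16) / h)).+1) => n; rewrite geq_max => /andP[hn hn1].
have nlt : (v + q + 16) / h < n%:R.
  have h1 : 0 <= (v + q + 16) / h by apply: divr_ge0; clear -v0 q0 h0; lra.
  have /andP[_ h2] := truncn_itv h1; by apply: lt_le_trans h2 _; rewrite ler_nat.
rewrite ltr_pdivrMr // in nlt.
pose m1 := level la n s1; pose m2 := level la n s2; pose c := Num.floor (x * n%:R).
have s2p : 0 <= s2 by lra.
have /andP[i1 i2] := level_bounds la n (ltW s10).
have /andP[i3 i4] := level_bounds la n s2p.
rewrite -/N0 -/m1 in i1 i2; rewrite -/N0 -/m2 in i3 i4.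
set N : R := (n ^ 2 * N0)%:R in i1 i2 i3 i4.
have m12 : (m1 <= m2)%N by apply: level_le => //; apply: ltW.
have m2N : (m2 <= n ^ 2 * N0)%N by apply: level_le_size.
have n0' : (0 < n)%N by apply: leq_trans hn1.
have nr : 0 < n%:R :> R by rewrite ltr0n.
have n1 : 1 <= n%:R :> R by rewrite ler1n.
have NE : N = n%:R ^+ 2 * N0%:R by rewrite /N natrM natrX.
have N1 : 0 < N by rewrite NE mulr_gt0 ?exprn_gt0.
have nN : n%:R <= N.
  have N01 : 1 <= N0%:R :> R by rewrite ler1n.
  rewrite NE; clear -n1 N01; nra.
have ms2 : m2%:R < (s0 + delta) * N by apply: le_lt_trans i3 _; rewrite ltr_pM2r.
have [_ [Y2 /andP[hS _]]] := hn0 n hn c m1 m2 (floor_close x n0') m12 m2N ms2 (ltW i2).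
have [sl szN _] := hdil n n0'.
have m2N' : (m2 <= size (boxes (dilate n la)))%N by rewrite szN.
have [_ tr] := poisson_transfer sl m12 m2N'
  (erefl : complex.Re (c%:~R +i* (n%:R * y))%C = c%:~R) Y2.
pose J := (Num.truncn (rho * n%:R)).+1.
have {}tr := tr J (ltn0Sn _).
rewrite /= -/(mean_poisson _ _ _) in tr.
set S := mean_poisson _ _ _ - _ in hS tr.
set d := mean_cnt _ m2 c - _ in tr.
have dE : scaled_height la x n s2 - scaled_height la x n s1 = d / n%:R.
  by rewrite /scaled_height -mulrBl.
rewrite dE ler_pdivlMr //.
have mlo : (s2 - s1) * N - 1 <= (m2 - m1)%:R.
  rewrite natrB //; rewrite -natr1 in i4; clear -i1 i4; lra.
have mhi : (m2 - m1)%:R <= N by rewrite /N ler_nat; apply: leq_trans (leq_subr _ _) m2N.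
have m0 : 0 <= (m2 - m1)%:R :> R by [].
have nN0 : (0 : R) < n%:R * N0%:R by rewrite mulr_gt0.
have s1N : 0 < s1 * N by rewrite mulr_gt0.
have f1 : ((s2 - s1) * N - 1) * ((v - eps) / (n%:R * N0%:R)) <=
    (m2 - m1)%:R * ((v - eps) / (n%:R * N0%:R)).
  by rewrite ler_wpM2r // divr_ge0 ?subr_ge0 // ltW.
have f2 : (m2 - m1)%:R * ((Q + n%:R * y) / (s1 * N)) <= N * ((Q + n%:R * y) / (s1 * N)).
  by rewrite ler_wpM2r // divr_ge0 ?(ltW s1N) // addr_ge0 // mulr_ge0 // ltW.
have g1 : ((s2 - s1) * N - 1) * ((v - eps) / (n%:R * N0%:R)) =
   (s2 - s1) * (v - eps) * n%:R - (v - eps) / (n%:R * N0%:R).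
  have x1 := lt0r_neq0 nr; have x2 := lt0r_neq0 N0r.
  by rewrite NE; field; rewrite x1 x2.
have g2 : N * ((Q + n%:R * y) / (s1 * N)) = q + n%:R * y / s1.
  have x1 := lt0r_neq0 N1; have x3 := lt0r_neq0 s10.
  by rewrite /q; move: (N) x1 => N' x1; field; rewrite x1 x3.
have g3 : (v - eps) / (n%:R * N0%:R) <= v.
  have N01 : 1 <= N0%:R :> R by rewrite ler1n.
  have k : 1 <= n%:R * N0%:R :> R by apply: mulr_ege1.
  have k2 : v * 1 <= v * (n%:R * N0%:R) by apply: ler_wpM2l; [exact: ltW|].
  rewrite ler_pdivrMr //; clear -eps0 k2; lra.
have hSlo : (s2 - s1) * (v - eps) * n%:R - v - q - n%:R * y / s1 <= S.
  apply: le_trans hS; rewrite mulrBr; clear -f1 f2 g1 g2 g3; lra.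
have /andP[j1 j2] := truncn_itv (mulr_ge0 (ltW rho0) (ltW nr)).
have jJ : J%:R <= rho * n%:R + 1 by rewrite -natr1; clear -j1; lra.
have j0 : 0 < J%:R :> R by rewrite ltr0n.
have rn0 : 0 < rho * n%:R by rewrite mulr_gt0.
have hJ : n%:R * y * (m2 - m1)%:R / J%:R ^+ 2 <= n%:R * (rho * N0%:R).
  apply: (@le_trans _ _ (n%:R * y * N / (rho * n%:R) ^+ 2)); last first.
    have x1 := lt0r_neq0 nr; have x3 := lt0r_neq0 rho0.
    have -> : n%:R * y * N / (rho * n%:R) ^+ 2 = n%:R * (rho * N0%:R).
      by rewrite NE /y; field; rewrite x1 x3.
    exact: lexx.
  apply: ler_pM.
  - by rewrite !mulr_ge0 // ltW.
  - by rewrite invr_ge0 exprn_ge0 // ltW.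
  - by rewrite ler_wpM2l // mulr_ge0 // ltW.
  - by rewrite lef_pV2 ?posrE ?exprn_gt0 // ler_pXn2r ?nnegrE ?(ltW rn0) ?(ltW j0) // ltW.
have yy : n%:R * y / s1 <= n%:R * (rho * s1^-1).
  by rewrite -mulrA ler_pM2l // ler_pM2r.
have rr : n%:R * (rho * G) <= n%:R * h by rewrite ler_pM2l.
have rE : n%:R * (rho * G) = n%:R * (rho * s1^-1) + 16 * (rho * n%:R) + n%:R * (rho * N0%:R).
  by rewrite /G; ring.
have -> : ((v - eps) * (s2 - s1) / 9 - h) * n%:R = (s2 - s1) * (v - eps) * n%:R / 9 - n%:R * h by ring.
rewrite rE in rr.
move: hSlo tr hJ yy rr nlt jJ.
move: ((s2 - s1) * (v - eps) * n%:R) (n%:R * y / s1) (n%:R * y * (m2 - m1)%:R / J%:R ^+ 2) => X1 X2 X3.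
move: (n%:R * (rho * s1^-1)) (n%:R * (rho * N0%:R)) (rho * n%:R) (n%:R * h) (J%:R : R) => X4 X5 X6 X7 X8.
clear -v0 q0; lra.
Qed.

End DensityBounds.

(** * The limiting profile *)

Section LimitHeight.
Context {R : realType}.
Implicit Types (la : seq nat) (H : R -> R -> R).

(** [H] in the coordinates of the integer diagram, where the n-fold dilation is rescaled by n and
    [eta] disappears. *)
Definition unscaled H la (x t : R) : R := H (eta la * x) t / eta la.

Lemma filter_le_take (v : seq (int * int)) (f : int * int -> R) (t : R) :
  pairwise <%R [seq f b | b <- v] ->
  [seq b <- v | f b <= t] = take (count (fun b => f b <= t) v) v.
Proof.
elim: v => //= b v IH /andP[/allP hb hv].
case: ifP => bt; first by rewrite /= IH.
suff h0 : count (fun b => f b <= t) v = 0%N.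
  by rewrite h0 /=; apply/eqP; rewrite -size_eq0 size_filter h0.
apply/eqP; rewrite -leqn0 leqNgt -has_count; apply/hasPn => b' b'v.
rewrite -ltNge; apply: lt_trans (hb (f b') _); last exact: map_f.
by rewrite ltNge bt.
Qed.

Lemma height_cell la s t Q (y : filling la) c : s \in linear_exts la ->
  cell (boxes la) s (BRight (1 : R)) t Q y ->
  height y c t = cnt c (take (count_le t [seq ev (boxes la) y b | b <- s]) s).
Proof.
move=> hs /andP[/andP[h1 _] _].
have ps : perm_eq s (boxes la) by move: hs; rewrite mem_filter mem_permutations => /andP[].
rewrite /height -(permP ps) /cnt /count_le count_map -(filter_le_take _ h1).
by rewrite count_filter; apply: eq_count => b /=.
Qed.

Lemma cnt_le_sqrt la s m c : sorted geq la -> s \in linear_exts la ->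
  (cnt c (take m s))%:R <= 2 * Num.sqrt (size (boxes la))%:R :> R.
Proof.
move=> sl hs; have h := cnt_sqr_le m c sl hs.
have h2 : (size (take m s) <= size (boxes la))%N.
  by rewrite -(size_linear_ext hs) size_take_min geq_minr.
have h3 : (cnt c (take m s) ^ 2 <= 4 * size (boxes la))%N .
  by apply: leq_trans h _; apply: leq_mul.
rewrite -(ler_pXn2r (n := 2)) ?nnegrE ?mulr_ge0 ?sqrtr_ge0 //.
by rewrite exprMn sqr_sqrtr // -[2 ^+ 2]natrX -[leLHS]natrX -natrM ler_nat.
Qed.

Lemma mean_cnt_le_sqrt la m c : sorted geq la ->
  mean_cnt la m c <= 2 * Num.sqrt (size (boxes la))%:R :> R.
Proof.
move=> sl; rewrite -(mean_cst m (2 * _) sl); apply: mean_le => s hs.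
exact: cnt_le_sqrt.
Qed.

Lemma sum_affine (I : Type) (r : seq I) (a b : R) (F : I -> R) :
  \sum_(i <- r) (a + b * F i) = a * (size r)%:R + b * \sum_(i <- r) F i.
Proof.
by rewrite big_split /= mulr_sumr big_const_seq count_predT iter_addr_0 mulr_natr.
Qed.

Lemma bin_sum n (t : R) (I : Type) (r : seq I) (F : I -> nat -> R) :
  bin n t (fun m => \sum_(i <- r) F i m) = \sum_(i <- r) bin n t (F i).
Proof.
elim: r => [|i r IH].
  by rewrite big_nil -[RHS](bin_cst n t 0); apply: eq_bin => m _; rewrite big_nil.
rewrite big_cons -IH -binD; apply: eq_bin => m _; by rewrite big_cons.
Qed.

(** Rescaled heights are at most 2, so a deviation never exceeds K = 2 + |h|. Hence convergence in
    probability gives convergence of means: the bad pairs of an extension and a number m have total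
    weight at most the probability in [is_limiting_height], which is below e1 / K. *)
Lemma bin_close la H (a0 am x t : R) : (0 < size (boxes la))%N ->
  (forall n, (0 < n)%N -> sorted geq (dilate n la) /\
     size (boxes (dilate n la)) = (n ^ 2 * size (boxes la))%N) ->
  is_limiting_height la a0 am H -> a0 <= x <= am -> 0 <= t <= 1 ->
  forall eps, 0 < eps -> exists n0 : nat, forall n, (n0 <= n)%N -> (0 < n)%N /\
   `|bin (n ^ 2 * size (boxes la)) t
       (fun m => mean_cnt (dilate n la) m (Num.floor (x * n%:R))) / n%:R - unscaled H la x t| <= eps.
Proof.
move=> N00 hdil hlim hx ht eps eps0; set N0 := size (boxes la) in N00 hdil *.
set rt : R := Num.sqrt N0%:R.
have rt0 : 0 < rt by rewrite sqrtr_gt0 ltr0n.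
have etaE : eta la = rt^-1 by [].
have eta0 : 0 < eta la :> R by rewrite etaE invr_gt0.
pose xx := eta la * x; pose h := H xx t.
have hU : unscaled H la x t = h * rt by rewrite /unscaled etaE invrK.
pose K := 2 + `|h|.
have K0 : 0 < K by rewrite /K; have := normr_ge0 h; lra.
pose e1 := eps / (2 * rt).
have e10 : 0 < e1 by rewrite divr_gt0 // mulr_gt0.
have := hlim e1 e10 => /cvgrPdist_lt /(_ (e1 / K) (divr_gt0 e10 K0)) [n0 _ hn0].
exists (maxn n0 1) => n; rewrite geq_max => /andP[hn n1]; split => //.
have nr : 0 < n%:R :> R by rewrite ltr0n.
have [sl szN] := hdil n n1.
set N := (n ^ 2 * N0)%N in szN *; set c := Num.floor _.
have sqE : Num.sqrt N%:R = n%:R * rt :> R.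
  by rewrite natrM natrX sqrtrM ?sqr_ge0 // sqrtr_sqr gtr0_norm.
have xE : xx * (n%:R * rt) = x * n%:R.
  by rewrite /xx etaE; field; rewrite gt_eqF.
have := hn0 n hn; rewrite /= sub0r normrN => hprob.
set A := (X in uniform_tableau_prob X) in hprob.
pose Phi (s : seq (int * int)) (m : nat) : bool := e1 < `|(cnt c (take m s))%:R / (n%:R * rt) - h|.
have hA : forall s (y : filling (dilate n la)), s \in linear_exts (dilate n la) ->
   cell (boxes (dilate n la)) s (BRight (1 : R)) t (Phi s) y -> A y.
  move=> s y hs hc; exists xx, t; split => //.
    by case/andP: hx => ? ?; rewrite /xx !ler_pM2l //; apply/andP.
  rewrite -/N sqE xE (height_cell _ hs hc).
  by case/andP: hc.
have := tableau_prob_ge sl ht hA; rewrite szN => hP.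
set P := _ / _ in hP.
have hP2 : K * P <= e1.
  rewrite mulrC -ler_pdivlMr //; apply: le_trans hP _; apply: le_trans (ltW hprob).
  exact: ler_norm.
have f0 : 0 < (num_ext (dilate n la))%:R :> R by rewrite ltr0n num_ext_gt0.
have sq0 : 0 < n%:R * rt by rewrite mulr_gt0.
have key : `|bin N t (fun m => mean_cnt (dilate n la) m c) / (n%:R * rt) - h| <= e1 + K * P.
  have E1 : bin N t (fun m => mean_cnt (dilate n la) m c) / (n%:R * rt) - h =
    (\sum_(s <- linear_exts (dilate n la))
      bin N t (fun m => (cnt c (take m s))%:R / (n%:R * rt) - h)) / (num_ext (dilate n la))%:R.
    rewrite -bin_sum.
    have -> : (fun m => \sum_(s <- linear_exts (dilate n la)) ((cnt c (take m s))%:R / (n%:R * rt) - h)) =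
      (fun m => (num_ext (dilate n la))%:R * ((n%:R * rt)^-1 * mean_cnt (dilate n la) m c + - h)).
      apply/funext => m; rewrite sumrB -mulr_suml big_const_seq count_predT iter_addr_0.
      rewrite -/(num_ext _) -[h *+ _]mulr_natl /mean_cnt /mean.
      by field; rewrite !gt_eqF.
    by rewrite binZ binD binZ bin_cst; field; rewrite !gt_eqF.
  rewrite E1 normrM [`|_^-1|]gtr0_norm ?invr_gt0 // ler_pdivrMr //.
  apply: le_trans (ler_norm_sum _ _ _) _.
  have -> : (e1 + K * P) * (num_ext (dilate n la))%:R =
     \sum_(s <- linear_exts (dilate n la)) (e1 + K * bin N t (fun m => (Phi s m)%:R)).
    rewrite sum_affine -/(num_ext _) /P; move: (\sum_(_ <- _) _) (e1) => S1 e2.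
    by field; rewrite gt_eqF.
  rewrite big_seq [leRHS]big_seq; apply: ler_sum => s hs.
  have b1 : bin N t (fun m => e1 + K * (Phi s m)%:R) = e1 + K * bin N t (fun m => (Phi s m)%:R).
    by rewrite binD bin_cst binZ.
  have pt m : - (e1 + K * (Phi s m)%:R) <= (cnt c (take m s))%:R / (n%:R * rt) - h <= e1 + K * (Phi s m)%:R.
    rewrite -ler_norml; rewrite /Phi; case: ltP => hh; last by rewrite mulr0 addr0.
    rewrite mulr1; apply: (@le_trans _ _ K); last by rewrite lerDr ltW.
    apply: le_trans (ler_normB _ _) _; rewrite lerD2r ger0_norm ?divr_ge0 ?(ltW sq0) //.
    by rewrite ler_pdivrMr // -sqE -szN cnt_le_sqrt.
  rewrite -b1 ler_norml; apply/andP; split.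
    rewrite -mulN1r -binZ; apply: bin_le => // m _.
    by rewrite mulN1r; case/andP: (pt m).
  by apply: bin_le => // m _; case/andP: (pt m).
rewrite hU.
have -> : bin N t (fun m => mean_cnt (dilate n la) m c) / n%:R - h * rt =
  (bin N t (fun m => mean_cnt (dilate n la) m c) / (n%:R * rt) - h) * rt.
  by field; rewrite !gt_eqF.
rewrite normrM (gtr0_norm rt0).
have : `|bin N t (fun m => mean_cnt (dilate n la) m c) / (n%:R * rt) - h| <= 2 * e1 by lra.
have -> : eps = 2 * e1 * rt by rewrite /e1; field; rewrite gt_eqF.
by move=> ?; rewrite ler_pM2r.
Qed.

Lemma nat_eventually (a : R) : exists n0 : nat, forall n, (n0 <= n)%N -> a < n%:R.
Proof.
exists (Num.truncn `|a|).+1 => n hn; apply: le_lt_trans (ler_norm a) _.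
have /andP[_ h] := truncn_itv (normr_ge0 a); apply: lt_le_trans h _; by rewrite ler_nat.
Qed.

(** Chebyshev's inequality: up to the level of s the height is monotone in m, and beyond it the
    bound 2 sqrt N is dominated by [W] times the squared deviation from N t, whose binomial mean is
    small. For s = 1 the level is the full diagram and monotonicity suffices; this case admits t =
    1. *)
Lemma squeeze_upper la H (a0 am x t s : R) : (0 < size (boxes la))%N ->
  (forall n, (0 < n)%N -> sorted geq (dilate n la) /\
     size (boxes (dilate n la)) = (n ^ 2 * size (boxes la))%N) ->
  is_limiting_height la a0 am H -> a0 <= x <= am -> 0 <= t <= 1 -> s <= 1 ->
  t < s \/ s = 1 ->
  forall h, 0 < h -> exists n0 : nat, forall n, (n0 <= n)%N ->
    unscaled H la x t <= scaled_height la x n s + h.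
Proof.
move=> N00 hdil hlim hx ht s1 hts h h0.
have [n1 hn1] := bin_close N00 hdil hlim hx ht (divr_gt0 h0 (ltr0n R 2)).
set N0 := size (boxes la) in N00 hdil hn1; set rt : R := Num.sqrt N0%:R.
have rt0 : 0 <= rt by apply: sqrtr_ge0.
case/andP: (ht) => t0 t1.
have s0 : 0 <= s by case: hts => hts; lra.
have [ts|ets] : t < s \/ s = 1 := hts; last first.
  exists n1 => n hn; have [n0 hb] := hn1 n hn.
  have [sl szN] := hdil n n0.
  rewrite /scaled_height.
  have -> : level la n s = (n ^ 2 * N0)%N.
    by rewrite /level ets mul1r natrK.
  set c := Num.floor _; have nr : 0 < n%:R :> R by rewrite ltr0n.
  have : bin (n ^ 2 * N0) t (fun m => mean_cnt (dilate n la) m c) / n%:R <=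
     mean_cnt (dilate n la) (n ^ 2 * N0) c / n%:R.
    rewrite ler_pM2r ?invr_gt0 // -[leRHS](bin_cst (n ^ 2 * N0) t).
    by apply: bin_le => // m hm; apply: mean_cnt_le.
  move: hb; rewrite -/c ler_norml => /andP[b1 b2]; lra.
have d0 : 0 < s - t by lra.
have [n2 hn2] := nat_eventually (4 * rt / (s - t) ^+ 2 / h).
exists (maxn n1 n2) => n; rewrite geq_max => /andP[hn hn'].
have [n0 hb] := hn1 n hn; have [sl szN] := hdil n n0.
have nr : 0 < n%:R :> R by rewrite ltr0n.
have n1r : 1 <= n%:R :> R by rewrite ler1n.
set c := Num.floor _ in hb.
have hnh := hn2 n hn'.
set N := (n ^ 2 * N0)%N in szN hb.
have NE : N%:R = n%:R ^+ 2 * N0%:R :> R by rewrite natrM natrX.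
have N01 : 1 <= N0%:R :> R by rewrite ler1n.
have N0' : 0 < N%:R :> R by rewrite NE mulr_gt0 ?exprn_gt0 //; lra.
have sqE : Num.sqrt N%:R = n%:R * rt :> R.
  by rewrite natrM natrX sqrtrM ?sqr_ge0 // sqrtr_sqr gtr0_norm.
rewrite /scaled_height -/c; set m0 := level la n s.
have /andP[l1 l2] := level_bounds la n s0; rewrite -/N0 -/m0 -/N in l1 l2.
pose W := 2 * (n%:R * rt) / ((s - t) * N%:R) ^+ 2.
have W0 : 0 <= W by rewrite divr_ge0 ?sqr_ge0 ?mulr_ge0 // ltW.
have key : bin N t (fun m => mean_cnt (dilate n la) m c) <=
   mean_cnt (dilate n la) m0 c + W * N%:R.
  apply: (@le_trans _ _ (bin N t (fun m => mean_cnt (dilate n la) m0 c + W * (m%:R - N%:R * t) ^+ 2))).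
    apply: bin_le => // m hm; have [mm0|mm0] := leqP m m0.
      rewrite -[leLHS]addr0 lerD ?mean_cnt_le // mulr_ge0 ?sqr_ge0 //.
    rewrite -[leLHS]add0r lerD ?mean_cnt_ge0 //.
    apply: le_trans (mean_cnt_le_sqrt _ _ sl) _; rewrite szN sqE.
    have -> : W * (m%:R - N%:R * t) ^+ 2 = 2 * (n%:R * rt) * ((m%:R - N%:R * t) ^+ 2 / ((s - t) * N%:R) ^+ 2).
      by rewrite /W; ring.
    rewrite ler_peMr ?mulr_ge0 ?(ltW nr) //.
    have mlo : s * N%:R < m%:R by apply: lt_le_trans l2 _; rewrite ler_nat.
    have q0 : 0 < (s - t) * N%:R by rewrite mulr_gt0.
    by rewrite ler_pdivlMr ?exprn_gt0 // mul1r ler_pXn2r ?nnegrE //; lra.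
  rewrite binD bin_cst binZ bin_variance subrr expr0n addr0 lerD2l ler_wpM2l //.
  have : t * (1 - t) <= 1 by nra.
  rewrite -mulrA => h1; rewrite -[leRHS]mulr1 ler_wpM2l //.
have WN : W * N%:R / n%:R <= h / 2.
  have -> : W * N%:R / n%:R = (2 * rt / (s - t) ^+ 2) / N%:R.
    rewrite /W; move: (N%:R : R) N0' => NN NN0; field.
    by apply/and3P; split; rewrite gt_eqF.
  rewrite ler_pdivrMr //.
  have hh : 4 * rt / (s - t) ^+ 2 < n%:R * h by rewrite -ltr_pdivrMr.
  have nN : n%:R <= N%:R :> R by rewrite NE; nra.
  have : n%:R * h <= N%:R * h by rewrite ler_pM2r.
  have : 4 * rt / (s - t) ^+ 2 = 2 * (2 * rt / (s - t) ^+ 2) by ring.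
  lra.
have : bin N t (fun m => mean_cnt (dilate n la) m c) / n%:R <=
  (mean_cnt (dilate n la) m0 c + W * N%:R) / n%:R by rewrite ler_pM2r ?invr_gt0.
rewrite mulrDl; move: hb; rewrite ler_norml => /andP[b1 b2]; lra.
Qed.

Lemma squeeze_lower la H (a0 am x t s : R) : (0 < size (boxes la))%N ->
  (forall n, (0 < n)%N -> sorted geq (dilate n la) /\
     size (boxes (dilate n la)) = (n ^ 2 * size (boxes la))%N) ->
  is_limiting_height la a0 am H -> a0 <= x <= am -> 0 <= t <= 1 -> 0 <= s -> s < t ->
  forall h, 0 < h -> exists n0 : nat, forall n, (n0 <= n)%N ->
    scaled_height la x n s <= unscaled H la x t + h.
Proof.
move=> N00 hdil hlim hx ht s0 st h h0.
have [n1 hn1] := bin_close N00 hdil hlim hx ht (divr_gt0 h0 (ltr0n R 2)).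
set N0 := size (boxes la) in N00 hdil hn1; set rt : R := Num.sqrt N0%:R.
have rt0 : 0 <= rt by apply: sqrtr_ge0.
case/andP: (ht) => t0 t1.
have d0 : 0 < t - s by lra.
have [n2 hn2] := nat_eventually (4 * rt / (t - s) ^+ 2 / h).
exists (maxn n1 n2) => n; rewrite geq_max => /andP[hn hn'].
have [n0 hb] := hn1 n hn; have [sl szN] := hdil n n0.
have nr : 0 < n%:R :> R by rewrite ltr0n.
have n1r : 1 <= n%:R :> R by rewrite ler1n.
set c := Num.floor _ in hb.
have hnh := hn2 n hn'.
set N := (n ^ 2 * N0)%N in szN hb.
have NE : N%:R = n%:R ^+ 2 * N0%:R :> R by rewrite natrM natrX.
have N01 : 1 <= N0%:R :> R by rewrite ler1n.
have N0' : 0 < N%:R :> R by rewrite NE mulr_gt0 ?exprn_gt0 //; lra.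
have sqE : Num.sqrt N%:R = n%:R * rt :> R.
  by rewrite natrM natrX sqrtrM ?sqr_ge0 // sqrtr_sqr gtr0_norm.
rewrite /scaled_height -/c; set m0 := level la n s.
have /andP[l1 l2] := level_bounds la n s0; rewrite -/N0 -/m0 -/N in l1 l2.
pose W := 2 * (n%:R * rt) / ((t - s) * N%:R) ^+ 2.
have W0 : 0 <= W by rewrite divr_ge0 ?sqr_ge0 ?mulr_ge0 // ltW.
have key : mean_cnt (dilate n la) m0 c - W * N%:R <= bin N t (fun m => mean_cnt (dilate n la) m c).
  apply: (@le_trans _ _ (bin N t (fun m => mean_cnt (dilate n la) m0 c + (- W) * (m%:R - N%:R * t) ^+ 2))).
    rewrite binD bin_cst binZ bin_variance subrr expr0n addr0 lerD2l mulNr lerN2 ler_wpM2l //.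
    have : t * (1 - t) <= 1 by nra.
    rewrite -mulrA => h1; rewrite -[leRHS]mulr1 ler_wpM2l //.
  apply: bin_le => // m hm; have [mm0|mm0] := leqP m0 m.
    rewrite -[leRHS]addr0 lerD ?mean_cnt_le // mulNr oppr_le0 mulr_ge0 ?sqr_ge0 //.
  apply: le_trans (mean_cnt_ge0 _ _ _); rewrite mulNr subr_le0.
  apply: le_trans (mean_cnt_le_sqrt _ _ sl) _; rewrite szN sqE.
  have -> : W * (m%:R - N%:R * t) ^+ 2 = 2 * (n%:R * rt) * ((N%:R * t - m%:R) ^+ 2 / ((t - s) * N%:R) ^+ 2).
    by rewrite /W; ring.
  rewrite ler_peMr ?mulr_ge0 ?(ltW nr) //.
  have mlo : m%:R <= s * N%:R by apply: le_trans l1; rewrite ler_nat ltnW.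
  have q0 : 0 < (t - s) * N%:R by rewrite mulr_gt0.
  by rewrite ler_pdivlMr ?exprn_gt0 // mul1r ler_pXn2r ?nnegrE //; lra.
have WN : W * N%:R / n%:R <= h / 2.
  have -> : W * N%:R / n%:R = (2 * rt / (t - s) ^+ 2) / N%:R.
    rewrite /W; move: (N%:R : R) N0' => NN NN0; field.
    by apply/and3P; split; rewrite gt_eqF.
  rewrite ler_pdivrMr //.
  have hh : 4 * rt / (t - s) ^+ 2 < n%:R * h by rewrite -ltr_pdivrMr.
  have nN : n%:R <= N%:R :> R by rewrite NE; nra.
  have : n%:R * h <= N%:R * h by rewrite ler_pM2r.
  have : 4 * rt / (t - s) ^+ 2 = 2 * (2 * rt / (t - s) ^+ 2) by ring.
  lra.
have : (mean_cnt (dilate n la) m0 c - W * N%:R) / n%:R <=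
  bin N t (fun m => mean_cnt (dilate n la) m c) / n%:R by rewrite ler_pM2r ?invr_gt0.
rewrite mulrBl; move: hb; rewrite ler_norml => /andP[b1 b2]; lra.
Qed.

End LimitHeight.

(** * Regularity, frozen and liquid points of the limiting height *)

Section LimitProfile.
Context {R : realType}.
Local Notation C := R[i].
Implicit Types (la : seq nat) (H : R -> R -> R).

Lemma dilation_size_gt0 la (a0 b1 a1 b2 a2 : R) :
  dilation_data la a0 b1 a1 b2 a2 -> (0 < size (boxes la))%N.
Proof. by case. Qed.

Lemma dilation_dilate la (a0 b1 a1 b2 a2 : R) : dilation_data la a0 b1 a1 b2 a2 ->
  forall n, (0 < n)%N -> sorted geq (dilate n la) /\ size (boxes (dilate n la)) = (n ^ 2 * size (boxes la))%N.
Proof. by case=> _ _ h n /h []. Qed.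

Section Profile.
Variables (la : seq nat) (H : R -> R -> R) (a0 b1 a1 b2 a2 : R).
Hypotheses (hd : dilation_data la a0 b1 a1 b2 a2) (hlim : is_limiting_height la a0 a2 H).
Local Notation U := (unscaled H la).

Lemma profile_mono x t1 t2 : a0 <= x <= a2 -> 0 <= t1 -> t1 <= t2 -> t2 <= 1 -> U x t1 <= U x t2.
Proof.
have N00 := dilation_size_gt0 hd.
have hdil := dilation_dilate hd.
move=> hx t10 t12 t21; have [->//|t12'] := eqVneq t1 t2.
have {t12'}t12 : t1 < t2 by rewrite lt_neqAle t12'.
apply/ler_addgt0Pr => e e0; pose s := (t1 + t2) / 2.
have st : t1 < s < t2 by rewrite /s; apply/andP; split; lra.
case/andP: st => st1 st2.
have h1 : 0 <= t1 <= 1 by apply/andP; split; lra.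
have h2 : 0 <= t2 <= 1 by apply/andP; split; lra.
have s0 : 0 <= s by lra.
have s1 : s <= 1 by lra.
have [n1 hn1] := squeeze_upper N00 hdil hlim hx h1 s1 (or_introl st1) (divr_gt0 e0 (ltr0n R 2)).
have [n2 hn2] := squeeze_lower N00 hdil hlim hx h2 s0 st2 (divr_gt0 e0 (ltr0n R 2)).
have := hn1 (maxn n1 n2) (leq_maxl _ _); have := hn2 (maxn n1 n2) (leq_maxr _ _); lra.
Qed.

Lemma profile_ge0 x t : a0 <= x <= a2 -> 0 <= t <= 1 -> 0 <= U x t.
Proof.
have N00 := dilation_size_gt0 hd.
have hdil := dilation_dilate hd.
move=> hx ht; apply/ler_addgt0Pr => e e0.
have [n0 hn0] := bin_close N00 hdil hlim hx ht e0.
have [n1] := hn0 _ (leqnn n0); rewrite ler_norml => /andP[h1 h2].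
have : 0 <= bin (n0 ^ 2 * size (boxes la)) t
       (fun m => mean_cnt (dilate n0 la) m (Num.floor (x * n0%:R))) / n0%:R.
  by rewrite divr_ge0 // bin_ge0 // => m _; apply: mean_cnt_ge0.
lra.
Qed.

Lemma profile_lip x x' t : a0 <= x <= a2 -> a0 <= x' <= a2 -> 0 <= t <= 1 ->
  U x t <= U x' t + `|x - x'|.
Proof.
have N00 := dilation_size_gt0 hd.
have hdil := dilation_dilate hd.
move=> hx hx' ht; apply/ler_addgt0Pr => e e0; have e30 : 0 < e / 3 by rewrite divr_gt0.
have [n1 hn1] := bin_close N00 hdil hlim hx ht e30.
have [n2 hn2] := bin_close N00 hdil hlim hx' ht e30.
have [n3 hn3] := nat_eventually (3 / e).
set n := maxn n1 (maxn n2 n3).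
have [n0 k1] := hn1 n (leq_maxl _ _).
have [_ k2] := hn2 n (leq_trans (leq_maxl _ _) (leq_maxr _ _)).
have k3 := hn3 n (leq_trans (leq_maxr _ _) (leq_maxr _ _)).
have [sl _] := hdil _ n0.
have nr : 0 < n%:R :> R by rewrite ltr0n.
have in3 : n%:R^-1 <= e / 3.
  by rewrite -[e / 3]invrK lef_pV2 ?posrE ?invr_gt0 // invf_div ltW.
set c := Num.floor (x * _) in k1; set c' := Num.floor (x' * _) in k2.
have f1 := floor_itv (x * n%:R); have f2 := floor_itv (x' * n%:R).
have [c0|c0] : (0 <= c - c' \/ 0 <= c' - c)%R.
  by case/orP: (le_total c' c) => ?; [left|right]; rewrite subr_ge0.
all: case/andP: f1 => f11 f12; case/andP: f2 => f21 f22;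
  rewrite -/c rmorphD /= in f11 f12; rewrite -/c' rmorphD /= in f21 f22.
- have ck : c = c' + `|c - c'|%N%:Z by rewrite gez0_abs // [RHS]addrC subrK.
  have kr : (`|c - c'|%N)%:R <= `|x - x'| * n%:R + 1 :> R.
    have -> : (`|c - c'|%N)%:R = c%:~R - c'%:~R :> R.
      by rewrite -rmorphB /= -[in RHS](gez0_abs c0).
    have : (x - x') * n%:R <= `|x - x'| * n%:R by rewrite ler_pM2r // ler_norm.
    rewrite mulrBl; lra.
  have : bin (n ^ 2 * size (boxes la)) t (fun m => mean_cnt (dilate n la) m c) <=
         bin (n ^ 2 * size (boxes la)) t (fun m => mean_cnt (dilate n la) m c' + (`|c - c'|%N)%:R).
    by apply: bin_le => // m _; rewrite {1}ck; apply: mean_cnt_left.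
  rewrite binD bin_cst -(ler_pM2r (x := n%:R^-1)) ?invr_gt0 // mulrDl => k4.
  have : (`|c - c'|%N)%:R / n%:R <= `|x - x'| + n%:R^-1.
    by rewrite ler_pdivrMr // mulrDl mulVf ?gt_eqF.
  move: k1 k2; rewrite !ler_norml => /andP[k11 k12] /andP[k21 k22]; lra.
- have ck : c' = c + `|c' - c|%N%:Z by rewrite gez0_abs // [RHS]addrC subrK.
  have kr : (`|c' - c|%N)%:R <= `|x - x'| * n%:R + 1 :> R.
    have -> : (`|c' - c|%N)%:R = c'%:~R - c%:~R :> R.
      by rewrite -rmorphB /= -[in RHS](gez0_abs c0).
    have : (x' - x) * n%:R <= `|x - x'| * n%:R by rewrite ler_pM2r // distrC ler_norm.
    rewrite mulrBl; lra.
  have : bin (n ^ 2 * size (boxes la)) t (fun m => mean_cnt (dilate n la) m c) <=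
         bin (n ^ 2 * size (boxes la)) t (fun m => mean_cnt (dilate n la) m c' + (`|c' - c|%N)%:R).
    by apply: bin_le => // m _; rewrite {1}ck; apply: mean_cnt_right.
  rewrite binD bin_cst -(ler_pM2r (x := n%:R^-1)) ?invr_gt0 // mulrDl => k4.
  have : (`|c' - c|%N)%:R / n%:R <= `|x - x'| + n%:R^-1.
    by rewrite ler_pdivrMr // mulrDl mulVf ?gt_eqF.
  move: k1 k2; rewrite !ler_norml => /andP[k11 k12] /andP[k21 k22]; lra.
Qed.

Lemma mean_cnt_sqr_le m c la' : sorted geq la' -> (m <= size (boxes la'))%N ->
  mean_cnt la' m c ^+ 2 <= 2 * m%:R :> R.
Proof.
move=> sl hm; apply: le_trans (mean_sqr_le _ _ sl) _.
rewrite -(mean_cst m (2 * m%:R) sl); apply: mean_le => s hs.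
rewrite -natrX -natrM ler_nat; apply: leq_trans (cnt_sqr_le m c sl hs) _.
by rewrite leq_mul2l size_take_min geq_minl.
Qed.

(** A shape with m boxes has at most sqrt(2 m) boxes on any diagonal, whence a bound uniform in
    x. *)
Lemma profile_small e : 0 < e -> exists2 tau, 0 < tau & forall x t, a0 <= x <= a2 ->
  0 <= t <= 1 -> t < tau -> U x t <= e.
Proof.
have N00 := dilation_size_gt0 hd.
have hdil := dilation_dilate hd.
move=> e0; set N0 := size (boxes la) in N00.
have N0r : 0 < N0%:R :> R by rewrite ltr0n.
pose s := Num.min 1 (e ^+ 2 / (8 * N0%:R)).
have s0 : 0 < s by rewrite lt_min ltr01 divr_gt0 ?exprn_gt0 // mulr_gt0.
have s1 : s <= 1 by rewrite ge_min lexx.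
have sN : s * N0%:R <= e ^+ 2 / 8.
  apply: (@le_trans _ _ (e ^+ 2 / (8 * N0%:R) * N0%:R)); last first.
    by rewrite invfM mulrA divfK ?gt_eqF.
  by rewrite ler_pM2r // ge_min lexx orbT.
exists s => // x t hx ht ts.
have [n1 hn1] := squeeze_upper N00 hdil hlim hx ht s1 (or_introl ts) (divr_gt0 e0 (ltr0n R 2)).
pose n := maxn n1 1; have n0 : (0 < n)%N by rewrite /n leq_maxr.
have := hn1 n (leq_maxl _ _).
suff : scaled_height la x n s <= e / 2 by lra.
have [sl szN] := hdil _ n0; have nr : 0 < n%:R :> R by rewrite ltr0n.
rewrite /scaled_height ler_pdivrMr //; set m := level _ _ _.
have hm : (m <= n ^ 2 * N0)%N by apply: level_le_size => //; apply: ltW.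
have en0 : 0 <= e / 2 * n%:R by rewrite mulr_ge0 ?divr_ge0 ?ltW.
rewrite -(ler_pXn2r (n := 2)) ?nnegrE ?mean_cnt_ge0 //.
apply: le_trans (mean_cnt_sqr_le _ sl _) _; first by rewrite szN.
have /andP[l1 _] := level_bounds la n (ltW s0); rewrite -/m natrM natrX -/N0 in l1.
have : s * N0%:R * n%:R ^+ 2 <= e ^+ 2 / 8 * n%:R ^+ 2 by rewrite ler_pM2r ?exprn_gt0.
rewrite exprMn expr_div_n; nra.
Qed.

(** As Im K(u) = 0, [density_upper] gives slope 2 (e/4) on a slightly larger interval [sg1, sg2] of
    length at most 3 g / 2. This spends 3/4 of e g; the three errors h = e g / 12 spend the rest. *)
Lemma profile_frozen x s0 u : a0 <= x <= a2 -> 0 < s0 -> s0 <= 1 ->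
  good_root a0 b1 a1 b2 a2 x s0 u -> complex.Im u = 0 ->
  forall e, 0 < e -> exists2 delta, 0 < delta & forall t1 t2, s0 - delta < t1 -> 0 < t1 ->
    t1 < t2 -> t2 < s0 + delta -> t2 <= 1 -> U x t2 - U x t1 <= e * (t2 - t1).
Proof.
have N00 := dilation_size_gt0 hd.
have hdil := dilation_dilate hd.
move=> hx s00 s01 gr iu e e0; have e40 : 0 < e / 4 by rewrite divr_gt0.
have [delta d0 hdel] := density_upper hd s00 s01 gr e40.
have v0 : complex.Im (KC a0 b1 a1 b2 a2 u) = 0.
  by case: hd gr => hI _ _ [_ hden _]; rewrite Im_KC // iu mul0r.
exists delta => // t1 t2 t1d t10 t12 t2d t21.
pose g := t2 - t1; have g0 : 0 < g by rewrite /g; lra.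
have [sg1 [g1a g1b g1c g1d]] : exists sg1, [/\ s0 - delta < sg1, 0 < sg1, sg1 < t1 & t1 - g / 4 <= sg1].
  exists (Num.max (t1 - g / 4) (Num.max ((s0 - delta + t1) / 2) (t1 / 2))).
  rewrite !gt_max !lt_max !le_max; split; first by apply/orP; right; apply/orP; left; lra.
  - by apply/orP; right; apply/orP; right; lra.
  - apply/andP; split; first lra.
    by apply/andP; split; lra.
  - by rewrite lexx.
have [sg2 [g2a g2b g2c g2d]] : exists sg2, [/\ sg2 < s0 + delta, sg2 <= 1, t2 < sg2 \/ sg2 = 1 & sg2 <= t2 + g / 4].
  case: (ltP t2 1) => t2l; last first.
    by exists 1; split; [lra|lra|right|lra].
  exists (Num.min (t2 + g / 4) (Num.min ((s0 + delta + t2) / 2) ((1 + t2) / 2))).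
  rewrite !gt_min !ge_min !lt_min; split.
  - by apply/orP; right; apply/orP; left; lra.
  - by apply/orP; right; apply/orP; right; lra.
  - left; apply/andP; split; first lra.
    by apply/andP; split; lra.
  - by rewrite lexx.
pose h := e * g / 12; have h0 : 0 < h by rewrite divr_gt0 ?mulr_gt0.
have ht1 : 0 <= t1 <= 1 by apply/andP; split; lra.
have ht2 : 0 <= t2 <= 1 by apply/andP; split; lra.
have g12 : sg1 <= sg2 by case: g2c => ?; lra.
have [n1 hn1] := squeeze_upper N00 hdil hlim hx ht2 g2b g2c h0.
have [n2 hn2] := squeeze_lower N00 hdil hlim hx ht1 (ltW g1b) g1c h0.
have [n3 hn3] := hdel sg1 sg2 g1a g1b g12 g2a g2b h h0.
pose n := maxn n1 (maxn n2 n3).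
have k1 := hn1 n (leq_maxl _ _).
have k2 := hn2 n (leq_trans (leq_maxl _ _) (leq_maxr _ _)).
have k3 := hn3 n (leq_trans (leq_maxr _ _) (leq_maxr _ _)).
rewrite v0 add0r in k3.
have : 2 * (e / 4) * (sg2 - sg1) <= e * g * (3 / 4).
  have -> : e * g * (3 / 4) = 2 * (e / 4) * (3 / 2 * g) by field.
  rewrite ler_pM2l; last by rewrite mulr_gt0.
  rewrite /g in g1d g2d *; lra.
rewrite -/g; rewrite /h in k1 k2 k3; lra.
Qed.

(** The derivative vanishes at every point: for each e, the set of t with U x t - U x t1 <= e (t -
    t1) contains its supremum, and [profile_frozen] pushes the supremum further unless it is t2. *)
Lemma profile_const x t1 t2 : a0 <= x <= a2 -> 0 < t1 -> t1 <= t2 -> t2 <= 1 ->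
  (forall s, t1 <= s <= t2 -> exists2 u, good_root a0 b1 a1 b2 a2 x s u & complex.Im u = 0) ->
  U x t1 = U x t2.
Proof.
move=> hx t10 t12 t21 hfr; apply: le_anti; rewrite profile_mono ?(ltW t10) //=.
have [->//|t12'] := eqVneq t1 t2.
have {t12'}t12' : t1 < t2 by rewrite lt_neqAle t12'.
suff key e : 0 < e -> U x t2 - U x t1 <= e * (t2 - t1).
  apply/ler_addgt0Pr => e e0.
  have := key (e / (t2 - t1)); rewrite divfK ?subr_eq0 ?gt_eqF // => /(_ _) h.
  by rewrite -lerBlDl h // divr_gt0 // subr_gt0.
move=> e0.
pose S := [set t | t1 <= t <= t2 /\ U x t - U x t1 <= e * (t - t1)].
have St1 : S t1 by split; [rewrite lexx|rewrite !subrr mulr0].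
have ubS : ubound S t2 by move=> t [/andP[]].
have supS : has_sup S by split; [exists t1|exists t2].
pose sg := sup S.
have sg1 : t1 <= sg by apply: sup_upper_bound.
have sg2 : sg <= t2 by apply: sup_le_ub => //; exists t1.
have sgi : t1 <= sg <= t2 by apply/andP.
have [u gu iu] := hfr sg sgi.
have sg0 : 0 < sg by lra.
have sgl : sg <= 1 by lra.
have [delta d0 hdel] := profile_frozen hx sg0 sgl gu iu e0.
have Ssg : S sg.
  have [t [/andP[ta tb] tc] td] := sup_adherent d0 supS.
  have tsg : t <= sg by apply: sup_upper_bound => //; split => //; apply/andP.
  have [-> |tsg'] := eqVneq sg t; first by split => //; apply/andP.
  split => //.
  have : U x sg - U x t <= e * (sg - t).
    by apply: hdel; rewrite -?/sg //; [lra|rewrite lt_neqAle eq_sym tsg'|lra].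
  lra.
have [e2|sgn] := eqVneq sg t2; first by rewrite -e2; case: Ssg.
have {sgn}sgn : sg < t2 by rewrite lt_neqAle sgn.
pose t := Num.min t2 (sg + delta / 2).
have ht2 : t <= t2 by rewrite ge_min lexx.
have htd : t <= sg + delta / 2 by rewrite ge_min lexx orbT.
have sgt : sg < t by rewrite lt_min sgn /=; lra.
have : S t.
  split; first by apply/andP; split; lra.
  have : U x t - U x sg <= e * (t - sg) by apply: hdel => //; lra.
  by case: Ssg => _; lra.
by move=> /(sup_upper_bound supS); rewrite leNgt sgt.
Qed.

Lemma profile_liquid x s0 u : a0 <= x <= a2 -> 0 < s0 -> s0 <= 1 ->
  good_root a0 b1 a1 b2 a2 x s0 u -> 0 < complex.Im u ->
  exists2 delta, 0 < delta & forall t1 t2, s0 - delta < t1 -> 0 < t1 ->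
    t1 < t2 -> t2 < s0 + delta -> t2 <= 1 -> U x t1 < U x t2.
Proof.
have N00 := dilation_size_gt0 hd.
have hdil := dilation_dilate hd.
move=> hx s00 s01 gr iu.
have v0 : 0 < complex.Im (KC a0 b1 a1 b2 a2 u).
  case: hd gr => hI _ _ [_ hden _]; rewrite Im_KC // mulr_gt0 //.
  by have := spread_ge0 u hI; lra.
have v20 : 0 < complex.Im (KC a0 b1 a1 b2 a2 u) / 2 by rewrite divr_gt0.
have v2v : complex.Im (KC a0 b1 a1 b2 a2 u) / 2 <= complex.Im (KC a0 b1 a1 b2 a2 u) by lra.
have [delta d0 hdel] := density_lower hd s00 s01 gr v20 v2v.
set v := complex.Im _ in v0 hdel.
exists delta => // t1 t2 t1d t10 t12 t2d t21.
pose g := t2 - t1; have g0 : 0 < g by rewrite /g; lra.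
(* The middle third of the interval gains v g / 54, and the three errors h cost only v g / 60. *)
pose h := v * g / 180; have h0 : 0 < h by rewrite divr_gt0 ?mulr_gt0.
have ht1 : 0 <= t1 <= 1 by apply/andP; split; lra.
have ht2 : 0 <= t2 <= 1 by apply/andP; split; lra.
pose sg1 := t1 + g / 3; pose sg2 := t2 - g / 3.
have g1a : s0 - delta < sg1 by rewrite /sg1; lra.
have g1b : 0 < sg1 by rewrite /sg1; lra.
have g1c : t1 < sg1 by rewrite /sg1; lra.
have g1d : sg1 <= 1 by rewrite /sg1 /g; lra.
have g12 : sg1 <= sg2 by rewrite /sg1 /sg2 /g; lra.
have g2a : sg2 < s0 + delta by rewrite /sg2; lra.
have g2b : sg2 <= 1 by rewrite /sg2; lra.
have g2c : sg2 < t2 by rewrite /sg2; lra.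
have g2d : 0 <= sg2 by lra.
have [n1 hn1] := squeeze_upper N00 hdil hlim hx ht1 g1d (or_introl g1c) h0.
have [n2 hn2] := squeeze_lower N00 hdil hlim hx ht2 g2d g2c h0.
have [n3 hn3] := hdel sg1 sg2 g1a g1b g12 g2a g2b h h0.
pose n := maxn n1 (maxn n2 n3).
have k1 := hn1 n (leq_maxl _ _).
have k2 := hn2 n (leq_trans (leq_maxl _ _) (leq_maxr _ _)).
have k3 := hn3 n (leq_trans (leq_maxr _ _) (leq_maxr _ _)).
have e1 : (v - v / 2) * (sg2 - sg1) / 9 = v * g / 54 by rewrite /sg1 /sg2 /g; field.
rewrite e1 in k3; rewrite /h in k1 k2 k3; rewrite /h in h0; lra.
Qed.

End Profile.

(* The set [D] is the domain, described through the height function at time 1. *)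
Lemma surface_criterion H (A0 A2 : R) (D : set (R * R)) :
  (forall P, D P <-> A0 <= P.1 <= A2 /\ 0 < (P.2 - `|P.1|) / 2 < H P.1 1) ->
  (forall X t1 t2, A0 <= X <= A2 -> 0 <= t1 -> t1 <= t2 -> t2 <= 1 -> H X t1 <= H X t2) ->
  (forall X, A0 <= X <= A2 -> H X 0 <= 0) ->
  (forall X X' t, A0 <= X <= A2 -> A0 <= X' <= A2 -> 0 <= t <= 1 ->
     H X t <= H X' t + `|X - X'|) ->
  surface_defined_continuous H D <->
  (forall X t1 t2, A0 <= X <= A2 -> 0 <= t1 -> t1 < t2 -> t2 <= 1 ->
     H X t1 = H X t2 -> 0 < H X t1 -> H X t2 < H X 1 -> False).
Proof.
move=> hD mono h0 lip.
pose lev (P : R * R) := (P.2 - `|P.1|) / 2.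
pose Sp P := [set t | 0 <= t <= 1 /\ H P.1 t <= lev P].
pose Si P := [set t | 0 <= t <= 1 /\ H P.1 t >= lev P].
have supE P : surface_sup H P = sup (Sp P) by [].
have infE P : surface_inf H P = inf (Si P) by [].
have z01 : 0 <= (0 : R) <= 1 by rewrite lexx ler01.
have o01 : 0 <= (1 : R) <= 1 by rewrite lexx ler01.
have Sp0 P : D P -> Sp P 0.
  by move=> /hD[hx /andP[l0 l1]]; split => //; apply: le_trans (h0 _ hx) (ltW l0).
have Si1 P : D P -> Si P 1 by move=> /hD[hx /andP[l0 l1]]; split => //; apply: ltW.
have hSp P : D P -> has_sup (Sp P).
  by move=> hP; split; [exists 0; apply: Sp0|exists 1 => t [/andP[]]].
have hSi P : D P -> has_inf (Si P).
  by move=> hP; split; [exists 1; apply: Si1|exists 0 => t [/andP[]]].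
have geS P t : D P -> Sp P t -> t <= surface_sup H P by move=> /hSp h ?; apply: sup_upper_bound.
have leI P t : D P -> Si P t -> surface_inf H P <= t by move=> /hSi [] h ??; apply: ge_inf.
split.
  move=> [heq _] X t1 t2 hX t10 t12 t21 e12 p1 p2.
  (* The point over X at the flat height: its infimum is at most t1 and its supremum at least t2. *)
  pose P := (X, `|X| + 2 * H X t1).
  have lP : lev P = H X t1 by rewrite /lev /=; field.
  have DP : D P by apply/hD; rewrite -/(lev P) lP; split => //; rewrite p1 e12.
  have h1 : Si P t1 by split; [apply/andP; split; lra|rewrite lP].
  have h2 : Sp P t2 by split; [apply/andP; split; lra|rewrite lP e12].
  have := heq P; rewrite inE => /(_ DP) e.
  by have := leI _ _ DP h1; have := geS _ _ DP h2; rewrite e; lra.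
move=> hflat.
have defd P : D P -> surface_inf H P = surface_sup H P.
  move=> DP; have [hx hl] := (hD P).1 DP; apply: le_anti; apply/andP; split; rewrite leNgt; apply/negP => hlt.
    set t := (surface_inf H P + surface_sup H P) / 2.
    have t1 : surface_sup H P < t < surface_inf H P by rewrite /t; apply/andP; split; lra.
    case/andP: t1 => t1 t2.
    have s0 : 0 <= surface_sup H P by apply: geS DP (Sp0 _ DP).
    have s1 : surface_inf H P <= 1 by apply: leI DP (Si1 _ DP).
    have t01 : 0 <= t <= 1 by apply/andP; split; lra.
    case: (leP (H P.1 t) (lev P)) => hh.
      by have : Sp P t by []; move=> /(geS _ _ DP); lra.
    have : Si P t by split => //; apply: ltW.
    by move=> /(leI _ _ DP); lra.
  have e0 : 0 < (surface_sup H P - surface_inf H P) / 2 by lra.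
  have [t' [/andP[t'0 t'1] ht'] kt'] := sup_adherent e0 (hSp _ DP).
  have [t [/andP[t0 t1] ht] kt] := inf_adherent e0 (hSi _ DP).
  rewrite -supE in kt'; rewrite -infE in kt.
  have tt' : t < t' by lra.
  have hm := mono _ _ _ hx t0 (ltW tt') t'1.
  have e1 : H P.1 t = lev P by apply: le_anti; rewrite ht (le_trans hm).
  have e2 : H P.1 t' = lev P by apply: le_anti; rewrite ht' (le_trans _ hm).
  move/andP: hl; rewrite -/(lev P) => -[l0 l1].
  by apply: (hflat P.1 t t'); rewrite ?e1 ?e2.
split; first by move=> P; rewrite inE; apply: defd.
apply/subspace_continuousP => P DP; apply/cvgrPdist_lt => e e0.
have [hx hl] := (hD P).1 DP.
set T0 := surface_sup H P.
have T00 : 0 <= T0 by apply: geS DP (Sp0 _ DP).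
have T01 : T0 <= 1 by rewrite /T0 -defd //; apply: leI DP (Si1 _ DP).
have lev_near P' (d : R) : `|P.1 - P'.1| < d -> `|P.2 - P'.2| < d -> `|lev P - lev P'| < d.
  move=> d1 d2; rewrite /lev.
  have h3 := ler_dist_dist P.1 P'.1.
  have : `| `|P.1| - `|P'.1| | < d by apply: le_lt_trans d1.
  by move: d2; rewrite !ltr_norml => /andP[? ?] /andP[? ?]; apply/andP; split; lra.
(* At a time later than the surface over P the height exceeds the level of P strictly, and the
   Lipschitz bound preserves this near P. The lower bound [hdl] is symmetric, through the
   infimum. *)
have [du du0 hu] : exists2 d, 0 < d & forall P', D P' -> `|P.1 - P'.1| < d -> `|P.2 - P'.2| < d ->
    surface_sup H P' <= T0 + e / 2.
  have [tb|tb] := ltP 1 (T0 + e / 2).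
    exists 1 => // P' DP' _ _; apply: le_trans (ltW tb).
    by rewrite -defd //; apply: leI DP' (Si1 _ DP').
  set t := T0 + e / 2 in tb *.
  have t01 : 0 <= t <= 1 by rewrite tb andbT /t; lra.
  have ht : lev P < H P.1 t.
    rewrite ltNge; apply/negP => hh; have : Sp P t by [].
    by move=> /(geS _ _ DP); rewrite -/T0 /t; lra.
  exists ((H P.1 t - lev P) / 2); first by lra.
  move=> P' DP' d1 d2; have [hx' _] := (hD P').1 DP'.
  have := lev_near _ _ d1 d2; rewrite ltr_norml => /andP[k1 k2].
  have k3 := lip _ _ _ hx hx' t01.
  apply: sup_le_ub; first by exists 0; apply: Sp0.
  move=> t' [/andP[t'0 t'1] ht']; rewrite leNgt; apply/negP => tt'.
  have := mono _ _ _ hx' (proj1 (andP t01)) (ltW tt') t'1.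
  have : H P'.1 t' <= lev P' by [].
  lra.
have [dl dl0 hdl] : exists2 d, 0 < d & forall P', D P' -> `|P.1 - P'.1| < d -> `|P.2 - P'.2| < d ->
    T0 - e / 2 <= surface_sup H P'.
  have [tb|tb] := ltP (T0 - e / 2) 0.
    exists 1 => // P' DP' _ _; apply: le_trans (ltW tb) _; apply: geS DP' (Sp0 _ DP').
  set t := T0 - e / 2 in tb *.
  have t01 : 0 <= t <= 1 by rewrite tb /= /t; lra.
  have ht : H P.1 t < lev P.
    rewrite ltNge; apply/negP => hh; have : Si P t by [].
    by move=> /(leI _ _ DP); rewrite defd // -/T0 /t; lra.
  exists ((lev P - H P.1 t) / 2); first by lra.
  move=> P' DP' d1 d2; have [hx' _] := (hD P').1 DP'.
  have := lev_near _ _ d1 d2; rewrite ltr_norml => /andP[k1 k2].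
  have k3 := lip _ _ _ hx' hx t01; rewrite distrC in k3.
  apply: geS DP' _; split => //; lra.
apply/nbhs_ballP; exists (Num.min du dl) => /=; first by rewrite lt_min du0.
move=> P' [b1 b2] DP'; rewrite -ball_normE /= in b1; rewrite -ball_normE /= in b2.
rewrite lt_min in b1; rewrite lt_min in b2.
move/andP: b1 => [b1u b1l]; move/andP: b2 => [b2u b2l].
have := hu _ DP' b1u b2u; have := hdl _ DP' b1l b2l.
move=> g1 g2; change (`|T0 - surface_sup H P'| < e).
by rewrite ltr_norml; apply/andP; split; lra.
Qed.

End LimitProfile.

(** * The real cubic *)

Section CriticalCubic.
Context {R : realType}.

Definition quadB (b1 b2 u : R) := (u - b1) * (u - b2).
Definition cubA (a0 a1 a2 u : R) := (u - a0) * (u - a1) * (u - a2).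
Definition cubic (a0 b1 a1 b2 a2 x c u : R) := (u - x) * quadB b1 b2 u - c * cubA a0 a1 a2 u.
Definition vieta2 (a0 b1 a1 b2 a2 x c : R) := x + b1 + b2 - c * (a0 + a1 + a2).
Definition vieta1 (a0 b1 a1 b2 a2 x c : R) :=
  x * b1 + x * b2 + b1 * b2 - c * (a0 * a1 + a0 * a2 + a1 * a2).
Definition vieta0 (a0 b1 a1 b2 a2 x c : R) := x * b1 * b2 - c * (a0 * a1 * a2).
Definition dcubic (a0 b1 a1 b2 a2 x c u : R) :=
  3 * (1 - c) * u ^+ 2 - 2 * vieta2 a0 b1 a1 b2 a2 x c * u + vieta1 a0 b1 a1 b2 a2 x c.

(** At a root the derivative of the cubic is B times that of w - c K(w), so the product with B has
    the sign required in [good_root]; its positivity also keeps u away from b1 and b2. *)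
Definition frozen (a0 b1 a1 b2 a2 x c : R) := exists u,
  cubic a0 b1 a1 b2 a2 x c u = 0 /\ 0 < quadB b1 b2 u * dcubic a0 b1 a1 b2 a2 x c u.

(* A real root r, and a pair of nonreal conjugate roots. *)
Definition liquid (a0 b1 a1 b2 a2 x c : R) := exists r e f,
  [/\ vieta2 a0 b1 a1 b2 a2 x c = (1 - c) * r - e, vieta1 a0 b1 a1 b2 a2 x c = f - e * r,
      vieta0 a0 b1 a1 b2 a2 x c = f * r & e ^+ 2 < 4 * (1 - c) * f].

Lemma cubicE a0 b1 a1 b2 a2 x c u : cubic a0 b1 a1 b2 a2 x c u =
  (1 - c) * u ^+ 3 - vieta2 a0 b1 a1 b2 a2 x c * u ^+ 2 + vieta1 a0 b1 a1 b2 a2 x c * u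
  - vieta0 a0 b1 a1 b2 a2 x c.
Proof. by rewrite /cubic /quadB /cubA /vieta2 /vieta1 /vieta0; ring. Qed.

Lemma cubic_ivt a0 b1 a1 b2 a2 x c u v : u < v ->
  cubic a0 b1 a1 b2 a2 x c u * cubic a0 b1 a1 b2 a2 x c v < 0 ->
  exists2 r, u < r < v & cubic a0 b1 a1 b2 a2 x c r = 0.
Proof.
move=> uv.
pose p : {poly R} := ('X - x%:P) * (('X - b1%:P) * ('X - b2%:P))
   - c *: (('X - a0%:P) * ('X - a1%:P) * ('X - a2%:P)).
have pE w : p.[w] = cubic a0 b1 a1 b2 a2 x c w by rewrite /p /cubic /quadB /cubA !hornerE; ring.
rewrite -!pE => h.
have [r ruv /rootP pr] := polyrcf.poly_ivtoo (ltW uv) h.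
exists r; last by rewrite -pE.
by move: ruv; rewrite in_itv.
Qed.

(** Two real roots found by sign changes determine the third. Vieta's relations serve as the
    factorization in all later arguments. *)
Lemma cubic_two_roots a0 b1 a1 b2 a2 x c r2 r3 : 1 - c != 0 -> r2 != r3 ->
  cubic a0 b1 a1 b2 a2 x c r2 = 0 -> cubic a0 b1 a1 b2 a2 x c r3 = 0 ->
  exists r1, [/\ vieta2 a0 b1 a1 b2 a2 x c = (1 - c) * (r1 + r2 + r3),
    vieta1 a0 b1 a1 b2 a2 x c = (1 - c) * (r1 * r2 + r1 * r3 + r2 * r3) &
    vieta0 a0 b1 a1 b2 a2 x c = (1 - c) * (r1 * r2 * r3)].
Proof.
move=> s0 r23; rewrite !cubicE.
move: (vieta2 _ _ _ _ _ _ _) (vieta1 _ _ _ _ _ _ _) (vieta0 _ _ _ _ _ _ _) (1 - c) s0.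
move=> p2 p1 p0 s s0 h2 h3; have d0 : r2 - r3 != 0 by rewrite subr_eq0.
have e1 : p1 = p2 * (r2 + r3) - s * (r2 ^+ 2 + r2 * r3 + r3 ^+ 2).
  apply: (mulfI d0); apply/eqP; rewrite -subr_eq0; apply/eqP.
  transitivity ((s * r2 ^+ 3 - p2 * r2 ^+ 2 + p1 * r2 - p0) - (s * r3 ^+ 3 - p2 * r3 ^+ 2 + p1 * r3 - p0)).
    by ring.
  by rewrite h2 h3 subrr.
exists (p2 / s - r2 - r3); split; first by field.
- by rewrite e1; field.
- have -> : p0 = s * r2 ^+ 3 - p2 * r2 ^+ 2 + p1 * r2 by lra.
  by rewrite e1; field.
Qed.

Lemma frozen_three_roots a0 b1 a1 b2 a2 x c r1 r2 r3 : c < 1 ->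
  vieta2 a0 b1 a1 b2 a2 x c = (1 - c) * (r1 + r2 + r3) ->
  vieta1 a0 b1 a1 b2 a2 x c = (1 - c) * (r1 * r2 + r1 * r3 + r2 * r3) ->
  vieta0 a0 b1 a1 b2 a2 x c = (1 - c) * (r1 * r2 * r3) ->
  0 < quadB b1 b2 r1 * ((r1 - r2) * (r1 - r3)) -> frozen a0 b1 a1 b2 a2 x c.
Proof.
move=> c1 e2 e1 e0 h; exists r1; split; first by rewrite cubicE e2 e1 e0; ring.
rewrite /dcubic e2 e1.
have -> : 3 * (1 - c) * r1 ^+ 2 - 2 * ((1 - c) * (r1 + r2 + r3)) * r1 +
  (1 - c) * (r1 * r2 + r1 * r3 + r2 * r3) = (1 - c) * ((r1 - r2) * (r1 - r3)) by ring.
by rewrite mulrCA mulr_gt0 // subr_gt0.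
Qed.

Section Interlaced.
Variables a0 b1 a1 b2 a2 : R.
Hypothesis hI : interlaced a0 b1 a1 b2 a2.
Local Notation A := (cubA a0 a1 a2).
Local Notation B := (quadB b1 b2).
Local Notation P := (cubic a0 b1 a1 b2 a2).

Lemma quadB_gt0l u : u < b1 -> 0 < B u.
Proof. by case: hI => *; rewrite /quadB nmulr_rgt0; lra. Qed.

Lemma quadB_gt0r u : b2 < u -> 0 < B u.
Proof. by case: hI => *; rewrite /quadB mulr_gt0; lra. Qed.

Lemma quadB_lt0 u : b1 < u -> u < b2 -> B u < 0.
Proof. by case: hI => *; rewrite /quadB pmulr_rlt0; lra. Qed.

Lemma cubA_lt0l u : u < a0 -> A u < 0.
Proof. by case: hI => *; rewrite /cubA pmulr_rlt0 ?nmulr_rgt0; lra. Qed.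

Lemma cubA_gt0 u : a0 < u -> u < a1 -> 0 < A u.
Proof. by case: hI => *; rewrite /cubA nmulr_rgt0 ?pmulr_rlt0; lra. Qed.

Lemma cubA_lt0 u : a1 < u -> u < a2 -> A u < 0.
Proof. by case: hI => *; rewrite /cubA pmulr_rlt0 ?mulr_gt0; lra. Qed.

Lemma cubic_b1 x c : 0 < c -> P x c b1 < 0.
Proof.
move=> c0; rewrite /cubic /quadB subrr mul0r mulr0 sub0r oppr_lt0 mulr_gt0 //.
by case: hI => *; apply: cubA_gt0.
Qed.

Lemma cubic_b2 x c : 0 < c -> 0 < P x c b2.
Proof.
move=> c0; rewrite /cubic /quadB subrr !mulr0 sub0r oppr_gt0 pmulr_rlt0 //.
by case: hI => *; apply: cubA_lt0.
Qed.

Lemma cubic_shift x c c' u : P x c' u = P x c u + (c - c') * A u.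
Proof. by rewrite /cubic; ring. Qed.

Lemma frozen_c0 x : x != b1 -> x != b2 -> frozen a0 b1 a1 b2 a2 x 0.
Proof.
move=> x1 x2; exists x; split; first by rewrite /cubic subrr; ring.
have -> : dcubic a0 b1 a1 b2 a2 x 0 x = B x by rewrite /dcubic /vieta2 /vieta1 /quadB; ring.
by rewrite -expr2 lt_neqAle sqr_ge0 eq_sym sqrf_eq0 mulf_neq0 ?subr_eq0.
Qed.

Lemma frozen_below x c u : a0 < x -> x < a1 -> 0 < c -> c < 1 -> a0 < u -> u < a1 ->
  P x c u = 0 -> forall c', 0 <= c' -> c' < c -> frozen a0 b1 a1 b2 a2 x c'.
Proof.
move=> x0 x1 c0 c1 u0 u1 Pu c' c'0 c'c; case: (hI) => i1 i2 i3 i4 i5.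
have Au := cubA_gt0 u0 u1; have Ax := cubA_gt0 x0 x1.
have eu : (u - x) * B u = c * A u by move: Pu; rewrite /cubic => /eqP; rewrite subr_eq0 => /eqP.
have cA : 0 < c * A u by apply: mulr_gt0.
have ub1 : u != b1.
  by apply/eqP => e; move: cA; rewrite -eu e /quadB subrr mul0r mulr0 ltxx.
have Pu' : 0 < P x c' u by rewrite (cubic_shift x c) Pu add0r mulr_gt0 // subr_gt0.
have s' : 1 - c' != 0 by rewrite gt_eqF // subr_gt0 (lt_trans c'c).
have c'1 : c' < 1 by apply: lt_trans c1.
have Px c'' : 0 < c'' -> P x c'' x < 0.
  by move=> h; rewrite /cubic subrr mul0r sub0r oppr_lt0 mulr_gt0.
case: (ltgtP u b1) ub1 => // [ub|ub] _.
  have Bu := quadB_gt0l ub.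
  have xu : x < u by rewrite -subr_gt0 -(pmulr_lgt0 _ Bu) eu.
  have [c'e|c'p] := eqVneq c' 0; first by rewrite c'e; apply: frozen_c0; lra.
  have {}c'p : 0 < c' by rewrite lt_neqAle eq_sym c'p.
  have [r1 /andP[r1a r1b] Pr1] : exists2 r, x < r < u & P x c' r = 0.
    by apply: cubic_ivt => //; rewrite nmulr_rlt0 // Px.
  have [r2 /andP[r2a r2b] Pr2] : exists2 r, u < r < b1 & P x c' r = 0.
    by apply: cubic_ivt => //; rewrite pmulr_rlt0 // cubic_b1.
  have r12 : r1 != r2 by rewrite lt_eqF //; lra.
  have [r3 [e2 e1 e0]] := cubic_two_roots s' r12 Pr1 Pr2.
  have [r3b|r3b] := ltP r2 r3; last first.
    have := cubic_b1 x c'p; rewrite cubicE e2 e1 e0.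
    have -> : (1 - c') * b1 ^+ 3 - (1 - c') * (r3 + r1 + r2) * b1 ^+ 2 +
      (1 - c') * (r3 * r1 + r3 * r2 + r1 * r2) * b1 - (1 - c') * (r3 * r1 * r2) =
      (1 - c') * ((b1 - r1) * (b1 - r2) * (b1 - r3)) by ring.
    rewrite ltNge mulr_ge0 ?subr_ge0 ?(ltW c'1) // !mulr_ge0 ?subr_ge0; lra.
  apply: (@frozen_three_roots _ _ _ _ _ _ _ r1 r2 r3) => //; rewrite ?e2 ?e1 ?e0; try by ring.
  rewrite mulr_gt0 ?quadB_gt0l //; first lra.
  by rewrite nmulr_rgt0; lra.
have Bu := quadB_lt0 ub (lt_trans u1 i3).
have xu : u < x by rewrite -subr_lt0 -(nmulr_lgt0 _ Bu) eu.
have [c'e|c'p] := eqVneq c' 0; first by rewrite c'e; apply: frozen_c0; lra.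
have {}c'p : 0 < c' by rewrite lt_neqAle eq_sym c'p.
have [r1 /andP[r1a r1b] Pr1] : exists2 r, b1 < r < u & P x c' r = 0.
  by apply: cubic_ivt => //; rewrite nmulr_rlt0 // cubic_b1.
have [r2 /andP[r2a r2b] Pr2] : exists2 r, u < r < x & P x c' r = 0.
  by apply: cubic_ivt => //; rewrite pmulr_rlt0 // Px.
have r12 : r1 != r2 by rewrite lt_eqF //; lra.
have [r3 [e2 e1 e0]] := cubic_two_roots s' r12 Pr1 Pr2.
have r3b : r2 < r3.
  rewrite ltNge; apply/negP => r3b.
  have := Px _ c'p; rewrite cubicE e2 e1 e0.
  have -> : (1 - c') * x ^+ 3 - (1 - c') * (r3 + r1 + r2) * x ^+ 2 +
      (1 - c') * (r3 * r1 + r3 * r2 + r1 * r2) * x - (1 - c') * (r3 * r1 * r2) =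
      (1 - c') * ((x - r1) * (x - r2) * (x - r3)) by ring.
  rewrite ltNge mulr_ge0 ?subr_ge0 ?(ltW c'1) // !mulr_ge0 ?subr_ge0; lra.
apply: (@frozen_three_roots _ _ _ _ _ _ _ r2 r1 r3) => //; rewrite ?e2 ?e1 ?e0; try by ring.
rewrite nmulr_rgt0; last by apply: quadB_lt0; lra.
by rewrite pmulr_rlt0; lra.
Qed.

(** At c' the cubic is positive at u, negative at b1 and positive at b2. Two roots lie in between,
    so the third lies left of u, where B is positive and the cubic increases. *)
Lemma frozen_above_left x c u : 0 < c -> u < a0 -> P x c u = 0 ->
  forall c', c < c' -> c' < 1 -> frozen a0 b1 a1 b2 a2 x c'.
Proof.
move=> c0 u0 Pu c' cc' c'1; case: (hI) => i1 i2 i3 i4 i5.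
have c'p : 0 < c' by apply: lt_trans cc'.
have Pu' : 0 < P x c' u.
  by rewrite (cubic_shift x c) Pu add0r nmulr_rgt0 ?subr_lt0 // cubA_lt0l.
have s' : 1 - c' != 0 by rewrite gt_eqF // subr_gt0.
have [r2 /andP[r2a r2b] Pr2] : exists2 r, u < r < b1 & P x c' r = 0.
  by apply: cubic_ivt; [lra|rewrite pmulr_rlt0 // cubic_b1].
have [r3 /andP[r3a r3b] Pr3] : exists2 r, b1 < r < b2 & P x c' r = 0.
  by apply: cubic_ivt; [lra|rewrite nmulr_rlt0 ?cubic_b2 ?cubic_b1].
have r23 : r2 != r3 by rewrite lt_eqF //; lra.
have [r1 [e2 e1 e0]] := cubic_two_roots s' r23 Pr2 Pr3.
have r1b : r1 < u.
  rewrite ltNge; apply/negP => ur.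
  move: Pu'; rewrite cubicE e2 e1 e0.
  have -> : (1 - c') * u ^+ 3 - (1 - c') * (r1 + r2 + r3) * u ^+ 2 +
      (1 - c') * (r1 * r2 + r1 * r3 + r2 * r3) * u - (1 - c') * (r1 * r2 * r3) =
      - ((1 - c') * ((r2 - u) * (r3 - u) * (r1 - u))) by ring.
  rewrite oppr_gt0 ltNge mulr_ge0 ?subr_ge0 ?(ltW c'1) // !mulr_ge0 ?subr_ge0; lra.
apply: (@frozen_three_roots _ _ _ _ _ _ _ r1 r2 r3) => //.
rewrite mulr_gt0 ?quadB_gt0l //; first lra.
by rewrite nmulr_rgt0; lra.
Qed.

End Interlaced.

(** Transposing the diagram reflects the line of contents; the mirror lemmas reduce each statement
    to one side. *)
Lemma interlaced_mirror (a0 b1 a1 b2 a2 : R) : interlaced a0 b1 a1 b2 a2 ->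
  interlaced (- a2) (- b2) (- a1) (- b1) (- a0).
Proof. by case=> *; split; lra. Qed.

Lemma cubic_mirror a0 b1 a1 b2 a2 x c u :
  cubic (- a2) (- b2) (- a1) (- b1) (- a0) (- x) c (- u) = - cubic a0 b1 a1 b2 a2 x c u.
Proof. by rewrite /cubic /quadB /cubA; ring. Qed.

Lemma frozen_mirror a0 b1 a1 b2 a2 x c :
  frozen (- a2) (- b2) (- a1) (- b1) (- a0) (- x) c -> frozen a0 b1 a1 b2 a2 x c.
Proof.
case=> u [Pu h]; exists (- u); split.
  by apply: oppr_inj; rewrite -cubic_mirror opprK Pu oppr0.
move: h; congr (0 < _); rewrite /quadB /dcubic /vieta2 /vieta1; ring.
Qed.

Lemma liquid_mirror a0 b1 a1 b2 a2 x c :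
  liquid (- a2) (- b2) (- a1) (- b1) (- a0) (- x) c -> liquid a0 b1 a1 b2 a2 x c.
Proof.
case=> r [e [f [e2 e1 e0 h]]]; exists (- r), (- e), f.
have k2 : vieta2 a0 b1 a1 b2 a2 x c = - vieta2 (- a2) (- b2) (- a1) (- b1) (- a0) (- x) c.
  by rewrite /vieta2; ring.
have k1 : vieta1 a0 b1 a1 b2 a2 x c = vieta1 (- a2) (- b2) (- a1) (- b1) (- a0) (- x) c.
  by rewrite /vieta1; ring.
have k0 : vieta0 a0 b1 a1 b2 a2 x c = - vieta0 (- a2) (- b2) (- a1) (- b1) (- a0) (- x) c.
  by rewrite /vieta0; ring.
split; first by rewrite k2 e2; ring.
- by rewrite k1 e1; ring.
- by rewrite k0 e0; ring.
- by rewrite sqrrN.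
Qed.

Lemma frozen_above a0 b1 a1 b2 a2 x c u : interlaced a0 b1 a1 b2 a2 -> 0 < c ->
  u < a0 \/ a2 < u -> cubic a0 b1 a1 b2 a2 x c u = 0 ->
  forall c', c < c' -> c' < 1 -> frozen a0 b1 a1 b2 a2 x c'.
Proof.
move=> hI c0 [hu|hu] Pu c' cc' c'1; first exact: frozen_above_left Pu _ cc' c'1.
apply: frozen_mirror; apply: (@frozen_above_left _ _ _ _ _ (interlaced_mirror hI) (- x) c (- u)) => //.
  by rewrite ltrN2.
by rewrite cubic_mirror Pu oppr0.
Qed.

End CriticalCubic.

(** * The critical case: frozen points extend to one end of time *)

Section Trichotomy.
Context {R : realType}.

(** The vanishing at a1 of the derivative of B / ((w - a0)(w - a2)), with denominators cleared. *)
Definition critical (a0 b1 a1 b2 a2 : R) :=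
  (2 * a1 - b1 - b2) * ((a1 - a0) * (a1 - a2)) = quadB b1 b2 a1 * (2 * a1 - a0 - a2).

Lemma critical_mirror (a0 b1 a1 b2 a2 : R) :
  critical a0 b1 a1 b2 a2 <-> critical (- a2) (- b2) (- a1) (- b1) (- a0).
Proof.
rewrite /critical /quadB; split=> h; apply: oppr_inj; apply: etrans (etrans h _); ring.
Qed.

(** The cubic is negative at b1 and positive at b2, which gives one real root; the discriminant of
    the remaining quadratic factor decides. *)
Lemma cubic_real_or_liquid (a0 b1 a1 b2 a2 x c : R) : interlaced a0 b1 a1 b2 a2 ->
  0 < c -> c < 1 ->
  liquid a0 b1 a1 b2 a2 x c \/ exists r1 r2 r3, [/\ b1 < r1 < b2,
    vieta2 a0 b1 a1 b2 a2 x c = (1 - c) * (r1 + r2 + r3),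
    vieta1 a0 b1 a1 b2 a2 x c = (1 - c) * (r1 * r2 + r1 * r3 + r2 * r3) &
    vieta0 a0 b1 a1 b2 a2 x c = (1 - c) * (r1 * r2 * r3)].
Proof.
move=> hI c0 c1; have [i1 i2 i3 i4 i5] := hI.
have [r rb Pr] : exists2 r, b1 < r < b2 & cubic a0 b1 a1 b2 a2 x c r = 0.
  by apply: cubic_ivt; [lra|rewrite nmulr_rlt0 ?(cubic_b2 hI) ?(cubic_b1 hI)].
move: Pr; rewrite cubicE.
set p2 := vieta2 _ _ _ _ _ _ _; set p1 := vieta1 _ _ _ _ _ _ _; set p0 := vieta0 _ _ _ _ _ _ _.
move=> Pr; pose s := 1 - c; have s0 : 0 < s by rewrite subr_gt0.
pose e := s * r - p2; pose f := p1 + e * r.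
have [hd|hd] := ltP (e ^+ 2) (4 * s * f).
  by left; exists r, e, f; split => //; rewrite -/p2 -/p1 -/p0 /f /e /s; move: Pr; lra.
right; pose d := Num.sqrt (e ^+ 2 - 4 * s * f).
have d2 : d ^+ 2 = e ^+ 2 - 4 * s * f by rewrite sqr_sqrtr // subr_ge0.
have sn : s != 0 by rewrite gt_eqF.
have fE : f = (e ^+ 2 - d ^+ 2) / (4 * s) by rewrite d2; field.
have p2E : p2 = s * r - e by rewrite /e; ring.
have p1E : p1 = f - e * r by rewrite /f; ring.
have p0E : p0 = f * r by rewrite /f /e /s; lra.
exists r, ((- e + d) / (2 * s)), ((- e - d) / (2 * s)).
rewrite -/s p2E p0E p1E fE.
move: (e) (d) (s) sn => e' d' s' sn; split=> //; field => //.
Qed.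

Section Critical.
Variables a0 b1 a1 b2 a2 : R.
Hypothesis hI : interlaced a0 b1 a1 b2 a2.
Local Notation D u := ((u - a0) * (u - a2)).
Local Notation B := (quadB b1 b2).
Local Notation P := (cubic a0 b1 a1 b2 a2).

(** At x = a1 the cubic is (u - a1)(B u - c D u); this is the value of c for which a1 is a multiple
    root. *)
Definition mid_ratio : R := B a1 / D a1.
(* The vertex of the discriminant of B - c (w - a0)(w - a2), as a function of c. *)
Definition top_ratio : R :=
  ((b1 - a0) * (a2 - b2) + (b2 - a0) * (a2 - b1)) / (a2 - a0) ^+ 2.
(* The other root of B - mid_ratio * (w - a0)(w - a2), which vanishes at a1. *)
Definition twin_root : R :=
  (b1 + b2 - mid_ratio * (a0 + a2)) / (1 - mid_ratio) - a1.

Lemma D_lt0 u : a0 < u -> u < a2 -> D u < 0.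
Proof. by move=> *; rewrite pmulr_rlt0; lra. Qed.

Lemma mid_ratioE : B a1 = mid_ratio * D a1.
Proof.
case: hI => *; rewrite /mid_ratio divfK // lt_eqF // D_lt0; lra.
Qed.

Lemma mid_ratio_gt0 : 0 < mid_ratio.
Proof.
case: (hI) => i1 i2 i3 i4 i5; have h1 := quadB_lt0 hI i2 i3.
have h2 : D a1 < 0 by apply: D_lt0; lra.
by rewrite /mid_ratio nmulr_rgt0 // invr_lt0.
Qed.

Lemma top_ratio_lt1 : top_ratio < 1.
Proof.
case: (hI) => i1 i2 i3 i4 i5; rewrite /top_ratio ltr_pdivrMr ?mul1r ?exprn_gt0; try lra.
have h1 : 0 < (b1 - a0) * (b2 - a0) by apply: mulr_gt0; lra.
have h2 : 0 < (a2 - b2) * (a2 - b1) by apply: mulr_gt0; lra.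
rewrite -subr_gt0.
have -> : (a2 - a0) ^+ 2 - ((b1 - a0) * (a2 - b2) + (b2 - a0) * (a2 - b1)) =
  (b1 - a0) * (b2 - a0) + (a2 - b2) * (a2 - b1) by ring.
exact: addr_gt0.
Qed.

Lemma top_disc : (b1 + b2 - top_ratio * (a0 + a2)) ^+ 2 <
  4 * (1 - top_ratio) * (b1 * b2 - top_ratio * (a0 * a2)).
Proof.
case: (hI) => i1 i2 i3 i4 i5; rewrite -subr_gt0.
have -> : 4 * (1 - top_ratio) * (b1 * b2 - top_ratio * (a0 * a2)) -
    (b1 + b2 - top_ratio * (a0 + a2)) ^+ 2 =
  4 * ((b1 - a0) * (a2 - b2)) * ((b2 - a0) * (a2 - b1)) / (a2 - a0) ^+ 2.
  by rewrite /top_ratio; field; rewrite subr_eq0 gt_eqF //; lra.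
by rewrite divr_gt0 ?exprn_gt0 ?mulr_gt0; lra.
Qed.

Lemma top_quad_gt0 u : top_ratio * D u < B u.
Proof.
have h := top_disc; have s0 : 0 < 4 * (1 - top_ratio) by rewrite mulr_gt0 // subr_gt0 top_ratio_lt1.
rewrite -subr_gt0 -(pmulr_rgt0 _ s0).
have -> : 4 * (1 - top_ratio) * (B u - top_ratio * D u) =
  (2 * (1 - top_ratio) * u - (b1 + b2 - top_ratio * (a0 + a2))) ^+ 2 +
  (4 * (1 - top_ratio) * (b1 * b2 - top_ratio * (a0 * a2)) - (b1 + b2 - top_ratio * (a0 + a2)) ^+ 2).
  by rewrite /quadB; ring.
by rewrite ltr_wpDl ?sqr_ge0 // subr_gt0.
Qed.

Lemma mid_ratio_lt_top : mid_ratio < top_ratio.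
Proof.
case: (hI) => i1 i2 i3 i4 i5.
have := top_quad_gt0 a1; rewrite mid_ratioE ltr_nM2r //.
by apply: D_lt0; lra.
Qed.

Lemma mid_ratio_lt1 : mid_ratio < 1.
Proof. exact: lt_trans mid_ratio_lt_top top_ratio_lt1. Qed.

Lemma liquid_center c : (b1 + b2 - c * (a0 + a2)) ^+ 2 <
  4 * (1 - c) * (b1 * b2 - c * (a0 * a2)) -> liquid a0 b1 a1 b2 a2 a1 c.
Proof.
move=> h; exists a1, (- (b1 + b2 - c * (a0 + a2))), (b1 * b2 - c * (a0 * a2)).
by split; rewrite ?sqrrN // /vieta2 /vieta1 /vieta0; ring.
Qed.

Lemma liquid_top : liquid a0 b1 a1 b2 a2 a1 top_ratio.
Proof. exact: liquid_center top_disc. Qed.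

Lemma twin_rootE : b1 + b2 - mid_ratio * (a0 + a2) = (1 - mid_ratio) * (a1 + twin_root).
Proof.
by have h := mid_ratio_lt1; rewrite /twin_root; field; rewrite subr_eq0 gt_eqF.
Qed.

Lemma quad_twin u : B u = mid_ratio * D u + (1 - mid_ratio) * ((u - a1) * (u - twin_root)).
Proof.
have h1 := mid_ratioE; have h2 := twin_rootE.
have h3 : (1 - mid_ratio) * twin_root =
  b1 + b2 - mid_ratio * (a0 + a2) - (1 - mid_ratio) * a1 by rewrite h2; ring.
transitivity (mid_ratio * D u + (u - a1) * ((1 - mid_ratio) * u - (1 - mid_ratio) * twin_root)); last by ring.
rewrite h3; apply/eqP; rewrite -subr_eq0; apply/eqP.
transitivity (B a1 - mid_ratio * D a1); first by rewrite /quadB; ring.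
by rewrite -h1 subrr.
Qed.

(** B / D takes the value [mid_ratio] exactly at a1 and at the twin root, so its derivative vanishes
    at a1 when the two coincide. *)
Lemma critical_twin : critical a0 b1 a1 b2 a2 <-> twin_root = a1.
Proof.
have h1 := mid_ratioE; have h2 := twin_rootE; have m1 := mid_ratio_lt1.
have D0 : D a1 < 0 by case: hI => *; apply: D_lt0; lra.
have e : (2 * a1 - b1 - b2) * D a1 - B a1 * (2 * a1 - a0 - a2) =
   D a1 * ((1 - mid_ratio) * (a1 - twin_root)).
  rewrite h1; have -> : (1 - mid_ratio) * (a1 - twin_root) =
    2 * (1 - mid_ratio) * a1 - (1 - mid_ratio) * (a1 + twin_root) by ring.
  by rewrite -h2; ring.
split=> [h|h].
  move: e; rewrite h subrr => /esym/eqP; rewrite mulf_eq0 (lt_eqF D0) mulf_eq0 !subr_eq0 /=.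
  by rewrite (gt_eqF m1) /= => /eqP.
by apply/eqP; rewrite -subr_eq0 e h subrr !mulr0.
Qed.

Section Trich.
Hypothesis hcrit : critical a0 b1 a1 b2 a2.

Lemma quad_crit u : B u = mid_ratio * D u + (1 - mid_ratio) * (u - a1) ^+ 2.
Proof. by have /critical_twin h := hcrit; rewrite quad_twin h expr2. Qed.

Lemma critical_root x c u : P x c u = 0 ->
  c * (u - a1) * - D u =
  (u - x) * (mid_ratio * - D u - (1 - mid_ratio) * (u - a1) ^+ 2).
Proof.
by rewrite /cubic quad_crit /cubA => h; lra.
Qed.

(** By [critical_root], c = ((u - x)/(u - a1)) (m - (1 - m)(u - a1)^2 / (- D u)) with m =
    [mid_ratio]. Right of a1 the first factor decreases since x < a1, and so does the second, since
    (u - a1)/(u - a0) and (u - a1)/(a2 - u) increase. Both are positive at a root, so c is attained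
    only once. *)
Lemma critical_unique x c u v : x < a1 -> 0 < c -> P x c u = 0 -> P x c v = 0 ->
  a1 < u -> u < v -> v < b2 -> False.
Proof.
move=> xa c0 /critical_root hu /critical_root hv a1u uv vb.
have m0 := mid_ratio_gt0; have m1 := mid_ratio_lt1.
have [i1 i2 i3 i4 i5] := hI.
move: mid_ratio m0 m1 hu hv => m m0 m1 hu hv.
have Eu : 0 < - D u by rewrite oppr_gt0 D_lt0; lra.
have Ev : 0 < - D v by rewrite oppr_gt0 D_lt0; lra.
have uxp : 0 < u - x by lra.
have vxp : 0 < v - x by lra.
have up : 0 < u - a1 by lra.
have vp : 0 < v - a1 by lra.
move: hv hu; set gu := m * - D u - _; set gv := m * - D v - _ => kv ku.
have gup : 0 < gu by rewrite -(pmulr_rgt0 _ uxp) -ku !mulr_gt0.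
have gvp : 0 < gv by rewrite -(pmulr_rgt0 _ vxp) -kv !mulr_gt0.
have mono : (u - a1) ^+ 2 * - D v < (v - a1) ^+ 2 * - D u.
  have -> : (u - a1) ^+ 2 * - D v = ((u - a1) * (v - a0)) * ((u - a1) * (a2 - v)) by ring.
  have -> : (v - a1) ^+ 2 * - D u = ((v - a1) * (u - a0)) * ((v - a1) * (a2 - u)) by ring.
  have k1 : 0 < (v - u) * (a1 - a0) by apply: mulr_gt0; lra.
  have k2 : 0 < (v - u) * (a2 - a1) by apply: mulr_gt0; lra.
  by apply: ltr_pM; rewrite ?mulr_ge0; lra.
have gl : gv * - D u < gu * - D v.
  have : 0 < (1 - m) * ((v - a1) ^+ 2 * - D u - (u - a1) ^+ 2 * - D v).
    by rewrite mulr_gt0 // subr_gt0.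
  rewrite /gu /gv; move: (- D u) (- D v) => X Y h.
  rewrite -subr_gt0; apply: lt_le_trans h _; rewrite le_eqVlt; apply/orP; left; apply/eqP; ring.
have k3 : (v - x) * (u - a1) < (u - x) * (v - a1).
  have : 0 < (v - u) * (a1 - x) by apply: mulr_gt0; lra.
  lra.
have k4 : ((v - x) * (u - a1)) * (gv * - D u) < ((u - x) * (v - a1)) * (gu * - D v).
  by apply: ltr_pM => //; rewrite mulr_ge0 ?ltW.
move: k4.
have -> : (v - x) * (u - a1) * (gv * - D u) = ((v - x) * gv) * ((u - a1) * - D u) by ring.
have -> : (u - x) * (v - a1) * (gu * - D v) = ((u - x) * gu) * ((v - a1) * - D v) by ring.
rewrite -kv -ku.
have -> : c * (v - a1) * - D v * ((u - a1) * - D u) = c * (u - a1) * - D u * ((v - a1) * - D v) by ring.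
by rewrite ltxx.
Qed.

(** The infinitesimal form of [critical_unique]: the derivative of the cubic is multiplied by (u -
    a1)(- D u) > 0, and [critical_root] eliminates c. *)
Lemma critical_simple x c u : x < a1 -> 0 < c -> P x c u = 0 -> a1 < u -> u < b2 ->
  0 < dcubic a0 b1 a1 b2 a2 x c u.
Proof.
move=> xa c0 Pu a1u ub; have ku := critical_root Pu.
have m0 := mid_ratio_gt0; have m1 := mid_ratio_lt1.
have hs : b1 + b2 = mid_ratio * (a0 + a2) + 2 * (1 - mid_ratio) * a1.
  have := twin_rootE; have /critical_twin -> := hcrit; lra.
have hB := quad_crit u.
have [i1 i2 i3 i4 i5] := hI.
have Eu : 0 < - D u by rewrite oppr_gt0 D_lt0; lra.
have uxp : 0 < u - x by lra.
have up : 0 < u - a1 by lra.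
have G0 : 0 < mid_ratio * - D u - (1 - mid_ratio) * (u - a1) ^+ 2.
  by rewrite -(pmulr_rgt0 _ uxp) -ku !mulr_gt0.
have yE : 0 < (u - a1) * - D u by apply: mulr_gt0.
rewrite -(pmulr_rgt0 _ yE).
have -> : dcubic a0 b1 a1 b2 a2 x c u = B u + (u - x) * (2 * u - (b1 + b2)) -
   c * (D u + (u - a1) * (2 * u - a0 - a2)).
  by rewrite /dcubic /vieta2 /vieta1 /quadB; ring.
rewrite hB hs.
set G := mid_ratio * - D u - _ in ku G0.
have -> : (u - a1) * - D u * (mid_ratio * D u + (1 - mid_ratio) * (u - a1) ^+ 2 +
    (u - x) * (2 * u - (mid_ratio * (a0 + a2) + 2 * (1 - mid_ratio) * a1)) -
    c * (D u + (u - a1) * (2 * u - a0 - a2))) =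
  - D u * ((u - a1) * - G + (u - a1) * (u - x) * (2 * u - (mid_ratio * (a0 + a2) + 2 * (1 - mid_ratio) * a1)) + c * (u - a1) * - D u)
   - (u - a1) * (2 * u - a0 - a2) * (c * (u - a1) * - D u).
  by rewrite /G; ring.
rewrite ku.
have -> : - D u * ((u - a1) * - G + (u - a1) * (u - x) * (2 * u - (mid_ratio * (a0 + a2) + 2 * (1 - mid_ratio) * a1)) + (u - x) * G)
   - (u - a1) * (2 * u - a0 - a2) * ((u - x) * G) =
  - D u * ((a1 - x) * G) + (u - x) * (1 - mid_ratio) * (u - a1) ^+ 2 *
   ((a1 - a0) * (a2 - u) + (u - a0) * (a2 - a1)).
  by rewrite /G; ring.
have k1 : 0 < (a1 - a0) * (a2 - u) + (u - a0) * (a2 - a1).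
  by rewrite addr_gt0 // mulr_gt0; lra.
have k2 : 0 < 1 - mid_ratio by rewrite subr_gt0.
have k3 : 0 < a1 - x by rewrite subr_gt0.
by apply: addr_gt0; apply: mulr_gt0 => //; apply: mulr_gt0 => //; rewrite ?exprn_gt0 ?mulr_gt0.
Qed.

(** Suppose the three roots are real. By the sign of the cubic, a root outside (a1, b2) lies in (a0,
    a1), where [frozen_below] applies, or left of a0 or right of a2, where [frozen_above] applies.
    If r1 and r2 both lie in (a1, b2), they coincide by [critical_unique], and a multiple root
    contradicts [critical_simple]. *)
Lemma trichotomy_left x c : a0 < x -> x < a1 -> 0 < c -> c < 1 ->
  [\/ liquid a0 b1 a1 b2 a2 x c,
      forall c', 0 <= c' -> c' < c -> frozen a0 b1 a1 b2 a2 x c' |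
      forall c', c < c' -> c' < 1 -> frozen a0 b1 a1 b2 a2 x c'].
Proof.
move=> x0 x1 c0 c1; have [i1 i2 i3 i4 i5] := hI.
case: (@cubic_real_or_liquid a0 b1 a1 b2 a2 x c) => //; first by apply: Or31.
move=> [r1 [r2 [r3 [/andP[r1l r1r] e2 e1 e0]]]].
have root w : w = r1 \/ w = r2 \/ w = r3 -> P x c w = 0.
  by rewrite cubicE e2 e1 e0; case=> [->|[->|->]]; ring.
have far w : P x c w = 0 -> a1 < w < b2 \/ 
  [\/ liquid a0 b1 a1 b2 a2 x c,
      forall c', 0 <= c' -> c' < c -> frozen a0 b1 a1 b2 a2 x c' |
      forall c', c < c' -> c' < 1 -> frozen a0 b1 a1 b2 a2 x c'].
  move=> Pw.
  have [wa0|wa0|e] := ltgtP w a0.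
  - by right; apply: Or33; apply: (frozen_above hI c0 _ Pw); left.
  - have [wa1|wa1|e] := ltgtP w a1.
    + by right; apply: Or32; apply: (frozen_below hI x0 x1 c0 c1 wa0 wa1 Pw).
    + have [wb2|wb2] := ltP w b2; first by left; apply/andP.
      right; have [wa2|wa2|e] := ltgtP w a2.
      * have : 0 < P x c w.
          rewrite /cubic subr_gt0 (@lt_le_trans _ _ 0) //.
            by rewrite pmulr_rlt0 // (cubA_lt0 hI).
          by rewrite mulr_ge0 ?mulr_ge0; lra.
        by rewrite Pw ltxx.
      * by apply: Or33; apply: (frozen_above hI c0 _ Pw); right.
      * have : 0 < P x c w.
          rewrite /cubic e /cubA subrr mulr0 mulr0 subr0 mulr_gt0 ?(quadB_gt0r hI) //; lra.
        by rewrite Pw ltxx.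
    + have : P x c w < 0.
        rewrite /cubic e /cubA subrr mulr0 mul0r mulr0 subr0 pmulr_rlt0 ?(quadB_lt0 hI) //; lra.
      by rewrite Pw ltxx.
  - have : P x c w < 0.
      rewrite /cubic e /cubA subrr mul0r mul0r mulr0 subr0 nmulr_rlt0 ?(quadB_gt0l hI) //; lra.
    by rewrite Pw ltxx.
have P1 : P x c r1 = 0 by apply: root; left.
have P2 : P x c r2 = 0 by apply: root; right; left.
have P3 : P x c r3 = 0 by apply: root; right; right.
case: (far r1 P1) => // /andP[r1a r1b].
case: (far r2 P2) => // /andP[r2a r2b].
have [lt|gt|eq] := ltgtP r1 r2.
- by case: (@critical_unique x c r1 r2).
- by case: (@critical_unique x c r2 r1).
have := critical_simple x1 c0 P1 r1a r1b; rewrite /dcubic e2 e1 eq.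
have -> : 3 * (1 - c) * r2 ^+ 2 - 2 * ((1 - c) * (r2 + r2 + r3)) * r2 +
  (1 - c) * (r2 * r2 + r2 * r3 + r2 * r3) = 0 by ring.
by rewrite ltxx.
Qed.

(** The cubic is (u - a1)(B - c D). Up to c = [mid_ratio] the root a1 is frozen for every smaller
    parameter. Beyond it, [quad_crit] makes B - c D positive on [a0, a2], so a real root lies
    outside and [frozen_above] applies. *)
Lemma trichotomy_center c : 0 < c -> c < 1 ->
  [\/ liquid a0 b1 a1 b2 a2 a1 c,
      forall c', 0 <= c' -> c' < c -> frozen a0 b1 a1 b2 a2 a1 c' |
      forall c', c < c' -> c' < 1 -> frozen a0 b1 a1 b2 a2 a1 c'].
Proof.
move=> c0 c1; have [i1 i2 i3 i4 i5] := hI; have m1 := mid_ratio_lt1.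
have Da : D a1 < 0 by apply: D_lt0; lra.
have hs : b1 + b2 = mid_ratio * (a0 + a2) + 2 * (1 - mid_ratio) * a1.
  have := twin_rootE; have /critical_twin -> := hcrit; lra.
have [cm|cm] := leP c mid_ratio.
  apply: Or32 => c' c'0 c'c; exists a1; split.
    by rewrite /cubic /cubA !subrr; ring.
  have -> : dcubic a0 b1 a1 b2 a2 a1 c' a1 = (mid_ratio - c') * D a1.
    have -> : dcubic a0 b1 a1 b2 a2 a1 c' a1 = B a1 - c' * D a1.
      by rewrite /dcubic /vieta2 /vieta1 /quadB; ring.
    by rewrite mid_ratioE; ring.
  rewrite nmulr_rgt0 ?(quadB_lt0 hI) // pmulr_rlt0 // subr_gt0; exact: lt_le_trans cm.
pose s := 1 - c; have s0 : 0 < s by rewrite subr_gt0.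
pose e := b1 + b2 - c * (a0 + a2); pose f := b1 * b2 - c * (a0 * a2).
have [hd|hd] := ltP (e ^+ 2) (4 * s * f); first by apply: Or31; apply: liquid_center.
pose d := Num.sqrt (e ^+ 2 - 4 * s * f).
have d2 : d ^+ 2 = e ^+ 2 - 4 * s * f by rewrite sqr_sqrtr // subr_ge0.
pose w := (e + d) / (2 * s).
have qw : B w - c * D w = 0.
  have sn : s != 0 by rewrite gt_eqF.
  have -> : B w - c * D w = s * w ^+ 2 - e * w + f by rewrite /quadB /s /e /f; ring.
  have -> : f = (e ^+ 2 - d ^+ 2) / (4 * s) by rewrite d2; field.
  by rewrite /w; move: (e) (d) (s) sn => e' d' s' sn; field.
have Pw : P a1 c w = 0.
  have -> : P a1 c w = (w - a1) * (B w - c * D w) by rewrite /cubic /cubA; ring.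
  by rewrite qw mulr0.
apply: Or33; apply: (frozen_above hI c0 _ Pw).
have [wl|wl] := ltP w a0; first by left.
have [wr|wr] := ltP a2 w; first by right.
exfalso; move: qw; rewrite quad_crit => qw.
have h1 : 0 <= (c - mid_ratio) * - D w.
  by rewrite mulr_ge0 // ?oppr_ge0 ?mulr_ge0_le0; lra.
have h2 : 0 <= (1 - mid_ratio) * (w - a1) ^+ 2 by rewrite mulr_ge0 ?sqr_ge0 //; lra.
have e2 : (1 - mid_ratio) * (w - a1) ^+ 2 = 0 by lra.
have wa : w = a1.
  move/eqP: e2; rewrite mulf_eq0 subr_eq0 (gt_eqF m1) /= sqrf_eq0 subr_eq0.
  by move=> /eqP.
have : 0 < (c - mid_ratio) * - D a1 by rewrite mulr_gt0 ?oppr_gt0 //; lra.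
rewrite wa in qw e2; lra.
Qed.

End Trich.
End Critical.

(** The parameter is c = 1 - s, so the cases read: liquid at time s, frozen at all later times up to
    1, frozen at all earlier positive times. *)
Lemma trichotomy (a0 b1 a1 b2 a2 x c : R) : interlaced a0 b1 a1 b2 a2 ->
  critical a0 b1 a1 b2 a2 -> a0 < x -> x < a2 -> 0 < c -> c < 1 ->
  [\/ liquid a0 b1 a1 b2 a2 x c,
      forall c', 0 <= c' -> c' < c -> frozen a0 b1 a1 b2 a2 x c' |
      forall c', c < c' -> c' < 1 -> frozen a0 b1 a1 b2 a2 x c'].
Proof.
move=> hI hc x0 x2 c0 c1; have [xa|xa|->] := ltgtP x a1.
- exact: trichotomy_left.
- have hI' := interlaced_mirror hI; have /critical_mirror hc' := hc.
  case: (@trichotomy_left _ _ _ _ _ hI' hc' (- x) c) => //; rewrite ?ltrN2 //.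
  + by move=> /liquid_mirror; apply: Or31.
  + by move=> h; apply: Or32 => c' h1 h2; apply: frozen_mirror; apply: h.
  + by move=> h; apply: Or33 => c' h1 h2; apply: frozen_mirror; apply: h.
- exact: trichotomy_center.
Qed.

End Trichotomy.

(** * The noncritical case: a frozen band between liquid times *)

Section FlatBand.
Context {R : realType}.

(* At c = mid_ratio, x = a1 the cubic has a double root at a1, which becomes a nonreal
   pair for x slightly below a1; for c slightly above, two real roots survive between
   a1 and twin_root. *)
Lemma flat_band_left (a0 b1 a1 b2 a2 : R) : interlaced a0 b1 a1 b2 a2 ->
  a1 < twin_root a0 b1 a1 b2 a2 ->
  exists cm cp d0, [/\ mid_ratio a0 b1 a1 b2 a2 < cm, cm < cp, cp < top_ratio a0 b1 b2 a2, 0 < d0 &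
    forall d, 0 < d -> d < d0 -> [/\ a0 < a1 - d,
      forall c, cm <= c <= cp -> frozen a0 b1 a1 b2 a2 (a1 - d) c &
      liquid a0 b1 a1 b2 a2 (a1 - d) (mid_ratio a0 b1 a1 b2 a2)]].
Proof.
move=> hI; have [i1 i2 i3 i4 i5] := hI.
have m0 := mid_ratio_gt0 hI; have m1 := mid_ratio_lt1 hI.
have m1t := top_ratio_lt1 hI.
have qt := quad_twin hI; have qtop := top_quad_gt0 hI; have te := twin_rootE hI.
move: (mid_ratio _ _ _ _ _) (top_ratio _ _ _ _) (twin_root _ _ _ _ _) m0 m1 m1t qt qtop te.
move=> c0 ct y c00 c01 ct1 qt qtop te ay.
pose D u := (u - a0) * (u - a2).
have Dneg u : a0 < u -> u < a2 -> D u < 0 by move=> *; apply: D_lt0.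
pose B := quadB b1 b2.
have {}qt u : B u = c0 * D u + (1 - c0) * ((u - a1) * (u - y)) by apply: qt.
have {}qtop u : ct * D u < B u by apply: qtop.
have s0 : 0 < 1 - c0 by rewrite subr_gt0.
have PE d c u : cubic a0 b1 a1 b2 a2 (a1 - d) c u = (u - a1) * (B u - c * D u) + d * B u.
  by rewrite /cubic /cubA /B /D; ring.
have yb : y < b2.
  have h : 0 < (1 - c0) * ((b2 - a1) * (b2 - y)).
    have := qt b2; rewrite {1}/B /quadB subrr mulr0.
    have : c0 * D b2 < 0 by rewrite pmulr_rlt0 // Dneg; lra.
    lra.
  by move: h; rewrite pmulr_rgt0 // pmulr_rgt0 ?subr_gt0.
pose g := y - a1; have g0 : 0 < g by rewrite subr_gt0.
pose ys := (a1 + y) / 2.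
have ysE : ys = a1 + g / 2 by rewrite /ys /g; lra.
have ys1 : a1 < ys by lra.
have ys2 : ys < y by rewrite /g in ysE; lra.
pose E := - D ys; have E0 : 0 < E by rewrite oppr_gt0 Dneg; lra.
(* At [ys], halfway to the twin root, B - c D equals (c - c0 - m) E, so it stays negative until c
   reaches c0 + m. *)
pose m := (1 - c0) * g ^+ 2 / (4 * E).
have mp : 0 < m by rewrite divr_gt0 ?mulr_gt0 ?exprn_gt0.
pose cm := c0 + m / 4; pose cp := c0 + m / 2.
have Bys : B ys = - (c0 * E) - (1 - c0) * g ^+ 2 / 4.
  by rewrite qt /E ysE /g; field.
have mE : m * E = (1 - c0) * g ^+ 2 / 4 by rewrite /m; field; rewrite gt_eqF.
have qs c : c <= cp -> B ys - c * D ys < 0.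
  move=> hc; have -> : c * D ys = - (c * E) by rewrite /E; ring.
  have h1 : c * E <= cp * E by rewrite ler_pM2r.
  have h2 : 0 < m * E by rewrite mulr_gt0.
  rewrite /cp mulrDl in h1; rewrite Bys -mE; lra.
have cpt : cp < ct.
  rewrite ltNge; apply/negP => /qs; have := qtop ys; lra.
have cmp : cm < cp by rewrite /cm /cp; lra.
pose Em := (a1 - a0) * (a2 - ys); have Em0 : 0 < Em by rewrite mulr_gt0; lra.
(* [y1] = a1 + ep is so close to a1 that B - c D, about (c - c0) times - D there, is positive from c
   = [cm] on; [Em] is a lower bound for - D at [y1]. *)
pose ep := Num.min (g / 4) (m * Em / (8 * ((1 - c0) * g))).
have sg0 : 0 < (1 - c0) * g by rewrite mulr_gt0.
have ep0 : 0 < ep.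
  by rewrite lt_min; apply/andP; split; apply: divr_gt0 => //; apply: mulr_gt0.
have ep1 : ep <= g / 4 by rewrite ge_min lexx.
have ep2 : (1 - c0) * g * ep <= m * Em / 8.
  have -> : m * Em / 8 = (1 - c0) * g * (m * Em / (8 * ((1 - c0) * g))).
    by field; rewrite !gt_eqF.
  by rewrite ler_pM2l // ge_min lexx orbT.
pose y1 := a1 + ep.
have y1a : a1 < y1 by rewrite /y1; lra.
have y1s : y1 < ys by rewrite /y1 ysE; lra.
have E1 : Em <= - D y1.
  have -> : - D y1 = (y1 - a0) * (a2 - y1) by rewrite /D; ring.
  by rewrite /Em; clear -i1 i2 i3 i4 y1a y1s ys1 ys2 yb; apply: ler_pM; lra.
pose ka := B y1 - cm * D y1.
have ka0 : 0 < ka.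
  have -> : ka = (1 - c0) * (ep * (ep - g)) + m / 4 * - D y1.
    by rewrite /ka qt /cm /y1 /g; ring.
  have h1 : m / 4 * Em <= m / 4 * - D y1 by rewrite ler_pM2l // divr_gt0.
  have h2 : 0 < m * Em by rewrite mulr_gt0.
  have h3 : 0 <= (1 - c0) * (ep * ep) by rewrite !mulr_ge0 ?ltW.
  lra.
have kac c : cm <= c -> ka <= B y1 - c * D y1.
  move=> hc; rewrite /ka lerD2l lerN2 ler_wnM2r //.
  by apply: ltW; apply: Dneg; clear -i1 i2 i3 i4 y1a y1s ys2 yb; lra.
have By1 : B y1 < 0 by apply: (quadB_lt0 hI); lra.
(* The first bound on d keeps the cubic positive at [y1], the second keeps it negative left of b1 in
   [rooty], and the third keeps x to the right of a0. *)
exists cm, cp, (Num.min (ep * ka / - B y1)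
   (Num.min ((1 - c0) * g * (a1 - b1) / (b2 - b1)) (a1 - a0))).
split => //; first by rewrite /cm; lra.
  rewrite !lt_min; apply/and3P; split; last lra.
    by apply: divr_gt0; rewrite ?oppr_gt0 //; apply: mulr_gt0.
  by apply: divr_gt0; last lra; apply: mulr_gt0 => //; lra.
move=> d dp; rewrite !lt_min => /and3P[d1 d2 d3].
have Ba1 : B a1 < 0 by apply: (quadB_lt0 hI).
split; first lra.
- move=> c /andP[ccm ccp]; have c1 : c < 1 by lra.
  have sn : 1 - c != 0 by rewrite gt_eqF // subr_gt0.
  have P1 : cubic a0 b1 a1 b2 a2 (a1 - d) c a1 < 0.
    by rewrite PE subrr mul0r add0r pmulr_rlt0.
  have P2 : 0 < cubic a0 b1 a1 b2 a2 (a1 - d) c y1.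
    rewrite PE; have -> : y1 - a1 = ep by rewrite /y1; ring.
    have h1 : ep * ka <= ep * (B y1 - c * D y1) by rewrite ler_pM2l // kac.
    rewrite ltr_pdivlMr ?oppr_gt0 // mulrN in d1; lra.
  have P3 : cubic a0 b1 a1 b2 a2 (a1 - d) c ys < 0.
    rewrite PE; have h1 : (ys - a1) * (B ys - c * D ys) < 0 by rewrite pmulr_rlt0 ?qs ?subr_gt0.
    have h2 : d * B ys < 0.
      by rewrite pmulr_rlt0 //; apply: (quadB_lt0 hI); clear -i2 ys1 ys2 yb; lra.
    clear -h1 h2; lra.
  clearbody y1 ys; clear -hI i1 i2 i3 i4 P1 P2 P3 sn c1 ys1 ys2 y1a y1s yb.
  have [r1 /andP[r1a r1b] Pr1] : exists2 r, a1 < r < y1 & cubic a0 b1 a1 b2 a2 (a1 - d) c r = 0.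
    by apply: cubic_ivt => //; rewrite nmulr_rlt0.
  have [r2 /andP[r2a r2b] Pr2] : exists2 r, y1 < r < ys & cubic a0 b1 a1 b2 a2 (a1 - d) c r = 0.
    by apply: cubic_ivt => //; rewrite pmulr_rlt0.
  have r12 : r1 != r2 by rewrite lt_eqF //; lra.
  have [r3 [e2 e1 e0]] := cubic_two_roots sn r12 Pr1 Pr2.
  have r3b : ys < r3.
    rewrite ltNge; apply/negP => r3b.
    move: P3; rewrite cubicE e2 e1 e0.
    have -> : (1 - c) * ys ^+ 3 - (1 - c) * (r3 + r1 + r2) * ys ^+ 2 +
      (1 - c) * (r3 * r1 + r3 * r2 + r1 * r2) * ys - (1 - c) * (r3 * r1 * r2) =
      (1 - c) * ((ys - r1) * (ys - r2) * (ys - r3)) by ring.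
    rewrite ltNge mulr_ge0 ?subr_ge0 ?(ltW c1) // !mulr_ge0 ?subr_ge0; lra.
  apply: (@frozen_three_roots _ _ _ _ _ _ _ _ r2 r1 r3) => //; rewrite ?e2 ?e1 ?e0; try by ring.
  rewrite nmulr_rgt0; last by apply: (quadB_lt0 hI); lra.
  by rewrite pmulr_rlt0; lra.
(* At c0 the cubic is negative left of y, so three real roots would have sum at least 3 y; but by
   [twin_rootE] their sum would be less than 2 a1 + y. Hence there is a nonreal pair. *)
have rooty w : cubic a0 b1 a1 b2 a2 (a1 - d) c0 w = 0 -> y <= w.
  clear -hI i1 i2 i3 i4 PE qt yb ay g0 s0 dp d2.
  move=> Pw; rewrite leNgt; apply/negP => wy.
  suff : cubic a0 b1 a1 b2 a2 (a1 - d) c0 w < 0 by rewrite Pw ltxx.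
  rewrite PE {1}qt.
  have -> : (w - a1) * (c0 * D w + (1 - c0) * ((w - a1) * (w - y)) - c0 * D w) =
    - ((1 - c0) * (y - w) * (a1 - w) ^+ 2) by ring.
  have [wb|wb] := ltP b1 w.
    have h1 : 0 <= (1 - c0) * (y - w) * (a1 - w) ^+ 2.
      by apply: mulr_ge0; [apply: mulr_ge0; lra|apply: sqr_ge0].
    have : d * B w < 0 by rewrite pmulr_rlt0 //; apply: (quadB_lt0 hI); lra.
    lra.
  rewrite addrC subr_lt0.
  have aw : 0 < a1 - w by lra.
  have bb : 0 < b2 - b1 by lra.
  have h1 : B w * (a1 - b1) <= (b2 - b1) * (a1 - w) ^+ 2.
    have -> : B w * (a1 - b1) = (b1 - w) * ((b2 - w) * (a1 - b1)) by rewrite /B /quadB; ring.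
    have -> : (b2 - b1) * (a1 - w) ^+ 2 = (a1 - w) * ((b2 - b1) * (a1 - w)) by ring.
    have h : 0 <= (b2 - a1) * (b1 - w) by rewrite mulr_ge0; lra.
    by rewrite ler_pM ?mulr_ge0; lra.
  have ab : 0 < a1 - b1 by lra.
  rewrite ltr_pdivlMr // in d2.
  rewrite -(ltr_pM2r ab).
  have k1 : d * B w * (a1 - b1) <= d * (b2 - b1) * (a1 - w) ^+ 2.
    rewrite -[leLHS]mulrA -[leRHS]mulrA ler_pM2l; first exact: h1.
    exact: dp.
  apply: le_lt_trans k1 _.
  have aw2 : 0 < (a1 - w) ^+ 2 by rewrite exprn_gt0.
  have k2 : d * (b2 - b1) * (a1 - w) ^+ 2 < (1 - c0) * g * (a1 - b1) * (a1 - w) ^+ 2.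
    by rewrite ltr_pM2r.
  apply: lt_le_trans k2 _.
  have -> : (1 - c0) * (y - w) * (a1 - w) ^+ 2 * (a1 - b1) =
    (1 - c0) * (y - w) * (a1 - b1) * (a1 - w) ^+ 2 by ring.
  rewrite ler_pM2r // ler_pM2r // ler_pM2l //; rewrite /g; lra.
clear -hI i1 i2 i3 i4 i5 te ay s0 dp c00 c01 rooty.
have [//|[r1 [r2 [r3 [_ e2 e1 e0]]]]] := cubic_real_or_liquid (a1 - d) hI c00 c01.
exfalso.
have root w : w = r1 \/ w = r2 \/ w = r3 -> y <= w.
  by move=> hw; apply: rooty; rewrite cubicE e2 e1 e0; case: hw => [->|[->|->]]; ring.
have h1 : y <= r1 by apply: root; left.
have h2 : y <= r2 by apply: root; right; left.
have h3 : y <= r3 by apply: root; right; right.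
have h4 : (1 - c0) * (y + y + y) <= (1 - c0) * (r1 + r2 + r3) by rewrite ler_pM2l // !lerD.
have h5 : 0 < (1 - c0) * (y - a1) by rewrite mulr_gt0 // subr_gt0.
rewrite /vieta2 in e2; lra.
Qed.

(** The twin root lies on one side of a1, and the band appears over points x on the other side; [sg]
    records that side, the mirrored diagram serving for sg = 1. *)
Lemma flat_band (a0 b1 a1 b2 a2 : R) : interlaced a0 b1 a1 b2 a2 ->
  ~ critical a0 b1 a1 b2 a2 ->
  exists c0 cm cp ct d0 sg, [/\ [/\ 0 < c0, c0 < cm, cm < cp, cp < ct & ct < 1],
    liquid a0 b1 a1 b2 a2 a1 ct, 0 < d0, `|sg| = 1 &
    forall d, 0 < d -> d < d0 -> [/\ a0 < a1 + sg * d < a2,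
      forall c, cm <= c <= cp -> frozen a0 b1 a1 b2 a2 (a1 + sg * d) c &
      liquid a0 b1 a1 b2 a2 (a1 + sg * d) c0]].
Proof.
move=> hI hc; have [i1 i2 i3 i4 i5] := hI.
have [lt|gt|eq] := ltgtP a1 (twin_root a0 b1 a1 b2 a2); last first.
- by case: hc; apply/critical_twin.
- have hI' := interlaced_mirror hI.
  have tE : twin_root (- a2) (- b2) (- a1) (- b1) (- a0) = - twin_root a0 b1 a1 b2 a2.
    have m1 := mid_ratio_lt1 hI.
    have mE : mid_ratio (- a2) (- b2) (- a1) (- b1) (- a0) = mid_ratio a0 b1 a1 b2 a2.
      by rewrite /mid_ratio /quadB; congr (_ / _); ring.
    by rewrite /twin_root mE; field; rewrite subr_eq0 gt_eqF.
  have lt : - a1 < twin_root (- a2) (- b2) (- a1) (- b1) (- a0) by rewrite tE ltrN2.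
  have [cm [cp [d0 [h1 h2 h3 h4 h5]]]] := flat_band_left hI' lt.
  have dp : 0 < Num.min d0 (a1 - a0) by rewrite lt_min h4 subr_gt0; lra.
  exists (mid_ratio (- a2) (- b2) (- a1) (- b1) (- a0)), cm, cp, (top_ratio (- a2) (- b2) (- b1) (- a0)), (Num.min d0 (a1 - a0)), 1.
  rewrite normr1; split => //.
  + by split => //; [exact: (mid_ratio_gt0 hI')|exact: (top_ratio_lt1 hI')].
  + by apply: liquid_mirror; exact: (liquid_top hI').
  + move=> d d00; rewrite lt_min mul1r => /andP[d1 d2].
    have e : - (a1 + d) = - a1 - d by ring.
    have [k1 k2 k3] := h5 d d00 d1; split; first by apply/andP; split; lra.
      by move=> c hcc; apply: frozen_mirror; rewrite e; apply: k2.
    by apply: liquid_mirror; rewrite e.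
- have [cm [cp [d0 [h1 h2 h3 h4 h5]]]] := flat_band_left hI lt.
  exists (mid_ratio a0 b1 a1 b2 a2), cm, cp, (top_ratio a0 b1 b2 a2), d0, (- 1).
  rewrite normrN1; split => //.
  + by split => //; [exact: (mid_ratio_gt0 hI)|exact: (top_ratio_lt1 hI)].
  + exact: (liquid_top hI).
  + move=> d d00 d1; have -> : a1 + -1 * d = a1 - d by ring.
    have [k1 k2 k3] := h5 d d00 d1; split => //; apply/andP; split; lra.
Qed.

End FlatBand.

(** * Flat pieces *)

Section SurfaceCritical.
Context {R : realType}.
Local Notation C := R[i].
Implicit Types (la : seq nat) (H : R -> R -> R).

Lemma frozen_good_root (a0 b1 a1 b2 a2 x s : R) : interlaced a0 b1 a1 b2 a2 ->
  frozen a0 b1 a1 b2 a2 x (1 - s) ->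
  exists2 u, good_root a0 b1 a1 b2 a2 x s u & complex.Im u = 0.
Proof.
move=> hI [u [Pu hu]]; have [i1 i2 i3 i4 i5] := hI.
have Bn : quadB b1 b2 u != 0 by apply/eqP => e; rewrite e mul0r ltxx in hu.
exists u%:C%C => //; split.
- rewrite /denC /numC -!rmorphB -!rmorphM; congr (_%:C%C).
  by move: Pu; rewrite /cubic /quadB /cubA; lra.
- by rewrite /denC -!rmorphB -rmorphM /= fmorph_eq0.
have cm b : cmod (u%:C%C - b%:C%C) ^+ 2 = (u - b) ^+ 2 by rewrite -rmorphB cmod_real real_normK ?num_real.
right; split => //; rewrite /spread !cm.
have Bp : 0 < quadB b1 b2 u ^+ 2 by rewrite lt_neqAle sqr_ge0 eq_sym sqrf_eq0 Bn.
rewrite -(pmulr_rgt0 _ Bp); move: hu; congr (0 < _).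
have eA : (u - x) * quadB b1 b2 u = (1 - s) * cubA a0 a1 a2 u by move: Pu; rewrite /cubic; lra.
have -> : dcubic a0 b1 a1 b2 a2 x (1 - s) u = quadB b1 b2 u + (u - x) * (2 * u - (b1 + b2)) -
   (1 - s) * ((u - a0) * (u - a1) + (u - a0) * (u - a2) + (u - a1) * (u - a2)).
  by rewrite /dcubic /vieta2 /vieta1 /quadB; ring.
have -> : quadB b1 b2 u * (quadB b1 b2 u + (u - x) * (2 * u - (b1 + b2)) -
   (1 - s) * ((u - a0) * (u - a1) + (u - a0) * (u - a2) + (u - a1) * (u - a2))) =
   quadB b1 b2 u ^+ 2 + ((u - x) * quadB b1 b2 u) * (2 * u - (b1 + b2)) -
   (1 - s) * (quadB b1 b2 u * ((u - a0) * (u - a1) + (u - a0) * (u - a2) + (u - a1) * (u - a2))).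
  by ring.
rewrite eA; move: Bn; rewrite /quadB mulf_eq0 negb_or => /andP[n1 n2].
have e1 : a1 = b1 + b2 - a0 - a2 by lra.
rewrite e1 /mass1 /mass2 /cubA; field.
rewrite n1 n2 /= subr_eq0 gt_eqF //; lra.
Qed.

Lemma liquid_good_root (a0 b1 a1 b2 a2 x s : R) : 0 < s ->
  liquid a0 b1 a1 b2 a2 x (1 - s) ->
  exists2 u, good_root a0 b1 a1 b2 a2 x s u & 0 < complex.Im u.
Proof.
move=> s0 [r [e [f [e2 e1 e0 hd]]]].
have ss : 1 - (1 - s) = s by ring.
rewrite ss in e2 hd.
pose d := Num.sqrt (4 * s * f - e ^+ 2).
have d0 : 0 < d by rewrite sqrtr_gt0 subr_gt0.
have d2 : d ^+ 2 = 4 * s * f - e ^+ 2 by rewrite sqr_sqrtr // ltW // subr_gt0.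
have sn : s != 0 by rewrite gt_eqF.
(* The root of s w^2 + e w + f in the upper half-plane. *)
pose u : C := Complex (- e / (2 * s)) (d / (2 * s)).
have iu : 0 < complex.Im u by rewrite /= divr_gt0 // mulr_gt0.
have un b : u - b%:C%C != 0.
  apply/eqP => h; move: iu; have : complex.Im (u - b%:C%C) = 0 by rewrite h.
  by rewrite cImD cImN /= subr0 => ->; rewrite ltxx.
have qu : s%:C%C * u * u + e%:C%C * u + f%:C%C = 0.
  have fE : f = (d ^+ 2 + e ^+ 2) / (4 * s) by rewrite d2; field.
  rewrite fE /u; move: (d) sn => d' sn; apply: complex_eq; rewrite /=; field; exact: sn.
exists u => //; split; last by left.
  have k2 : x%:C%C + b1%:C%C + b2%:C%C - (1 - s)%:C%C * (a0%:C%C + a1%:C%C + a2%:C%C) =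
    s%:C%C * r%:C%C - e%:C%C :> C by rewrite -!rmorphD -!rmorphM -!rmorphB /= -e2.
  have k1 : x%:C%C * b1%:C%C + x%:C%C * b2%:C%C + b1%:C%C * b2%:C%C
     - (1 - s)%:C%C * (a0%:C%C * a1%:C%C + a0%:C%C * a2%:C%C + a1%:C%C * a2%:C%C) =
     f%:C%C - e%:C%C * r%:C%C :> C by rewrite -!rmorphM -!rmorphD -!rmorphM -!rmorphB /= -e1.
  have k0 : x%:C%C * b1%:C%C * b2%:C%C - (1 - s)%:C%C * (a0%:C%C * a1%:C%C * a2%:C%C) =
     f%:C%C * r%:C%C :> C by rewrite -!rmorphM -!rmorphB /= -e0.
  have k3 : (1 - s)%:C%C = 1 - s%:C%C :> C by rewrite rmorphB /= rmorph1.
  apply/eqP; rewrite -subr_eq0; apply/eqP.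
  transitivity ((u - r%:C%C) * (s%:C%C * u * u + e%:C%C * u + f%:C%C)); last by rewrite qu mulr0.
  transitivity ((1 - (1 - s)%:C%C) * u ^+ 3 -
     (x%:C%C + b1%:C%C + b2%:C%C - (1 - s)%:C%C * (a0%:C%C + a1%:C%C + a2%:C%C)) * u ^+ 2 +
     (x%:C%C * b1%:C%C + x%:C%C * b2%:C%C + b1%:C%C * b2%:C%C
     - (1 - s)%:C%C * (a0%:C%C * a1%:C%C + a0%:C%C * a2%:C%C + a1%:C%C * a2%:C%C)) * u -
     (x%:C%C * b1%:C%C * b2%:C%C - (1 - s)%:C%C * (a0%:C%C * a1%:C%C * a2%:C%C))).
    rewrite /denC /numC; move: (1 - s)%:C%C => c; ring.
  by rewrite k2 k1 k0 k3; ring.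
by rewrite /denC mulf_neq0.
Qed.

Section Criterion.
Variables (la : seq nat) (H : R -> R -> R) (a0 b1 a1 b2 a2 : R).
Hypotheses (hd : dilation_data la a0 b1 a1 b2 a2) (hlim : is_limiting_height la a0 a2 H).
Local Notation U := (unscaled H la).

Lemma profile_frozen_const x c1 c2 : a0 <= x <= a2 -> 0 <= c1 -> c1 <= c2 -> c2 < 1 ->
  (forall c, c1 <= c <= c2 -> frozen a0 b1 a1 b2 a2 x c) -> U x (1 - c2) = U x (1 - c1).
Proof.
move=> hx c10 c12 c21 h; apply: (profile_const hd hlim hx); try lra.
move=> s /andP[s1 s2]; apply: frozen_good_root; first by case: hd.
by apply: h; apply/andP; split; lra.
Qed.

Lemma profile_liquid_lt x c : a0 <= x <= a2 -> 0 < c -> c < 1 -> liquid a0 b1 a1 b2 a2 x c ->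
  forall t1 t2, 0 <= t1 -> t2 <= 1 -> t1 <= 1 - c -> 1 - c <= t2 -> t1 < t2 -> U x t1 < U x t2.
Proof.
move=> hx c0 c1 hl t1 t2 t10 t21 t1c t2c t12.
have s0 : 0 < 1 - c by lra.
have s1 : 1 - c <= 1 by lra.
have [|u gu iu] := @liquid_good_root a0 b1 a1 b2 a2 x (1 - c) s0.
  by have -> : 1 - (1 - c) = c by ring.
have [del d0 hdel] := profile_liquid hd hlim hx s0 s1 gu iu.
pose v1 := Num.max ((t1 + (1 - c)) / 2) (1 - c - del / 2).
pose v2 := Num.min t2 (1 - c + del / 2).
have v1t : t1 <= v1 by rewrite le_max; apply/orP; left; lra.
have v2t : v2 <= t2 by rewrite ge_min lexx.
have v1d : 1 - c - del < v1 by rewrite lt_max; apply/orP; right; lra.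
have v2d : v2 < 1 - c + del by rewrite gt_min; apply/orP; right; lra.
have v1c : v1 <= 1 - c by rewrite ge_max; apply/andP; split; lra.
have v2c : 1 - c <= v2 by rewrite le_min; apply/andP; split; lra.
have v1p : 0 < v1 by rewrite lt_max; apply/orP; left; lra.
have v12 : v1 < v2.
  rewrite lt_min !gt_max; apply/andP; split; apply/andP; split; lra.
apply: (@le_lt_trans _ _ (U x v1)); first by apply: (profile_mono hd hlim hx); lra.
apply: (@lt_le_trans _ _ (U x v2)); last by apply: (profile_mono hd hlim hx); lra.
by apply: hdel => //; lra.
Qed.

(** The middle of a flat piece is not liquid. If all later times are frozen, the height there is
    already that of time 1. If all earlier times are frozen, the piece reaches down to times near 0,
    where [profile_small] makes the height too small. *)
Lemma no_flat x t1 t2 : critical a0 b1 a1 b2 a2 -> a0 < x -> x < a2 -> 0 <= t1 ->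
  t1 < t2 -> t2 <= 1 -> U x t1 = U x t2 -> 0 < U x t1 -> U x t2 < U x 1 -> False.
Proof.
move=> hc x0 x2 t10 t12 t21 e12 p1 p2.
have hI : interlaced a0 b1 a1 b2 a2 by case: hd.
have hx : a0 <= x <= a2 by apply/andP; split; lra.
pose c := 1 - (t1 + t2) / 2.
have c0 : 0 < c by rewrite /c; lra.
have c1 : c < 1 by rewrite /c; lra.
case: (trichotomy hI hc x0 x2 c0 c1) => [hl|hb|ha].
- have : U x t1 < U x t2 by apply: (profile_liquid_lt hx c0 c1 hl) => //; rewrite /c; lra.
  by rewrite e12 ltxx.
- have : U x (1 - (c + (1 - t2)) / 2) = U x (1 - 0).
    apply: profile_frozen_const => //; rewrite /c; try lra.
    by move=> c' /andP[k1 k2]; apply: hb => //; rewrite /c; lra.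
  rewrite subr0 => e.
  have : U x (1 - (c + (1 - t2)) / 2) <= U x t2.
    by apply: (profile_mono hd hlim hx); rewrite /c; lra.
  by rewrite e leNgt p2.
pose c' := (c + (1 - t1)) / 2.
have e0 : 0 < U x t1 / 2 by rewrite divr_gt0.
have [tau tau0 htau] := profile_small hd hlim e0.
pose c2 := Num.max c' (1 - tau / 2).
have c'c2 : c' <= c2 by rewrite le_max lexx.
have c2t : 1 - tau / 2 <= c2 by rewrite le_max lexx orbT.
have c'1 : c' < 1 by rewrite /c' /c; lra.
have c21 : c2 < 1 by rewrite gt_max c'1 /=; lra.
have c'0 : 0 <= c' by rewrite /c' /c; lra.
have e : U x (1 - c2) = U x (1 - c').
  apply: profile_frozen_const => // d /andP[k1 k2]; apply: ha; last lra.
  by apply: lt_le_trans k1; rewrite /c' /c; lra.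
have h1 : U x (1 - c2) <= U x t1 / 2 by apply: htau => //; [apply/andP; split; lra|lra].
have h2 : U x t1 <= U x (1 - c') by apply: (profile_mono hd hlim hx); rewrite /c' /c; lra.
lra.
Qed.

(** The liquid time 1 - ct over a1 comes before the band and makes the height over a1 positive at
    its start; the Lipschitz bound carries this to x close to a1. The liquid time 1 - c0 over x
    comes after the band, so the flat height is below the final one. *)
Lemma exists_flat : ~ critical a0 b1 a1 b2 a2 -> exists x t1 t2,
  [/\ a0 <= x <= a2, 0 <= t1, t1 < t2 & t2 <= 1] /\
  [/\ U x t1 = U x t2, 0 < U x t1 & U x t2 < U x 1].
Proof.
move=> hc; have hI : interlaced a0 b1 a1 b2 a2 by case: hd.
have [i1 i2 i3 i4 i5] := hI.
have [c0 [cm [cp [ct [d0 [sg [[k1 k2 k3 k4 k5] hl d00 sg1 hb]]]]]]] := flat_band hI hc.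
have ha1 : a0 <= a1 <= a2 by apply/andP; split; lra.
have Up : 0 < U a1 (1 - cp).
  apply: (@le_lt_trans _ _ (U a1 0)).
    by apply: (profile_ge0 hd hlim ha1); rewrite lexx ler01.
  by apply: (profile_liquid_lt ha1 _ k5 hl); lra.
pose d := Num.min (d0 / 2) (U a1 (1 - cp) / 2).
have dp : 0 < d by rewrite lt_min; apply/andP; split; apply: divr_gt0.
have dd0 : d < d0 by rewrite gt_min; apply/orP; left; lra.
have dU : d <= U a1 (1 - cp) / 2 by rewrite ge_min lexx orbT.
have [/andP[x0 x2] hf hl0] := hb d dp dd0.
exists (a1 + sg * d), (1 - cp), (1 - cm).
have hx : a0 <= a1 + sg * d <= a2 by apply/andP; split; lra.
split; first by split => //; lra.
have e : U (a1 + sg * d) (1 - cp) = U (a1 + sg * d) (1 - cm).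
  by apply: profile_frozen_const => //; lra.
split => //.
  have ht : 0 <= 1 - cp <= 1 by apply/andP; split; lra.
  have := profile_lip hd hlim ha1 hx ht.
  have -> : a1 - (a1 + sg * d) = - (sg * d) by ring.
  rewrite normrN normrM sg1 mul1r (gtr0_norm dp); lra.
by apply: (profile_liquid_lt hx k1 _ hl0); lra.
Qed.

Lemma surface_critical (D : set (R * R)) :
  (forall P, D P <-> eta la * a0 <= P.1 <= eta la * a2 /\ 0 < (P.2 - `|P.1|) / 2 < H P.1 1) ->
  (forall x, a0 <= x <= a2 -> 0 < U x 1 -> a0 < x < a2) ->
  surface_defined_continuous H D <-> critical a0 b1 a1 b2 a2.
Proof.
move=> hD htop; have N00 := dilation_size_gt0 hd.
have eta0 : 0 < eta la :> R by rewrite invr_gt0 sqrtr_gt0 ltr0n.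
have etan : eta la != 0 :> R by rewrite gt_eqF.
have HU X t : H X t = eta la * U (X / eta la) t.
  by rewrite /unscaled mulrCA mulfV // mulr1 mulrCA mulfV // mulr1.
have hX X : (eta la * a0 <= X <= eta la * a2) = (a0 <= X / eta la <= a2).
  by rewrite (ler_pdivlMr _ _ eta0) (ler_pdivrMr _ _ eta0) (mulrC _ a0) (mulrC _ a2).
apply: (iff_trans (surface_criterion hD _ _ _)).
- move=> X t1 t2; rewrite hX => h t10 t12 t21; rewrite !HU ler_pM2l //.
  exact: (profile_mono hd hlim h).
- move=> X; rewrite hX HU => h; apply/ler_addgt0Pr => e e0; rewrite add0r.
  have e1 : 0 < e / eta la by rewrite divr_gt0.
  have [tau tau0 htau] := profile_small hd hlim e1.
  rewrite mulrC -(ler_pdivlMr _ _ eta0).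
  have z01 : 0 <= (0 : R) <= 1 by rewrite lexx ler01.
  exact: (htau _ _ h z01 tau0).
- move=> X X' t; rewrite !hX => h1 h2 ht; rewrite !HU.
  have := profile_lip hd hlim h1 h2 ht.
  have etaV : 0 < (eta la)^-1 :> R by rewrite invr_gt0; exact: eta0.
  rewrite -mulrBl normrM (gtr0_norm etaV) => h.
  have : eta la * U (X / eta la) t <= eta la * (U (X' / eta la) t + `|X - X'| / eta la).
    by rewrite ler_pM2l.
  by rewrite mulrDr (mulrC (eta la) (`|_| / _)) divfK.
split=> [hflat|hc X t1 t2]; last first.
  rewrite hX !HU => h t10 t12 t21 /(mulfI etan) e12; rewrite pmulr_rgt0 // ltr_pM2l // => p1 p2.
  have /andP[x0 x2] : a0 < X / eta la < a2.
    apply: htop => //; apply: lt_trans p2; by rewrite -e12.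
  exact: (no_flat hc x0 x2 t10 t12 t21 e12 p1 p2).
apply: contrapT => /exists_flat [x [t1 [t2 [[hx t10 t12 t21] [e12 p1 p2]]]]].
have xE : eta la * x / eta la = x by rewrite mulrC mulKf.
apply: (hflat (eta la * x) t1 t2) => //; rewrite ?hX ?HU xE ?e12 //.
- by rewrite pmulr_rgt0 // -e12.
- by rewrite ltr_pM2l.
Qed.

End Criterion.
End SurfaceCritical.

(** * Diagrams with two blocks of rows *)

Section Boundary.
Context {R : realType}.
Implicit Types (la : seq nat) (x y : R).

(** In the coordinates y - x and x + y the square of a box is a product of two intervals of length
    2, indexed by its row and its column. *)
Lemma regionP la x y : region la (x, y) <-> exists i j : nat, [/\ (j < nth 0 la i)%N,
  2 * i%:R <= y - x <= 2 * i.+1%:R & 2 * j%:R <= x + y <= 2 * j.+1%:R].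
Proof.
have cell (i j : nat) : `|x - (box_at i j).1%:~R| + `|y - (box_at i j).2%:~R| <= 1 <->
   2 * i%:R <= y - x <= 2 * i.+1%:R /\ 2 * j%:R <= x + y <= 2 * j.+1%:R.
  have e1 : (box_at i j).1%:~R = j%:R - i%:R :> R by rewrite /= rmorphB.
  have e2 : (box_at i j).2%:~R = i%:R + j%:R + 1 :> R by rewrite /= -natrD natr1.
  rewrite e1 e2 -!natr1; split.
    have := ler_norm (x - (j%:R - i%:R)); have := ler_norm (- (x - (j%:R - i%:R))).
    have := ler_norm (y - (i%:R + j%:R + 1)); have := ler_norm (- (y - (i%:R + j%:R + 1))).
    rewrite !normrN => *; split; apply/andP; split; lra.
  move=> [/andP[? ?] /andP[? ?]].
  by case: (ger0P (x - (j%:R - i%:R))) => ?; case: (ger0P (y - (i%:R + j%:R + 1))) => ?; lra.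
split=> [[b /mem_boxesP[i [j [hj ->]]]] /cell[h1 h2]|[i [j [hj h1 h2]]]].
  by exists i, j.
by exists (box_at i j); [rewrite box_at_boxes|apply/cell].
Qed.

(** The upper boundary of the rectangle formed by rows 0 to i, all cut to the length of row i. A
    diagram is the union of these rectangles, so [omega] is the maximum of |x| and of the
    [row_height]. *)
Definition row_height la x (i : nat) : R :=
  Num.min (x + 2 * i.+1%:R) (2 * (nth 0%N la i)%:R - x).

Lemma region_le la x y : region la (x, y) -> exists2 i, (i < size la)%N & y <= row_height la x i.
Proof.
move=> /regionP[i [j [hj /andP[_ h1] /andP[_ h2]]]]; exists i.
  by rewrite ltnNge; apply/negP => h; rewrite nth_default in hj.
have : (j.+1)%:R <= (nth 0%N la i)%:R :> R by rewrite ler_nat.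
by move=> h3; rewrite /row_height le_min; apply/andP; split; lra.
Qed.

Lemma omega_sup la x : has_sup (`|x| |` [set y | region la (x, y)]).
Proof.
split; first by exists `|x|; left.
exists (Num.max `|x| (x + 2 * (size la)%:R)) => y [->|/region_le[i il h]].
  by rewrite le_max lexx.
rewrite le_max; apply/orP; right; apply: le_trans h _; rewrite /row_height ge_min.
by rewrite lerD2l ler_pM2l // ler_nat il.
Qed.

Lemma omega_ge_norm la x : `|x| <= omega la x.
Proof. by apply: (sup_upper_bound (omega_sup la x)); left. Qed.

Lemma omega_le la x (M : R) : `|x| <= M ->
  (forall i, (i < size la)%N -> row_height la x i <= M) -> omega la x <= M.
Proof.
move=> h1 h2; apply: sup_le_ub; first by exists `|x|; left.
by move=> y [->//|/region_le[i il h]]; apply: le_trans h (h2 i il).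
Qed.

Lemma unit_cell (n : nat) (u : R) : 0 < u -> u <= n%:R ->
  exists2 k, (k < n)%N & k%:R <= u <= k.+1%:R.
Proof.
elim: n => [|n IH] u0 un; first by move: un; rewrite mulr0n leNgt u0.
have [un'|un'] := leP u n%:R; last by exists n => //; rewrite un ltW.
by have [k kn hk] := IH u0 un'; exists k => //; apply: ltnW.
Qed.

Lemma row_height_le_omega la x i : sorted geq la -> row_height la x i <= omega la x.
Proof.
move=> sl; set y := row_height la x i.
have [yx|yx] := leP y `|x|; first exact: le_trans yx (omega_ge_norm la x).
apply: (sup_upper_bound (omega_sup la x)); right => /=; apply/regionP.
have := ler_norm x; have := ler_norm (- x); rewrite normrN => n1 n2.
have u0 : 0 < (y - x) / 2 by lra.
have v0 : 0 < (x + y) / 2 by lra.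
have y1 : y <= x + 2 * i.+1%:R by rewrite /y /row_height ge_min lexx.
have y2 : y <= 2 * (nth 0%N la i)%:R - x by rewrite /y /row_height ge_min lexx orbT.
have u1 : (y - x) / 2 <= i.+1%:R by lra.
have v1 : (x + y) / 2 <= (nth 0%N la i)%:R by lra.
have [k ki /andP[k1 k2]] := unit_cell u0 u1.
have [j ji /andP[j1 j2]] := unit_cell v0 v1.
exists k, j; split; last by apply/andP; split; lra.
  by apply: leq_trans ji _; apply: nth_sorted_geq => //; rewrite -ltnS.
by apply/andP; split; lra.
Qed.

Lemma local_maxP (f : R -> R) x (e : R) : 0 < e ->
  (forall y, `|x - y| < e -> f y <= f x) -> is_local_max f x.
Proof. by move=> e0 h; apply/nbhs_ballP; exists e => // y; rewrite -ball_normE /=; apply: h. Qed.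

Lemma local_minP (f : R -> R) x (e : R) : 0 < e ->
  (forall y, `|x - y| < e -> f x <= f y) -> is_local_min f x.
Proof. by move=> e0 h; apply/nbhs_ballP; exists e => // y; rewrite -ball_normE /=; apply: h. Qed.

Lemma not_local_max (f : R -> R) x (e : R) : 0 < e ->
  (forall d, 0 < d -> d < e -> f x < f (x + d)) \/
  (forall d, 0 < d -> d < e -> f x < f (x - d)) -> ~ is_local_max f x.
Proof.
move=> e0 h /nbhs_ballP[d /= d0 hd].
pose c := Num.min (d / 2) (e / 2).
have c0 : 0 < c by rewrite lt_min; apply/andP; split; apply: divr_gt0.
have cd : c < d by rewrite gt_min; apply/orP; left; lra.
have ce : c < e by rewrite gt_min; apply/orP; right; lra.
case: h => h; have := h c c0 ce; rewrite ltNge => /negP; apply; apply: hd; rewrite -ball_normE /=.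
- have -> : x - (x + c) = - c by ring.
  by rewrite normrN gtr0_norm.
- have -> : x - (x - c) = c by ring.
  by rewrite gtr0_norm.
Qed.

Lemma corner_local_max la i : sorted geq la -> corner i la ->
  is_local_max (omega la) ((nth 0%N la i)%:R - i.+1%:R : R).
Proof.
move=> sl /andP[il hc]; set x := _ - _; set L := nth 0%N la i in hc x *.
have L1 : 1 <= L%:R :> R by rewrite ler1n; case: (L) hc.
have i1 : 1 <= i.+1%:R :> R by rewrite ler1n.
apply: (@local_maxP _ _ 1) => // y; rewrite ltr_norml => /andP[y1 y2].
have hx : row_height la x i = L%:R + i.+1%:R.
  rewrite /row_height -/L /x.
  have -> : L%:R - i.+1%:R + 2 * i.+1%:R = 2 * L%:R - (L%:R - i.+1%:R) :> R.
    by ring.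
  by rewrite minxx; ring.
have hw : L%:R + i.+1%:R <= omega la x by rewrite -hx row_height_le_omega.
apply: le_trans hw; rewrite /x in y1 y2; apply: omega_le.
  by rewrite ler_norml; apply/andP; split; lra.
move=> k kl; rewrite /row_height ge_min.
case: (ltngtP k i) => ki.
- have : k.+1%:R + 1 <= i.+1%:R :> R by rewrite natr1 ler_nat.
  by move=> ?; apply/orP; left; lra.
- have h1 : (nth 0%N la k <= nth 0%N la i.+1)%N by apply: nth_sorted_geq.
  have : (nth 0%N la k)%:R + 1 <= L%:R :> R by rewrite natr1 ler_nat; apply: leq_ltn_trans h1 hc.
  by move=> ?; apply/orP; right; lra.
rewrite ki -/L; case: (lerP y (L%:R - i.+1%:R)) => ?; apply/orP; [left|right]; lra.
Qed.

Lemma no_corner_const la i j : sorted geq la -> (i <= j)%N -> (j < size la)%N ->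
  (forall k, (i <= k)%N -> (k < j)%N -> ~~ corner k la) -> nth 0%N la i = nth 0%N la j.
Proof.
move=> sl; elim: j => [|j IH]; first by rewrite leqn0 => /eqP ->.
rewrite leq_eqVlt => /orP[/eqP -> //|ij] jl h.
rewrite (IH _ _ _) //; [|exact: ltnW|by move=> k k1 k2; apply: h => //; apply: ltnW].
have := h j ij (ltnSn j); rewrite /corner (ltnW jl) /= -leqNgt => h1.
by apply/eqP; rewrite eqn_leq h1 nth_sorted_geq.
Qed.

(** The last row always ends in a corner, and row lengths are constant between consecutive
    corners. *)
Lemma two_blocks la : is_partition la ->
  (forall i j k, (i < j)%N -> (j < k)%N -> corner i la -> corner j la -> corner k la -> False) ->
  (exists h L, la = nseq h L) \/
  exists h1 h2 L1 L2, [/\ la = nseq h1 L1 ++ nseq h2 L2, (0 < h1)%N, (0 < h2)%N, (L2 < L1)%N & (0 < L2)%N].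
Proof.
move=> /andP[sl z0] h3; have [s0|s0] := posnP (size la).
  by left; exists 0%N, 0%N; apply: size0nil.
set n := size la in s0.
have pos k : (k < n)%N -> (0 < nth 0 la k)%N.
  move=> kn; rewrite lt0n; apply: contraNneq z0 => <-; exact: mem_nth.
have cl : corner n.-1 la.
  by rewrite /corner prednK // leqnn /= nth_default ?pos // prednK.
case: (boolP (has (fun i => corner i la) (iota 0 n.-1))) => [hh|hh].
  have [i il ci] := elimT seq.hasP hh; rewrite mem_iota add0n /= in il; right.
  exists i.+1, (n - i.+1)%N, (nth 0%N la i), (nth 0%N la i.+1).
  have iln : (i.+1 < n)%N by rewrite -ltn_predRL.
  have hsz : size la = size (nseq i.+1 (nth 0%N la i) ++ nseq (n - i.+1) (nth 0%N la i.+1)).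
    by rewrite size_cat !size_nseq subnKC // ltnW.
  split=> //; last 3 first.
  - by rewrite subn_gt0.
  - by case/andP: ci.
  - exact: pos.
  apply: (eq_from_nth (x0 := 0%N) hsz) => k kn; rewrite nth_cat size_nseq.
  have [ki|ki] := ltnP k i.+1.
    rewrite nth_nseq ki; apply: no_corner_const => //; first by apply: ltn_trans iln; rewrite ltnS.
    move=> j kj ji; apply/negP => cj; exact: (h3 j i n.-1).
  rewrite nth_nseq ltn_sub2r //; apply/esym; apply: no_corner_const => //.
  move=> j ij jk; apply/negP => cj; apply: (h3 i j n.-1) => //.
  by rewrite -ltnS prednK //; apply: leq_ltn_trans kn.
left; exists n, (nth 0%N la n.-1).
have hn := elimT seq.hasPn hh.
apply: (eq_from_nth (x0 := 0%N)); first by rewrite size_nseq.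
move=> k kn; rewrite nth_nseq kn; apply: no_corner_const => //; rewrite ?prednK //.
  by rewrite -ltnS prednK.
by move=> j kj jn; apply: hn; rewrite mem_iota.
Qed.

(** Excludes rectangles, since their boundary cannot have two distinct local maxima. *)
Lemma nseq_local_max h L x : is_local_max (omega (nseq h L)) x -> x = L%:R - h%:R.
Proof.
have sl : sorted geq (nseq h L).
  apply: sorted_geq_nth => i; rewrite !nth_nseq; case: ltnP => [/ltnW ->//|_]; exact: leq0n.
have top y : (0 < h)%N -> y + 2 * h%:R <= 2 * L%:R - y -> y + 2 * h%:R <= omega (nseq h L) y.
  move=> h0 hy; have := row_height_le_omega y h.-1 sl.
  by rewrite /row_height nth_nseq prednK // leqnn min_l.
have top' y : (0 < h)%N -> 2 * L%:R - y <= y + 2 * h%:R -> 2 * L%:R - y <= omega (nseq h L) y.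
  move=> h0 hy; have := row_height_le_omega y h.-1 sl.
  by rewrite /row_height nth_nseq prednK // leqnn min_r.
have upper y M : `|y| <= M -> y + 2 * h%:R <= M \/ 2 * L%:R - y <= M -> omega (nseq h L) y <= M.
  move=> h1 h2; apply: omega_le => // i; rewrite size_nseq => ih.
  rewrite /row_height nth_nseq ih ge_min; case: h2 => h2; apply/orP; [left|right] => //.
  by apply: le_trans h2; rewrite lerD2l ler_pM2l // ler_nat.
have ge y := omega_ge_norm (nseq h L) y.
have hr : 0 <= h%:R :> R by []; have Lr : 0 <= L%:R :> R by [].
have [h0|h0] := posnP h.
  move=> hmax; exfalso; have h0r : h%:R = 0 :> R by rewrite h0.
  have om y : omega (nseq h L) y = `|y|.
    apply: le_anti; rewrite ge andbT; apply: upper => //; left; rewrite h0r mulr0 addr0; exact: ler_norm.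
  apply: (@not_local_max (omega (nseq h L)) x 1) hmax => //.
  have [x0|x0] := leP 0 x; [left|right] => d d0 d1; rewrite !om.
    by rewrite !ger0_norm; lra.
  by rewrite !ltr0_norm; lra.
move=> hmax; apply/eqP; apply/negPn/negP => xne.
case: (ltP x (- h%:R)) => xh.
  apply: (@not_local_max (omega (nseq h L)) x 1) hmax => //; right => d d0 d1.
  have : omega (nseq h L) x <= - x.
    by apply: upper; [rewrite ler0_norm; lra|left; lra].
  have := ge (x - d); rewrite ler0_norm; lra.
case: (ltP L%:R x) => xL.
  apply: (@not_local_max (omega (nseq h L)) x 1) hmax => //; left => d d0 d1.
  have : omega (nseq h L) x <= x.
    by apply: upper; [rewrite ger0_norm; lra|right; lra].
  have := ge (x + d); rewrite ger0_norm; lra.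
case: (ltgtP x (L%:R - h%:R)) xne => // xc _.
  have e0 : 0 < L%:R - h%:R - x by lra.
  apply: (@not_local_max (omega (nseq h L)) x _ e0) hmax; left => d d0 d1.
  have : omega (nseq h L) x <= x + 2 * h%:R.
    by apply: upper; [rewrite ler_norml; apply/andP; split; lra|left].
  have := top (x + d) h0; lra.
have e0 : 0 < x - (L%:R - h%:R) by lra.
apply: (@not_local_max (omega (nseq h L)) x _ e0) hmax; right => d d0 d1.
have : omega (nseq h L) x <= 2 * L%:R - x.
  by apply: upper; [rewrite ler_norml; apply/andP; split; lra|right].
have := top' (x - d) h0; lra.
Qed.

End Boundary.

Section TwoBlocks.
Context {R : realType}.
Implicit Types (la : seq nat) (x y : R).

Definition two_block (h1 h2 L1 L2 : nat) : seq nat := nseq h1 L1 ++ nseq h2 L2.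

Lemma nth_two_block h1 h2 L1 L2 i : nth 0%N (two_block h1 h2 L1 L2) i =
  if (i < h1)%N then L1 else if (i < h1 + h2)%N then L2 else 0%N.
Proof.
rewrite /two_block nth_cat size_nseq; case: ltnP => hi; first by rewrite nth_nseq hi.
by rewrite nth_nseq ltn_subLR.
Qed.

Lemma size_two_block h1 h2 L1 L2 : size (two_block h1 h2 L1 L2) = (h1 + h2)%N.
Proof. by rewrite size_cat !size_nseq. Qed.

Lemma sorted_two_block h1 h2 L1 L2 : (L2 <= L1)%N -> sorted geq (two_block h1 h2 L1 L2).
Proof.
move=> hL; apply: sorted_geq_nth => i; rewrite !nth_two_block.
by case: (ltnP i.+1 h1) => ?; case: (ltnP i h1) => ?; case: (ltnP i.+1 (h1 + h2)) => ?;
  case: (ltnP i (h1 + h2)) => ?; rewrite ?leqnn //; lia.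
Qed.

Lemma dilate_two_block n h1 h2 L1 L2 : dilate n (two_block h1 h2 L1 L2) =
  two_block (n * h1) (n * h2) (n * L1) (n * L2).
Proof.
have blk h L : flatten [seq nseq n (n * l)%N | l <- nseq h L] = nseq (n * h) (n * L).
  elim: h => [|h IH] /=; first by rewrite muln0.
  by rewrite IH mulnS nseqD.
by rewrite /dilate /two_block map_cat flatten_cat !blk.
Qed.

Lemma size_boxes_two_block h1 h2 L1 L2 :
  size (boxes (two_block h1 h2 L1 L2)) = (h1 * L1 + h2 * L2)%N.
Proof.
rewrite size_boxes size_two_block iotaD big_cat /= add0n; congr addn.
  rewrite big_seq (eq_bigr (fun=> L1)); last first.
    by move=> k; rewrite mem_iota add0n nth_two_block => /andP[_ ->].
  by rewrite -big_seq big_const_seq count_predT size_iota iter_addn_0 mulnC.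
rewrite big_seq (eq_bigr (fun=> L2)); last first.
  by move=> k; rewrite mem_iota nth_two_block => /andP[k1 ->]; rewrite ltnNge k1.
by rewrite -big_seq big_const_seq count_predT size_iota iter_addn_0 mulnC.
Qed.

Local Notation C := R[i].

(** The row ends of equal rows are consecutive integers, so the product over a block telescopes. *)
Lemma telescope_rows (z : C) (f : nat -> C) (u h L : nat) : non_integer z ->
  (forall k, (u <= k)%N -> (k < u + h)%N -> f k = L%:R - k.+1%:R) ->
  \prod_(k <- iota u h) (1 - (z - f k)^-1) = (z - L%:R + u%:R) / (z - L%:R + (u + h)%:R).
Proof.
move=> hz; have zn (k : nat) : z - L%:R + k%:R != 0.
  have := hz (L%:Z - k%:Z); rewrite rmorphB /= -!pmulrn.
  by have -> : z - (L%:R - k%:R) = z - L%:R + k%:R by ring.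
elim: h => [|h IH] hf; first by rewrite big_nil addn0 divff.
have -> : iota u h.+1 = iota u h ++ [:: (u + h)%N] by rewrite -addn1 iotaD.
rewrite big_cat IH; last by move=> k k1 k2; apply: hf => //; rewrite addnS ltnW.
rewrite big_seq1 hf ?leq_addr ?addnS //.
have -> : z - (L%:R - (u + h).+1%:R) = z - L%:R + (u + h).+1%:R by ring.
have n1 := zn (u + h)%N; have n2 := zn (u + h).+1.
rewrite -natr1 in n2 *; rewrite addrA /= in n2 *.
by move: (z - L%:R) ((u + h)%:R : C) n1 n2 => w v n1 n2; field; rewrite n1 n2.
Qed.

Lemma kerov_two_block h1 h2 L1 L2 (z : C) : non_integer z ->
  kerov (boxes (two_block h1 h2 L1 L2)) z = (z + (h1 + h2)%:R) *
   ((z - L1%:R) / (z - L1%:R + h1%:R) * ((z - L2%:R + h1%:R) / (z - L2%:R + (h1 + h2)%:R))).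
Proof.
move=> hz; rewrite kerov_rows // size_two_block iotaD big_cat /= add0n.
rewrite (@telescope_rows z _ 0 h1 L1) ?(@telescope_rows z _ h1 h2 L2) ?addr0 //.
- by move=> k k1 k2; rewrite /row_end nth_two_block k2 ltnNge k1.
- by move=> k _; rewrite add0n => k1; rewrite /row_end nth_two_block k1.
Qed.

Section Shape.
Variables (h1 h2 L1 L2 : nat).
Hypotheses (h1p : (0 < h1)%N) (h2p : (0 < h2)%N) (L21 : (L2 < L1)%N) (L2p : (0 < L2)%N).
Local Notation la := (two_block h1 h2 L1 L2).
Local Notation A0 := (- (h1 + h2)%:R : R).
Local Notation B1 := (L2%:R - (h1 + h2)%:R : R).
Local Notation A1 := (L2%:R - h1%:R : R).
Local Notation B2 := (L1%:R - h1%:R : R).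
Local Notation A2 := (L1%:R : R).

Lemma two_block_pos : [/\ 0 < h1%:R :> R, 0 < h2%:R :> R, L2%:R < L1%:R :> R, 0 < L2%:R :> R &
  (h1 + h2)%:R = h1%:R + h2%:R :> R].
Proof. by rewrite !ltr0n ltr_nat natrD. Qed.

(** The transform is a quotient of factors linear in z and in the sizes of the blocks, hence exactly
    homogeneous under dilation. *)
Lemma two_block_dilation_data : dilation_data la A0 B1 A1 B2 A2.
Proof.
have [p1 p2 p3 p4 pd] := two_block_pos.
split; first by rewrite pd; split; lra.
  by rewrite size_boxes_two_block addn_gt0 muln_gt0 h1p (leq_ltn_trans (leq0n _) L21).
move=> n n0; rewrite dilate_two_block; split.
- by apply: sorted_two_block; rewrite leq_mul2l (ltnW L21) orbT.
- by rewrite !size_boxes_two_block; lia.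
move=> z iz; have nr : n%:R != 0 :> C by rewrite pnatr_eq0 -lt0n.
have niz (w : R) : z - w%:C%C != 0.
  apply/eqP => e; move/eqP: iz; apply; have : complex.Im (z - w%:C%C) = 0 by rewrite e.
  by rewrite cImD cImN /= subr0.
rewrite kerov_two_block; last first.
  apply: non_integer_Im; rewrite cImM Re_natr Im_natr mul0r addr0 mulf_neq0 ?pnatr_eq0 -?lt0n //.
rewrite /KC /numC /denC pd.
have nb1 := niz B1; have nb2 := niz B2; rewrite pd in nb1.
rewrite !(rmorphB, rmorphN, rmorphD) /= !rmorph_nat in nb1 nb2 *.
rewrite !natrM -!mulrDr.
have e1 : n%:R * z - n%:R * L1%:R + n%:R * h1%:R = n%:R * (z - (L1%:R - h1%:R)) :> C by ring.
have e2 : n%:R * z - n%:R * L2%:R + n%:R * (h1%:R + h2%:R) = n%:R * (z - (L2%:R - (h1%:R + h2%:R))) :> C by ring.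
rewrite e1 e2; field; rewrite nr nb1 nb2.
by [].
Qed.

Lemma two_block_omega_le x M : `|x| <= M -> x + 2 * h1%:R <= M \/ 2 * L1%:R - x <= M ->
  x + 2 * (h1 + h2)%:R <= M \/ 2 * L2%:R - x <= M -> omega la x <= M.
Proof.
move=> k0 k1 k2; apply: omega_le => // i; rewrite size_two_block => il.
rewrite /row_height nth_two_block il ge_min; case: ltnP => hi.
  case: k1 => k1; apply/orP; [left|right] => //.
  by apply: le_trans k1; rewrite lerD2l ler_pM2l // ler_nat.
case: k2 => k2; apply/orP; [left|right] => //.
by apply: le_trans k2; rewrite lerD2l ler_pM2l // ler_nat.
Qed.

Lemma two_block_omega_ge x M : M <= `|x| \/
  (M <= x + 2 * h1%:R /\ M <= 2 * L1%:R - x) \/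
  (M <= x + 2 * (h1 + h2)%:R /\ M <= 2 * L2%:R - x) -> M <= omega la x.
Proof.
have sl : sorted geq la by apply: sorted_two_block; apply: ltnW.
case=> [h|[[k1 k2]|[k1 k2]]]; first exact: le_trans h (omega_ge_norm _ _).
- apply: le_trans (row_height_le_omega x h1.-1 sl).
  by rewrite /row_height nth_two_block prednK // leqnn le_min k1.
- apply: le_trans (row_height_le_omega x (h1 + h2).-1 sl).
  have d0 : (0 < h1 + h2)%N by rewrite addn_gt0 h1p.
  rewrite /row_height nth_two_block prednK // leqnn.
  have -> : (h1 + h2 <= h1)%N = false by apply/negbTE; rewrite -ltnNge -[X in (X < _)%N]addn0 ltn_add2l.
  by rewrite le_min k1.
Qed.

Lemma two_block_local_max :
  is_local_max (omega la) B1 /\ is_local_max (omega la) B2.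
Proof.
have sl : sorted geq la by apply: sorted_two_block; apply: ltnW.
have d0 : (0 < h1 + h2)%N by rewrite addn_gt0 h1p.
have d1 : (h1 + h2 <= h1)%N = false by apply/negbTE; rewrite -ltnNge -[X in (X < _)%N]addn0 ltn_add2l.
split.
- have c : corner (h1 + h2).-1 la.
    by rewrite /corner size_two_block !nth_two_block prednK // leqnn d1 !ltnn (ltnNge (h1 + h2) h1) leq_addr /= L2p.
  have := @corner_local_max R la _ sl c.
  by rewrite nth_two_block prednK // leqnn d1.
- have c : corner h1.-1 la.
    rewrite /corner size_two_block !nth_two_block prednK // leqnn ltnn.
    by rewrite -[X in (X < h1 + h2)%N]addn0 ltn_add2l h2p L21 leq_addr.
  have := @corner_local_max R la _ sl c.
  by rewrite nth_two_block prednK // leqnn.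
Qed.

Lemma two_block_local_min : [/\ is_local_min (omega la) A0, is_local_min (omega la) A1 &
  is_local_min (omega la) A2].
Proof.
have [p1 p2 p3 p4 pd] := two_block_pos.
have hle := two_block_omega_le; have hge := two_block_omega_ge; rewrite pd in hle hge *.
split.
- have up : omega la (- (h1%:R + h2%:R)) <= h1%:R + h2%:R :> R.
    by apply: hle; [rewrite normrN ger0_norm; lra|left; lra|left; lra].
  apply: (@local_minP _ _ _ L2%:R) => //.
  move=> y; rewrite ltr_norml => /andP[y1 y2]; apply: le_trans up _; apply: hge.
  case: (leP y (- (h1%:R + h2%:R))) => hy; first by left; rewrite ler0_norm; lra.
  by right; right; split; lra.
- have up : omega la (L2%:R - h1%:R) <= L2%:R + h1%:R :> R.
    by apply: hle; [rewrite ler_norml; apply/andP; split; lra|left; lra|right; lra].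
  apply: (@local_minP _ _ _ (Num.min (L1%:R - L2%:R) h2%:R)); first by rewrite lt_min subr_gt0 p3.
  move=> y; rewrite lt_min => /andP[]; rewrite !ltr_norml => /andP[y1 y2] /andP[y3 y4].
  apply: le_trans up _; apply: hge; right.
  by case: (leP y (L2%:R - h1%:R)) => hy; [right|left]; split; lra.
- have up : omega la L1%:R <= L1%:R :> R.
    by apply: hle; [rewrite ger0_norm|right; lra|right; lra].
  apply: (@local_minP _ _ _ h1%:R) => // y; rewrite ltr_norml => /andP[y1 y2].
  apply: le_trans up _; apply: hge.
  case: (leP L1%:R y) => hy; first by left; rewrite ger0_norm; lra.
  by right; left; split; lra.
Qed.

End Shape.

(** Each corner yields its own local maximum of the boundary, so there are at most two corners, and
    a rectangle has too few maxima. The explicit extrema of the two-block boundary are then matched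
    with the given ones by their order. *)
Lemma interlacing_two_block la (a0 b1 a1 b2 a2 : R) : is_partition la ->
  interlacing_coordinates la [:: a0; a1; a2] [:: b1; b2] ->
  exists h1 h2 L1 L2, [/\ la = two_block h1 h2 L1 L2,
    [/\ (0 < h1)%N, (0 < h2)%N, (L2 < L1)%N & (0 < L2)%N] &
    [/\ a0 = - (h1 + h2)%:R, b1 = L2%:R - (h1 + h2)%:R, a1 = L2%:R - h1%:R,
        b2 = L1%:R - h1%:R & a2 = L1%:R]].
Proof.
move=> pla [_ hab hmin hmax].
have /andP[i1 i2] : a0 < b1 < a1 by exact: (hab 0%N isT).
have /andP[i3 i4] : a1 < b2 < a2 by exact: (hab 1%N isT).
have sl : sorted geq la by case/andP: pla.
have maxP x : is_local_max (omega la) x <-> x = b1 \/ x = b2.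
  have -> : is_local_max (omega la) x = [set x | is_local_max (omega la) x] x by [].
  rewrite hmax /= !inE; split; first by case/orP => /eqP; [left|right].
  by case=> ->; rewrite eqxx ?orbT.
have minP x : is_local_min (omega la) x -> [\/ x = a0, x = a1 | x = a2].
  have -> : is_local_min (omega la) x = [set x | is_local_min (omega la) x] x by [].
  by rewrite hmin /= !inE => /or3P[] /eqP; [apply: Or31|apply: Or32|apply: Or33].
clear hmin hmax hab.
have [|[h [L e]]|[h1 [h2 [L1 [L2 [e h1p h2p L21 L2p]]]]]] := two_blocks pla.
- move=> i j k ij jk ci cj ck.
  have lt u v : (u < v)%N -> (nth 0%N la v)%:R - v.+1%:R < (nth 0%N la u)%:R - u.+1%:R :> R.
    move=> uv; have h : (nth 0%N la v)%:R <= (nth 0%N la u)%:R :> R.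
      by rewrite ler_nat nth_sorted_geq // ltnW.
    have : (u.+1)%:R < (v.+1)%:R :> R by rewrite ltr_nat.
    lra.
  have := lt _ _ ij; have := lt _ _ jk.
  have [->|->] := (maxP _).1 (corner_local_max sl ci);
  have [->|->] := (maxP _).1 (corner_local_max sl cj);
  have [->|->] := (maxP _).1 (corner_local_max sl ck); lra.
- have e1 : b1 = L%:R - h%:R by apply: nseq_local_max; rewrite -e; apply/maxP; left.
  have e2 : b2 = L%:R - h%:R by apply: nseq_local_max; rewrite -e; apply/maxP; right.
  lra.
have [p1 p2 p3 p4 pd] := two_block_pos h1p h2p L21 L2p.
exists h1, h2, L1, L2; split => //.
have [m1 m2] := two_block_local_max h1p h2p L21 L2p.
have [n1 n2 n3] := two_block_local_min h1p h2p L21 L2p.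
rewrite -[two_block _ _ _ _]e in m1 m2 n1 n2 n3; rewrite pd in m1 n1 *.
have {}m1 := (maxP _).1 m1; have {}m2 := (maxP _).1 m2.
have {}n1 := minP _ n1; have {}n2 := minP _ n2; have {}n3 := minP _ n3.
have [e1 e2] : b1 = L2%:R - (h1%:R + h2%:R) /\ b2 = L1%:R - h1%:R.
  by case: m1 => m1; case: m2 => m2; split; lra.
clear m1 m2 maxP minP.
have e0 : a0 = - (h1%:R + h2%:R).
  case: n1 => n1; first exact/esym; exfalso.
    by case: n2 => n2; case: n3 => n3; lra.
  by case: n2 => n2; lra.
have e4 : a2 = L1%:R.
  case: n3 => n3; last exact/esym; exfalso; first lra.
  by case: n2 => n2; lra.
by split => //; case: n2 => n2; lra.
Qed.

End TwoBlocks.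

(** * The height at time 1 and the domain *)

Section TopHeight.
Context {R : realType}.
Implicit Types (la : seq nat) (x y : R).

(* Contents are written a - b, one of a and b being 0 in the applications. *)
Lemma count_diagonal_row (a b i L : nat) :
  count (fun j => j%:Z - i%:Z == a%:Z - b%:Z) (iota 1 L) = ((b < i + a) && (i + a <= L + b))%N.
Proof.
elim: L => [|L IH]; first by rewrite /= add0n; case: ltnP => //= h; rewrite leqNgt h.
have -> : iota 1 L.+1 = iota 1 L ++ [:: L.+1] by rewrite -(addn1 L) iotaD add1n addn1.
rewrite count_cat IH /= addn0; clear IH.
case: (boolP (L.+1%:Z - i%:Z == a%:Z - b%:Z)) => [/eqP|/eqP] h; lia.
Qed.

Lemma sum_diagonal_block (a b u h L : nat) :
  (\sum_(k <- iota u h) ((b < k.+1 + a) && (k.+1 + a <= L + b)) =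
   minn (u + h) (L + b - a) - maxn u (b - a))%N.
Proof.
elim: h => [|h IH]; first by rewrite big_nil; lia.
have -> : iota u h.+1 = iota u h ++ [:: (u + h)%N] by rewrite -addn1 iotaD.
rewrite big_cat /= IH big_seq1; clear IH; lia.
Qed.

Lemma cnt_two_block (a b h1 h2 L1 L2 : nat) :
  cnt (a%:Z - b%:Z) (boxes (two_block h1 h2 L1 L2)) =
  ((minn h1 (L1 + b - a) - (b - a)) + (minn (h1 + h2) (L2 + b - a) - maxn h1 (b - a)))%N.
Proof.
have rows la : cnt (a%:Z - b%:Z) (boxes la) = (\sum_(k <- iota 0 (size la))
    ((b < k.+1 + a) && (k.+1 + a <= nth 0 la k + b)))%N.
  rewrite /cnt -sum1_count big_mkcond big_allpairs_dep /=.
  have -> : iota 1 (size la) = [seq (1 + k)%N | k <- iota 0 (size la)] by rewrite -(iotaDl 1 0).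
  rewrite big_map.
  apply: eq_bigr => k _; rewrite add1n -(count_diagonal_row a b k.+1) -sum1_count.
  by rewrite [RHS]big_mkcond.
rewrite rows size_two_block iotaD big_cat /= add0n; congr addn.
  rewrite -[(b - a)%N]max0n -[in minn h1 _](add0n h1) -sum_diagonal_block.
  rewrite big_seq [RHS]big_seq; apply: eq_bigr => k.
  by rewrite mem_iota nth_two_block add0n => /andP[_ ->].
rewrite -sum_diagonal_block big_seq [RHS]big_seq; apply: eq_bigr => k.
by rewrite mem_iota nth_two_block => /andP[k1 ->]; rewrite (ltnNge k h1) k1.
Qed.

Lemma cnt_two_block_omega (c : int) (h1 h2 L1 L2 : nat) : (0 < h1)%N -> (0 < h2)%N -> (L2 < L1)%N ->
  (cnt c (boxes (two_block h1 h2 L1 L2)))%:R =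
  (omega (two_block h1 h2 L1 L2) c%:~R - `|c%:~R|) / 2 :> R.
Proof.
move=> h1p h2p L21.
have [a [b [cE ab]]] : exists a b : nat, c = a%:Z - b%:Z /\ (a = 0%N \/ b = 0%N).
  case: c => n; first by exists n, 0%N; split; [lia|right].
  by exists 0%N, n.+1; split; [lia|left].
have nE : `|c%:~R| = a%:R + b%:R :> R.
  rewrite cE rmorphB /=; case: ab => ->; first by rewrite sub0r normrN add0r normr_nat.
  by rewrite subr0 addr0 normr_nat.
have := cnt_two_block a b h1 h2 L1 L2; rewrite -cE.
move: (cnt _ _) => T hT.
(* T is the largest of 0 and the lengths of the diagonal in the rectangles of the two blocks,
   expressed by inequalities that survive the passage to real numbers. *)
have [P1 [P2 P3]] : (T = 0 \/ (T + b <= h1 /\ T + a <= L1) \/ (T + b <= h1 + h2 /\ T + a <= L2))%N /\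
  ((h1 <= T + b \/ L1 <= T + a) /\ (h1 + h2 <= T + b \/ L2 <= T + a))%N.
  by clear -hT ab h1p h2p L21; lia.
suff -> : omega (two_block h1 h2 L1 L2) c%:~R = 2 * T%:R + `|c%:~R| :> R by field.
have toR (m n k : nat) : (m <= n + k)%N -> m%:R <= n%:R + k%:R :> R by rewrite -natrD ler_nat.
have toR' (m n k : nat) : (n + k <= m)%N -> n%:R + k%:R <= m%:R :> R by rewrite -natrD ler_nat.
have cR : c%:~R = a%:R - b%:R :> R by rewrite cE rmorphB.
have T0 : 0 <= T%:R :> R by [].
apply: le_anti; apply/andP; split.
  apply: two_block_omega_le; rewrite ?nE ?cR.
  - lra.
  - by case: P2 => /toR ?; [left|right]; lra.
  - by case: P3 => /toR ?; [left|right]; lra.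
apply: two_block_omega_ge => //; rewrite !nE cR.
case: P1 => [->|[[/toR' q1 /toR' q2]|[/toR' q1 /toR' q2]]].
- by left; lra.
- by right; left; split; lra.
- by right; right; split; lra.
Qed.

Lemma omega_lip la x y : sorted geq la -> omega la x <= omega la y + `|x - y|.
Proof.
move=> sl; have := ler_norm (x - y); have := ler_norm (- (x - y)); rewrite normrN => k1 k2.
apply: omega_le => [|i il].
  have := omega_ge_norm la y; have := ler_normD (x - y) y; rewrite subrK; lra.
have := row_height_le_omega y i sl; rewrite /row_height !ge_min => /orP[] h; apply/orP; [left|right]; lra.
Qed.

Lemma two_block_omegaE (h1 h2 L1 L2 : nat) x : (0 < h1)%N -> (0 < h2)%N -> (L2 < L1)%N ->
  omega (two_block h1 h2 L1 L2) x = Num.max `|x| (Num.max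
    (Num.min (x + 2 * h1%:R) (2 * L1%:R - x)) (Num.min (x + 2 * (h1 + h2)%:R) (2 * L2%:R - x))).
Proof.
move=> h1p h2p L21; apply: le_anti; rewrite !ge_max; apply/andP; split.
  apply: two_block_omega_le; rewrite ?le_max ?lexx //.
    by case: (leP (x + 2 * h1%:R) (2 * L1%:R - x)) => _; [left|right]; rewrite lexx ?orbT.
  by case: (leP (x + 2 * (h1 + h2)%:R) (2 * L2%:R - x)) => _; [left|right]; rewrite lexx ?orbT.
apply/and3P; split; apply: two_block_omega_ge => //; first by left.
- by right; left; rewrite !ge_min !lexx orbT.
- by right; right; rewrite !ge_min !lexx orbT.
Qed.

Lemma two_block_omega_scale (n h1 h2 L1 L2 : nat) x : (0 < n)%N -> (0 < h1)%N -> (0 < h2)%N ->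
  (L2 < L1)%N -> omega (two_block (n * h1) (n * h2) (n * L1) (n * L2)) (n%:R * x) =
  n%:R * omega (two_block h1 h2 L1 L2) x.
Proof.
move=> n0 h1p h2p L21; rewrite !two_block_omegaE ?muln_gt0 ?n0 ?ltn_mul2l ?n0 ?L21 //.
rewrite !maxr_pMr // !minr_pMr // normrM normr_nat -mulnDr !natrM.
congr (Num.max _ (Num.max (Num.min _ _) (Num.min _ _))); ring.
Qed.

Lemma bin_at1 n (F : nat -> R) : bin n 1 F = F n.
Proof. by elim: n F => //= n IH F; rewrite !IH; ring. Qed.

Lemma mean_cnt_full la c : sorted geq la ->
  mean_cnt la (size (boxes la)) c = (cnt c (boxes la))%:R :> R.
Proof.
move=> sl; rewrite /mean_cnt (@mean_full R la (fun p => (cnt c p)%:R)) // => p q pq.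
by rewrite /cnt (permP pq).
Qed.

Section Top.
Variables (h1 h2 L1 L2 : nat) (H : R -> R -> R).
Hypotheses (h1p : (0 < h1)%N) (h2p : (0 < h2)%N) (L21 : (L2 < L1)%N) (L2p : (0 < L2)%N).
Local Notation la := (two_block h1 h2 L1 L2).
Hypothesis hlim : is_limiting_height la (- (h1 + h2)%:R) L1%:R H.

(** At t = 1 the binomial law sits at N, and the height of the full diagram is deterministic, equal
    to the boundary formula at integer contents. *)
Lemma profile_top x : - (h1 + h2)%:R <= x <= L1%:R ->
  unscaled H la x 1 = (omega la x - `|x|) / 2.
Proof.
move=> hx; have hd := @two_block_dilation_data R _ _ _ _ h1p h2p L21 L2p.
have N00 := dilation_size_gt0 hd; have hdil := dilation_dilate hd.
have sl : sorted geq la by apply: sorted_two_block; apply: ltnW.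
have o01 : 0 <= (1 : R) <= 1 by rewrite ler01 lexx.
apply/eqP; rewrite -subr_eq0 -normr_le0; apply/ler_addgt0Pr => e e0; rewrite add0r.
have e20 : 0 < e / 2 by rewrite divr_gt0.
have [n1 hn1] := bin_close N00 hdil hlim hx o01 e20.
have [n2 hn2] := nat_eventually (2 / e).
pose n := maxn n1 n2.
have [n0 k1] := hn1 n (leq_maxl _ _); have k2 := hn2 n (leq_maxr _ _).
have nr : 0 < n%:R :> R by rewrite ltr0n.
have [sln szn] := hdil n n0.
move: k1; rewrite bin_at1 -szn mean_cnt_full // dilate_two_block.
set c := Num.floor _; rewrite cnt_two_block_omega ?muln_gt0 ?n0 ?ltn_mul2l ?n0 ?L21 //.
pose y : R := c%:~R / n%:R.
have cy : c%:~R = n%:R * y by rewrite /y mulrC divfK // gt_eqF.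
rewrite {1}cy two_block_omega_scale // cy normrM normr_nat.
have -> : (n%:R * omega la y - n%:R * `|y|) / 2 / n%:R = (omega la y - `|y|) / 2.
  by move: (omega _ _) (`|y|) => u v; field; rewrite gt_eqF.
have fy : `|y - x| <= n%:R^-1 by apply: floor_close.
have in2 : n%:R^-1 <= e / 2.
  by rewrite -[e / 2]invrK lef_pV2 ?posrE ?invr_gt0 // invf_div ltW.
have l1 := omega_lip x y sl; have l2 := omega_lip y x sl; rewrite distrC in l1.
have l3 := ler_normD (y - x) x; rewrite subrK in l3.
have l4 := ler_normD (x - y) y; rewrite subrK distrC in l4.
rewrite !ler_norml => /andP[q1 q2]; apply/andP; split; lra.
Qed.

Lemma two_block_omega_range x : `|x| < omega la x -> - (h1 + h2)%:R < x < L1%:R.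
Proof.
have [p1 p2 p3 p4 pd] := @two_block_pos R _ _ _ _ h1p h2p L21 L2p.
move=> h; apply/andP; split; rewrite ltNge; apply/negP => hx; move: h; rewrite ltNge => /negP; apply.
  apply: two_block_omega_le => //; left; rewrite ler0_norm; rewrite pd in hx *; lra.
by apply: two_block_omega_le => //; right; rewrite ger0_norm; lra.
Qed.

Lemma two_block_surface : surface_defined_continuous H (domain la) <->
  critical (- (h1 + h2)%:R) (L2%:R - (h1 + h2)%:R) (L2%:R - h1%:R) (L1%:R - h1%:R) (L1%:R : R).
Proof.
have hd := @two_block_dilation_data R _ _ _ _ h1p h2p L21 L2p.
have N00 := dilation_size_gt0 hd.
have eta0 : 0 < eta la :> R by rewrite invr_gt0 sqrtr_gt0 ltr0n.
have etan : eta la != 0 :> R by rewrite gt_eqF.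
apply: (surface_critical hd hlim); last first.
  move=> x hx; rewrite profile_top // => h; apply: two_block_omega_range; lra.
have HU (X : R) : H X 1 = eta la * unscaled H la (X / eta la) 1.
  by rewrite /unscaled mulrCA mulfV // mulr1 mulrCA mulfV // mulr1.
have hX (X : R) : (eta la * - (h1 + h2)%:R <= X <= eta la * L1%:R) = (- (h1 + h2)%:R <= X / eta la <= L1%:R).
  by rewrite (ler_pdivlMr _ _ eta0) (ler_pdivrMr _ _ eta0) (mulrC _ (- _)) (mulrC _ L1%:R).
have nX (X : R) : `|X| = eta la * `|X / eta la|.
  by rewrite -[in LHS](divfK etan X) normrM (gtr0_norm eta0) mulrC.
move=> [X Y]; rewrite /domain /= hX; split.
  move=> /andP[k1 k2].
  have hr : - (h1 + h2)%:R < X / eta la < L1%:R.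
    by apply: two_block_omega_range; rewrite -(ltr_pM2l eta0) -nX; lra.
  have hr' : - (h1 + h2)%:R <= X / eta la <= L1%:R by case/andP: hr => *; apply/andP; split; lra.
  split => //; rewrite HU profile_top // mulrA mulrBr -nX; apply/andP; split; lra.
move=> [hr /andP[k1 k2]]; rewrite HU profile_top // mulrA mulrBr -nX in k2.
by apply/andP; split; lra.
Qed.

End Top.
End TopHeight.

(** * The condition on p, q, r *)

Section QuadraticCondition.
Context {R : realType}.

Lemma critical_scale (k a0 b1 a1 b2 a2 : R) : k != 0 ->
  critical (k * a0) (k * b1) (k * a1) (k * b2) (k * a2) <-> critical a0 b1 a1 b2 a2.
Proof.
move=> k0; have k3 : k ^+ 3 != 0 by rewrite expf_eq0.
rewrite /critical /quadB; split=> h.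
  by apply: (mulfI k3); apply: etrans (etrans h _); ring.
apply: etrans (etrans (congr1 (fun z => k ^+ 3 * z) h) _); ring.
Qed.

Section Conditions.
Variables p q r : R.
Hypotheses (r0 : 0 < r) (p1 : -1 < p) (pr : p < r) (pq : `|p| < q) (q1 : q < p + 2)
  (q2 : q < 2 * r - p).
Local Notation crit := (critical (-1) ((p + q - 2) / 2) p ((p - q + 2 * r) / 2) r).
Local Notation m := (1 + 2 * p - r).
Local Notation n := (1 + p - r).
Local Notation W := (p * r + (1 + r) ^+ 2 - p - 2 * p ^+ 2).

Lemma criticalE : crit <-> m * (q - 1 - r) ^+ 2 = n * W.
Proof.
have e : 4 * ((2 * p - (p + q - 2) / 2 - (p - q + 2 * r) / 2) * ((p - -1) * (p - r))
    - quadB ((p + q - 2) / 2) ((p - q + 2 * r) / 2) p * (2 * p - -1 - r)) =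
  m * (q - 1 - r) ^+ 2 - n * W by rewrite /quadB; field.
rewrite /critical; split=> [h|h]; apply/eqP; rewrite -subr_eq0.
  by rewrite -e h subrr mulr0.
move: e; rewrite h subrr => /eqP; rewrite mulf_eq0 => /orP[] //.
by rewrite pnatr_eq0.
Qed.

(** Half the sum of the two upper bounds on q; it fixes the sign of the square root in both cases of
    the theorem. *)
Lemma shift_lt0 : q - 1 - r < 0.
Proof. move: (q1) (q2) => ? ?; lra. Qed.

Lemma critical_r1 : r = 1 -> crit <-> p = 0 \/ q = 2 - Num.sqrt (2 - p ^+ 2).
Proof.
move=> r1; have s0 := shift_lt0; rewrite criticalE; move: (pr) (p1); rewrite r1 => h1 h2.
have pp : 0 <= 2 - p ^+ 2 by nra.
split=> [h|[->|->]]; last 2 first.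
- ring.
- rewrite (_ : 2 - _ - 1 - 1 = - Num.sqrt (2 - p ^+ 2)); last by ring.
  by rewrite sqrrN sqr_sqrtr //; ring.
have : p * ((q - 2) ^+ 2 - (2 - p ^+ 2)) = 0.
  transitivity (((1 + 2 * p - 1) * (q - 1 - 1) ^+ 2 - (1 + p - 1) * (p * 1 + (1 + 1) ^+ 2 - p - 2 * p ^+ 2)) / 2).
    by field.
  by rewrite h subrr mul0r.
move=> /eqP; rewrite mulf_eq0 => /orP[/eqP ->|]; first by left.
rewrite subr_eq0 => /eqP e; right; rewrite -e sqrtr_sqr ltr0_norm; last by rewrite r1 in s0; lra.
ring.
Qed.

Lemma Q_radicandE : Qradicand r p = m * (n * W).
Proof. by rewrite /Qradicand; ring. Qed.

(** Multiplied by m, the condition says that the radicand is the square of m (q - 1 - r). As q - 1 -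
    r < 0, the sign of m selects [is_Qplus] or [is_Qminus]. Under the condition, m < 0 entails p <=
    0 and m > 0 entails r - 1 <= p. *)
Lemma critical_rn1 : r <> 1 ->
  crit <-> (p <= 0 /\ is_Qplus r p q) \/ (r - 1 <= p /\ is_Qminus r p q).
Proof.
move=> rn1; have s0 := shift_lt0; rewrite criticalE.
move: (r0) (p1) (pr) (pq) (q1) (q2) => h0 h1 h2 h3 h4 h5.
split; last first.
  have back (d : R) : Q_wd r p -> q - 1 - r = d -> d ^+ 2 = Qradicand r p / m ^+ 2 ->
      m * (q - 1 - r) ^+ 2 = n * W.
    move=> [_ m0] -> ->; rewrite Q_radicandE; move: (n * W) => X; field; exact: m0.
  case=> -[_ [wd e]]; have [R0 m0] := wd.
    apply: (back (Num.sqrt (Qradicand r p) / m)) => //; first by rewrite e; ring.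
    by rewrite expr_div_n sqr_sqrtr.
  apply: (back (- (Num.sqrt (Qradicand r p) / m))) => //; first by rewrite e; ring.
  by rewrite sqrrN expr_div_n sqr_sqrtr.
move=> h.
have radE : Qradicand r p = (m * (q - 1 - r)) ^+ 2 by rewrite Q_radicandE -h; ring.
have rad0 : 0 <= Qradicand r p by rewrite radE sqr_ge0.
have qs : 0 < (q - 1 - r) ^+ 2 by rewrite lt_neqAle sqr_ge0 eq_sym sqrf_eq0 lt_eqF.
have We : W = n * m + 4 * ((p + 1) * (r - p)) by ring.
have Wp : 0 < (p + 1) * (r - p) by apply: mulr_gt0; lra.
have W2 : W = (1 + r) ^+ 2 - p * m by ring.
have [mn|mp|m0] := ltgtP m 0.
- left; split; last first.
    split; first by split; [|rewrite lt_eqF].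
    rewrite radE sqrtr_sqr gtr0_norm; last by rewrite nmulr_rgt0.
    by field; rewrite lt_eqF.
  (* If p > 0, then n < m < 0 and W > (1 + r)^2 > (q - 1 - r)^2, which makes n W smaller than m (q -
     1 - r)^2. *)
  rewrite leNgt; apply/negP => pp.
  have pm : p * m < 0 by rewrite pmulr_rlt0.
  have Wb : (1 + r) ^+ 2 < W by rewrite W2; lra.
  have np : 0 <= `|p| by [].
  have qb : (q - 1 - r) ^+ 2 < (1 + r) ^+ 2.
    have : 0 < (1 + r + (q - 1 - r)) * (1 + r - (q - 1 - r)) by apply: mulr_gt0; lra.
    move=> k; rewrite -subr_gt0; move: k; congr (0 < _); ring.
  have W0 : 0 < W by apply: lt_trans Wb; rewrite exprn_gt0 //; lra.
  have k1 : n * W < m * W by rewrite ltr_pM2r //; lra.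
  have k2 : m * W < m * (1 + r) ^+ 2 by rewrite ltr_nM2l.
  have k3 : m * (1 + r) ^+ 2 < m * (q - 1 - r) ^+ 2 by rewrite ltr_nM2l.
  by have := lt_trans k1 (lt_trans k2 k3); rewrite h ltxx.
- right.
  (* For n <= 0 one has p = m - n > 0 and W > 0, so n W <= 0 while m (q - 1 - r)^2 > 0. *)
  have n0 : 0 < n.
    rewrite ltNge; apply/negP => n0.
    have pp : 0 < p by lra.
    have : 0 < W by rewrite W2; nra.
    have : 0 < n * W by rewrite -h mulr_gt0.
    by rewrite ltNge => /negP hn Wp'; apply: hn; rewrite mulr_le0_ge0 // ltW.
  split; first lra.
  split; first by split; [|rewrite gt_eqF].
  rewrite radE sqrtr_sqr ltr0_norm; last by rewrite pmulr_rlt0.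
  by field; rewrite gt_eqF.
(* With m = 0, W is positive and the condition gives n = 0; then p = m - n = 0 and r = 1. *)
exfalso; apply: rn1; move: h; rewrite m0 mul0r We m0 mulr0 add0r => /esym/eqP.
rewrite mulf_eq0 (gt_eqF (mulr_gt0 _ Wp)) // orbF => /eqP n0.
lra.
Qed.

End Conditions.
End QuadraticCondition.

Theorem proposition11 (R : realType) (p q r : rat)
    (r_gt0 : 0 < r) (p_bounds : -1 < p < r)
    (q_bounds : `|p| < q < Num.min (p + 2) (2 * r - p))
    (k : nat) (k_gt0 : (0 < k)%N) (la : seq nat) (la_part : is_partition la)
    (la_coords : interlacing_coordinates la
       [seq k%:R * ratr c : R | c <- [:: -1; p; r]]
       [seq k%:R * ratr c : R | c <- [:: (p + q - 2) / 2; (p - q + 2 * r) / 2]])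
    (H : R -> R -> R)
    (H_lim : is_limiting_height la (k%:R * ratr (-1)) (k%:R * ratr r) H) :
  (r = 1 ->
     (surface_defined_continuous H (domain la) <->
      p = 0 \/ ratr q = 2 - Num.sqrt (2 - ratr p ^+ 2) :> R)) /\
  (r <> 1 ->
     (surface_defined_continuous H (domain la) <->
      (p <= 0 /\ is_Qplus (ratr r) (ratr p) (ratr q : R)) \/
      (r - 1 <= p /\ is_Qminus (ratr r) (ratr p) (ratr q : R)))).
Proof.
have [h1 [h2 [L1 [L2 [laE [h1p h2p L21 L2p] [e0 e1 e2 e3 e4]]]]]] :=
  interlacing_two_block la_part la_coords.
have kn : k%:R != 0 :> R by rewrite pnatr_eq0 -lt0n.
subst la; rewrite e0 e4 in H_lim.
have crit := two_block_surface h1p h2p L21 L2p H_lim.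
rewrite -e1 -e2 -e3 -e0 -e4 in crit.
(* The condition is homogeneous of degree 3 in the coordinates, so the factor k drops out. *)
have {}crit := iff_trans crit (critical_scale _ _ _ _ _ kn).
have eN : ratr (-1) = -1 :> R by rewrite rmorphN rmorph1.
have eb1 : ratr ((p + q - 2) / 2) = (ratr p + ratr q - 2) / 2 :> R.
  by rewrite rmorphM fmorphV /= rmorphB rmorphD /= !rmorph_nat.
have eb2 : ratr ((p - q + 2 * r) / 2) = (ratr p - ratr q + 2 * ratr r) / 2 :> R.
  by rewrite rmorphM fmorphV /= rmorphD rmorphB rmorphM /= !rmorph_nat.
rewrite eN eb1 eb2 in crit.
case/andP: p_bounds => pl pr; case/andP: q_bounds => ql; rewrite lt_min => /andP[qa qb].
have r0 : 0 < ratr r :> R by rewrite ltr0q.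
have p1 : -1 < ratr p :> R by rewrite -eN ltr_rat.
have pr' : ratr p < ratr r :> R by rewrite ltr_rat.
have ql' : `|ratr p| < ratr q :> R by rewrite -ratr_norm ltr_rat.
have qa' : ratr q < ratr p + 2 :> R.
  by have := qa; rewrite -(ltr_rat R) rmorphD /= rmorph_nat.
have qb' : ratr q < 2 * ratr r - ratr p :> R.
  by have := qb; rewrite -(ltr_rat R) rmorphB rmorphM /= rmorph_nat.
split=> hr; apply: (iff_trans crit).
  apply: (iff_trans (critical_r1 p1 pr' qa' qb' _)); first by rewrite hr rmorph1.
  split; case=> h; [left|right|left|right] => //.
    by move/eqP: h; rewrite fmorph_eq0 => /eqP.
  by rewrite h rmorph0.
have rn1 : ratr r <> 1 :> R.
  move=> e; apply: hr; apply/eqP; rewrite -subr_eq0 -(fmorph_eq0 (@ratr R)).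
  by rewrite rmorphB rmorph1 /= e subrr.
apply: (iff_trans (critical_rn1 r0 p1 pr' ql' qa' qb' rn1)).
have c1 : (ratr p <= 0 :> R) = (p <= 0) by rewrite lerq0.
have c2 : (ratr r - 1 <= ratr p :> R) = (r - 1 <= p).
  by rewrite -[RHS](ler_rat R) rmorphB rmorph1.
by rewrite c1 c2.
Qed.
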